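(* Suppose that $G$ is a compact connected Lie group. Then the linear span $$\mathcal{H}_G:=\operatorname{Span}\big\{(Z^R_\varphi)^{1/2}:\varphi\in H(G)\big\}$$ is dense in $L^2(W(G),\mu)$.
   Context: $G$ is a compact connected Lie group, realized as a Lie subgroup of $\mathrm{GL}_n(\mathbb{R})$, with identity $e$ and Lie algebra $\mathfrak{g}\subset M_n(\mathbb{R})$; $\mathfrak{g}$ carries an $\mathrm{Ad}_G$-invariant inner product $\langle\cdot,\cdot\rangle$ with norm $|\cdot|$. Fix $0<T<\infty$. $W(G)$ is the space of continuous $\gamma:[0,T]\to G$ with $\gamma_0=e$, with the uniform topology and Borel $\sigma$-algebra; $g_t(\gamma)=\gamma_t$. $H(G)$ is the group (pointwise multiplication) of absolutely continuous $h\in W(G)$ with $\int_0^T|h(s)^{-1}h'(s)|^2ds<\infty$. $\mu$ is the Wiener measure on $W(G)$, i.e. the law of the Brownian motion on $G$ started at $e$: for $0=s_0<s_1<\dots<s_k=T$, the joint law of $(g_{s_1},\dots,g_{s_k})$ has density $\prod_{i=1}^k p_{s_i-s_{i-1}}(x_{i-1}^{-1}x_i)$ ($x_0=e$) with respect to product Haar measure, where $p_t$ is the convolution heat kernel of $\frac12\Delta$, $\Delta=\sum_{A}\widetilde A^2$, the sum over an orthonormal basis of $\mathfrak{g}$ and $\widetilde A$ the left invariant vector field with value $A$ at $e$. With $\delta$ the Stratonovich differential, $B^L_t=\int_0^t g_\tau^{-1}\delta g_\tau$ is a $\mathfrak{g}$-valued Brownian motion under $\mu$. For $\varphi\in H(G)$,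 $$Z^R_\varphi=\exp\Big(-\int_0^T\langle\varphi'\varphi^{-1},\delta B^L\rangle-\tfrac12\int_0^T|\varphi'\varphi^{-1}|^2dt\Big).$$ *)

(* Defs.v *)
From HB Require Import structures.
From mathcomp Require Import all_boot all_order all_algebra.
From mathcomp Require Import all_classical all_reals all_analysis.

Set Implicit Arguments.
Unset Strict Implicit.
Unset Printing Implicit Defensive.

Import Order.TTheory GRing.Theory Num.Theory.
Import numFieldNormedType.Exports.

Local Open Scope classical_set_scope.
Local Open Scope ring_scope.

Notation borel X := (g_sigma_algebraType (@open X)).

(* A compact subgroup of GL_n(R) is closed, hence a Lie subgroup by Cartan's
   theorem; conversely every compact Lie subgroup of GL_n(R) is a compact subset
   of M_n(R) and carries the induced topology. *)
Record compact_connected_lie_group (R : realType) (n : nat) := CompactLieGroup {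
  lie_set :> set 'M[R]_n;
  lie_unit : lie_set `<=` [set x | x \in unitmx];
  lie_one : lie_set 1%:M;
  lie_mul : forall x y, lie_set x -> lie_set y -> lie_set (x *m y);
  lie_inv : forall x, lie_set x -> lie_set (invmx x);
  lie_compact : compact lie_set;
  lie_connected : connected lie_set }.

Section LieAlgebra.
Context (R : realType) (n : nat).
Implicit Types (G : compact_connected_lie_group R n) (A B x : 'M[R]_n).

Definition expmx A : 'M[R]_n :=
  limn (fun N : nat => \sum_(k < N) (k`!%:R : R)^-1 *: A ^+ k).

Definition lie_algebra G : set 'M[R]_n :=
  [set A | forall t : R, lie_set G (expmx (t *: A))].

(* [ip] is total on matrices, but only its values on the Lie algebra matter. *)
Record Ad_invariant_inner_product G (ip : 'M[R]_n -> 'M[R]_n -> R) : Prop :=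
  AdInvariantInnerProduct {
  ip_sym : forall A B, lie_algebra G A -> lie_algebra G B -> ip A B = ip B A;
  ip_linear : forall (a : R) A B C,
    lie_algebra G A -> lie_algebra G B -> lie_algebra G C ->
    ip (a *: A + B) C = a * ip A C + ip B C;
  ip_pos : forall A, lie_algebra G A -> A != 0 -> 0 < ip A A;
  ip_Ad : forall x A B, lie_set G x -> lie_algebra G A -> lie_algebra G B ->
    ip (x *m A *m invmx x) (x *m B *m invmx x) = ip A B }.

Record orthonormal_basis G (ip : 'M[R]_n -> 'M[R]_n -> R) (d : nat)
    (E : 'I_d -> 'M[R]_n) : Prop := OrthonormalBasis {
  onb_mem : forall i, lie_algebra G (E i);
  onb_ortho : forall i j, ip (E i) (E j) = (i == j)%:R;
  onb_span : forall A, lie_algebra G A ->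
    exists c : 'I_d -> R, A = \sum_i c i *: E i }.

(* the integral curve through [x] of the left invariant vector field with value
   [A] at the identity *)
Definition left_curve A x (t : R) : 'M[R]_n := x *m expmx (t *: A).

Definition left_field A (f : 'M[R]_n -> R) : 'M[R]_n -> R :=
  fun x => derive1 (f \o left_curve A x) 0.

Definition laplacian (d : nat) (E : 'I_d -> 'M[R]_n) (f : 'M[R]_n -> R) :
  'M[R]_n -> R := fun x => \sum_i left_field (E i) (left_field (E i) f) x.

End LieAlgebra.

Section HeatKernel.
Context (R : realType) (n : nat) (G : compact_connected_lie_group R n).

(* no normalization: the heat kernel below is normalized accordingly *)
Record haar_measure (lam : {measure set (borel 'M[R]_n) -> \bar R}) : Prop :=
  HaarMeasure {
  haar_supp : lam (~` G) = 0%E;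
  haar_gt0 : (0 < lam G)%E;
  haar_fin : (lam G < +oo)%E;
  haar_inv : forall (x : 'M[R]_n) (A : set (borel 'M[R]_n)),
    lie_set G x -> measurable A -> lam [set x *m y | y in A] = lam A }.

(* [u] is of class C^1 in t > 0 and C^2 in x \in G, jointly *)
Record C12 (d : nat) (E : 'I_d -> 'M[R]_n) (u : R -> 'M[R]_n -> R) : Prop :=
  MkC12 {
  C12_t : forall (t : R) (x : 'M[R]_n), 0 < t -> lie_set G x ->
    derivable (u ^~ x) t 1;
  C12_x : forall (t : R) (x : 'M[R]_n) i, 0 < t -> lie_set G x ->
    derivable (u t \o left_curve (E i) x) 0 1;
  C12_xx : forall (t : R) (x : 'M[R]_n) i j, 0 < t -> lie_set G x ->
    derivable (left_field (E i) (u t) \o left_curve (E j) x) 0 1;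
  C12_cont : {within `]0, +oo[ `*` G, continuous
    (fun tx : R * 'M[R]_n => u tx.1 tx.2)};
  C12_cont_t : {within `]0, +oo[ `*` G, continuous
    (fun tx : R * 'M[R]_n => derive1 (u ^~ tx.2) tx.1)};
  C12_cont_x : forall i, {within `]0, +oo[ `*` G, continuous
    (fun tx : R * 'M[R]_n => left_field (E i) (u tx.1) tx.2)};
  C12_cont_xx : forall i j, {within `]0, +oo[ `*` G, continuous
    (fun tx : R * 'M[R]_n =>
       left_field (E j) (left_field (E i) (u tx.1)) tx.2)} }.

(* the fundamental solution at the identity of du/dt = (1/2) Laplacian u *)
Record heat_kernel (d : nat) (E : 'I_d -> 'M[R]_n)
    (lam : {measure set (borel 'M[R]_n) -> \bar R})
    (p : R -> 'M[R]_n -> R) : Prop := HeatKernel {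
  hk_C12 : C12 E p;
  hk_eq : forall (t : R) (x : 'M[R]_n), 0 < t -> lie_set G x ->
    derive1 (p ^~ x) t = 2^-1 * laplacian E (p t) x;
  hk_init : forall f : 'M[R]_n -> R, {within G, continuous f} ->
    \int[lam]_(x in G) (f x * p t x) @[t --> 0^'+] --> f 1%:M }.

End HeatKernel.

Section WienerSpace.
Context (R : realType) (n : nat) (G : compact_connected_lie_group R n) (T : R).

(* A path on [0, T] is encoded as a function on R, extended by the identity
   outside [0, T]; this gives each path exactly one representative. *)
Definition wiener_paths : set {uniform` `[0, T] -> 'M[R]_n} :=
  [set w : R -> 'M[R]_n | [/\ {within `[0, T], continuous w},
     (forall t : R, t \in `[0, T] -> lie_set G (w t)),
     w 0 = 1%:M &
     (forall t : R, t \notin `[0, T] -> w t = 1%:M)]].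

Definition wiener_space : Type := set_type wiener_paths.

Fact cst1_wiener_paths : ((fun=> 1%:M) : R -> 'M[R]_n) \in wiener_paths.
Proof.
apply/mem_set; split => //=; last by move=> t _; exact: lie_one.
by move=> x; exact: cst_continuous.
Qed.

HB.instance Definition _ := Topological.on wiener_space.
HB.instance Definition _ :=
  isPointed.Build wiener_space 
    (exist (fun w => w \in wiener_paths) _ cst1_wiener_paths).

Definition path_at (t : R) (w : wiener_space) : 'M[R]_n :=
  (set_val w : R -> 'M[R]_n) t.

End WienerSpace.

Arguments path_at {R n G T} t w.

Notation wiener_measurable G T := (borel (wiener_space G T)).

Section WienerMeasure.
Context (R : realType) (n : nat) (G : compact_connected_lie_group R n) (T : R).
Variables (lam : {measure set (borel 'M[R]_n) -> \bar R})
          (p : R -> 'M[R]_n -> R).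

(* integral over G^k against the product of k copies of Haar measure, as an
   iterated integral *)
Fixpoint haar_power_integral (k : nat) :
    (k.-tuple (borel 'M[R]_n) -> \bar R) -> \bar R :=
  if k is k'.+1 then
    fun f => (\int[lam]_(x in (G : set (borel 'M[R]_n)))
                haar_power_integral (fun y : k'.-tuple _ => f (cons_tuple x y)))%E
  else fun f => f [tuple].

Definition transition_density (k : nat) (s : k.-tuple R)
    (x : k.-tuple (borel 'M[R]_n)) : R :=
  \prod_(i < k) p (tnth s i - nth 0 (0 :: s) i)
                  (invmx (nth 1%:M (1%:M :: (x : seq 'M[R]_n)) i) *m tnth x i).

Definition wiener_measure
    (mu : probability (wiener_measurable G T) R) : Prop :=
  forall (k : nat) (s : k.-tuple R), itv_partition 0 T s ->
  forall B : set (k.-tuple (borel 'M[R]_n)), measurable B ->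
    mu [set w | B (map_tuple (fun t => path_at t w) s)] =
    haar_power_integral (fun x => (\1_B x * transition_density s x)%:E).

End WienerMeasure.

Section CameronMartin.
Context (R : realType) (n : nat) (G : compact_connected_lie_group R n) (T : R).
Variable ip : 'M[R]_n -> 'M[R]_n -> R.

Definition absolutely_continuous_path (h : R -> 'M[R]_n) : Prop :=
  forall e : R, 0 < e -> exists2 delta : R, 0 < delta &
    forall (m : nat) (a b : 'I_m -> R),
      (forall i, [/\ 0 <= a i, a i <= b i & b i <= T]) ->
      (forall i j, i != j -> b i <= a j \/ b j <= a i) ->
      \sum_i (b i - a i) < delta -> \sum_i `|h (b i) - h (a i)| < e.

(* squared norm in L^2([0, T]; Lie algebra) *)
Definition energy (f : R -> 'M[R]_n) : \bar R :=
  (\int[lebesgue_measure]_(t in `[0%R, T]) (ip (f t) (f t))%:E)%E.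

Definition cameron_martin : set (wiener_space G T) :=
  [set h | absolutely_continuous_path (path_at ^~ h) /\
    (energy (fun t => invmx (path_at t h) *m derive1 (path_at ^~ h) t) < +oo)%E].

Definition right_log_derivative (h : wiener_space G T) (t : R) : 'M[R]_n :=
  derive1 (path_at ^~ h) t *m invmx (path_at t h).

End CameronMartin.

Section StochasticIntegrals.
Context (R : realType) (n : nat) (G : compact_connected_lie_group R n) (T : R).
Local Notation W := (wiener_measurable G T).
Variables (ip : 'M[R]_n -> 'M[R]_n -> R) (mu : probability W R).
Implicit Types X Y : R -> W -> 'M[R]_n.

Definition mesh (s : seq R) : R :=
  \big[Num.max/0]_(i < size s) (nth 0 s i - nth 0 (0 :: s) i).

Definition midpoint_sum Y X (s : seq R) (w : W) : 'M[R]_n :=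
  \sum_(i < size s)
    (2^-1 *: (Y (nth 0 (0 :: s) i) w + Y (nth 0 s i) w)) *m
    (X (nth 0 s i) w - X (nth 0 (0 :: s) i) w).

(* [I] is a version of the Stratonovich integral of Y dX over [0, t]: the limit
   in probability of the symmetric Riemann sums *)
Definition stratonovich_integral Y X (t : R) (I : W -> 'M[R]_n) : Prop :=
  (forall i j, measurable_fun setT (fun w => I w i j)) /\
  forall s : nat -> seq R, (forall m, itv_partition 0 t (s m)) ->
    mesh (s m) @[m --> \oo] --> 0 ->
    forall e : R, 0 < e ->
      mu [set w | e <= `|midpoint_sum Y X (s m) w - I w|] @[m --> \oo] --> 0%E.

(* B^L_t, the integral of g^-1 dg. Like BL_integral below it is determined up to
   mu-null sets only: [xget] picks a version, here with values in the Lie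
   algebra. *)
Definition BL (t : R) : W -> 'M[R]_n :=
  xget (fun=> 0) [set I | (forall w, lie_algebra G (I w)) /\
    stratonovich_integral (fun s w => invmx (path_at s w)) path_at
      t I].

(* A step function is a list of triples (a, b, A), standing for the sum of the
   functions equal to A on ]a, b] and to 0 elsewhere. *)
Definition is_step (l : seq (R * R * 'M[R]_n)) : Prop :=
  forall x, x \in l ->
    [/\ 0 <= x.1.1, x.1.1 <= x.1.2, x.1.2 <= T & lie_algebra G x.2].

Definition step_fun (l : seq (R * R * 'M[R]_n)) (t : R) : 'M[R]_n :=
  \sum_(x <- l) (\1_(`]x.1.1, x.1.2] : set R) t : R) *: x.2.

Definition step_integral (l : seq (R * R * 'M[R]_n)) (w : W) : R :=
  \sum_(x <- l) ip x.2 (BL x.1.2 w - BL x.1.1 w).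

(* A version of the integral of <f, delta B^L> over [0, T] for a deterministic
   square integrable f: the Stratonovich correction vanishes for deterministic
   integrands, and the integral is the L^2(mu)-limit of the integrals of step
   functions converging to f in L^2. *)
Definition BL_integral (f : R -> 'M[R]_n) : W -> R :=
  xget (fun=> 0) [set I | I \in Lfun mu 2%:E /\
    exists2 l : nat -> seq (R * R * 'M[R]_n), (forall m, is_step (l m)) &
      (energy T ip (fun t => step_fun (l m) t - f t) @[m --> \oo] --> 0%E) /\
      ('N[mu]_(2%:E) [EFin \o (step_integral (l m) \- I)%R]%E
         @[m --> \oo] --> 0%E)].

Definition ZR (phi : wiener_space G T) (w : W) : R :=
  let f := right_log_derivative phi in
  expR (- BL_integral f w - 2^-1 * fine (energy T ip f)).

End StochasticIntegrals.

Definition linear_span (R : realType) (X : Type) (S : set (X -> R)) :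
    set (X -> R) :=
  [set h | exists (m : nat) (c : 'I_m -> R) (z : 'I_m -> X -> R),
     (forall i, S (z i)) /\ h = (fun x => \sum_i c i * z i x)].

Definition HG (R : realType) (n : nat) (G : compact_connected_lie_group R n)
    (T : R) (ip : 'M[R]_n -> 'M[R]_n -> R)
    (mu : probability (wiener_measurable G T) R) :
    set (wiener_measurable G T -> R) :=
  linear_span [set (fun w => Num.sqrt (ZR ip mu phi w)) |
                 phi in @cameron_martin R n G T ip].

Definition dense_in_L2 d (X : measurableType d) (R : realType)
    (mu : {measure set X -> \bar R}) (S : set (X -> R)) : Prop :=
  (forall h, S h -> h \in Lfun mu 2%:E) /\
  (forall f : X -> R, f \in Lfun mu 2%:E -> forall e : R, 0 < e ->
     exists2 h, S h & ('N[mu]_(2%:E) [EFin \o (f \- h)%R] < e%:E)%E).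

(* Main.v *)
Require Import Defs.
From HB Require Import structures.
From mathcomp Require Import all_boot all_order all_algebra.
From mathcomp Require Import all_classical all_reals all_analysis.
From mathcomp Require Import measurable_realfun.
From mathcomp Require Import ring lra.
Set Implicit Arguments.
Unset Strict Implicit.
Unset Printing Implicit Defensive.
Import Order.TTheory GRing.Theory Num.Theory.
Import numFieldNormedType.Exports.
Local Open Scope classical_set_scope.
Local Open Scope ring_scope.

(* The Wiener measure enters only through the independence of the increments of
   the path g and the moments of one increment, which the heat equation gives to
   second order.  The sums of (x - x^-1) / 2 over the increments x of g along a
   partition are Cauchy in L^2 as the mesh tends to 0; the limit is B^L.  The
   integral I(l) of a step function l with values in the Lie algebra satisfies
   E I(l)^2 = |l|^2 and E exp(I(l)) <= exp(|l|^2 + 1).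

   The solution phi of phi' = l phi is in H(G) and (Z_phi)^(1/2) is a multiple of
   exp(- I(l) / 2), so that up to null sets H_G contains every exp(I(l)).  For a
   general phi, (Z_phi)^(1/2) is square integrable by Fatou's lemma.

   Call a bounded X a multiplier if X exp(I(l)) is in the closed span of the
   exponentials for every l.  Multipliers form an algebra closed under bounded
   almost sure limits.  Expanding the sine shows that sin(I(l)) is a multiplier;
   the class of those Y for which all sin(c Y) are multipliers contains the I(l)
   and is closed under sums, products and almost sure limits.  The Euler scheme
   for dg = g dB + (1/2) g C dt, C the sum of the squares of an orthonormal basis,
   makes g_t an almost sure limit of polynomials in the I(l).  Hence the indicator
   of every Borel set is a multiplier, and simple functions are dense in L^2. *)

(** * Matrices and the matrix exponential *)

Section MatrixTopology.
Context {R : realType}.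

(** [BL] and [BL_integral] are choices among almost surely equal versions, so each needs an explicit
    candidate and a uniqueness argument. The law of mu is accessible only through finite partitions
    of [0, T]. The decisive estimate is the covariance of two midpoint terms over overlapping
    intervals. An increment is a product over subintervals; the factors outside the common part are
    independent of the rest and are replaced by their mean exp(tC/2). What remains differs from the
    Brownian covariance by an error proportional to the overlap, so it can be summed over all pairs
    of cells. Since x and x^-1 have the same mean, terms over disjoint intervals are exactly
    uncorrelated. The law of I(l) is never identified as Gaussian: the crude exponential bound
    suffices for square integrability. Multipliers are bounded while the I(l) are not; k sin(Y / k)
    is the bounded substitute for Y. For a step function l the path phi is an explicit product of
    matrix exponentials, and for any other phi only the square integrability of (Z_phi)^(1/2) is at
    stake. *)

Lemma cvg_uniq {V : normedModType R} {T : Type} {F : set_system T}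
    {FF : ProperFilter F} (f : T -> V) (a b : V) :
  f x @[x --> F] --> a -> f x @[x --> F] --> b -> a = b.
Proof. by move=> /cvg_lim <- // /cvg_lim <-. Qed.

Lemma cvgr_uniq {T : Type} {F : set_system T} {FF : ProperFilter F}
    (f : T -> R) (a b : R) :
  f x @[x --> F] --> a -> f x @[x --> F] --> b -> a = b.
Proof. exact: (@cvg_uniq R^o). Qed.

Lemma le_mx_norm m n (A : 'M[R]_(m, n)) i j : `|A i j| <= `|A|.
Proof.
rewrite [in leRHS]/Num.Def.normr/= mx_normrE.
exact: (le_bigmax _ (fun ij => `|A ij.1 ij.2|) (i, j)).
Qed.

Lemma mx_norm_le m n (A : 'M[R]_(m, n)) (e : R) : 0 <= e ->
  (forall i j, `|A i j| <= e) -> `|A| <= e.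
Proof.
move=> e0 Ae; rewrite [in leLHS]/Num.Def.normr/= mx_normrE.
by apply: bigmax_le => // -[i j] _; exact: Ae.
Qed.

Lemma cvg_mx (T : Type) (F : set_system T) (FF : Filter F) m n
    (f : T -> 'M[R]_(m, n)) (M : 'M[R]_(m, n)) :
  (forall i j, f x i j @[x --> F] --> M i j) <-> (f x @[x --> F] --> M).
Proof.
split=> [fM|fM i j]; last first.
  exact: (cvg_comp _ _ fM (@coord_continuous R m n i j M)).
apply/cvgrPdist_le => e e0.
have H : \forall x \near F, forall ij : 'I_m * 'I_n,
    `|M ij.1 ij.2 - f x ij.1 ij.2| <= e.
  by apply: filter_forall => ij; have /cvgrPdist_le/(_ e e0) := fM ij.1 ij.2.
apply: filterS H => x Hx; apply: mx_norm_le; first exact: ltW.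
by move=> i j; rewrite !mxE; exact: (Hx (i, j)).
Qed.

Lemma continuous_mx (T : topologicalType) m n (f : T -> 'M[R]_(m, n)) :
  (forall i j, continuous (fun x => f x i j)) -> continuous f.
Proof. by move=> fc x; apply/cvg_mx => i j; exact: fc. Qed.

Lemma norm_mulmx_le m n p (A : 'M[R]_(m, n)) (B : 'M[R]_(n, p)) :
  `|A *m B| <= n%:R * `|A| * `|B|.
Proof.
apply: mx_norm_le => [|i j]; first by rewrite !mulr_ge0.
rewrite mxE (le_trans (ler_norm_sum _ _ _))//.
have -> : n%:R * `|A| * `|B| = \sum_(k < n) `|A| * `|B|.
  by rewrite sumr_const card_ord -[RHS]mulr_natl mulrA.
by apply: ler_sum => k _; rewrite normrM ler_pM// le_mx_norm.
Qed.

Lemma cvg_sumr (T I : Type) (F : set_system T) (FF : Filter F) (s : seq I)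
    (P : pred I) (f : I -> T -> R) (l : I -> R) :
  (forall i, P i -> f i x @[x --> F] --> l i) ->
  \sum_(i <- s | P i) f i x @[x --> F] --> \sum_(i <- s | P i) l i.
Proof.
move=> fl; elim: s => [|i s IH].
  by under eq_fun do rewrite big_nil; rewrite big_nil; exact: cvg_cst.
under eq_fun do rewrite big_cons; rewrite big_cons.
by case: ifPn => // Pi; apply: cvgD => //; exact: fl.
Qed.

Lemma cvg_mulmx (T : Type) (F : set_system T) (FF : Filter F) m n p
    (f : T -> 'M[R]_(m, n)) (g : T -> 'M[R]_(n, p))
    (A : 'M[R]_(m, n)) (B : 'M[R]_(n, p)) :
  f x @[x --> F] --> A -> g x @[x --> F] --> B ->
  f x *m g x @[x --> F] --> A *m B.
Proof.
move=> /cvg_mx fA /cvg_mx gB; apply/cvg_mx => i j; rewrite mxE.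
under eq_fun do rewrite mxE.
by apply: cvg_sumr => k _; apply: cvgM.
Qed.

End MatrixTopology.

Section MatrixExponential.
Context {R : realType} {n : nat}.
Implicit Types A B : 'M[R]_n.

(** The entry (i, j) of A^m exp(tA) is the power series in t with coefficients [c A i j m]. Formal
    differentiation of the series raises m by one, so a single family describes exp(tA) and its
    derivatives. *)
Let c A i j (m k : nat) : R := (A ^+ (k + m)) i j / k`!%:R.

Lemma norm_expr_mx_le A k : `|A ^+ k| <= (n%:R * `|A| + 1) ^+ k.
Proof.
elim: k => [|k IH].
  rewrite expr0 expr0; apply: mx_norm_le => // i j.
  by rewrite mxE; case: (i == j); rewrite ?mulr1n ?mulr0n ?normr1 ?normr0.
rewrite exprS [in leRHS]exprS (le_trans (norm_mulmx_le _ _))//.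
by rewrite ler_pM// ?mulr_ge0// lerDl.
Qed.

Let is_cvg_c A i j m (K : R) : cvgn (pseries (c A i j m) K).
Proof.
apply: normed_cvg; set a := n%:R * `|A| + 1.
have a0 : 0 <= a by rewrite addr_ge0// mulr_ge0.
apply: (@series_le_cvg _ _ (fun k => a ^+ m * (exp_coeff (a * `|K|) k))) => /=.
- by [].
- move=> k; rewrite mulr_ge0 ?exprn_ge0//; apply: divr_ge0 => //.
  by rewrite exprn_ge0// mulr_ge0.
- move=> k; rewrite /c normrM normrX normf_div (ger0_norm (ler0n _ _)).
  rewrite /exp_coeff/= exprMn.
  have -> : a ^+ m * (a ^+ k * `|K| ^+ k / k`!%:R) =
    a ^+ (k + m) / k`!%:R * `|K| ^+ k by rewrite exprD; ring.
  apply: ler_wpM2r; first exact: exprn_ge0.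
  apply: ler_wpM2r; first by rewrite invr_ge0.
  by rewrite (le_trans (le_mx_norm _ _ _))// norm_expr_mx_le.
- apply: is_cvg_seriesZ; exact: is_cvg_series_exp_coeff.
Qed.

Let pseries_diffs_c A i j m : pseries_diffs (c A i j m) = c A i j m.+1.
Proof.
apply/funext => k; rewrite /pseries_diffs /c addSnnS factS natrM invfM.
by rewrite mulrCA; congr (_ * _); rewrite mulrA divff ?mul1r// pnatr_eq0.
Qed.

Let pE A i j m (t : R) := limn (pseries (c A i j m) t).

Let is_derive_pE A i j m (t : R) :
  is_derive t 1 (pE A i j m) (pE A i j m.+1 t).
Proof.
rewrite /pE -pseries_diffs_c.
apply: (@pseries_snd_diffs _ _ (`|t| + 1)); rewrite ?pseries_diffs_c.
- exact: is_cvg_c.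
- exact: is_cvg_c.
- exact: is_cvg_c.
- by rewrite [ltRHS]ger0_norm ?addr_ge0// ltrDl.
Qed.

Let cvg_pE A i j m (t : R) : pseries (c A i j m) t k @[k --> \oo] --> pE A i j m t.
Proof. exact: is_cvg_c. Qed.

Lemma expmx_cvg A : \sum_(k < N) (k`!%:R : R)^-1 *: A ^+ k @[N --> \oo] --> expmx A.
Proof.
suff : cvgn (fun N : nat => \sum_(k < N) (k`!%:R : R)^-1 *: A ^+ k) by [].
apply/cvg_ex; exists (\matrix_(i, j) pE A i j 0 1); apply/cvg_mx => i j.
rewrite mxE; have := @cvg_pE A i j 0 1; apply: cvg_trans; apply: near_eq_cvg.
near=> N; rewrite /pseries /series/= big_mkord summxE; apply: eq_bigr => k _.
by rewrite mxE expr1n mulr1 /c addn0 mulrC.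
Unshelve. all: by end_near. Qed.

Lemma exprZmx (t : R) A k : (t *: A) ^+ k = t ^+ k *: A ^+ k.
Proof.
elim: k => [|k IH]; first by rewrite !expr0 scale1r.
by rewrite !exprS IH -[_ * _]/(_ *m _) -scalemxAl -scalemxAr scalerA.
Qed.

Let expmxE A (t : R) : expmx (t *: A) = \matrix_(i, j) pE A i j 0 t.
Proof.
apply/matrixP => i j; rewrite mxE.
have /cvg_mx/(_ i j) h := @expmx_cvg (t *: A).
apply/esym; apply: (cvgr_uniq (@cvg_pE A i j 0 t)).
move: h; apply: cvg_trans; apply: near_eq_cvg.
near=> N; rewrite /pseries /series/= big_mkord summxE; apply: eq_bigr => k _.
by rewrite mxE exprZmx mxE /c addn0; ring.
Unshelve. all: by end_near. Qed.

Let mulmx_pE A (t : R) i j : (A *m expmx (t *: A)) i j = pE A i j 1 t.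
Proof.
rewrite expmxE mxE; apply/esym; apply: (cvgr_uniq (@cvg_pE A i j 1 t)).
have : \sum_k A i k * pseries (c A k j 0) t N @[N --> \oo] -->
    \sum_k A i k * (\matrix_(i, j) pE A i j 0 t) k j.
  by apply: cvg_sumr => k _; rewrite mxE; apply: cvgMr; exact: cvg_pE.
apply: cvg_trans; apply: near_eq_cvg; near=> N.
rewrite /pseries /series/=.
under [LHS]eq_bigr do rewrite mulr_sumr.
rewrite exchange_big/=; apply: eq_bigr => k _.
rewrite /c addn1 exprS mxE !mulr_suml; apply: eq_bigr => l _.
by rewrite addn0 !mulrA.
Unshelve. all: by end_near. Qed.

Let pE_mulmx A (t : R) i j : (expmx (t *: A) *m A) i j = pE A i j 1 t.
Proof.
rewrite expmxE mxE; apply/esym; apply: (cvgr_uniq (@cvg_pE A i j 1 t)).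
have : \sum_k pseries (c A i k 0) t N * A k j @[N --> \oo] -->
    \sum_k (\matrix_(i, j) pE A i j 0 t) i k * A k j.
  by apply: cvg_sumr => k _; rewrite mxE; apply: cvgMl; exact: cvg_pE.
apply: cvg_trans; apply: near_eq_cvg; near=> N.
rewrite /pseries /series/=.
under [LHS]eq_bigr do rewrite mulr_suml.
rewrite exchange_big/=; apply: eq_bigr => k _.
rewrite /c addn1 exprSr mxE !mulr_suml; apply: eq_bigr => l _.
by rewrite addn0; ring.
Unshelve. all: by end_near. Qed.

Lemma expmx_comm A (t : R) : A *m expmx (t *: A) = expmx (t *: A) *m A.
Proof. by apply/matrixP => i j; rewrite mulmx_pE pE_mulmx. Qed.

Lemma is_derive_expmx A (t : R) i j :
  is_derive t 1 (fun s => expmx (s *: A) i j) ((A *m expmx (t *: A)) i j).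
Proof.
rewrite mulmx_pE (_ : (fun _ => _) = pE A i j 0); first exact: is_derive_pE.
by apply/funext => s; rewrite expmxE mxE.
Qed.

Lemma expmx0 : expmx 0 = 1%:M :> 'M[R]_n.
Proof.
apply: (cvg_uniq (@expmx_cvg 0)) => //.
apply: (@cvg_trans _ (cst (1%:M : 'M[R]_n) @ \oo)); last exact: cvg_cst.
apply: near_eq_cvg; exists 1 => // -[//|N] _ /=.
rewrite big_ord_recl/= expr0 fact0 invr1 scale1r big1 ?addr0// => i _.
by rewrite exprS mul0r scaler0.
Qed.

End MatrixExponential.

Section MatrixCalculus.
Context {R : realType}.

Lemma is_derive_sumr (I : Type) (s : seq I) (f : I -> R -> R) (df : I -> R) (t : R) :
  (forall i, is_derive t 1 (f i) (df i)) ->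
  is_derive t 1 (fun x => \sum_(i <- s) f i x) (\sum_(i <- s) df i).
Proof.
move=> fdf; elim: s => [|i s IH].
  by under eq_fun do rewrite big_nil; rewrite big_nil; exact: is_derive_cst.
by under eq_fun do rewrite big_cons; rewrite big_cons; exact: is_deriveD.
Qed.

Lemma is_derive_mulmx m n p (f : R -> 'M[R]_(m, n)) (g : R -> 'M[R]_(n, p))
    (df : 'M[R]_(m, n)) (dg : 'M[R]_(n, p)) (t : R) :
  (forall i j, is_derive t 1 (fun s => f s i j) (df i j)) ->
  (forall i j, is_derive t 1 (fun s => g s i j) (dg i j)) ->
  forall i j, is_derive t 1 (fun s => (f s *m g s) i j)
    ((df *m g t + f t *m dg) i j).
Proof.
move=> fd gd i j; under eq_fun do rewrite mxE.
rewrite 3!mxE -big_split/=; apply: is_derive_sumr => k.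
by apply: is_derive_eq; rewrite /GRing.scale/=; ring.
Qed.

Context {n : nat}.
Implicit Types A B : 'M[R]_n.

Lemma is_derive_expmx_comp A (a b t : R) i j :
  is_derive t 1 (fun s => expmx ((a * s + b) *: A) i j)
    (a * (A *m expmx ((a * t + b) *: A)) i j).
Proof.
have h : is_derive t 1 (fun s => a * s + b) a.
  by apply: is_derive_eq; rewrite /GRing.scale/=; ring.
have := @is_derive1_comp _ (fun s => expmx (s *: A) i j) _ t _ _
  (@is_derive_expmx _ _ A (a * t + b) i j) h.
by rewrite /GRing.scale/= [in X in _ -> X]mulrC.
Qed.

(** The curve r |-> exp((s + t - r)A) exp(rA) has derivative zero, because A commutes with its
    exponential; its values at r = 0 and r = t are the two sides. *)
Lemma expmxDl A (s t : R) :
  expmx ((s + t) *: A) = expmx (s *: A) *m expmx (t *: A).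
Proof.
pose f (r : R) := expmx ((-1 * r + (s + t)) *: A) *m expmx ((1 * r + 0) *: A).
suff fC i j : f 0 i j = f t i j.
  transitivity (f 0).
    by rewrite /f !mulr0 add0r addr0 scale0r expmx0 mulmx1.
  transitivity (f t); first by apply/matrixP => i j.
  by rewrite /f mul1r addr0 mulN1r addrCA addNr addr0.
apply: (@is_derive_0_is_cst _ (fun r => f r i j)) => r.
have := @is_derive_mulmx _ _ _ (fun r => expmx ((-1 * r + (s + t)) *: A))
   (fun r => expmx ((1 * r + 0) *: A))
   (-1 *: (A *m expmx ((-1 * r + (s + t)) *: A)))
   (1 *: (A *m expmx ((1 * r + 0) *: A))) r.
move=> /(_ _ _ i j) h.
apply: (is_derive_eq (h _ _)) => [k l|k l|].
- by rewrite [X in is_derive _ _ _ X]mxE; exact: is_derive_expmx_comp.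
- by rewrite [X in is_derive _ _ _ X]mxE; exact: is_derive_expmx_comp.
- rewrite scaleN1r scale1r (expmx_comm A (-1 * r + (s + t))).
  by rewrite mulNmx mulmxA addNr mxE.
Qed.

Lemma expmxNl A (t : R) : expmx (t *: A) *m expmx (- t *: A) = 1%:M.
Proof. by rewrite -expmxDl subrr scale0r expmx0. Qed.

Lemma expmx_unit A (t : R) : expmx (t *: A) \in unitmx.
Proof. by have [] := mulmx1_unit (expmxNl A t). Qed.

Lemma invmx_expmx A (t : R) : invmx (expmx (t *: A)) = expmx (- t *: A).
Proof.
by rewrite -[LHS]mulmx1 -(expmxNl A t) mulmxA mulVmx ?mul1mx// expmx_unit.
Qed.

End MatrixCalculus.

(** * Borel measurability of matrix-valued maps *)

Section BorelMaps.
Context {R : realType}.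

Lemma borel_open (X : ptopologicalType) (U : set X) :
  open U -> measurable (U : set (borel X)).
Proof. by move=> oU; exact: sub_sigma_algebra. Qed.

Lemma borel_closed (X : ptopologicalType) (U : set X) :
  closed U -> measurable (U : set (borel X)).
Proof.
move=> cU; rewrite -(setCK U); apply: measurableC.
by apply: borel_open; rewrite openC.
Qed.

Lemma eq_within_continuous (X Y : topologicalType) (D : set X) (f g : X -> Y) :
  (forall x, D x -> f x = g x) ->
  {within D, continuous f} -> {within D, continuous g}.
Proof.
by move=> fg; apply: subspace_eq_continuous => x /set_mem; exact: fg.
Qed.

Lemma within_continuous_borel (X Y : ptopologicalType) (D : set X) (f : X -> Y) :
  measurable (D : set (borel X)) -> {within D, continuous f} ->
  measurable_fun (D : set (borel X)) (f : borel X -> borel Y).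
Proof.
move=> mD /continuousP cf.
apply: (@measurability _ _ (borel X) (borel Y) D f (@open Y) erefl).
move=> _ [B Bopen <-].
have /open_subspaceP := cf B Bopen; move=> -[U oU UB].
have -> : D `&` f @^-1` B = D `&` U by rewrite setIC [in RHS]setIC UB.
by apply: measurableI => //; exact: borel_open.
Qed.

Lemma within_continuous_measurable (X : ptopologicalType) (D : set X) (f : X -> R) :
  measurable (D : set (borel X)) -> {within D, continuous f} ->
  measurable_fun (D : set (borel X)) f.
Proof.
move=> mD /continuousP cf.
apply: (measurability _ (measurable_realfun.RGenOpens.measurableE R)).
move=> _ [_ [a [b ->] <-]].
have /open_subspaceP := cf _ (@interval_open R (BSide false a) (BSide true b) isT isT).
move=> -[U oU UB].
have -> : D `&` f @^-1` `]a, b[ = D `&` U by rewrite setIC [in RHS]setIC UB.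
by apply: measurableI => //; exact: borel_open.
Qed.

Lemma measurable_entry m n (i : 'I_m) (j : 'I_n) :
  measurable_fun setT (fun x : borel 'M[R]_(m, n) => x i j).
Proof.
apply: (@within_continuous_measurable 'M[R]_(m, n) setT (fun x => x i j)) => //.
by apply: continuous_subspaceT; exact: coord_continuous.
Qed.

(** Cubes with a rational centre and radius 1/(k+1) form a countable base of the matrix space. Hence
    a map with measurable entries is Borel. *)
Let box m n (q : 'M[rat]_(m, n)) (k : nat) : set 'M[R]_(m, n) :=
  [set x | forall i j, `|x i j - ratr (q i j)| < k.+1%:R^-1].

Let open_bigcup_box m n (U : set 'M[R]_(m, n)) : open U ->
  U = \bigcup_k [set x | exists2 qk : 'M[rat]_(m, n) * nat,
    unpickle k = Some qk /\ box qk.1 qk.2 `<=` U & box qk.1 qk.2 x].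
Proof.
move=> oU; apply/seteqP; split=> [x Ux|x [k _ [qk [_]]]]; last exact.
have /nbhs_ballP[e e0 xeU] := open_nbhs_nbhs (conj oU Ux).
have [k ke] : exists k : nat, k.+1%:R^-1 < e / 2.
  have : 0 < e / 2 by rewrite divr_gt0.
  by move=> e20; have [k _ /(_ k (leqnn k))] := near_infty_natSinv_lt (PosNum e20); exists k.
have k0 : 0 < k.+1%:R^-1 :> R by rewrite invr_gt0.
have [q qx] : exists q : 'M[rat]_(m, n), forall i j, `|x i j - ratr (q i j)| < k.+1%:R^-1.
  have h (ij : 'I_m * 'I_n) : exists r : rat, `|x ij.1 ij.2 - ratr r| < k.+1%:R^-1.
    have : x ij.1 ij.2 - k.+1%:R^-1 < x ij.1 ij.2 + k.+1%:R^-1.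
      by rewrite ltrBlDr -addrA ltrDl addr_gt0.
    move=> /rat_in_itvoo[r]; rewrite in_itv/= => /andP[r1 r2].
    by exists r; rewrite ltr_distlC r1.
  have [f fP] := choice h.
  by exists (\matrix_(i, j) f (i, j)) => i j; rewrite mxE; exact: (fP (i, j)).
exists (pickle (q, k)) => //; exists (q, k); last exact: qx.
split; first by rewrite pickleK.
move=> y yq; apply: xeU; rewrite mx_norm_ball /ball_/=.
apply: (@le_lt_trans _ _ (k.+1%:R^-1 + k.+1%:R^-1)); last first.
  by rewrite (splitr e) ltrD.
apply: mx_norm_le => [|i j]; first by rewrite addr_ge0 ?ltW.
rewrite !mxE -(subrKA (ratr (q i j))) (le_trans (ler_normD _ _))//.
by apply: lerD; apply: ltW; [exact: qx|rewrite distrC; exact: yq].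
Qed.

Lemma measurable_fun_mx d (T : measurableType d) m n (D : set T)
    (f : T -> 'M[R]_(m, n)) :
  (forall i j, measurable_fun D (fun x => f x i j)) ->
  measurable_fun D (f : T -> borel 'M[R]_(m, n)).
Proof.
move=> mf mD.
apply: (@measurability _ _ T (borel 'M[R]_(m, n)) D f (@open _) erefl) => //.
move=> _ [U oU <-].
rewrite (open_bigcup_box oU) preimage_bigcup setI_bigcupr.
apply: bigcupT_measurable => k.
case E : (unpickle k : option ('M[rat]_(m, n) * nat)) => [qk|]; last first.
  rewrite (_ : D `&` _ = set0)//; by apply/seteqP; split=> // x [_ [qk []]].
have [qkU|qkU] := pselect (box qk.1 qk.2 `<=` U); last first.
  rewrite (_ : D `&` _ = set0)//; apply/seteqP; split=> // x [_ [qk' []]].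
  by move=> -[<-].
rewrite (_ : D `&` _ = D `&` \bigcap_(ij in [set: 'I_m * 'I_n])
   (D `&` (fun x => f x ij.1 ij.2) @^-1`
     `](ratr (qk.1 ij.1 ij.2) - qk.2.+1%:R^-1),
       (ratr (qk.1 ij.1 ij.2) + qk.2.+1%:R^-1)[)); last first.
  apply/seteqP; split=> x [Dx].
    move=> [qk' [[qq] _] bx]; split=> // -[i j] _; split=> //.
    by rewrite /= in_itv/=; have := bx i j; rewrite -qq ltr_distl.
  move=> bx; split=> //; exists qk => // i j.
  by have [_] := bx (i, j) I; rewrite /= in_itv/= ltr_distl.
apply: measurableI => //; apply: fin_bigcap_measurable => // ij _.
exact: (mf ij.1 ij.2).
Qed.

Lemma continuous_prodr (T : topologicalType) (I : Type) (s : seq I) (f : I -> T -> R) :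
  (forall i, continuous (f i)) -> continuous (fun x => \prod_(i <- s) f i x).
Proof.
move=> fc; elim: s => [|i s IH] x.
  by under eq_fun do rewrite big_nil; exact: cvg_cst.
by under eq_fun do rewrite big_cons; apply: cvgM; [exact: fc|exact: IH].
Qed.

Lemma continuous_det (T : topologicalType) n (f : T -> 'M[R]_n) :
  continuous f -> continuous (fun x => \det (f x)).
Proof.
move=> fc x; apply: cvg_sumr => s _; apply: cvgM; first exact: cvg_cst.
apply: continuous_prodr => i y.
by have /cvg_mx h := fc y; exact: h.
Qed.

Lemma continuous_adj n i j : continuous (fun x : 'M[R]_n => \adj x i j).
Proof.
have detc : continuous (fun x : 'M[R]_n => \det (row' j (col' i x))).
  apply: continuous_det; apply: continuous_mx => k l.
  have -> : (fun x : 'M[R]_n => (row' j (col' i x)) k l) =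
      (fun x => x (lift j k) (lift i l)) by apply/funext => y; rewrite !mxE.
  exact: coord_continuous.
have -> : (fun x : 'M[R]_n => \adj x i j) =
    cst ((-1) ^+ (j + i)) \* (fun x => \det (row' j (col' i x))).
  by apply/funext => x; rewrite mxE.
by move=> x; apply: continuousM; [exact: cst_continuous|exact: detc].
Qed.

(** The cofactor expression is continuous near x. It agrees with [invmx] on invertible matrices
    only: elsewhere [invmx] returns its argument. *)
Lemma continuous_invmx n (x : 'M[R]_n) : x \in unitmx ->
  forall i j, (\det y)^-1 * \adj y i j @[y --> x] --> invmx x i j.
Proof.
move=> xu i j; rewrite /invmx xu mxE.
have detc : \det y @[y --> x] --> \det x.
  by apply: (@continuous_det _ _ id) => y; exact: cvg_id.
have det0 : \det x != 0 by move: xu; rewrite unitmxE unitfE.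
exact: (cvgM (cvgV det0 detc) (@continuous_adj n i j x)).
Qed.

End BorelMaps.

Section LieGroup.
Context {R : realType} {n : nat} (G : compact_connected_lie_group R n).

Lemma lie_unitmx x : lie_set G x -> x \in unitmx.
Proof. by move=> /lie_unit. Qed.

Lemma lie_closed : closed G.
Proof. by apply: compact_closed; [exact: norm_hausdorff|exact: lie_compact]. Qed.

Lemma measurable_lie : measurable (G : set (borel 'M[R]_n)).
Proof. exact: (@borel_closed 'M[R]_n G lie_closed). Qed.

Lemma lie_bounded (F : 'M[R]_n -> R) : {within G, continuous F} ->
  exists2 M, 0 <= M & forall x, lie_set G x -> `|F x| <= M.
Proof.
move=> Fc; have /compact_bounded[M [_ MG]] := continuous_compact Fc (@lie_compact _ _ G).
exists (`|M| + 1); first by rewrite addr_ge0.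
move=> x Gx; apply: (MG (`|M| + 1)); last by exists x.
by rewrite (le_lt_trans (ler_norm M))// ltrDl.
Qed.

Lemma invmx_within_continuous i j : {within G, continuous (fun x : 'M[R]_n => invmx x i j)}.
Proof.
apply: (@eq_within_continuous 'M[R]_n R G (fun x : 'M[R]_n => (\det x)^-1 * \adj x i j)).
  by move=> x Gx; rewrite /invmx (lie_unitmx Gx) [RHS]mxE.
apply: continuous_in_subspaceT => x /set_mem Gx.
have := @continuous_invmx R n x (lie_unitmx Gx) i j.
by rewrite {1}/invmx (lie_unitmx Gx) [X in _ --> X]mxE.
Qed.

Lemma lie_measurable_inv i j :
  measurable_fun (G : set (borel 'M[R]_n)) (fun x => invmx x i j).
Proof.
apply: within_continuous_measurable; first exact: measurable_lie.
exact: invmx_within_continuous.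
Qed.

Lemma measurable_fun_mulmx d (T : measurableType d) m k l (D : set T)
    (f : T -> 'M[R]_(m, k)) (g : T -> 'M[R]_(k, l)) :
  (forall i j, measurable_fun D (fun x => f x i j)) ->
  (forall i j, measurable_fun D (fun x => g x i j)) ->
  forall i j, measurable_fun D (fun x => (f x *m g x) i j).
Proof.
move=> mf mg i j; under eq_fun do rewrite mxE.
by apply: measurable_sum => r; exact: measurable_funM.
Qed.

Lemma lie_left_curve A x t : lie_algebra G A -> lie_set G x -> lie_set G (left_curve A x t).
Proof. by move=> GA Gx; apply: lie_mul => //; exact: GA. Qed.

End LieGroup.

(** * Haar measure and integration by parts *)

Section IntegralHelpers.
Context {R : realType}.

Lemma bounded_integrable d (T : measurableType d) (m : {measure set T -> \bar R})
    (D : set T) (f : T -> R) (K : R) :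
  measurable D -> (m D < +oo)%E -> measurable_fun D f ->
  (forall x, D x -> `|f x| <= K) -> m.-integrable D (EFin \o f).
Proof.
move=> mD fD mf fK; apply: measurable_bounded_integrable => //.
exists K; split; first exact: num_real.
by move=> y Ky x Dx; exact: (le_trans (fK _ Dx) (ltW Ky)).
Qed.

Lemma ge0_integral_image_measure d d' (X : measurableType d) (Y : measurableType d')
    (phi : X -> Y) (mu : {measure set X -> \bar R})
    (nu : {measure set Y -> \bar R}) (D : set Y) (f : Y -> \bar R) :
  measurable_fun setT phi ->
  (forall A, measurable A -> mu (phi @^-1` A) = nu A) ->
  measurable D -> measurable_fun D f -> (forall y, (0 <= f y)%E) ->
  (\int[mu]_(x in phi @^-1` D) f (phi x) = \int[nu]_(y in D) f y)%E.
Proof.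
move=> mphi munu mD mf f0.
pose phi' : {mfun X >-> Y} := HB.pack phi (isMeasurableFun.Build _ _ _ _ _ mphi).
rewrite -[LHS](@ge0_integral_pushforward _ _ _ _ _ _ mphi mu D f)//.
apply: (@eq_measure_integral _ _ _ _ nu (pushforward mu phi')).
by move=> A mA _; exact: munu.
Qed.

Lemma invmx_mulmx n (A B : 'M[R]_n) : A \in unitmx -> B \in unitmx ->
  invmx (A *m B) = invmx B *m invmx A.
Proof.
move=> Au Bu; have ABu : A *m B \in unitmx by rewrite unitmx_mul Au.
rewrite -[RHS](mulKmx ABu) -[LHS]mulmx1; congr (_ *m _).
by rewrite mulmxA -(mulmxA A) mulmxV// mulmx1 mulmxV.
Qed.

End IntegralHelpers.

Section Haar.
Context {R : realType} {n : nat} (G : compact_connected_lie_group R n).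
Context (lam : {measure set (borel 'M[R]_n) -> \bar R}).
Hypothesis hlam : haar_measure G lam.
Local Notation M := (borel 'M[R]_n).
Local Notation mG := (measurable_lie G).

Lemma haar_integrable (f : M -> R) (K : R) : measurable_fun (G : set M) f ->
  (forall x, lie_set G x -> `|f x| <= K) -> lam.-integrable G (EFin \o f).
Proof. by apply: bounded_integrable; [exact: mG|exact: haar_fin hlam]. Qed.

Lemma measurable_lie_mul (z : 'M[R]_n) (w : 'M[R]_n) (D : set M) :
  measurable_fun D (fun x : M => (z *m x *m w) : M).
Proof.
apply: measurable_fun_mx; apply: measurable_fun_mulmx => // i j.
apply: measurable_fun_mulmx => // {}i {}j.
exact: (measurable_funS _ _ (@measurable_entry R n n i j)).
Qed.

Lemma measurable_lie_invmx : measurable_fun (G : set M) (fun x : M => invmx x : M).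
Proof. by apply: measurable_fun_mx => i j; exact: lie_measurable_inv. Qed.

Lemma measurable_lie_comp d (T : measurableType d) d' (T' : measurableType d')
    (D : set T) (f : M -> T') (g : T -> M) : measurable D ->
  measurable_fun (G : set M) f -> measurable_fun D g ->
  (forall x, D x -> lie_set G (g x)) -> measurable_fun D (f \o g).
Proof.
move=> mD mf mg DG; apply: (measurable_comp mG _ mf mg).
by move=> _ [x Dx <-]; exact: DG.
Qed.

Lemma haar_left (h : M -> \bar R) (y : 'M[R]_n) : lie_set G y ->
  measurable_fun (G : set M) h -> (forall x, (0 <= h x)%E) ->
  (\int[lam]_(x in G) h (y *m x) = \int[lam]_(x in G) h x)%E.
Proof.
move=> Gy mh h0; pose phi (x : M) : M := y *m x.
have yu := lie_unitmx Gy.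
have mphi : measurable_fun setT phi.
  rewrite (_ : phi = (fun x => y *m x *m 1%:M)); first exact: measurable_lie_mul.
  by apply/funext => x; rewrite mulmx1.
have GE : (G : set M) = phi @^-1` (G : set M).
  apply/seteqP; split=> [x Gx|x Gyx]; first exact: lie_mul.
  by rewrite -[x]mul1mx -(mulVmx yu) -mulmxA; apply: lie_mul => //; exact: lie_inv.
rewrite [in LHS]GE; apply: ge0_integral_image_measure => //; last exact: mG.
move=> A mA; rewrite -(haar_inv hlam (lie_inv Gy) mA).
congr (lam _); apply/seteqP; split=> [x Ax|_ [x Ax <-]].
  by exists (phi x) => //; rewrite /phi mulmxA mulVmx// mul1mx.
by rewrite /preimage/phi/= mulmxA mulmxV// mul1mx.
Qed.

Let finlam : fin_num_fun lam.
Proof.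
move=> A mA; rewrite ge0_fin_numE//.
rewrite (le_lt_trans _ (haar_fin hlam))//.
rewrite (measureDI _ mA mG) [X in (X + _)%E](_ : _ = 0%E) ?add0e.
  by apply: le_measure; rewrite ?inE //; [apply: measurableI; [|exact: mG]|exact: mG].
apply/eqP; rewrite eq_le measure_ge0 andbT -(haar_supp hlam).
apply: le_measure; rewrite ?inE //; first by apply: measurableD => //; exact: mG.
by apply: measurableC; exact: mG.
Qed.

Let sigma_finlam : sigma_finite setT lam.
Proof. by apply: fin_num_fun_sigma_finite; [rewrite measure0|exact: finlam]. Qed.

Let sfinlam : sfinite_measure lam.
Proof. exact: sfinite_measure_sigma_finite. Qed.

(** The double integral of h(x^-1 y) over G x G is computed in both orders. Integrating in y gives
    lam(G) times the integral of h. Integrating in x, after the left translation x |-> yx, gives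
    lam(G) times the integral of h(x^-1). As 0 < lam(G) < oo, the factor cancels; compactness of G
    enters here. *)
Lemma haar_inversion (h : M -> \bar R) :
  measurable_fun (G : set M) h -> (forall x, (0 <= h x)%E) ->
  (\int[lam]_(x in G) h (invmx x) = \int[lam]_(x in G) h x)%E.
Proof.
move=> mh h0.
(* The same measure, repackaged with its finiteness as the Tonelli theorem demands. *)
pose lamF : {finite_measure set M -> \bar R} :=
  HB.pack_for (FiniteMeasure.type M R) (Measure.sort lam)
   (isFinite.Build _ _ _ (Measure.sort lam) finlam)
   (isSigmaFinite.Build _ _ _ (Measure.sort lam) sigma_finlam)
   (isSFinite.Build _ _ _ (Measure.sort lam) sfinlam).
pose GG : set (M * M) := (G : set M) `*` (G : set M).
have mGG : measurable GG by apply: measurableX; exact: mG.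
pose m (xy : M * M) : M := invmx xy.1 *m xy.2.
have mm : measurable_fun GG m.
  apply: measurable_fun_mx; apply: measurable_fun_mulmx => i j.
    apply: (@measurable_comp _ _ _ _ _ _ (G : set M)
      (fun x : M => invmx x i j) GG fst) => //; first exact: mG.
    - by move=> _ [[x y] [Gx Gy] <-].
    - exact: lie_measurable_inv.
    - exact: measurable_funTS.
  apply: (@measurable_comp _ _ _ _ _ _ setT (fun x : M => x i j) GG snd) => //.
    exact: measurable_entry.
  exact: measurable_funTS.
pose f := (h \o m) \_ GG.
have mf : measurable_fun setT f.
  apply/(measurable_restrictT _ mGG).
  apply: measurable_lie_comp => // -[x y] [Gx Gy].
  by apply: lie_mul => //; exact: lie_inv.
have f0 xy : (0 <= f xy)%E by apply: erestrict_ge0 => yz _; exact: h0.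
have := @fubini_tonelli _ _ _ _ _ lamF lamF f mf f0.
have GE (g : M -> \bar R) :
  (\int[lam]_x ((g \_ G) x) = \int[lam]_(x in G) g x)%E by rewrite [RHS]integral_mkcond.
have fE x y : f (x, y) = ((fun x => ((fun y => h (invmx x *m y)) \_ G) y) \_ G) x.
  rewrite /f !patchE !in_setX /=.
  by case: (x \in _) => //=; case: (y \in _).
have -> : (\int[lamF]_x \int[lamF]_y f (x, y) = lam G * \int[lam]_(x in G) h x)%E.
  rewrite -[LHS]/(\int[lam]_x \int[lam]_y f (x, y))%E.
  transitivity (\int[lam]_(x in G) (\int[lam]_(y in G) h y))%E.
    rewrite [RHS]integral_mkcond; apply: eq_integral => x _.
    under eq_integral do rewrite fE patchE.
    rewrite patchE; case: ifPn => [/set_mem Gx|_]; last by rewrite integral0.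
    by rewrite GE (haar_left (lie_inv Gx)).
  rewrite (integral_cst lam mG) muleC//.
have -> : (\int[lamF]_y \int[lamF]_x f (x, y) = lam G * \int[lam]_(x in G) h (invmx x))%E.
  rewrite -[LHS]/(\int[lam]_y \int[lam]_x f (x, y))%E.
  transitivity (\int[lam]_(x in G) (\int[lam]_(y in G) h (invmx y)))%E.
    rewrite [RHS]integral_mkcond; apply: eq_integral => y _.
    transitivity (\int[lam]_x ((fun x => ((fun y => h (invmx x *m y)) \_ G) y) \_ G) x)%E.
      by apply: eq_integral => x _; rewrite fE.
    rewrite GE patchE; under eq_integral do rewrite patchE.
    case: ifPn => [/set_mem Gy|_]; last by rewrite integral0.
    have mk : measurable_fun (G : set M) (fun x : M => h (invmx x *m y)).
      apply: (@measurable_lie_comp _ _ _ _ (G : set M) h (fun x : M => invmx x *m y : M)) => //.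
      - exact: mG.
      - apply: (@measurable_lie_comp _ _ _ _ (G : set M) (fun x : M => (x *m y : M)) (fun x : M => (invmx x : M))).
        + exact: mG.
        + rewrite (_ : (fun x => _) = (fun x => 1%:M *m x *m y)).
            exact: measurable_lie_mul.
          by apply/funext => x; rewrite mul1mx.
        + exact: measurable_lie_invmx.
        + exact: lie_inv.
      - by move=> x Gx; apply: lie_mul => //; exact: lie_inv.
    rewrite -[LHS](haar_left Gy mk)//.
    apply: eq_integral => x /set_mem Gx.
    have yu := lie_unitmx Gy; have xu := lie_unitmx Gx.
    have -> : invmx (y *m x) = invmx x *m invmx y.
      exact: invmx_mulmx.
    by rewrite -mulmxA mulVmx// mulmx1.
  by rewrite (integral_cst lam mG) muleC.
have G0 := haar_gt0 hlam; have Gf := haar_fin hlam.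
have Gfin : lam G \is a fin_num by rewrite ge0_fin_numE.
move=> /(congr1 (fun r => ((fine (lam G))^-1)%:E * r)%E).
rewrite !muleA -(fineK Gfin) -EFinM mulVf ?mul1e//.
by rewrite /= gt_eqF// fine_gt0// G0 Gf.
Qed.

(** Right translation by z is left translation by z^-1 conjugated by inversion, and both preserve
    the integral. *)
Lemma haar_right (h : M -> \bar R) (z : 'M[R]_n) : lie_set G z ->
  measurable_fun (G : set M) h -> (forall x, (0 <= h x)%E) ->
  (\int[lam]_(x in G) h (x *m z) = \int[lam]_(x in G) h x)%E.
Proof.
move=> Gz mh h0.
have mhz : measurable_fun (G : set M) (fun x => h (x *m z)).
  apply: (@measurable_lie_comp _ _ _ _ (G : set M) h (fun x : M => x *m z : M)) => //.
  - exact: mG.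
  - rewrite (_ : (fun x => _) = (fun x => 1%:M *m x *m z)); first exact: measurable_lie_mul.
    by apply/funext => x; rewrite mul1mx.
  - by move=> x Gx; exact: lie_mul.
have mhV : measurable_fun (G : set M) (fun x => h (invmx x)).
  apply: (@measurable_lie_comp _ _ _ _ (G : set M) h (fun x : M => invmx x : M)) => //.
  - exact: mG.
  - exact: measurable_lie_invmx.
  - exact: lie_inv.
rewrite -(haar_inversion mhz) ?(haar_inversion mh)//.
rewrite -[RHS](haar_inversion mh)// -[RHS](haar_left (lie_inv Gz) mhV)//.
apply: eq_integral => x /set_mem Gx; congr h.
by rewrite invmx_mulmx ?invmxK ?(lie_unitmx Gx) ?(lie_unitmx (lie_inv Gz)).
Qed.

Lemma haar_right_R (F : M -> R) (z : 'M[R]_n) : lie_set G z ->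
  measurable_fun (G : set M) F ->
  \int[lam]_(x in G) F (x *m z) = \int[lam]_(x in G) F x.
Proof.
move=> Gz mF; rewrite /Rintegral; congr fine.
rewrite integralE [RHS]integralE; congr (_ - _)%E.
- transitivity (\int[lam]_(x in G) (EFin \o F)^\+ (x *m z))%E.
    by apply: eq_integral => x _; rewrite !funeposE.
  apply: haar_right => //; apply: measurable_funepos; exact/measurable_EFinP.
- transitivity (\int[lam]_(x in G) (EFin \o F)^\- (x *m z))%E.
    by apply: eq_integral => x _; rewrite !funenegE.
  apply: haar_right => //; apply: measurable_funeneg; exact/measurable_EFinP.
Qed.

(* Right translations by [expmx (t *: A)] preserve the Haar integral, so the
   derivative of the constant integral vanishes. *)
Lemma haar_left_field (F F' : M -> R) (A : 'M[R]_n) : lie_algebra G A ->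
  {within (G : set 'M[R]_n), continuous F} ->
  {within (G : set 'M[R]_n), continuous F'} ->
  (forall x, lie_set G x -> is_derive (0 : R) 1 (F \o left_curve A x) (F' x)) ->
  \int[lam]_(x in G) F' x = 0.
Proof.
move=> GA Fc Fc' dF.
have mF := within_continuous_measurable mG Fc.
have mF' := within_continuous_measurable mG Fc'.
have [K K0 FK] := lie_bounded Fc; have [K' K'0 FK'] := lie_bounded Fc'.
have curve x (s t : R) : left_curve A (left_curve A x s) t = left_curve A x (s + t).
  by rewrite /left_curve -mulmxA -expmxDl.
have dFt x (t : R) : lie_set G x ->
    is_derive t 1 (F \o left_curve A x) (F' (left_curve A x t)).
  move=> Gx; have Gt := lie_left_curve t GA Gx.
  have h : is_derive t 1 (fun s : R => s - t) 1.
    by apply: is_derive_eq; rewrite subr0.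
  have := dF _ Gt; rewrite -(subrr t) => h1.
  have := @is_derive1_comp _ _ _ t _ _ h1 h.
  rewrite mulr1; congr is_derive; apply/funext => s /=.
  by rewrite curve addrC subrK.
pose f (t : R) (x : M) := F (left_curve A x t).
have intf t : lam.-integrable G (EFin \o f t).
  apply: (@haar_integrable _ K).
    apply: (@measurable_lie_comp _ _ _ _ (G : set M) F (fun x : M => left_curve A x t : M)) => //.
    - exact: mG.
    - rewrite (_ : (fun x => _) = (fun x => 1%:M *m x *m expmx (t *: A))).
        exact: measurable_lie_mul.
      by apply/funext => x; rewrite mul1mx.
    - by move=> x Gx; exact: lie_left_curve.
  by move=> x Gx; apply: FK; exact: lie_left_curve.
have dfE t x : lie_set G x -> partial1of2 f t x = F' (left_curve A x t).
  by move=> Gx; rewrite partial1of2E; have [] := dFt x t Gx.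
have I0 : `]-1, 1[%classic (0 : R) by rewrite /= in_itv/= ltrN10 ltr01.
have intK' : lam.-integrable G (EFin \o cst K').
  by apply: (@haar_integrable _ K') => // x _; rewrite ger0_norm.
have dvf (t : R) (x : M) : `]-1, 1[%classic t -> (G : set M) x -> derivable (f ^~ x) t 1.
  by move=> _ Gx; have [] := dFt x t Gx.
have bdf (t : R) (x : M) : `]-1, 1[%classic t -> (G : set M) x ->
    `|partial1of2 f t x| <= K'.
  by move=> _ Gx; rewrite dfE//; apply: FK'; exact: lie_left_curve.
have := @differentiation_under_integral R _ _ lam f (G : set M) mG 0 (-1) 1 I0
  (fun t _ => intf t) dvf (cst K') (fun _ => K'0) intK' bdf.
rewrite (_ : (fun t => _) = cst (\int[lam]_(x in G) F x)); last first.
  by apply/funext => t; apply: haar_right_R mF; exact: GA.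
rewrite derive1_cst => ->; apply: eq_Rintegral => x /set_mem Gx.
by rewrite dfE// /left_curve scale0r expmx0 mulmx1.
Qed.

End Haar.

Section RealCalculus.
Context {R : realType}.

(** The mean value theorem on [s, t], followed by s -> 0+. The heat kernel is differentiable for t >
    0 only and attains its initial value as a limit, hence the right limit in place of a value at
    0. *)
Lemma derive_bound_at_right (h h' : R -> R) (l K t : R) : 0 < t ->
  (forall s, 0 < s <= t -> is_derive s 1 h (h' s)) ->
  (forall s, 0 < s < t -> `|h' s| <= K) ->
  h s @[s --> 0^'+] --> l -> `|h t - l| <= K * t.
Proof.
move=> t0 dh h'K hl.
have K0 : 0 <= K.
  by apply: le_trans (h'K (t / 2) _) => //; rewrite divr_gt0//= gtr_pMr// invf_lt1// ltr1n.
have step s : 0 < s < t -> `|h t - h s| <= K * t.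
  move=> /andP[s0 st].
  have dhs x : x \in `]s, t[ -> is_derive x 1 h (h' x).
    rewrite in_itv/= => /andP[sx xt]; apply: dh; by rewrite (lt_trans s0 sx) ltW.
  have ch : {within `[s, t], continuous h}.
    apply: derivable_within_continuous => x; rewrite in_itv/= => /andP[sx xt].
    by have [] := dh x _; rewrite ?xt ?(lt_le_trans s0 sx).
  have [c] := MVT st dhs ch; rewrite in_itv/= => /andP[sc ct] ->.
  rewrite normrM (ger0_norm (_ : 0 <= t - s)) ?subr_ge0 ?(ltW st)//.
  apply: ler_pM => //.
  - by rewrite subr_ge0 ltW.
  - by apply: h'K; rewrite (lt_trans s0 sc).
  - by rewrite gerBl ltW.
have hc : `|h t - h s| @[s --> 0^'+] --> `|h t - l|.
  by apply: cvg_norm; apply: cvgB => //; exact: cvg_cst.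
apply: (ler_cvg_to hc (cvg_cst (K * t))).
near=> s; apply: step; apply/andP; split; near: s.
- exact: nbhs_right_gt.
- exact: nbhs_right_lt.
Unshelve. all: by end_near. Qed.

End RealCalculus.

(** * Smooth functions on the group and left invariant fields *)

Section SmoothFunctions.
Context {R : realType} {n : nat} (G : compact_connected_lie_group R n).
Local Notation M := 'M[R]_n.

(** An algebra of functions stable under left invariant fields, large enough for every function
    whose mean is expanded below: entries of x and x^-1, their polynomials, and exponentials.
    [smooth_ext] makes membership depend only on the values on G. *)
Inductive smooth : (M -> R) -> Prop :=
| smooth_cst (c : R) : smooth (fun=> c)
| smooth_entry (i j : 'I_n) : smooth (fun x => x i j)
| smooth_inv (i j : 'I_n) : smooth (fun x => invmx x i j)
| smoothD F H : smooth F -> smooth H -> smooth (fun x => F x + H x)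
| smoothM F H : smooth F -> smooth H -> smooth (fun x => F x * H x)
| smooth_exp F : smooth F -> smooth (fun x => expR (F x))
| smooth_ext F H : (forall x, lie_set G x -> F x = H x) -> smooth F -> smooth H.

Lemma smooth_sum (I : Type) (s : seq I) (F : I -> M -> R) :
  (forall i, smooth (F i)) -> smooth (fun x => \sum_(i <- s) F i x).
Proof.
move=> sF; elim: s => [|i s IH].
  by apply: (smooth_ext _ (smooth_cst 0)) => x _; rewrite big_nil.
by apply: (smooth_ext _ (smoothD (sF i) IH)) => x _; rewrite big_cons.
Qed.

Lemma smoothZ (c : R) F : smooth F -> smooth (fun x => c * F x).
Proof. by move=> sF; apply: smoothM => //; exact: smooth_cst. Qed.

Lemma smoothB F H : smooth F -> smooth H -> smooth (fun x => F x - H x).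
Proof.
move=> sF sH; apply: (smooth_ext _ (smoothD sF (smoothZ (-1) sH))) => x _.
by rewrite mulN1r.
Qed.

Lemma smooth_continuous F : smooth F -> {within (G : set M), continuous F}.
Proof.
elim=> [c|i j|i j|{}F H _ cF _ cH|{}F H _ cF _ cH|{}F _ cF|{}F H FH _ cF].
- by move=> x; exact: cvg_cst.
- by apply: continuous_subspaceT; exact: coord_continuous.
- exact: invmx_within_continuous.
- by move=> x; apply: cvgD; [exact: cF|exact: cH].
- by move=> x; apply: cvgM; [exact: cF|exact: cH].
- move=> x; exact: (@continuous_comp (subspace (G : set M)) R R F expR x (cF x) (@continuous_expR R (F x))).
- exact: (eq_within_continuous FH).
Qed.

Lemma smooth_bounded F : smooth F ->
  exists2 K, 0 <= K & forall x, lie_set G x -> `|F x| <= K.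
Proof. by move=> /smooth_continuous /lie_bounded. Qed.

Lemma smooth_measurable F : smooth F ->
  measurable_fun (G : set (borel M)) (F : borel M -> R).
Proof.
by move=> /smooth_continuous; apply: within_continuous_measurable; exact: measurable_lie.
Qed.

Lemma is_derive_left_curve (A x : M) i j :
  is_derive (0 : R) 1 (fun t => left_curve A x t i j) ((x *m A) i j).
Proof.
have := @is_derive_mulmx _ _ _ _ (cst x) (fun t => expmx (t *: A)) 0 A 0.
rewrite /cst mul0mx add0r; apply=> [k l|k l].
  by rewrite mxE; exact: is_derive_cst.
apply: is_derive_eq (is_derive_expmx _ _ _ _) _.
by rewrite scale0r expmx0 mulmx1.
Qed.

Lemma is_derive_left_curveV (A x : M) i j : lie_set G x ->
  is_derive (0 : R) 1 (fun t => invmx (left_curve A x t) i j)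
    (- (A *m invmx x) i j).
Proof.
move=> Gx; have xu := lie_unitmx Gx.
have -> : (fun t => invmx (left_curve A x t) i j) =
    (fun t => (expmx ((-1 * t + 0) *: A) *m invmx x) i j).
  apply/funext => t; rewrite /left_curve invmx_mulmx ?expmx_unit//.
  by rewrite invmx_expmx addr0 mulN1r.
have := @is_derive_mulmx _ _ _ _ (fun t => expmx ((-1 * t + 0) *: A))
  (cst (invmx x)) (-1 *: A) 0 0.
move=> /(_ _ _ i j) h; apply: is_derive_eq (h _ _) _ => [k l|k l|].
- apply: is_derive_eq (is_derive_expmx_comp _ _ _ _ _ _) _.
  by rewrite mulr0 addr0 scale0r expmx0 mulmx1 mulN1r scaleN1r mxE.
- by rewrite mxE; exact: is_derive_cst.
- by rewrite mulmx0 addr0 scaleN1r mulNmx mxE.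
Qed.

Lemma smooth_derive A F : lie_algebra G A -> smooth F ->
  exists2 F', smooth F' & forall x, lie_set G x ->
    is_derive (0 : R) 1 (F \o left_curve A x) (F' x).
Proof.
move=> GA; have c0 x : left_curve A x 0 = x.
  by rewrite /left_curve scale0r expmx0 mulmx1.
elim=> [c|i j|i j|{}F H _ [F' sF' dF] _ [H' sH' dH]|
  {}F H sF [F' sF' dF] sH [H' sH' dH]|{}F sF [F' sF' dF]|{}F H FH _ [F' sF' dF]].
- by exists (fun=> 0) => [|x _]; [exact: smooth_cst|exact: is_derive_cst].
- exists (fun x => (x *m A) i j) => [|x _]; last exact: is_derive_left_curve.
  apply: (@smooth_ext (fun x => \sum_k A k j * x i k)) => [x _|].
    by rewrite mxE; apply: eq_bigr => k _; rewrite mulrC.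
  by apply: smooth_sum => k; apply: smoothZ; exact: smooth_entry.
- exists (fun x => - (A *m invmx x) i j) => [|x Gx]; last exact: is_derive_left_curveV.
  apply: (@smooth_ext (fun x => \sum_k (- A i k) * invmx x k j)) => [x _|].
    by rewrite mxE -sumrN; apply: eq_bigr => k _; rewrite mulNr.
  by apply: smooth_sum => k; apply: smoothZ; exact: smooth_inv.
- exists (fun x => F' x + H' x) => [|x Gx]; first exact: smoothD.
  by apply: is_deriveD; [exact: dF|exact: dH].
- exists (fun x => F x * H' x + H x * F' x) => [|x Gx].
    by apply: smoothD; exact: smoothM.
  have := is_deriveM (dF x Gx) (dH x Gx).
  by rewrite /GRing.scale/= c0.
- exists (fun x => expR (F x) * F' x) => [|x Gx].
    by apply: smoothM => //; exact: smooth_exp.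
  have := @is_derive1_comp _ expR (F \o left_curve A x) 0 _ _ (is_derive_expR _) (dF x Gx).
  by rewrite /= c0.
- exists F' => // x Gx; rewrite (_ : H \o _ = F \o left_curve A x); first exact: dF.
  by apply/funext => t /=; rewrite FH//; exact: lie_left_curve.
Qed.

Lemma smooth_left_field A F : lie_algebra G A -> smooth F -> smooth (left_field A F).
Proof.
move=> GA /(smooth_derive GA)[F' sF' dF]; apply: smooth_ext sF' => x Gx.
by rewrite /left_field derive1E; have [_ ->] := dF x Gx.
Qed.

Lemma smooth_is_derive A F x : lie_algebra G A -> smooth F -> lie_set G x ->
  is_derive (0 : R) 1 (F \o left_curve A x) (left_field A F x).
Proof.
move=> GA /(smooth_derive GA)[F' sF' dF] Gx; have dFx := dF x Gx.
by rewrite /left_field derive1E; have [_ ->] := dFx.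
Qed.

Lemma eq_left_field A F H x : lie_algebra G A -> lie_set G x ->
  (forall x, lie_set G x -> F x = H x) -> left_field A F x = left_field A H x.
Proof.
move=> GA Gx FH; rewrite /left_field; congr (derive1 _ 0).
by apply/funext => t /=; apply: FH; exact: lie_left_curve.
Qed.

Lemma smooth_laplacian d (E : 'I_d -> M) F :
  (forall i, lie_algebra G (E i)) -> smooth F -> smooth (laplacian E F).
Proof.
move=> GE sF; apply: smooth_sum => i.
by apply: smooth_left_field => //; exact: smooth_left_field.
Qed.

Lemma left_fieldM A F H x : lie_algebra G A -> lie_set G x ->
  smooth F -> smooth H ->
  left_field A (fun x => F x * H x) x =
  left_field A F x * H x + F x * left_field A H x.
Proof.
move=> GA Gx sF sH.
have dF := smooth_is_derive GA sF Gx; have dH := smooth_is_derive GA sH Gx.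
rewrite /left_field derive1E; have [_ ->] := is_deriveM dF dH.
by rewrite /GRing.scale/= /left_curve scale0r expmx0 mulmx1 addrC [X in X + _]mulrC.
Qed.

Lemma laplacianM d (E : 'I_d -> M) F H x : (forall i, lie_algebra G (E i)) ->
  lie_set G x -> smooth F -> smooth H ->
  laplacian E (fun x => F x * H x) x = laplacian E F x * H x +
    2 * \sum_i left_field (E i) F x * left_field (E i) H x + F x * laplacian E H x.
Proof.
move=> GE Gx sF sH; rewrite /laplacian mulr_sumr mulr_suml mulr_sumr -!big_split/=.
apply: eq_bigr => i _.
have sEF := smooth_left_field (GE i) sF; have sEH := smooth_left_field (GE i) sH.
rewrite (eq_left_field (H := fun x => left_field (E i) F x * H x + F x * left_field (E i) H x))//; last first.
  by move=> y Gy; exact: left_fieldM.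
have d1 := smooth_is_derive (GE i) (smoothM sEF sH) Gx.
have d2 := smooth_is_derive (GE i) (smoothM sF sEH) Gx.
rewrite {1}/left_field derive1E; have [_ ->] := is_deriveD d1 d2.
rewrite (left_fieldM (GE i) Gx sEF sH) (left_fieldM (GE i) Gx sF sEH).
move: (left_field _ (left_field _ F) x) (left_field _ (left_field _ H) x).
by move: (left_field _ F x) (left_field _ H x) (F x) (H x) => a b c e f h; ring.
Qed.

End SmoothFunctions.

(** * The Lie product formula and the linearity of the Lie algebra *)

Section TrotterFormula.
Context {R : realType} {n : nat}.
Local Notation M := 'M[R]_n.

Lemma expmx_bounded (A : M) : exists2 K : R, 0 <= K &
  forall t, 0 <= t <= 1 -> `|expmx (t *: A)| <= K.
Proof.
have ent i j : exists2 K : R, 0 <= K & forall t, 0 <= t <= 1 -> `|expmx (t *: A) i j| <= K.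
  pose f (t : R) := `|expmx (t *: A) i j|.
  have cf : continuous f.
    move=> t; apply: cvg_norm; have := is_derive_expmx A t i j.
    by move=> [/derivable1_diffP /differentiable_continuous].
  have [||c _ hc] := @EVT_max R f 0 1; first exact: ler01.
    exact: continuous_subspaceT.
  by exists (f c) => [|t t01]; [exact: normr_ge0|exact: hc].
pose K i j := sval (cid2 (ent i j)).
have hK i j : 0 <= K i j /\ forall t, 0 <= t <= 1 -> `|expmx (t *: A) i j| <= K i j.
  by rewrite /K; case: cid2.
exists (\sum_i \sum_j K i j) => [|t t01].
  by apply: sumr_ge0 => i _; apply: sumr_ge0 => j _; have [] := hK i j.
apply: mx_norm_le => [|i j].
  by apply: sumr_ge0 => i _; apply: sumr_ge0 => j _; have [] := hK i j.
rewrite (le_trans ((hK i j).2 _ t01))// (bigD1 i)//= (bigD1 j)//= -addrA lerDl addr_ge0//.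
  by apply: sumr_ge0 => l _; have [] := hK i l.
by apply: sumr_ge0 => k _; apply: sumr_ge0 => l _; have [] := hK k l.
Qed.

Lemma expmx_cvg0 (A : M) i j : expmx (s *: A) i j @[s --> 0^'+] --> (1%:M : M) i j.
Proof.
have := is_derive_expmx A 0 i j => -[/derivable1_diffP /differentiable_continuous h _].
rewrite -expmx0 -(scale0r A); exact: cvg_at_right_filter.
Qed.

Lemma expmx_order1 (A : M) : exists2 K : R, 0 <= K &
  forall t, 0 < t <= 1 -> `|expmx (t *: A) - 1%:M| <= K * t.
Proof.
have [K K0 hK] := expmx_bounded A.
exists (n%:R * `|A| * K) => [|t /andP[t0 t1]]; first by rewrite !mulr_ge0.
apply: mx_norm_le => [|i j]; first by rewrite !mulr_ge0// ltW.
have -> : (expmx (t *: A) - 1%:M) i j = expmx (t *: A) i j - (1%:M : M) i j by rewrite !mxE.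
apply: (@derive_bound_at_right R (fun s => expmx (s *: A) i j)
  (fun s => (A *m expmx (s *: A)) i j)) => // [s _|s /andP[s0 st]|].
- exact: is_derive_expmx.
- rewrite (le_trans (le_mx_norm _ _ _))// (le_trans (norm_mulmx_le _ _))// ler_wpM2l ?mulr_ge0//.
  by apply: hK; rewrite (ltW s0) (le_trans (ltW st)).
- exact: expmx_cvg0.
Qed.

Lemma expmx_order2 (A : M) : exists2 K : R, 0 <= K &
  forall t, 0 < t <= 1 -> `|expmx (t *: A) - (1%:M + t *: A)| <= K * t ^+ 2.
Proof.
have [K K0 hK] := expmx_order1 A.
exists (n%:R * `|A| * K) => [|t /andP[t0 t1]]; first by rewrite !mulr_ge0.
apply: mx_norm_le => [|i j]; first by rewrite !mulr_ge0// ltW.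
have -> : (expmx (t *: A) - (1%:M + t *: A)) i j = (expmx (t *: A) i j - t * A i j) - (1%:M : M) i j.
  by rewrite !mxE; ring.
rewrite expr2 mulrA.
apply: (@derive_bound_at_right R (fun s => expmx (s *: A) i j - s * A i j)
  (fun s => (A *m expmx (s *: A)) i j - A i j)) => // [s _|s /andP[s0 st]|].
- have h1 := is_derive_expmx A s i j.
  have h2 : is_derive s 1 (fun s : R => s * A i j) (A i j).
    have := is_deriveM (is_derive_id s 1) (is_derive_cst (A i j) s 1).
    by move=> h; apply: (is_derive_eq h); rewrite scaler0 add0r /= -[_ *: _]/(_ * _) mulr1.
  exact: is_deriveB.
- have -> : (A *m expmx (s *: A)) i j - A i j = (A *m (expmx (s *: A) - 1%:M)) i j.
    by rewrite mulmxBr mulmx1 [RHS]mxE [X in _ = _ + X]mxE.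
  rewrite (le_trans (le_mx_norm _ _ _))// (le_trans (norm_mulmx_le _ _))// -(mulrA _ K t) ler_wpM2l ?mulr_ge0//.
  rewrite (le_trans (hK _ _)) ?s0 ?(le_trans (ltW st))// ler_wpM2l//.
  exact: ltW.
- rewrite -[X in _ --> X]subr0; apply: cvgB; first exact: expmx_cvg0.
  rewrite -[X in _ --> X](mul0r (A i j)); apply: cvgMl.
  by apply: cvg_at_right_filter; exact: cvg_id.
Qed.

Lemma telescope_mulmx (X Y : M) k :
  X ^+ k - Y ^+ k = \sum_(j < k) X ^+ (k.-1 - j) *m (X - Y) *m Y ^+ j.
Proof.
elim: k => [|k IH]; first by rewrite big_ord0 !expr0 subrr.
rewrite big_ord_recl/= subn0 expr0 mulmx1.
have -> : X ^+ k.+1 - Y ^+ k.+1 = X ^+ k *m (X - Y) + (X ^+ k - Y ^+ k) *m Y.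
  by rewrite exprSr exprSr mulmxBr mulmxBl addrA subrK.
congr (_ + _); rewrite IH mulmx_suml; apply: eq_bigr => j _.
rewrite /bump/= add1n exprSr !mulmxA; congr (_ ^+ _ *m _ *m _ *m _).
by case: k j {IH} => [[]//|k j]; rewrite subSS.
Qed.

End TrotterFormula.

Section LieAlgebraLinear.
Context {R : realType} {n : nat} (G : compact_connected_lie_group R n).
Local Notation M := 'M[R]_n.

Lemma lie_algebra0 : lie_algebra G 0.
Proof. by move=> t; rewrite scaler0 expmx0; exact: lie_one. Qed.

Lemma lie_algebraZ (c : R) (A : M) : lie_algebra G A -> lie_algebra G (c *: A).
Proof. by move=> GA t; rewrite scalerA; exact: GA. Qed.

Lemma lie_exp (x : M) k : lie_set G x -> lie_set G (x ^+ k).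
Proof.
move=> Gx; elim: k => [|k IH]; first by rewrite expr0; exact: lie_one.
by rewrite exprS; exact: lie_mul.
Qed.

Lemma lie_norm_bounded : exists2 K : R, 0 <= K & forall x : M, lie_set G x -> `|x| <= K.
Proof.
have [K K0 hK] : exists2 K : R, 0 <= K & forall x : M, lie_set G x -> `| (`|x|) | <= K.
  by apply: lie_bounded; apply: continuous_subspaceT; exact: norm_continuous.
by exists K => // x /hK; rewrite normr_id.
Qed.

(** The Lie product formula: (exp(A/k) exp(B/k))^k lies in G and tends to exp(A + B), and G is
    closed. One factor errs by O(1/k^2), and the telescoped difference of k-th powers has k such
    terms, with factors bounded because powers of elements of G stay in G. *)
Lemma lie_algebraD (A B : M) : lie_algebra G A -> lie_algebra G B -> lie_algebra G (A + B).
Proof.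
move=> GA GB.
suff h (A' B' : M) : lie_algebra G A' -> lie_algebra G B' -> lie_set G (expmx (A' + B')).
  by move=> t; rewrite scalerDr; apply: h; exact: lie_algebraZ.
move=> {GA GB} {}GA {}GB {A B}.
have [KG KG0 hG] := lie_norm_bounded; have [KS KS0 hS] := expmx_bounded (A' + B').
have [Ka Ka0 ha] := expmx_order2 A'; have [Kb Kb0 hb] := expmx_order2 B'.
have [Ks Ks0 hs] := expmx_order2 (A' + B').
pose N : R := n%:R.
(* One summand for each remainder: the second order errors of exp(tB) and exp(tA), the product t^2
   AB, and the second order error of exp(t(A + B)). *)
pose K := N * KG * Kb + N * Ka * (`|1%:M : M| + `|B'|) + N * `|A'| * `|B'| + Ks.
have N0 : 0 <= N by [].
have K0 : 0 <= K by rewrite !addr_ge0// !mulr_ge0// addr_ge0.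
have near t : 0 < t <= 1 ->
    `|expmx (t *: A') *m expmx (t *: B') - expmx (t *: (A' + B'))| <= K * t ^+ 2.
  move=> /[dup] t01 /andP[t0 t1].
  have -> : expmx (t *: A') *m expmx (t *: B') - expmx (t *: (A' + B')) =
      expmx (t *: A') *m (expmx (t *: B') - (1%:M + t *: B')) +
      (expmx (t *: A') - (1%:M + t *: A')) *m (1%:M + t *: B') +
      (t ^+ 2) *: (A' *m B') - (expmx (t *: (A' + B')) - (1%:M + t *: (A' + B'))).
    rewrite mulmxBr mulmxBl (mulmxDl 1%:M) mul1mx mulmxDr mulmx1.
    rewrite (mulmxDr (t *: A')) mulmx1 scalerDr.
    have -> : (t *: A') *m (t *: B') = t ^+ 2 *: (A' *m B').
      by rewrite -scalemxAl -scalemxAr scalerA expr2.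
    move: (expmx (t *: A') *m expmx (t *: B')) => X.
    move: (expmx (t *: A') *m (t *: B')) => Y; move: (expmx (t *: A')) => Z.
    move: (expmx (t *: A' + t *: B')) (t ^+ 2 *: (A' *m B')) => U V.
    move: (t *: A') (t *: B') => A1 B1.
    have sub (P Q : M) i j : (P - Q) i j = P i j - Q i j by rewrite !mxE.
    have add (P Q : M) i j : (P + Q) i j = P i j + Q i j by rewrite !mxE.
    by apply/matrixP => i j; rewrite !(sub, add); ring.
  rewrite (le_trans (ler_normB _ _))// /K mulrDl lerD ?hs//.
  rewrite (le_trans (ler_normD _ _))// mulrDl lerD//; last first.
    rewrite normrZ ger0_norm ?sqr_ge0// mulrC ler_wpM2r ?sqr_ge0//.
    exact: norm_mulmx_le.
  rewrite (le_trans (ler_normD _ _))// mulrDl lerD//.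
    rewrite (le_trans (norm_mulmx_le _ _))// -!mulrA ler_wpM2l//.
    by apply: ler_pM => //; [exact/hG/GA|exact: hb].
  rewrite (le_trans (norm_mulmx_le _ _))// -!mulrA ler_wpM2l// (mulrC (_ + _)) mulrA.
  apply: ler_pM => //; first exact: ha.
  rewrite (le_trans (ler_normD _ _))// lerD2l normrZ ger0_norm ?ler_piMl//; exact: ltW.
have powE (D : M) t j : expmx (t *: D) ^+ j = expmx ((j%:R * t) *: D).
  elim: j => [|j IH]; first by rewrite expr0 mul0r scale0r expmx0.
  by rewrite exprS IH -[_ * _]/(_ *m _) -expmxDl mulrSr mulrDl mul1r addrC.
pose X k := expmx (k.+1%:R^-1 *: A') *m expmx (k.+1%:R^-1 *: B').
have GX k : lie_set G (X k) by apply: lie_mul; [exact: GA|exact: GB].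
pose c : R := N * (N * KG * K) * KS.
have c0 : 0 <= c by rewrite !mulr_ge0.
have XY k : `|X k ^+ k.+1 - expmx (A' + B')| <= c / k.+1%:R.
  have k0 : 0 < k.+1%:R^-1 :> R by rewrite invr_gt0 ltr0n.
  have k1 : 0 < (k.+1%:R^-1 : R) <= 1 by rewrite k0 invf_le1 ?ler1n ?ltr0n.
  have -> : expmx (A' + B') = expmx (k.+1%:R^-1 *: (A' + B')) ^+ k.+1.
    by rewrite powE divff ?scale1r// pnatr_eq0.
  rewrite telescope_mulmx (le_trans (ler_norm_sum _ _ _))//.
  apply: (@le_trans _ _ (\sum_(j < k.+1) c * k.+1%:R^-1 ^+ 2)); last first.
    have alg (a b : R) : b != 0 -> b * (a * b^-1 ^+ 2) = a / b by move=> b0; field.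
    by rewrite sumr_const card_ord -[leLHS]mulr_natl alg// pnatr_eq0.
  apply: ler_sum => j _; rewrite (le_trans (norm_mulmx_le _ _))// -/N.
  rewrite /c [leRHS]mulrAC ler_pM ?mulr_ge0//; last first.
    rewrite powE; apply: hS; rewrite mulr_ge0 ?invr_ge0//= ler_pdivrMr ?ltr0n// mul1r ler_nat.
    exact: ltnW (ltn_ord j).
  have -> : N * (N * KG * K) * k.+1%:R^-1 ^+ 2 = N * (N * (KG * (K * k.+1%:R^-1 ^+ 2))) by ring.
  rewrite ler_wpM2l// (le_trans (norm_mulmx_le _ _))// -/N -mulrA ler_wpM2l//.
  by apply: ler_pM => //; [exact/hG/lie_exp|exact: near].
suff cX : X k ^+ k.+1 @[k --> \oo] --> expmx (A' + B').
  have nG : \forall k \near \oo, lie_set G (X k ^+ k.+1) by apply: nearW => k; exact: lie_exp.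
  have h := @closed_cvg nat M \oo _ (fun k => X k ^+ k.+1) (lie_set G) (lie_closed (G := G)) nG.
  exact: h cX.
apply/cvgrPdist_le => e e0; have e1 : 0 < e / (c + 1) by rewrite divr_gt0// ltr_wpDl.
near=> k; rewrite distrC (le_trans (XY k))//.
have : k.+1%:R^-1 <= e / (c + 1).
  by apply/ltW; near: k; exact: (near_infty_natSinv_lt (PosNum e1)).
rewrite ler_pdivlMr ?ltr_wpDl// => h; apply: le_trans h.
by rewrite mulrC ler_wpM2l ?invr_ge0// lerDl.
Unshelve. all: by end_near. Qed.

Lemma lie_algebra_sum (I : Type) (s : seq I) (A : I -> M) :
  (forall i, lie_algebra G (A i)) -> lie_algebra G (\sum_(i <- s) A i).
Proof.
move=> GA; elim: s => [|i s IH]; first by rewrite big_nil; exact: lie_algebra0.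
by rewrite big_cons; exact: lie_algebraD.
Qed.

End LieAlgebraLinear.

(** * The heat semigroup *)

Section HeatSemigroup.
Context {R : realType} {n : nat} (G : compact_connected_lie_group R n).
Context (lam : {measure set (borel 'M[R]_n) -> \bar R}).
Hypothesis hlam : haar_measure G lam.
Context (d : nat) (E : 'I_d -> 'M[R]_n).
Hypothesis GE : forall i, lie_algebra G (E i).
Context (p : R -> 'M[R]_n -> R).
Hypothesis hp : heat_kernel G E lam p.
Local Notation M := 'M[R]_n.
Local Notation mG := (measurable_lie G).

Lemma within_slice (u : R * M -> R) (t : R) : 0 < t ->
  {within `]0, +oo[ `*` (G : set M), continuous u} ->
  {within (G : set M), continuous (fun x => u (t, x))}.
Proof.
move=> t0 /subspace_continuousP uc; apply/subspace_continuousP => x Gx.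
have tx : (`]0, +oo[ `*` (G : set M)) (t, x) by split => //=; rewrite in_itv/= t0.
apply: cvg_comp (uc _ tx) => A.
rewrite /within/= => -[[U V] /= [Ut Vx] UVA].
rewrite /within /=; apply: filterS Vx => y Vy Gy.
apply: (UVA (t, y)); first by split=> //=; exact: nbhs_singleton.
by split => //=; rewrite in_itv/= t0.
Qed.

(** Source of the dominating constants for differentiation under the integral sign: the slab stays
    away from t = 0, so it is a compact part of the domain of continuity. *)
Lemma bounded_slab (u : R * M -> R) (a b : R) : 0 < a ->
  {within `]0, +oo[ `*` (G : set M), continuous u} ->
  exists2 K, 0 <= K & forall t x, a <= t <= b -> lie_set G x -> `|u (t, x)| <= K.
Proof.
move=> a0 uc.
have sub : `[a, b] `*` (G : set M) `<=` `]0, +oo[ `*` (G : set M).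
  move=> [t x] [/=]; rewrite !in_itv/= => /andP[at_ _] Gx; split=> //=.
  by rewrite andbT (lt_le_trans a0 at_).
have cK : compact (`[a, b] `*` (G : set M)).
  by apply: compact_setX; [exact: segment_compact|exact: lie_compact].
have [K [_ KP]] := compact_bounded (continuous_compact (continuous_subspaceW sub uc) cK).
exists (`|K| + 1); first by rewrite addr_ge0.
move=> t x abt Gx; apply: (KP (`|K| + 1)).
  by rewrite (le_lt_trans (ler_norm K))// ltrDl.
by exists (t, x) => //; split => //=; rewrite in_itv.
Qed.

(** The heat semigroup applied to F and evaluated at the identity. *)
Definition heat_mean (F : M -> R) (t : R) : R :=
  \int[lam]_(x in (G : set (borel M))) (F x * p t x).

Let intcont (f : M -> R) : {within (G : set M), continuous f} ->
  lam.-integrable (G : set (borel M)) (EFin \o f).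
Proof.
move=> fc; have [K K0 fK] := lie_bounded fc.
apply: (haar_integrable hlam _ fK).
by apply: within_continuous_measurable => //; exact: mG.
Qed.

Let within_M (f g : M -> R) : {within (G : set M), continuous f} ->
  {within (G : set M), continuous g} ->
  {within (G : set M), continuous (fun x => f x * g x)}.
Proof. by move=> fc gc x; apply: cvgM; [exact: fc|exact: gc]. Qed.

Let within_D (f g : M -> R) : {within (G : set M), continuous f} ->
  {within (G : set M), continuous g} ->
  {within (G : set M), continuous (fun x => f x + g x)}.
Proof. by move=> fc gc x; apply: cvgD; [exact: fc|exact: gc]. Qed.

Let cpx_t (t : R) i : 0 < t -> {within (G : set M), continuous (left_field (E i) (p t))}.
Proof.
move=> t0; have := @within_slice (fun tx => left_field (E i) (p tx.1) tx.2) t t0.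
by apply; exact: (C12_cont_x (hk_C12 hp)).
Qed.

Let cpxx_t (t : R) i : 0 < t ->
  {within (G : set M), continuous (left_field (E i) (left_field (E i) (p t)))}.
Proof.
move=> t0.
have := @within_slice (fun tx => left_field (E i) (left_field (E i) (p tx.1)) tx.2) t t0.
by apply; exact: (C12_cont_xx (hk_C12 hp)).
Qed.

Let cp_t (t : R) : 0 < t -> {within (G : set M), continuous (p t)}.
Proof.
move=> t0; have := @within_slice (fun tx => p tx.1 tx.2) t t0.
by apply; exact: (C12_cont (hk_C12 hp)).
Qed.

Lemma integration_by_parts_left_field A (F H F' H' : M -> R) : lie_algebra G A ->
  {within (G : set M), continuous F} -> {within (G : set M), continuous H} ->
  {within (G : set M), continuous F'} -> {within (G : set M), continuous H'} ->
  (forall x, lie_set G x -> is_derive (0 : R) 1 (F \o left_curve A x) (F' x)) ->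
  (forall x, lie_set G x -> is_derive (0 : R) 1 (H \o left_curve A x) (H' x)) ->
  \int[lam]_(x in (G : set (borel M))) (F x * H' x) =
  - \int[lam]_(x in (G : set (borel M))) (F' x * H x).
Proof.
move=> GA cF cH cF' cH' dF dH.
apply/eqP; rewrite -addr_eq0; apply/eqP.
rewrite -RintegralD//; [|exact: mG|by apply: intcont; exact: within_M..].
apply: (haar_left_field hlam GA (F := fun x => F x * H x)).
- exact: within_M.
- by apply: within_D; exact: within_M.
- move=> x Gx; have := is_deriveM (dF x Gx) (dH x Gx).
  by rewrite /GRing.scale/= /left_curve scale0r expmx0 mulmx1 [H x * _]mulrC.
Qed.

(** Symmetry of the Laplacian: each left invariant field is antisymmetric for Haar measure, and it
    is moved from the kernel to F twice. *)
Lemma heat_mean_laplacian F (t : R) : 0 < t -> smooth G F ->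
  \int[lam]_(x in (G : set (borel M))) (F x * laplacian E (p t) x) =
  heat_mean (laplacian E F) t.
Proof.
move=> t0 sF; rewrite /heat_mean /laplacian.
have step i : \int[lam]_(x in (G : set (borel M))) (F x * left_field (E i) (left_field (E i) (p t)) x) =
   \int[lam]_(x in (G : set (borel M))) (left_field (E i) (left_field (E i) F) x * p t x).
  have sE := smooth_left_field (GE i) sF.
  have sEE := smooth_left_field (GE i) sE.
  have dp x : lie_set G x -> is_derive (0 : R) 1 (p t \o left_curve (E i) x) (left_field (E i) (p t) x).
    move=> Gx; have := @C12_x R n G d E p (hk_C12 hp) t x i t0 Gx.
    by rewrite /left_field derive1E => h; exact: DeriveDef.
  have ddp x : lie_set G x -> is_derive (0 : R) 1 (left_field (E i) (p t) \o left_curve (E i) x)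
      (left_field (E i) (left_field (E i) (p t)) x).
    move=> Gx; have := @C12_xx R n G d E p (hk_C12 hp) t x i i t0 Gx.
    by rewrite /left_field derive1E => h; exact: DeriveDef.
  have sder (H : M -> R) x : smooth G H -> lie_set G x ->
      is_derive (0 : R) 1 (H \o left_curve (E i) x) (left_field (E i) H x).
    by move=> sH Gx; exact: smooth_is_derive.
  have h1 := @integration_by_parts_left_field (E i) F (left_field (E i) (p t))
    (left_field (E i) F) (left_field (E i) (left_field (E i) (p t))) (GE i)
    (smooth_continuous sF) (@cpx_t t i t0) (smooth_continuous sE) (@cpxx_t t i t0)
    (fun x => sder F x sF) ddp.
  have h2 := @integration_by_parts_left_field (E i) (left_field (E i) F) (p t)
    (left_field (E i) (left_field (E i) F)) (left_field (E i) (p t)) (GE i)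
    (smooth_continuous sE) (@cp_t t t0) (smooth_continuous sEE) (@cpx_t t i t0)
    (fun x => sder _ x sE) dp.
  by rewrite [LHS]h1 [in LHS]h2 opprK.
under eq_Rintegral do rewrite mulr_sumr.
under [RHS]eq_Rintegral do rewrite mulr_suml.
have sumint (f : 'I_d -> M -> R) : (forall i, {within (G : set M), continuous (f i)}) ->
    \int[lam]_(x in (G : set (borel M))) (\sum_i f i x) = \sum_i \int[lam]_(x in (G : set (borel M))) f i x.
  move=> fc; elim: (index_enum _) => [|i s IH].
    under eq_Rintegral do rewrite big_nil.
    by rewrite big_nil /Rintegral integral0.
  under eq_Rintegral do rewrite big_cons.
  rewrite big_cons RintegralD ?IH//; [exact: mG|exact: intcont|].
  apply: intcont => {IH}; elim: s => [|j s IH] x.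
    by under eq_fun do rewrite big_nil; exact: cvg_cst.
  by under eq_fun do rewrite big_cons; apply: cvgD; [exact: fc|exact: IH].
rewrite sumint; last first.
  by move=> i; apply: within_M; [exact: smooth_continuous|exact: cpxx_t].
rewrite sumint; last first.
  move=> i; apply: within_M; last exact: cp_t.
  by apply: smooth_continuous; apply: smooth_left_field => //; exact: smooth_left_field.
by apply: eq_bigr => i _; exact: step.
Qed.

(** Differentiation under the integral on ]t/2, 2t[, where the time derivative of the kernel is
    bounded; the heat equation and the symmetry of the Laplacian then put the Laplacian on F. *)
Lemma is_derive_heat_mean F (t : R) : 0 < t -> smooth G F ->
  is_derive t 1 (heat_mean F) (2^-1 * heat_mean (laplacian E F) t).
Proof.
move=> t0 sF; have cF := smooth_continuous sF; have [KF KF0 FK] := smooth_bounded sF.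
have t20 : 0 < t / 2 by rewrite divr_gt0.
have [K K0 pK] := bounded_slab (2 * t) t20 (C12_cont_t (hk_C12 hp)).
pose f (s : R) (x : borel M) := F x * p s x.
have It : `](t / 2), (2 * t)[%classic t.
  rewrite /= in_itv/= gtr_pMr// invf_lt1// ltr1n/=.
  by rewrite ltr_pMl// ltr1n.
have Ipos s : `](t / 2), (2 * t)[%classic s -> 0 < s /\ t / 2 <= s <= 2 * t.
  rewrite /= in_itv/= => /andP[ts st]; split; first exact: lt_trans ts.
  by rewrite !ltW.
have intf s : `](t / 2), (2 * t)[%classic s -> lam.-integrable (G : set (borel M)) (EFin \o f s).
  by move=> /Ipos[s0 _]; apply: intcont; apply: within_M => //; exact: cp_t.
have dp (s : R) (x : M) : 0 < s -> lie_set G x -> is_derive s 1 (f ^~ x) (F x * derive1 (p ^~ x) s).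
  move=> s0 Gx; have dps : is_derive s 1 (p ^~ x) (derive1 (p ^~ x) s).
    have := @C12_t R n G d E p (hk_C12 hp) s x s0 Gx.
    by rewrite derive1E => h; exact: DeriveDef.
  have := is_deriveZ (F x) dps.
  by rewrite /GRing.scale/=.
have dvf (s : R) (x : borel M) : `](t / 2), (2 * t)[%classic s -> (G : set (borel M)) x -> derivable (f ^~ x) s 1.
  by move=> /Ipos[s0 _] Gx; have [] := dp s x s0 Gx.
have df1 (s : R) (x : borel M) : 0 < s -> (G : set (borel M)) x ->
   partial1of2 f s x = F x * derive1 (p ^~ x) s.
  by move=> s0 Gx; rewrite partial1of2E; have [] := dp s x s0 Gx.
have bdf (s : R) (x : borel M) : `](t / 2), (2 * t)[%classic s -> (G : set (borel M)) x ->
    `|partial1of2 f s x| <= KF * K.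
  move=> /Ipos[s0 st] Gx; rewrite df1// normrM ler_pM//; first exact: FK.
  exact: (pK s x st Gx).
have KK0 (x : borel M) : 0 <= cst (KF * K) x by rewrite mulr_ge0.
have intK : lam.-integrable (G : set (borel M)) (EFin \o cst (KF * K)).
  by apply: intcont => x; exact: cvg_cst.
have := @derivable_under_integral R _ _ lam f (G : set (borel M)) mG t (t / 2) (2 * t) It
  intf dvf (cst (KF * K)) KK0 intK bdf.
have := @differentiation_under_integral R _ _ lam f (G : set (borel M)) mG t (t / 2) (2 * t) It
  intf dvf (cst (KF * K)) KK0 intK bdf.
rewrite derive1E => h1 h2; apply: (DeriveDef h2); rewrite [LHS]h1.
rewrite -heat_mean_laplacian// -RintegralZl//; [|exact: mG|]; last first.
  apply: intcont; apply: within_M => // x.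
  apply: cvg_sumr => i _; exact: cpxx_t.
apply: eq_Rintegral => x /set_mem Gx.
by rewrite df1// (hk_eq hp t0 Gx) mulrCA.
Qed.

Lemma cvg_heat_mean F : smooth G F -> heat_mean F t @[t --> 0^'+] --> F 1%:M.
Proof. by move=> sF; apply: (hk_init hp); exact: smooth_continuous. Qed.

Section Expansion.
Context (T : R).
Hypothesis T0 : 0 < T.
(** The maximum principle. [heat_kernel] does not state that p is nonnegative; the bound is supplied
    later by reading [heat_mean] as an expectation under mu. *)
Hypothesis heat_mean_bounded : forall F K t, smooth G F -> 0 < t <= T ->
  (forall x, lie_set G x -> `|F x| <= K) -> `|heat_mean F t| <= K.

Lemma heat_mean_order1 F : smooth G F ->
  exists2 K, 0 <= K & forall t, 0 < t <= T -> `|heat_mean F t - F 1%:M| <= K * t.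
Proof.
move=> sF; have [K K0 FK] := smooth_bounded (smooth_laplacian GE sF).
exists (2^-1 * K) => [|t /andP[t0 tT]]; first by rewrite mulr_ge0.
apply: (derive_bound_at_right t0 _ _ (cvg_heat_mean sF)) => s /andP[s0 st].
  exact: is_derive_heat_mean.
rewrite normrM ger0_norm// ler_wpM2l//; apply: heat_mean_bounded FK.
  exact: smooth_laplacian.
by rewrite s0 (le_trans (ltW st)).
Qed.

(** After subtraction of the linear term, the derivative in time is half of [heat_mean (laplacian E
    F) s - laplacian E F 1%:M], which is O(s) by the first order bound applied to the Laplacian of
    F. *)
Lemma heat_mean_order2 F : smooth G F ->
  exists2 K, 0 <= K & forall t, 0 < t <= T ->
    `|heat_mean F t - F 1%:M - t / 2 * laplacian E F 1%:M| <= K * t ^+ 2.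
Proof.
move=> sF; have [K K0 LK] := heat_mean_order1 (smooth_laplacian GE sF).
exists K => // t /andP[t0 tT].
have -> : heat_mean F t - F 1%:M - t / 2 * laplacian E F 1%:M =
  (heat_mean F t - t * (2^-1 * laplacian E F 1%:M)) - F 1%:M by ring.
have -> : K * t ^+ 2 = (K * t) * t by ring.
pose h s := heat_mean F s - s * (2^-1 * laplacian E F 1%:M).
pose h' s := 2^-1 * heat_mean (laplacian E F) s - 2^-1 * laplacian E F 1%:M.
apply: (@derive_bound_at_right _ h h') => // [s /andP[s0 st]|s /andP[s0 st]|].
- have h1 := is_derive_heat_mean s0 sF.
  by rewrite /h /h'; apply: is_derive_eq; rewrite /GRing.scale/=; ring.
- rewrite /h' -mulrBr normrM ger0_norm//.
  apply: (@le_trans _ _ (2^-1 * (K * s))).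
    by rewrite ler_wpM2l// LK// s0 (le_trans (ltW st)).
  rewrite (@le_trans _ _ (K * s))//; last by rewrite ler_wpM2l// ltW.
  by rewrite ler_piMl ?mulr_ge0 ?(ltW s0)// invf_le1// ler1n.
- rewrite -[F 1%:M]subr0; apply: cvgB; first exact: cvg_heat_mean.
  rewrite -[X in _ --> X](mul0r (2^-1 * laplacian E F 1%:M)).
  by apply: cvgMl; apply: cvg_at_right_filter; exact: cvg_id.
Qed.

End Expansion.

(** The Casimir matrix: the Laplacian acts on the coordinate x as right multiplication by C and on
    x^-1 as left multiplication by C. *)
Let C : M := \sum_i E i *m E i.

Lemma laplacian_entry i j x : lie_set G x ->
  laplacian E (fun x => x i j) x = (x *m C) i j.
Proof.
move=> Gx; rewrite /laplacian /C mulmx_sumr summxE; apply: eq_bigr => k _.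
have dE A y : lie_algebra G A -> left_field A (fun x : M => x i j) y = (y *m A) i j.
  move=> GA; rewrite /left_field derive1E.
  by have [_ <-] := is_derive_left_curve A y i j.
rewrite (@eq_left_field _ _ G _ _ (fun y => \sum_l E k l j * y i l))//; last first.
  by move=> y Gy; rewrite dE// mxE; apply: eq_bigr => l _; rewrite mulrC.
rewrite /left_field derive1E.
have := @is_derive_sumr _ _ (index_enum 'I_n)
  (fun l t => E k l j * left_curve (E k) x t i l)
  (fun l => E k l j * (x *m E k) i l) 0.
move=> /(_ _) h; have [|_ ->] := h.
  by move=> l; have := is_deriveZ (E k l j) (is_derive_left_curve (E k) x i l).
by rewrite mulmxA mxE; apply: eq_bigr => l _; rewrite mulrC.
Qed.

Lemma laplacian_inv i j x : lie_set G x ->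
  laplacian E (fun x => invmx x i j) x = (C *m invmx x) i j.
Proof.
move=> Gx; rewrite /laplacian /C mulmx_suml summxE; apply: eq_bigr => k _.
have dE A y : lie_algebra G A -> lie_set G y ->
    left_field A (fun x : M => invmx x i j) y = - (A *m invmx y) i j.
  move=> GA Gy; rewrite /left_field derive1E.
  by have [_ <-] := is_derive_left_curveV A i j Gy.
rewrite (@eq_left_field _ _ G _ _ (fun y => \sum_l (- E k i l) * invmx y l j))//; last first.
  by move=> y Gy; rewrite dE// mxE -sumrN; apply: eq_bigr => l _; rewrite mulNr.
rewrite /left_field derive1E.
have := @is_derive_sumr _ _ (index_enum 'I_n)
  (fun l t => (- E k i l) * invmx (left_curve (E k) x t) l j)
  (fun l => (- E k i l) * (- (E k *m invmx x) l j)) 0.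
move=> /(_ _) h; have [|_ ->] := h.
  by move=> l; have := is_deriveZ (- E k i l) (is_derive_left_curveV (E k) l j Gx).
by rewrite -mulmxA mxE; apply: eq_bigr => l _; rewrite mulrNN.
Qed.

Definition mean_mx (t : R) : M := \matrix_(i, j) heat_mean (fun x => x i j) t.
Definition mean_inv_mx (t : R) : M := \matrix_(i, j) heat_mean (fun x => invmx x i j) t.

Lemma heat_mean_lin (a : 'I_n -> R) (F : 'I_n -> M -> R) (t : R) : 0 < t ->
  (forall k, smooth G (F k)) ->
  heat_mean (fun x => \sum_k a k * F k x) t = \sum_k a k * heat_mean (F k) t.
Proof.
move=> t0 sF; rewrite /heat_mean.
have intF k : lam.-integrable (G : set (borel M)) (EFin \o (fun x => F k x * p t x)).
  by apply: intcont; apply: within_M; [exact: smooth_continuous|exact: cp_t].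
elim: (index_enum _) => [|i s IH].
  under eq_Rintegral do rewrite big_nil mul0r.
  by rewrite big_nil /Rintegral integral0.
under eq_Rintegral do rewrite big_cons mulrDl -mulrA.
rewrite big_cons RintegralD ?IH ?RintegralZl//; try exact: mG.
- apply: (intcont (f := fun x => a i * (F i x * p t x))); apply: within_M => [x|].
    exact: cvg_cst.
  by apply: within_M; [exact: smooth_continuous|exact: cp_t].
- apply: intcont; apply: within_M; last exact: cp_t.
  by apply: smooth_continuous; apply: smooth_sum => k; exact: smoothZ.
Qed.

Lemma eq_heat_mean F H (t : R) : (forall x, lie_set G x -> F x = H x) ->
  heat_mean F t = heat_mean H t.
Proof. by move=> FH; apply: eq_Rintegral => x /set_mem Gx; rewrite FH. Qed.

Lemma const_at_right (h : R -> R) (l t : R) : 0 < t ->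
  (forall s : R, 0 < s -> is_derive s 1 h 0) -> h s @[s --> 0^'+] --> l -> h t = l.
Proof.
move=> t0 dh hl; apply/eqP; rewrite -subr_eq0 -normr_le0 -[leRHS](mul0r t).
apply: (derive_bound_at_right (h' := fun=> 0) t0 _ _ hl) => s.
  by move=> /andP[s0 _]; exact: dh.
by rewrite normr0.
Qed.

Let cvg_expC i j : expmx ((- (2^-1) * s + 0) *: C) i j @[s --> 0^'+] --> (1%:M : M) i j.
Proof.
have h := @is_derive_expmx_comp R n C (- 2^-1) 0 0 i j.
have /derivable1_diffP/differentiable_continuous hc := @ex_derive _ _ _ _ _ _ _ h.
rewrite (_ : 1%:M = expmx ((- (2^-1) * 0 + 0) *: C)); last first.
  by rewrite mulr0 addr0 scale0r expmx0.
exact: cvg_at_right_filter hc.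
Qed.

(** The mean m solves m' = mC/2 with m(0+) = 1, so m exp(-tC/2) is constant. The mean of x^-1 solves
    the mirrored equation and has the same value, which is what makes x - x^-1 centred. *)
Lemma mean_mxE (t : R) : 0 < t -> mean_mx t = expmx ((t / 2) *: C).
Proof.
move=> t0.
have dm (s : R) i j : 0 < s ->
    is_derive s 1 (fun s => mean_mx s i j) ((2^-1 *: (mean_mx s *m C)) i j).
  move=> s0; have := is_derive_heat_mean s0 (smooth_entry G i j).
  rewrite (eq_heat_mean (H := fun x => \sum_l C l j * x i l)); last first.
    by move=> x Gx; rewrite laplacian_entry// mxE; apply: eq_bigr => l _; rewrite mulrC.
  rewrite heat_mean_lin//; last by move=> k; exact: smooth_entry.
  rewrite [in X in _ -> X]mxE [in X in _ -> X]mxE.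
  rewrite (_ : (fun s => mean_mx s i j) = heat_mean (fun x => x i j)); last first.
    by apply/funext => r; rewrite mxE.
  by under [in X in _ -> X]eq_bigr do rewrite mxE mulrC.
pose N (s : R) := mean_mx s *m expmx ((- (2^-1) * s + 0) *: C).
have N1 : N t = 1%:M.
  apply/matrixP => i j; apply: (@const_at_right (fun s => N s i j)) => // [s s0|].
    have := @is_derive_mulmx _ _ _ _ mean_mx (fun s => expmx ((- (2^-1) * s + 0) *: C))
      (2^-1 *: (mean_mx s *m C)) (- 2^-1 *: (C *m expmx ((- (2^-1) * s + 0) *: C))) s.
    move=> /(_ _ _ i j) h; apply: is_derive_eq (h _ _) _ => [k l|k l|].
    - exact: dm.
    - by rewrite [X in is_derive _ _ _ X]mxE; exact: is_derive_expmx_comp.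
    - by rewrite scaleNr mulmxN -scalemxAl -scalemxAr mulmxA subrr mxE.
  apply: (@cvg_trans _ ((mean_mx s *m expmx ((- (2^-1) * s + 0) *: C)) i j @[s --> 0^'+])) => //.
  rewrite -[1%:M](mulmx1 1%:M).
  have cA : mean_mx s @[s --> 0^'+] --> (1%:M : M).
    apply/cvg_mx => k l; under eq_fun do rewrite mxE.
    exact: (cvg_heat_mean (smooth_entry G k l)).
  have cB : expmx ((- (2^-1) * s + 0) *: C) @[s --> 0^'+] --> (1%:M : M).
    by apply/cvg_mx => k l; exact: cvg_expC.
  by have /(_ _)/cvg_mx h := cvg_mulmx _ cA cB; exact: h.
move: N1; rewrite /N addr0 => /(congr1 (mulmx^~ (expmx ((t / 2) *: C)))).
rewrite -mulmxA -expmxDl mul1mx [_ * t]mulrC mulrN addrC subrr.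
by rewrite scale0r expmx0 mulmx1.
Qed.

Lemma mean_inv_mxE (t : R) : 0 < t -> mean_inv_mx t = expmx ((t / 2) *: C).
Proof.
move=> t0.
have dm (s : R) i j : 0 < s ->
    is_derive s 1 (fun s => mean_inv_mx s i j) ((2^-1 *: (C *m mean_inv_mx s)) i j).
  move=> s0; have := is_derive_heat_mean s0 (smooth_inv G i j).
  rewrite (eq_heat_mean (H := fun x => \sum_l C i l * invmx x l j)); last first.
    by move=> x Gx; rewrite laplacian_inv// mxE.
  rewrite heat_mean_lin//; last by move=> k; exact: smooth_inv.
  rewrite [in X in _ -> X]mxE [in X in _ -> X]mxE.
  rewrite (_ : (fun s => mean_inv_mx s i j) = heat_mean (fun x => invmx x i j)); last first.
    by apply/funext => r; rewrite mxE.
  by under [in X in _ -> X]eq_bigr do rewrite mxE.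
pose N (s : R) := expmx ((- (2^-1) * s + 0) *: C) *m mean_inv_mx s.
have N1 : N t = 1%:M.
  apply/matrixP => i j; apply: (@const_at_right (fun s => N s i j)) => // [s s0|].
    have := @is_derive_mulmx _ _ _ _ (fun s => expmx ((- (2^-1) * s + 0) *: C)) mean_inv_mx
      (- 2^-1 *: (C *m expmx ((- (2^-1) * s + 0) *: C))) (2^-1 *: (C *m mean_inv_mx s)) s.
    move=> /(_ _ _ i j) h; apply: is_derive_eq (h _ _) _ => [k l|k l|].
    - by rewrite [X in is_derive _ _ _ X]mxE; exact: is_derive_expmx_comp.
    - exact: dm.
    - rewrite expmx_comm scaleNr mulNmx -scalemxAl -scalemxAr mulmxA.
      by rewrite addrC subrr mxE.
  apply: (@cvg_trans _ ((expmx ((- (2^-1) * s + 0) *: C) *m mean_inv_mx s) i j @[s --> 0^'+])) => //.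
  rewrite -[1%:M](mulmx1 1%:M).
  have cA : mean_inv_mx s @[s --> 0^'+] --> (1%:M : M).
    apply/cvg_mx => k l; under eq_fun do rewrite mxE.
    have := cvg_heat_mean (smooth_inv G k l).
    by rewrite invmx1.
  have cB : expmx ((- (2^-1) * s + 0) *: C) @[s --> 0^'+] --> (1%:M : M).
    by apply/cvg_mx => k l; exact: cvg_expC.
  by have /(_ _)/cvg_mx h := cvg_mulmx _ cB cA; exact: h.
move: N1; rewrite /N addr0 => /(congr1 (mulmx (expmx ((t / 2) *: C)))).
rewrite mulmxA -expmxDl mulmx1 [_ * t]mulrC mulrN subrr.
by rewrite scale0r expmx0 mul1mx.
Qed.

End HeatSemigroup.

Import HBNNSimple.

(** * Bounded measurable functions and their expectations *)

Section BoundedMeasurable.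
Context {R : realType} d {T : measurableType d}.
Implicit Types X Y : T -> R.

Definition bounded_measurable X :=
  measurable_fun setT X /\ exists K : R, forall w, `|X w| <= K.

Lemma bounded_measurable_ge0 X : bounded_measurable X ->
  exists2 K : R, 0 <= K & forall w, `|X w| <= K.
Proof.
move=> [_ [K XK]]; exists `|K| => // w.
exact: le_trans (XK w) (ler_norm K).
Qed.

Lemma bm_cst c : bounded_measurable (fun=> c).
Proof. by split => //; exists `|c|. Qed.

Lemma bmD X Y : bounded_measurable X -> bounded_measurable Y ->
  bounded_measurable (fun w => X w + Y w).
Proof.
move=> [mX [K XK]] [mY [K' YK]]; split; first exact: measurable_funD.
by exists (K + K') => w; rewrite (le_trans (ler_normD _ _))// lerD.
Qed.

Lemma bmM X Y : bounded_measurable X -> bounded_measurable Y ->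
  bounded_measurable (fun w => X w * Y w).
Proof.
move=> [mX [K XK]] [mY [K' YK]]; split; first exact: measurable_funM.
by exists (K * K') => w; rewrite normrM ler_pM.
Qed.

Lemma bmZ c X : bounded_measurable X -> bounded_measurable (fun w => c * X w).
Proof. by apply: bmM; exact: bm_cst. Qed.

Lemma bmB X Y : bounded_measurable X -> bounded_measurable Y ->
  bounded_measurable (fun w => X w - Y w).
Proof.
move=> bX bY; have := bmD bX (bmZ (-1) bY).
by under eq_fun do rewrite mulN1r.
Qed.

Lemma bm_sum (I : Type) (s : seq I) (X : I -> T -> R) :
  (forall i, bounded_measurable (X i)) ->
  bounded_measurable (fun w => \sum_(i <- s) X i w).
Proof.
move=> bX; elim: s => [|i s IH].
  by under eq_fun do rewrite big_nil; exact: bm_cst.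
by under eq_fun do rewrite big_cons; exact: bmD.
Qed.

Lemma bm_prod (I : Type) (s : seq I) (P : pred I) (X : I -> T -> R) :
  (forall i, bounded_measurable (X i)) ->
  bounded_measurable (fun w => \prod_(i <- s | P i) X i w).
Proof.
move=> bX; elim: s => [|i s IH].
  by under eq_fun do rewrite big_nil; exact: bm_cst.
under eq_fun do rewrite big_cons; case: (P i) => //; exact: bmM.
Qed.

Lemma bm_indic (A : set T) : measurable A -> bounded_measurable (\1_A : T -> R).
Proof.
move=> mA; split; first exact: measurable_indic.
by exists 1 => w; rewrite indicE; case: (w \in A); rewrite ?normr1 ?normr0.
Qed.

(** A functional monotone class argument. A nonnegative bounded function is a bounded limit of
    simple functions; a general one is first shifted by its bound. *)
Lemma bounded_measurable_class (D : (T -> R) -> Prop) :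
  (forall A, measurable A -> D \1_A) ->
  (forall a X Y, D X -> D Y -> D (fun w => a * X w + Y w)) ->
  (forall (X_ : nat -> T -> R) X K, (forall k, D (X_ k)) ->
    (forall k, bounded_measurable (X_ k)) ->
    (forall k w, `|X_ k w| <= K) ->
    (forall w, X_ k w @[k --> \oo] --> X w) -> bounded_measurable X -> D X) ->
  forall X, bounded_measurable X -> D X.
Proof.
move=> Dind Dlin Dlim.
have D0 : D (fun=> 0).
  have := Dind set0 measurable0.
  by congr D; apply/funext => w; rewrite indic0.
have Dsum (I : Type) (s : seq I) (a : I -> R) (A : I -> set T) :
    (forall i, measurable (A i)) -> D (fun w => \sum_(i <- s) a i * \1_(A i) w).
  move=> mA; elim: s => [|i s IH]; first by under eq_fun do rewrite big_nil.
  by under eq_fun do rewrite big_cons; exact: Dlin (Dind _ (mA i)) IH.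
have Dpos X : bounded_measurable X -> (forall w, 0 <= X w) -> D X.
  move=> bX X0; have [K K0 XK] := bounded_measurable_ge0 bX.
  have mX : measurable_fun setT (EFin \o X) by apply/measurable_EFinP; case: bX.
  pose f_ := nnsfun_approx measurableT mX.
  have f0 k w : 0 <= f_ k w by [].
  have hX w : f_ k w @[k --> \oo] --> X w.
    have X0' y : [set: T] y -> (0 <= (EFin \o X) y)%E by move=> _; rewrite lee_fin.
    by have /fine_cvgP[_] := cvg_nnsfun_approx measurableT mX X0' (x := w) I.
  have fle k w : f_ k w <= X w.
    rewrite -(cvg_lim _ (hX w))//; apply: nondecreasing_cvgn_le; last exact: cvgP (hX w).
    by move=> a b ab; exact/lefP/nd_nnsfun_approx.
  have fK k w : `|f_ k w| <= K by rewrite ger0_norm// (le_trans (fle k w))// (le_trans (ler_norm _)).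
  apply: (Dlim f_ X K) => //.
  - move=> k.
    have -> : (f_ k : T -> R) = fun w => \sum_(y <- finmap.enum_fset (fset_set (range (f_ k)))) y * \1_(f_ k @^-1` [set y]) w.
      apply/funext => w; rewrite {1}(fimfunE (f_ k)) fsbig_finite//=.
    by apply: Dsum => y; exact: measurable_sfunP.
  - by move=> k; split; [exact: measurable_funP|exists K].
move=> X bX; have [K K0 XK] := bounded_measurable_ge0 bX.
have bK : bounded_measurable (fun w => X w + K) by apply: bmD => //; exact: bm_cst.
have DK : D (fun w => X w + K).
  by apply: Dpos => // w; rewrite -lerBlDr sub0r; have := XK w; rewrite ler_norml => /andP[].
have Dc : D (fun=> K) by apply: Dpos => //; exact: bm_cst.
have := Dlin (-1) _ _ Dc DK; congr D; apply/funext => w.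
by rewrite mulN1r addrC addrK.
Qed.

End BoundedMeasurable.

Section Expectation.
Context {R : realType} d {T : measurableType d} (mu : probability T R).
Implicit Types X Y : T -> R.

Definition Ex X : R := \int[mu]_w X w.

Lemma bm_integrable X : bounded_measurable X -> mu.-integrable setT (EFin \o X).
Proof.
move=> [mX [K XK]]; apply: (@bounded_integrable _ _ _ _ _ _ K) => //.
apply: (@le_lt_trans _ _ 1%E); [exact: (@probability_le1 _ _ _ mu)|exact: ltry].
Qed.

Lemma Ex_cst c : Ex (fun=> c) = c.
Proof.
rewrite /Ex Rintegral_cst// (_ : fine _ = 1) ?mulr1//.
exact: (congr1 fine (probability_setT mu)).
Qed.

Lemma ExD X Y : bounded_measurable X -> bounded_measurable Y ->
  Ex (fun w => X w + Y w) = Ex X + Ex Y.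
Proof. by move=> bX bY; rewrite /Ex RintegralD//; exact: bm_integrable. Qed.

Lemma ExB X Y : bounded_measurable X -> bounded_measurable Y ->
  Ex (fun w => X w - Y w) = Ex X - Ex Y.
Proof. by move=> bX bY; rewrite /Ex RintegralB//; exact: bm_integrable. Qed.

Lemma ExZ c X : bounded_measurable X -> Ex (fun w => c * X w) = c * Ex X.
Proof. by move=> bX; rewrite /Ex RintegralZl//; exact: bm_integrable. Qed.

Lemma Ex_sum (I : Type) (s : seq I) (X : I -> T -> R) :
  (forall i, bounded_measurable (X i)) ->
  Ex (fun w => \sum_(i <- s) X i w) = \sum_(i <- s) Ex (X i).
Proof.
move=> bX; elim: s => [|i s IH].
  by under [X in Ex X]eq_fun do rewrite big_nil; rewrite big_nil Ex_cst.
under [X in Ex X]eq_fun do rewrite big_cons.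
by rewrite big_cons ExD ?IH//; exact: bm_sum.
Qed.

Lemma Ex_le X Y : bounded_measurable X -> bounded_measurable Y ->
  (forall w, X w <= Y w) -> Ex X <= Ex Y.
Proof. by move=> bX bY XY; apply: le_Rintegral => //; exact: bm_integrable. Qed.

Lemma Ex_ge0 X : (forall w, 0 <= X w) -> 0 <= Ex X.
Proof. by move=> X0; apply: Rintegral_ge0. Qed.

Lemma eq_Ex X Y : (forall w, X w = Y w) -> Ex X = Ex Y.
Proof. by move=> XY; congr Ex; exact/funext. Qed.

Lemma Ex_norm_le X K : bounded_measurable X -> (forall w, `|X w| <= K) -> `|Ex X| <= K.
Proof.
move=> bX XK; rewrite ler_norml; apply/andP; split.
  rewrite -(Ex_cst (- K)); apply: Ex_le => //; first exact: bm_cst.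
  by move=> w; have := XK w; rewrite ler_norml => /andP[].
rewrite -(Ex_cst K); apply: Ex_le => //; first exact: bm_cst.
by move=> w; have := XK w; rewrite ler_norml => /andP[].
Qed.

Lemma Ex_indic A : measurable A -> Ex \1_A = fine (mu A).
Proof. by move=> mA; rewrite /Ex /Rintegral integral_indic// setIT. Qed.

End Expectation.

Lemma Rintegral_dominated_cvg {R : realType} d (T : measurableType d)
    (m : {measure set T -> \bar R}) (D : set T) (f_ : nat -> T -> R) (f g : T -> R) :
  measurable D -> (forall k, measurable_fun D (f_ k)) -> measurable_fun D f ->
  (forall x, D x -> f_ k x @[k --> \oo] --> f x) ->
  m.-integrable D (EFin \o g) ->
  (forall k x, D x -> `|f_ k x| <= g x) ->
  \int[m]_(x in D) f_ k x @[k --> \oo] --> \int[m]_(x in D) f x.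
Proof.
move=> mD mf_ mf fcvg ig fg.
have mEf_ k : measurable_fun D (EFin \o f_ k) by exact/measurable_EFinP.
have mEf : measurable_fun D (EFin \o f) by exact/measurable_EFinP.
have cE : \forall x \ae m, D x -> (EFin \o f_ k) x @[k --> \oo] --> (EFin \o f) x.
  by apply/aeW => x Dx; apply: cvg_EFin; [exact: nearW|exact: fcvg].
have bE : \forall x \ae m, forall k, D x -> (`|(EFin \o f_ k) x| <= (EFin \o g) x)%E.
  by apply/aeW => x k Dx /=; rewrite lee_fin fg.
have [intf _ h] := dominated_convergence mD mEf_ mEf cE ig bE.
apply: fine_cvg; rewrite fineK; first exact: h.
exact: integrable_fin_num.
Qed.

(** * Wiener space and increments *)

Section InvMeasurable.
Context {R : realType} {n : nat}.
Local Notation M := (borel 'M[R]_n).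

(** The invertible matrices form a Borel set, on which the cofactor formula is continuous; on the
    complement [invmx x] is x. *)
Lemma measurable_invmx_entry i j : measurable_fun setT (fun x : M => invmx x i j).
Proof.
have cm (f : 'M[R]_n -> R) : continuous f -> measurable_fun setT (f : M -> R).
  move=> fc; apply: (@within_continuous_measurable R 'M[R]_n setT f) => //.
  exact: continuous_subspaceT.
have md : measurable_fun setT (fun x : M => \det x).
  by apply: cm; apply: (@continuous_det R _ n id) => x; exact: cvg_id.
pose U : set M := [set x : M | x \in unitmx].
have UE : U = (fun x : M => \det x) @^-1` [set~ 0].
  by apply/seteqP; split=> x /=; rewrite /U/= unitmxE unitfE => /eqP.
have mU : measurable U.
  by rewrite UE -[X in measurable X]setTI; apply: md => //; exact: measurableC.
rewrite -(setUv U); apply/measurable_funU => //; first exact: measurableC.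
split; last first.
  apply: (eq_measurable_fun (fun x : M => x i j)).
    by move=> x /set_mem /= /negP xU; rewrite /invmx (negbTE xU).
  by apply: measurable_funTS; exact: measurable_entry.
apply: (@within_continuous_measurable R 'M[R]_n U) => //.
apply: (@eq_within_continuous 'M[R]_n R U (fun x : 'M[R]_n => (\det x)^-1 * \adj x i j)).
  by move=> x /= xu; rewrite /invmx xu [RHS]mxE.
apply: continuous_in_subspaceT => x /set_mem xu.
have := @continuous_invmx R n x xu i j.
by rewrite {1}/invmx xu [X in _ --> X]mxE.
Qed.

Lemma measurable_fun_invmx d (T : measurableType d) (f : T -> 'M[R]_n) :
  (forall i j, measurable_fun setT (fun x => f x i j)) ->
  forall i j, measurable_fun setT (fun x => invmx (f x) i j).
Proof.
move=> mf i j; apply: (measurableT_comp (measurable_invmx_entry i j)).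
exact: measurable_fun_mx.
Qed.

End InvMeasurable.

Section WienerPaths.
Context {R : realType} {n : nat} {G : compact_connected_lie_group R n} {T : R}.
Local Notation W := (wiener_measurable G T).
Local Notation M := 'M[R]_n.

Lemma path_at_lie t (w : wiener_space G T) : lie_set G (path_at t w).
Proof.
case: w => w pw; have [_ wG _ wT] := set_mem pw.
rewrite -[path_at _ _]/((w : R -> M) t).
by have [/wG//|/wT ->] := boolP (t \in `[0, T]); exact: lie_one.
Qed.

Lemma path_at0 (w : wiener_space G T) : path_at 0 w = 1%:M.
Proof. by case: w => w pw; have [] := set_mem pw. Qed.

Lemma continuous_path_at t : continuous (path_at t : wiener_space G T -> M).
Proof.
have [tT|tT] := boolP (t \in `[0, T]); last first.
  have -> : (path_at t : wiener_space G T -> M) = cst 1%:M.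
    by apply/funext => -[w pw]; have [_ _ _ wT] := set_mem pw; exact: wT.
  exact: cst_continuous.
have sv : continuous (@set_val _ (@wiener_paths R n G T)) by exact: initial_continuous.
move=> w; apply: (@cvg_comp _ _ _ _ (fun f : {uniform` `[0, T] -> M} => (f : R -> M) t) _ _ _ (sv w)).
move=> A /= nA; apply/uniform_nbhs.
have /nbhs_ballP[e e0 eA] := nA.
exists [set xy | ball xy.1 e xy.2]; split; first exact: (entourage_ball _ (PosNum e0)).
by move=> h hE /=; apply: eA; exact: hE.
Qed.

Lemma measurable_path_at t : measurable_fun setT (path_at t : W -> borel M).
Proof.
apply: (@within_continuous_borel (wiener_space G T) M setT (path_at t)) => //.
by apply: continuous_subspaceT; exact: continuous_path_at.
Qed.

Lemma measurable_path_entry t i j : measurable_fun setT (fun w : W => path_at t w i j).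
Proof. exact: (measurableT_comp (measurable_entry i j) (measurable_path_at t)). Qed.

Definition incr (s t : R) (w : wiener_space G T) : M := invmx (path_at s w) *m path_at t w.

Lemma incr_lie s t w : lie_set G (incr s t w).
Proof. by apply: lie_mul; [apply: lie_inv|]; exact: path_at_lie. Qed.

Lemma incrii t w : incr t t w = 1%:M.
Proof. by rewrite /incr mulVmx// (lie_unitmx (path_at_lie t w)). Qed.

Lemma incr0 t w : incr 0 t w = path_at t w.
Proof. by rewrite /incr path_at0 invmx1 mul1mx. Qed.

Lemma incrD s t u w : incr s u w = incr s t w *m incr t u w.
Proof.
rewrite /incr mulmxA -(mulmxA _ (path_at t w)) mulmxV ?mulmx1//.
exact: (lie_unitmx (path_at_lie t w)).
Qed.

Lemma incrV s t w : invmx (incr s t w) = incr t s w.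
Proof.
rewrite /incr invmx_mulmx ?invmxK// ?unitmx_inv;
  exact: (lie_unitmx (path_at_lie _ w)).
Qed.

Lemma measurable_incr_entry s t i j : measurable_fun setT (fun w : W => incr s t w i j).
Proof.
apply: measurable_fun_mulmx => {}i {}j; last exact: measurable_path_entry.
by apply: measurable_fun_invmx => {}i {}j; exact: measurable_path_entry.
Qed.

Lemma measurable_incr s t : measurable_fun setT (incr s t : W -> borel M).
Proof. by apply: measurable_fun_mx => i j; exact: measurable_incr_entry. Qed.

End WienerPaths.

Section Increments.
Context {R : realType} {n : nat} (G : compact_connected_lie_group R n) (T : R).
Context (lam : {measure set (borel 'M[R]_n) -> \bar R}).
Hypothesis hlam : haar_measure G lam.
Context (p : R -> 'M[R]_n -> R).
Hypothesis cp : forall t, 0 < t -> {within (G : set 'M[R]_n), continuous (p t)}.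
Context (mu : probability (wiener_measurable G T) R).
Hypothesis hmu : wiener_measure lam p mu.
Local Notation W := (wiener_measurable G T).
Local Notation M := (borel 'M[R]_n).
Local Notation mG := (measurable_lie G).

Definition density_prob (t : R) (B : set M) : R :=
  \int[lam]_(x in (G : set M)) (\1_B x * p t x).

Let dens_bounded t : 0 < t -> exists2 K : R, 0 <= K & forall x, lie_set G x -> `|p t x| <= K.
Proof. by move=> t0; exact: (lie_bounded (cp t0)). Qed.

Lemma measurable_density t : 0 < t -> measurable_fun (G : set M) (p t).
Proof.
by move=> t0; apply: within_continuous_measurable; [exact: mG|exact: cp].
Qed.

Let D (x0 : 'M[R]_n) (x : seq 'M[R]_n) (i : nat) : 'M[R]_n :=
  invmx (nth 1%:M (x0 :: x) i) *m nth 1%:M x i.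

Lemma haar_left_R (F : M -> R) (y : 'M[R]_n) : lie_set G y ->
  measurable_fun (G : set M) F ->
  \int[lam]_(x in (G : set M)) F (y *m x) = \int[lam]_(x in (G : set M)) F x.
Proof.
move=> Gy mF; rewrite /Rintegral; congr fine.
rewrite integralE [RHS]integralE; congr (_ - _)%E.
- transitivity (\int[lam]_(x in (G : set M)) (EFin \o F)^\+ (y *m x))%E.
    by apply: eq_integral => x _; rewrite !funeposE.
  apply: haar_left => //; apply: measurable_funepos; exact/measurable_EFinP.
- transitivity (\int[lam]_(x in (G : set M)) (EFin \o F)^\- (y *m x))%E.
    by apply: eq_integral => x _; rewrite !funenegE.
  apply: haar_left => //; apply: measurable_funeneg; exact/measurable_EFinP.
Qed.

(** Left invariance replaces each position by its increment. The induction needs the base point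
    [x0], which becomes the outermost variable for the inner integrals, and the constant [c], which
    carries the factors already fixed by the outer variables. *)
Lemma haar_power_integral_prod k (c a : R) (x0 : 'M[R]_n) (s : seq R) (B : nat -> set M) :
  size s = k -> lie_set G x0 -> path <%R a s -> (forall i, measurable (B i)) ->
  haar_power_integral G lam (fun x : k.-tuple M =>
    (c * \prod_(i < k) (\1_(B i) (D x0 x i) *
       p (nth 0 s i - nth 0 (a :: s) i) (D x0 x i)))%:E) =
  (c * \prod_(i < k) density_prob (nth 0 s i - nth 0 (a :: s) i) (B i))%:E.
Proof.
elim: k c a x0 s B => [|k IH] c a x0 s B; first by rewrite /= !big_ord0.
case: s => // r s [sk] Gx0 /=/andP[ar rs] mB.
have ra0 : 0 < r - a by rewrite subr_gt0.
pose phi (x : M) : R := \1_(B 0%N) x * p (r - a) x.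
pose K := \prod_(i < k) density_prob (nth 0 s i - nth 0 (r :: s) i) (B i.+1).
have mphi : measurable_fun (G : set M) phi.
  apply: measurable_funM; last exact: measurable_density.
  by apply: measurable_funTS; exact: measurable_indic.
have [Kp Kp0 pK] := dens_bounded ra0.
have phiK x : lie_set G x -> `|phi x| <= Kp.
  move=> Gx; rewrite /phi indicE normrM; apply: le_trans (pK _ Gx).
  by case: (_ \in _); rewrite ?normr1 ?mul1r// normr0 mul0r.
have mphi0 : measurable_fun (G : set M) (fun x => phi (invmx x0 *m x)).
  apply: (@measurable_lie_comp _ _ G _ _ _ _ (G : set M) phi (fun x : M => invmx x0 *m x : M)) => //.
  - exact: mG.
  - rewrite (_ : (fun x => _) = (fun x => invmx x0 *m x *m 1%:M)); first exact: measurable_lie_mul.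
    by apply/funext => x; rewrite mulmx1.
  - by move=> x Gx; apply: lie_mul => //; exact: lie_inv.
transitivity (\int[lam]_(x in (G : set M)) (c * K * phi (invmx x0 *m x))%:E)%E.
  rewrite [LHS]/=; apply: eq_integral => x /set_mem Gx.
  rewrite (_ : (c * K * phi (invmx x0 *m x))%:E = (c * phi (invmx x0 *m x) * K)%:E); last by congr EFin; ring.
  rewrite /K -(IH (c * phi (invmx x0 *m x)) r x s (fun i => B i.+1))//.
  congr (haar_power_integral G lam _); apply/funext => y; congr EFin.
  by rewrite big_ord_recl/= mulrA.
have -> : c * \prod_(i < k.+1) density_prob (nth 0 (r :: s) i - nth 0 (a :: r :: s) i) (B i) =
    \int[lam]_(x in (G : set M)) (c * K * phi (invmx x0 *m x)).
  rewrite big_ord_recl/= RintegralZl//; [|exact: mG|]; last first.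
    apply: (haar_integrable hlam (K := Kp)) => // x Gx; apply: phiK.
    by apply: lie_mul => //; exact: lie_inv.
  rewrite haar_left_R//; last exact: lie_inv.
  by rewrite -/(density_prob _ _) -/K; ring.
rewrite /Rintegral fineK//; apply: integrable_fin_num; first exact: mG.
apply: (haar_integrable hlam (K := `|c * K| * Kp)).
  by apply: measurable_funM.
move=> x Gx; rewrite normrM ler_pM//; apply: phiK.
by apply: lie_mul => //; exact: lie_inv.
Qed.

Lemma incr_prob (s : seq R) (B : nat -> set M) : itv_partition 0 T s ->
  (forall i, measurable (B i)) ->
  mu [set w | forall i, (i < size s)%N -> B i (incr (nth 0 (0 :: s) i) (nth 0 s i) w)] =
  (\prod_(i < size s) density_prob (nth 0 s i - nth 0 (0 :: s) i) (B i))%:E.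
Proof.
move=> ps mB; pose k := size s.
pose A : set (k.-tuple M) := [set x | forall i : 'I_k, B i (D 1%:M x i)].
have mD (i : 'I_k) : measurable_fun setT (fun x : k.-tuple M => D 1%:M x i : M).
  have mn (j : nat) : (j < k)%N -> measurable_fun setT (fun x : k.-tuple M => nth 1%:M x j : M).
    move=> jk; have := @measurable_tnth _ M k (Ordinal jk).
    by congr measurable_fun; apply/funext => x; rewrite (tnth_nth 1%:M).
  have me (j : nat) a b : (j < k)%N -> measurable_fun setT (fun x : k.-tuple M => nth 1%:M x j a b).
    by move=> jk; exact: (measurableT_comp (measurable_entry a b) (mn j jk)).
  apply: measurable_fun_mx; apply: measurable_fun_mulmx => a b; last exact: me.
  apply: measurable_fun_invmx => {}a {}b.
  by case: i => -[|i] ik /=; [exact: measurable_cst|apply: me; exact: ltnW].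
have mA : measurable A.
  rewrite (_ : A = \bigcap_(i in [set: 'I_k]) ((fun x : k.-tuple M => D 1%:M x i : M) @^-1` (B i))).
    apply: fin_bigcap_measurable => // i _; rewrite -[X in measurable X]setTI.
    exact: mD.
  by apply/seteqP; split=> x Ax i => [_|]; exact: Ax.
have := hmu (s := in_tuple s) ps mA.
rewrite (_ : [set w | _] = [set w | forall i, (i < size s)%N -> B i (incr (nth 0 (0 :: s) i) (nth 0 s i) w)]).
  move=> ->; rewrite -[RHS](congr1 EFin (mul1r _)).
  have [pth _] := ps.
  rewrite -(@haar_power_integral_prod k 1 0 1%:M s B erefl (lie_one G) pth mB).
  congr (haar_power_integral G lam _); apply/funext => x; congr EFin.
  rewrite mul1r big_split/=; congr (_ * _).
    rewrite indicE; have [|nA] := pselect (A x).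
      move=> Ax; rewrite mem_set// big1// => i _; rewrite indicE mem_set//; exact: Ax.
    rewrite memNset//; have [i nB] : exists i : 'I_k, ~ B i (D 1%:M x i).
      by apply/existsNP.
    by rewrite (bigD1 i)//= indicE memNset// mul0r.
  apply: eq_bigr => i _; rewrite /D (tnth_nth 0) (tnth_nth 1%:M)//.
have DE w i : (i < size s)%N ->
    D 1%:M [seq path_at t w | t <- s] i = incr (nth 0 (0 :: s) i) (nth 0 s i) w.
  move=> ik; rewrite /D /incr (nth_map 0)//; case: i ik => [|i] ik /=.
    by rewrite path_at0.
  by rewrite (nth_map 0)// ltnW.
apply/seteqP; split => w /= h i.
  by move=> ik; have := h (Ordinal ik); rewrite DE.
by rewrite DE//; exact: h.
Qed.

End Increments.

(** * The joint law of the increments *)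

Section IndependentIncrements.
Context {R : realType} {n : nat} (G : compact_connected_lie_group R n) (T : R).
Hypothesis T0 : 0 < T.
Context (lam : {measure set (borel 'M[R]_n) -> \bar R}).
Hypothesis hlam : haar_measure G lam.
Context (d : nat) (E : 'I_d -> 'M[R]_n).
Hypothesis GE : forall i, lie_algebra G (E i).
Context (p : R -> 'M[R]_n -> R).
Hypothesis hp : heat_kernel G E lam p.
Context (mu : probability (wiener_measurable G T) R).
Hypothesis hmu : wiener_measure lam p mu.
Local Notation W := (wiener_measurable G T).
Local Notation M := (borel 'M[R]_n).
Local Notation mG := (measurable_lie G).

Lemma heat_kernel_slice (t : R) : 0 < t -> {within (G : set 'M[R]_n), continuous (p t)}.
Proof.
move=> t0; have := @within_slice _ _ G (fun tx => p tx.1 tx.2) t t0.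
by apply; exact: (C12_cont (hk_C12 hp)).
Qed.

(** The kernel has total mass one: the mass has derivative zero and tends to 1 at time 0. *)
Lemma heat_mean1 (t : R) : 0 < t -> heat_mean G lam p (fun=> 1) t = 1.
Proof.
move=> t0; apply: (@const_at_right R (heat_mean G lam p (fun=> 1))) => // [s s0|]; last first.
  exact: (cvg_heat_mean hp (smooth_cst G 1)).
have := is_derive_heat_mean hlam GE hp s0 (smooth_cst G 1).
rewrite (@eq_heat_mean R n G lam p (laplacian E (fun=> 1)) (fun=> 0) s); last first.
  move=> x Gx; rewrite /laplacian big1// => i _.
  rewrite (@eq_left_field _ _ G _ _ (fun=> 0))//; last first.
    by move=> y Gy; rewrite /left_field; exact: derive1_cst.
  by rewrite /left_field; exact: derive1_cst.
rewrite (_ : heat_mean _ _ _ (fun=> 0) s = 0) ?mulr0//.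
by rewrite /heat_mean; under eq_Rintegral do rewrite mul0r; rewrite /Rintegral integral0.
Qed.

(** The mean of f over an increment of duration t. The kernel is specified for t > 0; an increment
    of duration 0 is the identity. *)
Definition increment_mean (t : R) (f : M -> R) : R :=
  if t == 0 then f 1%:M else heat_mean G lam p f t.

Fixpoint incr_prod (a : R) (l : seq (R * (M -> R))) (w : W) : R :=
  if l is (t, f) :: l' then f (incr a t w) * incr_prod t l' w else 1.

Fixpoint incr_mean_prod (a : R) (l : seq (R * (M -> R))) : R :=
  if l is (t, f) :: l' then increment_mean (t - a) f * incr_mean_prod t l' else 1.

Lemma nth_In (A : Type) (x0 : A) (s : seq A) i : (i < size s)%N -> List.In (nth x0 s i) s.
Proof.
elim: s i => // x s IH [|i] il /=; first by left.
by right; exact: IH.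
Qed.

Lemma incr_prod_cat a l1 l2 w : incr_prod a (l1 ++ l2) w =
  incr_prod a l1 w * incr_prod (last a (map fst l1)) l2 w.
Proof.
elim: l1 a => [|[t f] l1 IH] a /=; first by rewrite mul1r.
by rewrite IH mulrA.
Qed.

Lemma incr_mean_prod_cat a l1 l2 : incr_mean_prod a (l1 ++ l2) =
  incr_mean_prod a l1 * incr_mean_prod (last a (map fst l1)) l2.
Proof.
elim: l1 a => [|[t f] l1 IH] a /=; first by rewrite mul1r.
by rewrite IH mulrA.
Qed.

Lemma bm_incr s t (f : M -> R) : bounded_measurable f ->
  bounded_measurable (fun w : W => f (incr s t w)).
Proof.
move=> [mf [K fK]]; split; last by exists K.
exact: (measurableT_comp mf (measurable_incr s t)).
Qed.

Lemma bm_incr_prod a l : (forall x, List.In x l -> bounded_measurable x.2) ->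
  bounded_measurable (incr_prod a l).
Proof.
elim: l a => [|[t f] l IH] a bl; first exact: bm_cst.
apply: bmM; first by apply: bm_incr; exact: (bl (t, f) (or_introl erefl)).
by apply: IH => x xl; apply: bl; right.
Qed.

(** [wiener_measure] speaks of strictly increasing times. Increments of zero duration are constants,
    collected in c. *)
Lemma incr_prod_strict a l : path <=%R a (map fst l) ->
  (forall x, List.In x l -> bounded_measurable x.2) ->
  exists c l', [/\ path <%R a (map fst l'), last a (map fst l') = last a (map fst l),
    (forall x, List.In x l' -> bounded_measurable x.2),
    (forall w, incr_prod a l w = c * incr_prod a l' w) &
    incr_mean_prod a l = c * incr_mean_prod a l'].
Proof.
elim: l a => [|[t f] l IH] a /=; first by exists 1, [::]; split => //= *; rewrite mulr1.
move=> /andP[at_ pl] bl.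
have [|c [l' [pl' ll' bl' h1 h2]]] := IH t pl; first by move=> x xl; apply: bl; right.
move: at_; rewrite le_eqVlt => /orP[/eqP at_|at_].
  subst a; exists (f 1%:M * c), l'; split => // [w|].
    by rewrite incrii h1 mulrA.
  by rewrite /increment_mean subrr eqxx h2 mulrA.
exists c, ((t, f) :: l'); split => //= [|x [<-|]|w|]; rewrite ?at_//.
- exact: (bl (t, f) (or_introl erefl)).
- exact: bl'.
- by rewrite h1 mulrCA.
- by rewrite h2 mulrCA.
Qed.

Lemma incr_prodE a l w : incr_prod a l w =
  \prod_(i < size l) (nth (0, fun=> 0) l i).2
    (incr (nth 0 (a :: map fst l) i) (nth 0 (map fst l) i) w).
Proof.
elim: l a => [|[t f] l IH] a /=; first by rewrite big_ord0.
by rewrite big_ord_recl/= IH.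
Qed.

Lemma incr_mean_prodE a l : incr_mean_prod a l =
  \prod_(i < size l) increment_mean (nth 0 (map fst l) i - nth 0 (a :: map fst l) i)
    (nth (0, fun=> 0) l i).2.
Proof.
elim: l a => [|[t f] l IH] a /=; first by rewrite big_ord0.
by rewrite big_ord_recl/= IH.
Qed.

Let indics (l : seq (R * set M)) : seq (R * (M -> R)) :=
  map (fun x => (x.1, \1_(x.2))) l.

Let Ex_indics (l : seq (R * set M)) : path <%R 0 (map fst l) ->
  last 0 (map fst l) = T -> (forall x, List.In x l -> measurable x.2) ->
  Ex mu (incr_prod 0 (indics l)) = incr_mean_prod 0 (indics l).
Proof.
move=> pl lT ml.
have mfst : map fst (indics l) = map fst l by rewrite /indics -map_comp.
pose B i := (nth (0, set0 : set M) l i).2.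
have mB i : measurable (B i).
  have [il|il] := ltnP i (size l); last by rewrite /B nth_default//=; exact: measurable0.
  by apply: ml; apply: nth_In.
have ps : itv_partition 0 T (map fst l) by split => //; exact/eqP.
have nthB i : (i < size l)%N -> (nth (0, fun=> 0) (indics l) i).2 = \1_(B i).
  by move=> il; rewrite /indics (nth_map (0, set0)).
have := incr_prob hlam heat_kernel_slice hmu ps mB.
set A : set W := [set w | _] => muA.
have mA : measurable A.
  rewrite (_ : A = \bigcap_(i in [set: 'I_(size l)])
     (incr (nth 0 (0 :: map fst l) i) (nth 0 (map fst l) i) @^-1` (B i))).
    apply: fin_bigcap_measurable => // i _; rewrite -[X in measurable X]setTI.
    exact: measurable_incr.
  apply/seteqP; split=> w; rewrite /A/= size_map => Aw i; first by move=> _; exact: Aw.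
  by move=> il; exact: (Aw (Ordinal il) I).
transitivity (Ex mu \1_A).
  apply: eq_Ex => w; rewrite incr_prodE mfst size_map indicE.
  have [Aw|nA] := pselect (A w).
    rewrite mem_set// big1// => i _; rewrite nthB// indicE mem_set//.
    by apply: Aw; rewrite size_map.
  rewrite memNset//.
  have [i nB] : exists i : 'I_(size l), ~ B i (incr (nth 0 (0 :: map fst l) i) (nth 0 (map fst l) i) w).
    apply/existsNP => h; apply: nA => i; rewrite size_map => il.
    exact: (h (Ordinal il)).
  by rewrite (bigD1 i)//= nthB// indicE memNset// mul0r.
rewrite Ex_indic// muA incr_mean_prodE mfst !size_map/=.
apply: eq_bigr => i _; rewrite nthB// /increment_mean /density_prob /heat_mean.
rewrite ifF//; apply/negbTE; rewrite subr_eq0 gt_eqF//.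
case: i => i il /=; move: pl => /(pathP 0); apply; by rewrite size_map.
Qed.

(** Indicators are replaced by bounded functions one at a time. The list splits into arbitrary
    functions [l1] followed by indicators [l2]; by the monotone class argument the last function of
    [l1] may be taken to be an indicator, which is handed over to [l2]. *)
Let Ex_strict (l1 : seq (R * (M -> R))) (l2 : seq (R * set M)) :
  let l := l1 ++ indics l2 in
  path <%R 0 (map fst l) -> last 0 (map fst l) = T ->
  (forall x, List.In x l1 -> bounded_measurable x.2) ->
  (forall x, List.In x l2 -> measurable x.2) ->
  Ex mu (incr_prod 0 l) = incr_mean_prod 0 l.
Proof.
elim/last_ind: l1 l2 => [|l1 [t f] IH] l2 /= pl lT bl1 ml2.
  apply: Ex_indics => //; first by move: pl; rewrite /indics -map_comp.
  by move: lT; rewrite /indics -map_comp.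
rewrite cat_rcons in pl lT *.
have bf : bounded_measurable f.
  by apply: (bl1 (t, f)); rewrite -cats1; apply/List.in_or_app; right; left.
have bl1' x : List.In x l1 -> bounded_measurable x.2.
  by move=> xl; apply: bl1; rewrite -cats1; apply/List.in_or_app; left.
pose a := last 0 (map fst l1).
have bi2 x : List.In x (indics l2) -> bounded_measurable x.2.
  by move=> /List.in_map_iff[y [<- yl]]; apply: bm_indic; exact: ml2.
have EE h : bounded_measurable h ->
    bounded_measurable (incr_prod 0 (l1 ++ (t, h) :: indics l2)).
  move=> bh; apply: bm_incr_prod => x /List.in_app_iff[/bl1'//|[<-//|]].
  exact: bi2.
have ta : 0 < t - a.
  move: pl; rewrite map_cat cat_path => /andP[_] /= /andP[].
  by rewrite subr_gt0.
pose Dc (h : M -> R) := bounded_measurable h /\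
  Ex mu (incr_prod 0 (l1 ++ (t, h) :: indics l2)) =
  incr_mean_prod 0 (l1 ++ (t, h) :: indics l2).
suff : Dc f by case.
have iE h w : incr_prod 0 (l1 ++ (t, h) :: indics l2) w =
    h (incr a t w) * (incr_prod 0 l1 w * incr_prod t (indics l2) w).
  by rewrite incr_prod_cat/= -/a; ring.
have mE h : incr_mean_prod 0 (l1 ++ (t, h) :: indics l2) =
    heat_mean G lam p h (t - a) * (incr_mean_prod 0 l1 * incr_mean_prod t (indics l2)).
  by rewrite incr_mean_prod_cat/= -/a /increment_mean gt_eqF//; ring.
have inth (h : M -> R) : bounded_measurable h ->
    lam.-integrable (G : set M) (EFin \o (fun x => h x * p (t - a) x)).
  move=> [mh [K hK]]; have [K' K'0 pK'] := lie_bounded (heat_kernel_slice ta).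
  apply: (haar_integrable hlam (K := K * K')).
    apply: measurable_funM; first exact: measurable_funTS.
    by apply: within_continuous_measurable; [exact: mG|exact: heat_kernel_slice].
  by move=> x Gx; rewrite normrM ler_pM// pK'.
apply: (bounded_measurable_class _ _ _ bf).
- move=> A mA; split; first exact: bm_indic.
  have := IH ((t, A) :: l2); move: pl lT; rewrite !map_cat/= => pl lT; apply.
  + by rewrite map_cat.
  + by rewrite map_cat.
  + exact: bl1'.
  + by move=> x [<-//|]; exact: ml2.
- move=> c X Y [bX hX] [bY hY]; split; first by apply: bmD => //; exact: bmZ.
  transitivity (c * Ex mu (incr_prod 0 (l1 ++ (t, X) :: indics l2)) +
     Ex mu (incr_prod 0 (l1 ++ (t, Y) :: indics l2))).
    rewrite -ExZ; last exact: EE.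
    rewrite -ExD; [|by apply: bmZ; exact: EE|exact: EE].
    by apply: eq_Ex => w; rewrite !iE; ring.
  rewrite hX hY !mE mulrA -mulrDl; congr (_ * _).
  rewrite /heat_mean -RintegralZl//; [|exact: mG|exact: inth].
  have icX : lam.-integrable (G : set M) (EFin \o (fun x => c * (X x * p (t - a) x))).
    rewrite (_ : (fun x => c * _) = (fun x => c * X x * p (t - a) x)).
      exact: inth (bmZ c bX).
    by apply/funext => x; rewrite mulrA.
  rewrite -RintegralD//; [|exact: mG|exact: inth].
  by apply: eq_Rintegral => x _; rewrite mulrDl mulrA.
- move=> X_ X K hX_ bX_ X_K X_X bX; split => //.
  have bZ : bounded_measurable (fun w => incr_prod 0 l1 w * incr_prod t (indics l2) w).
    by apply: bmM; apply: bm_incr_prod.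
  have [KZ KZ0 ZK] := bounded_measurable_ge0 bZ.
  have c1 : Ex mu (incr_prod 0 (l1 ++ (t, X_ k) :: indics l2)) @[k --> \oo] -->
      Ex mu (incr_prod 0 (l1 ++ (t, X) :: indics l2)).
    apply: (@Rintegral_dominated_cvg _ _ _ mu setT _ _ (fun=> K * KZ)) => //.
    + by move=> k; have [] := EE _ (bX_ k).
    + by have [] := EE _ bX.
    + move=> w _; rewrite iE; under eq_fun do rewrite iE.
      by apply: cvgMl; exact: X_X.
    + by apply: bm_integrable; exact: bm_cst.
    + by move=> k w _; rewrite iE normrM ler_pM.
  have c2 : incr_mean_prod 0 (l1 ++ (t, X_ k) :: indics l2) @[k --> \oo] -->
      incr_mean_prod 0 (l1 ++ (t, X) :: indics l2).
    rewrite mE; under eq_fun do rewrite mE.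
    apply: cvgMl.
    have [Kp Kp0 pK] := lie_bounded (heat_kernel_slice ta).
    apply: (@Rintegral_dominated_cvg _ _ _ lam (G : set M) _ _ (fun=> K * Kp)) => //.
    + exact: mG.
    + by move=> k; have /measurable_int/measurable_EFinP := inth _ (bX_ k).
    + by have /measurable_int/measurable_EFinP := inth _ bX.
    + by move=> x Gx; apply: cvgMl; exact: X_X.
    + by apply: (haar_integrable hlam (K := `|K * Kp|)).
    + by move=> k x Gx; rewrite normrM ler_pM// pK.
  rewrite (_ : (fun k => Ex mu _) =
      (fun k => incr_mean_prod 0 (l1 ++ (t, X_ k) :: indics l2))) in c1; last first.
    by apply/funext => k; have [_ ->] := hX_ k.
  exact: cvgr_uniq c1 c2.
Qed.

Lemma Ex_incr_prod l : path <=%R 0 (map fst l) -> last 0 (map fst l) <= T ->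
  (forall x, List.In x l -> bounded_measurable x.2) ->
  Ex mu (incr_prod 0 l) = incr_mean_prod 0 l.
Proof.
move=> pl lT bl.
have [c [l' [pl' ll' bl' h1 h2]]] := incr_prod_strict pl bl.
rewrite h2 (eq_Ex _ h1) ExZ; last exact: bm_incr_prod.
congr (c * _); move: lT; rewrite -ll' le_eqVlt => /orP[/eqP lT|lT].
  by have := @Ex_strict l' [::]; rewrite /= cats0; exact.
(* A partition has to end at T: a last increment up to T is appended with the function 1, whose mean
   is 1. *)
have := @Ex_strict (l' ++ [:: (T, fun=> 1)]) [::]; rewrite /= cats0 => h.
transitivity (Ex mu (incr_prod 0 (l' ++ [:: (T, fun=> 1)]))).
  by apply: eq_Ex => w; rewrite incr_prod_cat/= !mulr1.
rewrite h//.
- rewrite incr_mean_prod_cat/= /increment_mean gt_eqF ?subr_gt0// heat_mean1 ?subr_gt0//.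
  by rewrite !mulr1.
- by rewrite map_cat cat_path pl'/= lT.
- by rewrite map_cat last_cat.
- by move=> x /List.in_app_iff[/bl'//|[<-//|[]]]; exact: bm_cst.
Qed.

End IndependentIncrements.

(** * Lengths of intersections of intervals *)

Section Overlap.
Context {R : realType}.
Implicit Types a b s t : R.

(** The length of the intersection of [a, b] and [s, t] when a <= b and s <= t. Written as a
    difference of clamped end points, it telescopes along a subdivision of [s, t]. *)
Definition overlap a b s t : R :=
  Num.min (Num.max t a) b - Num.min (Num.max s a) b.

Lemma overlap_disjoint a b s t : a <= b -> b <= s -> s <= t -> overlap a b s t = 0.
Proof.
move=> ab bs st; have bt := le_trans bs st; have as_ := le_trans ab bs.
by rewrite /overlap (max_l (le_trans ab bt)) (min_r bt) (max_l as_) (min_r bs) subrr.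
Qed.

Lemma overlap_shifted a b s t : a <= s -> s <= b -> b <= t -> overlap a b s t = b - s.
Proof.
move=> as_ sb bt; have ab := le_trans as_ sb.
by rewrite /overlap (max_l (le_trans ab bt)) (min_r bt) (max_l as_) (min_l sb).
Qed.

Lemma overlap_nested a b s t : a <= s -> s <= t -> t <= b -> overlap a b s t = t - s.
Proof.
move=> as_ st tb; have sb := le_trans st tb.
by rewrite /overlap (max_l (le_trans as_ st)) (min_l tb) (max_l as_) (min_l sb).
Qed.

Let overlap_case a b s t : s <= a -> a <= b -> s <= t -> overlap a b s t = overlap s t a b.
Proof.
move=> sa ab st; have [ta|/ltW at_] := leP t a.
  by rewrite (overlap_disjoint st ta ab) /overlap (max_r ta) (max_r sa) subrr.
have [tb|/ltW bt] := leP t b.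
  by rewrite (overlap_shifted sa at_ tb) /overlap (max_l at_) (max_r sa) (min_l tb) (min_l ab).
by rewrite (overlap_nested sa ab bt) /overlap (max_l at_) (max_r sa) (min_r bt) (min_l ab).
Qed.

Lemma overlapC a b s t : a <= b -> s <= t -> overlap a b s t = overlap s t a b.
Proof.
by move=> ab st; have [sa|/ltW as_] := leP s a; [|symmetry]; exact: overlap_case.
Qed.

Lemma overlap_bounds a b s t : a <= b -> s <= t ->
  [/\ 0 <= overlap a b s t, overlap a b s t <= b - a & overlap a b s t <= t - s].
Proof.
wlog as_ : a b s t / a <= s.
  move=> wl ab st; have [as_|/ltW sa] := leP a s; first exact: wl.
  by have [] := wl s t a b sa st ab; rewrite (overlapC st ab).
move=> ab st; have [bs|/ltW sb] := leP b s.
  by rewrite (overlap_disjoint ab bs st) !subr_ge0.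
have [bt|/ltW tb] := leP b t.
  by rewrite (overlap_shifted as_ sb bt) subr_ge0 lerB// lerB.
by rewrite (overlap_nested as_ st tb) subr_ge0 lerB.
Qed.

(** The left side is the length of the symmetric difference of the two intervals. *)
Lemma overlap_dist a b s t : a <= b -> s <= t ->
  (b - a) + (t - s) - 2 * overlap a b s t <= `|a - s| + `|b - t|.
Proof.
wlog as_ : a b s t / a <= s.
  move=> wl ab st; have [as_|/ltW sa] := leP a s; first exact: wl.
  have := wl s t a b sa st ab.
  by rewrite (overlapC st ab) (addrC (t - s)) (distrC s) (distrC t).
move=> ab st; have n1 : s - a <= `|a - s| by rewrite distrC ler_norm.
have n2 : t - b <= `|b - t| by rewrite distrC ler_norm.
have n3 : b - t <= `|b - t| by rewrite ler_norm.
rewrite (le_trans _ (lerD n1 (lexx _)))//.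
have [bs|/ltW sb] := leP b s.
  by rewrite (overlap_disjoint ab bs st) (le_trans _ (lerD (lexx _) n2))//; lra.
have [bt|/ltW tb] := leP b t.
  by rewrite (overlap_shifted as_ sb bt) (le_trans _ (lerD (lexx _) n2))//; lra.
by rewrite (overlap_nested as_ st tb) (le_trans _ (lerD (lexx _) n3))//; lra.
Qed.

Lemma overlap_sum a b (r : nat -> R) k :
  \sum_(i < k) overlap a b (r i) (r i.+1) = overlap a b (r 0%N) (r k).
Proof.
elim: k => [|k IH]; first by rewrite big_ord0 /overlap subrr.
by rewrite big_ord_recr/= IH /overlap addrC addrA subrK.
Qed.

End Overlap.

(** * Mean square convergence *)

Section SquareIntegral.
Context {R : realType} d {X : measurableType d} (mu : {measure set X -> \bar R}).
Implicit Types f g h : X -> R.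

(** The square of the L^2 norm. Moments of increments give squares directly, and extended values
    allow bounds to be stated before integrability is known. *)
Definition sq_integral f : \bar R := (\int[mu]_w (f w ^+ 2)%:E)%E.

Let msq f : measurable_fun setT f -> measurable_fun setT (fun w => (f w ^+ 2)%:E : \bar R).
Proof. by move=> mf; apply/measurable_EFinP; exact: measurable_funX. Qed.

Lemma sq_integral_ge0 f : (0 <= sq_integral f)%E.
Proof. by apply: integral_ge0 => w _; rewrite lee_fin sqr_ge0. Qed.

Lemma eq_sq_integral f g : (forall w, f w ^+ 2 = g w ^+ 2) -> sq_integral f = sq_integral g.
Proof. by move=> fg; apply: eq_integral => w _; rewrite fg. Qed.

Lemma le_sq_integral f g : measurable_fun setT f -> measurable_fun setT g ->
  (forall w, `|f w| <= `|g w|) -> (sq_integral f <= sq_integral g)%E.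
Proof.
move=> mf mg fg; apply: ge0_le_integral => //; [|exact: msq|exact: msq|].
  by move=> w _; rewrite lee_fin sqr_ge0.
move=> w _; rewrite lee_fin -(real_normK (num_real (f w))) -(real_normK (num_real (g w))).
by rewrite ler_pXn2r ?nnegrE.
Qed.

Lemma sq_integralZ (c : R) f : measurable_fun setT f ->
  sq_integral (fun w => c * f w) = ((c ^+ 2)%R%:E * sq_integral f)%E.
Proof.
move=> mf; rewrite /sq_integral -ge0_integralZl//.
- by apply: eq_integral => w _; rewrite exprMn EFinM.
- exact: msq.
- by move=> w _; rewrite lee_fin sqr_ge0.
- by rewrite lee_fin sqr_ge0.
Qed.

(** The squared form of the triangle inequality. With c = 1 it gives the usual factor 2; letting c
    tend to 0 gives the convergence of norms. *)
Lemma sq_integralD_weighted (c : R) f g : 0 < c -> measurable_fun setT f -> measurable_fun setT g ->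
  (sq_integral (fun w => (f w + g w)%R) <=
   (1 + c)%R%:E * sq_integral f + (1 + c^-1)%R%:E * sq_integral g)%E.
Proof.
move=> c0 mf mg.
rewrite /sq_integral -!ge0_integralZl//; try exact: msq;
  try (by move=> w _; rewrite lee_fin sqr_ge0); try by rewrite lee_fin addr_ge0// ?invr_ge0 ltW.
rewrite -ge0_integralD//; last 4 first.
- by move=> w _; rewrite -EFinM lee_fin mulr_ge0 ?sqr_ge0// addr_ge0// ltW.
- by apply: measurable_funeM; exact: msq.
- by move=> w _; rewrite -EFinM lee_fin mulr_ge0 ?sqr_ge0// addr_ge0// invr_ge0 ltW.
- by apply: measurable_funeM; exact: msq.
apply: ge0_le_integral => //.
- by move=> w _; rewrite lee_fin sqr_ge0.
- by apply: msq; exact: measurable_funD.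
- by apply: emeasurable_funD; apply: measurable_funeM; exact: msq.
move=> w _; rewrite -!EFinM -EFinD lee_fin -subr_ge0.
have -> : (1 + c) * f w ^+ 2 + (1 + c^-1) * g w ^+ 2 - (f w + g w) ^+ 2 = c^-1 * (c * f w - g w) ^+ 2.
  by field; rewrite gt_eqF.
by rewrite mulr_ge0 ?sqr_ge0// invr_ge0 ltW.
Qed.

Lemma sq_integralD f g : measurable_fun setT f -> measurable_fun setT g ->
  (sq_integral (fun w => (f w + g w)%R) <= 2%R%:E * sq_integral f + 2%R%:E * sq_integral g)%E.
Proof. by move=> mf mg; have := sq_integralD_weighted ltr01 mf mg; rewrite invr1. Qed.

Lemma ae_eq_sq_integral f g : measurable_fun setT f -> measurable_fun setT g ->
  (\forall w \ae mu, f w = g w) -> sq_integral f = sq_integral g.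
Proof.
move=> mf mg fg; apply: ge0_ae_eq_integral => //; try exact: msq;
  try by move=> w _; rewrite lee_fin sqr_ge0.
by apply: filterS fg => w + _ => ->.
Qed.

Lemma sq_integral_eq0 f : measurable_fun setT f -> sq_integral f = 0%E ->
  \forall w \ae mu, f w = 0.
Proof.
move=> mf f0.
have h : (\int[mu]_w `|(f w ^+ 2)%:E|)%E = 0%E.
  by rewrite -[RHS]f0; apply: eq_integral => w _; rewrite gee0_abs// lee_fin sqr_ge0.
have /ae_eq_integral_abs := h; move=> /(_ measurableT (msq mf)).
by apply: filterS => w /(_ I) /eqP; rewrite eqe sqrf_eq0 => /eqP.
Qed.

(** All functions are cut off on the exceptional null set, so that the convergence becomes pointwise
    and the lower limit is the limit. *)
Lemma fatou_ae (f_ : nat -> X -> R) f (c : \bar R) :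
  (forall k, measurable_fun setT (f_ k)) -> measurable_fun setT f ->
  (forall k w, 0 <= f_ k w) -> (forall w, 0 <= f w) ->
  (\forall w \ae mu, f_ k w @[k --> \oo] --> f w) ->
  (forall k, (\int[mu]_w (f_ k w)%:E <= c)%E) -> (\int[mu]_w (f w)%:E <= c)%E.
Proof.
move=> mf_ mf f_0 f0 [N [mN N0 fN]] fc.
have mI : measurable_fun setT (\1_(~` N) : X -> R) by apply: measurable_indic; exact: measurableC.
have I01 w : (0 : R) <= \1_(~` N) w <= 1 by rewrite indicE ler0n -[1]/(1%:R) ler_nat; case: (w \in _).
have mg k : measurable_fun setT (fun w => f_ k w * \1_(~` N) w) by exact: measurable_funM.
rewrite (_ : (\int[mu]_w (f w)%:E)%E = (\int[mu]_w limn_einf (fun k => (f_ k w * \1_(~` N) w)%R%:E))%E); last first.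
  transitivity (\int[mu]_w (f w * \1_(~` N) w)%R%:E)%E.
    apply: ge0_ae_eq_integral => //.
    - exact/measurable_EFinP.
    - by apply/measurable_EFinP; exact: measurable_funM.
    - by move=> w _; rewrite lee_fin.
    - by move=> w _; rewrite lee_fin mulr_ge0//; case/andP: (I01 w).
    exists N; split => // w /= h; apply: contrapT => Nw; apply: h => _.
    by rewrite indicE mem_set ?mulr1.
  apply: eq_integral => w _; apply/esym.
  have h : (f_ k w * \1_(~` N) w)%R%:E @[k --> \oo] --> (f w * \1_(~` N) w)%R%:E.
    apply: cvg_EFin; first exact: nearW.
    have [Nw|nNw] := pselect (N w).
      have -> : (\1_(~` N) w : R) = 0 by rewrite indicE memNset//= => /(_ Nw).
      by rewrite mulr0; under eq_fun do rewrite mulr0; exact: cvg_cst.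
    apply: cvgMl => //; apply: contrapT => h; apply: nNw; exact: fN.
  by have [-> _] := cvg_limn_einf_sup h.
apply: (le_trans (fatou _ _ _ _)) => //.
- by move=> k; apply/measurable_EFinP.
- by move=> k w _; rewrite lee_fin mulr_ge0//; case/andP: (I01 w).
rewrite limn_einf_lim; apply: lime_le; first exact: is_cvg_einfs.
apply: nearW => k; apply: (@le_trans _ _ (\int[mu]_w (f_ k w * \1_(~` N) w)%R%:E)%E).
  by apply: ereal_inf_lbound; exists k => //=.
apply: le_trans (fc k); apply: ge0_le_integral => //.
- by move=> w _; rewrite lee_fin mulr_ge0//; case/andP: (I01 w).
- by apply/measurable_EFinP.
- by apply/measurable_EFinP.
- by move=> w _; rewrite lee_fin ler_piMr//; case/andP: (I01 w).
Qed.

Lemma sq_integral_fatou (f_ : nat -> X -> R) f (c : \bar R) :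
  (forall k, measurable_fun setT (f_ k)) -> measurable_fun setT f ->
  (\forall w \ae mu, f_ k w @[k --> \oo] --> f w) ->
  (forall k, (sq_integral (f_ k) <= c)%E) -> (sq_integral f <= c)%E.
Proof.
move=> mf_ mf fcvg; apply: fatou_ae.
- by move=> k; exact: measurable_funX.
- exact: measurable_funX.
- by move=> k w; exact: sqr_ge0.
- by move=> w; exact: sqr_ge0.
- apply: filterS fcvg => w h; rewrite expr2; under eq_fun do rewrite expr2.
  exact: cvgM.
Qed.

End SquareIntegral.

Section AlmostSureLimits.
Context {R : realType} d {X : measurableType d} (mu : probability X R).
Implicit Types f g h : X -> R.

(** From |x| <= e + x^2 / e with e = 2^-k the expectation of |f_k| is at most (1 + K) 2^-k, so the
    sum of the |f_k| is integrable, hence finite almost surely. The rate 4^-k required here explains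
    the grids with 4^N cells used later. *)
Lemma ae_summable (f_ : nat -> X -> R) (K : R) :
  (forall k, measurable_fun setT (f_ k)) ->
  (forall k, (sq_integral mu (f_ k) <= (K * 4^-1 ^+ k)%R%:E)%E) ->
  \forall w \ae mu, cvgn (series (fun k => f_ k w)).
Proof.
move=> mf hK; pose e (k : nat) : R := 2^-1 ^+ k.
have e0 k : 0 < e k by rewrite exprn_gt0.
have K0 : 0 <= K by have := le_trans (sq_integral_ge0 mu (f_ 0%N)) (hK 0%N); rewrite expr0 mulr1 lee_fin.
have le1 k : (\int[mu]_w `|(f_ k w)%:E| <= ((1 + K) * e k)%R%:E)%E.
  apply: (@le_trans _ _ (\int[mu]_w ((e k)%:E + (e k)^-1%:E * (f_ k w ^+ 2)%:E))%E).
    apply: ge0_le_integral => //.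
    - by apply: measurableT_comp => //; exact/measurable_EFinP.
    - apply: emeasurable_funD => //; apply: measurable_funeM.
      by apply/measurable_EFinP; exact: measurable_funX.
    - move=> w _; rewrite -EFinM -EFinD lee_fin.
      rewrite -(real_normK (num_real (f_ k w))); set x := `|f_ k w|.
      have -> : e k + (e k)^-1 * x ^+ 2 = (e k)^-1 * ((e k - x) ^+ 2 + e k * x) + x.
        by field; rewrite gt_eqF.
      by rewrite lerDr mulr_ge0 ?invr_ge0 ?addr_ge0 ?sqr_ge0 ?mulr_ge0 ?normr_ge0// ltW.
  rewrite ge0_integralD//; last 3 first.
  - by move=> w _; rewrite lee_fin ltW.
  - by move=> w _; rewrite -EFinM lee_fin mulr_ge0 ?sqr_ge0// invr_ge0 ltW.
  - by apply: measurable_funeM; apply/measurable_EFinP; exact: measurable_funX.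
  have -> : (\int[mu]_w (e k)%:E = (e k)%:E)%E.
    rewrite integral_cst//; transitivity ((e k)%:E * 1)%E; last exact: mule1.
    by congr (_ * _)%E; exact: probability_setT.
  rewrite ge0_integralZl//; last 3 first.
  - by apply/measurable_EFinP; exact: measurable_funX.
  - by move=> w _; rewrite lee_fin sqr_ge0.
  - by rewrite lee_fin invr_ge0 ltW.
  rewrite mulrDl mul1r EFinD leeD2l//.
  apply: (@le_trans _ _ ((e k)^-1%:E * (K * 4^-1 ^+ k)%R%:E)%E).
    by apply: lee_wpmul2l; [rewrite lee_fin invr_ge0 ltW|exact: hK].
  have ee : (4 : R)^-1 ^+ k = e k * e k.
    by rewrite /e -exprMn; congr (_ ^+ k); field.
  by rewrite ee -EFinM lee_fin mulrCA (mulrA (e k)^-1) mulVf ?mul1r// gt_eqF.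
have fin : (\int[mu]_w (\sum_(0 <= k <oo) `|(f_ k w)%:E|) < +oo)%E.
  rewrite integral_nneseries//; last by move=> k; apply: measurableT_comp => //; exact/measurable_EFinP.
  apply: (@le_lt_trans _ _ ((1 + K) * 2)%R%:E); last exact: ltry.
  apply: lime_le; first by apply: is_cvg_nneseries => k _ _; exact: integral_ge0.
  apply: nearW => N; apply: (@le_trans _ _ (\sum_(0 <= k < N) ((1 + K) * e k)%R%:E)%E).
    by apply: lee_sum => k _; exact: le1.
  rewrite sumEFin lee_fin -mulr_sumr ler_wpM2l ?addr_ge0//.
  have -> : \sum_(0 <= k < N) e k = 2 - 2 * e N.
    elim: N => [|N IH]; first by rewrite big_geq// /e expr0 mulr1 subrr.
    by rewrite big_nat_recr//= IH /e exprS; field.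
  by rewrite gerBl mulr_ge0// ltW.
have mS : measurable_fun setT (fun w => \sum_(0 <= k <oo) `|(f_ k w)%:E|)%E.
  apply: ge0_emeasurable_sum => // k _; apply: measurableT_comp => //; exact/measurable_EFinP.
have S0 w : (0 <= \sum_(0 <= k <oo) `|(f_ k w)%:E|)%E by exact: nneseries_ge0.
have : mu.-integrable setT (fun w => \sum_(0 <= k <oo) `|(f_ k w)%:E|)%E.
  by apply/integrableP; split => //; under eq_integral do rewrite gee0_abs//.
move/(integrable_ae measurableT); apply: filterS => w /(_ I).
rewrite ge0_fin_numE// => h; apply: normed_cvg.
by apply: nnseries_is_cvg => // k; exact: normr_ge0.
Qed.

Lemma ae_limit (f_ : nat -> X -> R) (K : R) :
  (forall k, measurable_fun setT (f_ k)) ->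
  (forall k, (sq_integral mu (fun w => (f_ k.+1 w - f_ k w)%R) <= (K * 4^-1 ^+ k)%R%:E)%E) ->
  exists2 f : X -> R, measurable_fun setT f & \forall w \ae mu, f_ k w @[k --> \oo] --> f w.
Proof.
move=> mf hK; have [|N [mN N0 hN]] := @ae_summable (fun k w => f_ k.+1 w - f_ k w) K _ hK.
  by move=> k; exact: measurable_funB.
have cf w : ~ N w -> cvgn (fun k => f_ k w).
  move=> nNw; have : cvgn (series (fun k => f_ k.+1 w - f_ k w)).
    by apply: contrapT => h; apply: nNw; exact: hN.
  have -> : series (fun k => f_ k.+1 w - f_ k w) = (fun k => f_ k w - f_ 0%N w).
    by apply/funext => k; rewrite seriesEnat/= telescope_sumr.
  move=> h; have -> : (fun k => f_ k w) = (fun k => (f_ k w - f_ 0%N w) + f_ 0%N w).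
    by apply/funext => k; rewrite subrK.
  by apply: is_cvgD; [exact: h|exact: is_cvg_cst].
pose f w := \1_(~` N) w * limn (fun k => f_ k w).
have hf w : \1_(~` N) w * f_ k w @[k --> \oo] --> f w.
  rewrite /f indicE; have [Nw|nNw] := pselect (N w).
    rewrite memNset /= => [|/(_ Nw)//]; rewrite mul0r; under eq_fun do rewrite mul0r.
    exact: cvg_cst.
  rewrite mem_set//= mul1r; under eq_fun do rewrite mul1r.
  exact: cf.
exists f.
  apply: (@measurable_fun_cvg _ _ _ _ (fun k w => \1_(~` N) w * f_ k w)) => [k|w _]; last exact: hf.
  by apply: measurable_funM => //; apply: measurable_indic; exact: measurableC.
exists N; split => // w /= h; apply: contrapT => nNw; apply: h.
by rewrite /f indicE mem_set//= mul1r; exact: cf.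
Qed.

Lemma ae_cvg_sq (f_ : nat -> X -> R) f (K : R) :
  (forall k, measurable_fun setT (f_ k)) -> measurable_fun setT f ->
  (forall k, (sq_integral mu (fun w => (f_ k w - f w)%R) <= (K * 4^-1 ^+ k)%R%:E)%E) ->
  \forall w \ae mu, f_ k w @[k --> \oo] --> f w.
Proof.
move=> mf_ mf hK.
have := @ae_summable (fun k w => f_ k w - f w) K _ hK.
move=> /(_ (fun k => measurable_funB (mf_ k) mf)); apply: filterS => w /cvg_series_cvg_0 h.
have -> : (fun k => f_ k w) = (fun k => (f_ k w - f w) + f w).
  by apply/funext => k; rewrite subrK.
by rewrite -[X in _ --> X]add0r; apply: cvgD => //; exact: cvg_cst.
Qed.

End AlmostSureLimits.

Section SquareConvergence.
Context {R : realType} d {X : measurableType d} (mu : {measure set X -> \bar R}).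
Implicit Types f g : X -> R.

Definition sq_cvg (f_ : nat -> X -> R) f : Prop :=
  sq_integral mu (fun w => f_ k w - f w) @[k --> \oo] --> 0%E.

Lemma eq_sq_cvg (f_ : nat -> X -> R) f (g_ : nat -> X -> R) g : (forall k w, g_ k w = f_ k w) ->
  (forall w, g w = f w) -> sq_cvg f_ f -> sq_cvg g_ g.
Proof.
move=> h1 h2; have -> : g_ = f_ by apply/funext => k; apply/funext => w; exact: h1.
by have -> : g = f by apply/funext => w; exact: h2.
Qed.

Lemma sq_cvg_squeeze (f_ : nat -> X -> R) f (e_ : nat -> \bar R) :
  (forall k, (sq_integral mu (fun w => (f_ k w - f w)%R) <= e_ k)%E) ->
  e_ k @[k --> \oo] --> 0%E -> sq_cvg f_ f.
Proof.
move=> fe e0; apply: (@squeeze_cvge nat \oo _ R (fun=> 0%E) _ e_) => //; last exact: cvg_cst.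
by apply: nearW => k; rewrite sq_integral_ge0 fe.
Qed.

Lemma sq_cvg_bound (f_ : nat -> X -> R) f (K : R) :
  (forall k, (sq_integral mu (fun w => (f_ k w - f w)%R) <= (K / k.+1%:R)%:E)%E) ->
  sq_cvg f_ f.
Proof.
move=> h; apply: sq_cvg_squeeze h _; apply: cvg_EFin; first exact: nearW.
by rewrite -[X in _ --> X](mulr0 K); apply: cvgMr; exact: cvg_harmonic.
Qed.

Lemma sq_cvgD (f_ : nat -> X -> R) f (g_ : nat -> X -> R) g :
  (forall k, measurable_fun setT (f_ k)) -> measurable_fun setT f ->
  (forall k, measurable_fun setT (g_ k)) -> measurable_fun setT g ->
  sq_cvg f_ f -> sq_cvg g_ g -> sq_cvg (fun k w => f_ k w + g_ k w) (fun w => f w + g w).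
Proof.
move=> mf_ mf mg_ mg hf hg.
apply: (@sq_cvg_squeeze _ _ (fun k => 2%R%:E * sq_integral mu (fun w => (f_ k w - f w)%R) +
   2%R%:E * sq_integral mu (fun w => (g_ k w - g w)%R))%E).
  move=> k; rewrite (@eq_sq_integral _ _ _ _ _ (fun w => (f_ k w - f w) + (g_ k w - g w))).
    by apply: sq_integralD; exact: measurable_funB.
  by move=> w; rewrite opprD addrACA.
rewrite -[X in _ --> X]adde0 -[X in (X + _)%E](mule0 2%:E) -[X in (_ + X)%E](mule0 2%:E).
by apply: cvgeD; [rewrite !mule0|exact: cvgeZl|exact: cvgeZl].
Qed.

Lemma sq_cvgZ (c : R) (f_ : nat -> X -> R) f :
  (forall k, measurable_fun setT (f_ k)) -> measurable_fun setT f ->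
  sq_cvg f_ f -> sq_cvg (fun k w => c * f_ k w) (fun w => c * f w).
Proof.
move=> mf_ mf hf.
apply: (@sq_cvg_squeeze _ _ (fun k => (c ^+ 2)%R%:E * sq_integral mu (fun w => (f_ k w - f w)%R))%E).
  move=> k; rewrite -sq_integralZ; last exact: measurable_funB.
  by rewrite (@eq_sq_integral _ _ _ _ _ (fun w => c * (f_ k w - f w)))// => w; rewrite mulrBr.
by rewrite -(mule0 (c ^+ 2)%:E); exact: cvgeZl.
Qed.

Lemma sq_cvg_cst0 : sq_cvg (fun _ _ => 0) (fun=> 0).
Proof.
rewrite /sq_cvg /sq_integral; under eq_fun do rewrite subrr expr0n/= integral0.
exact: cvg_cst.
Qed.

Lemma measurable_bigsum (I : Type) (s : seq I) (f : I -> X -> R) :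
  (forall i, measurable_fun setT (f i)) -> measurable_fun setT (fun w => \sum_(i <- s) f i w).
Proof.
move=> mf; elim: s => [|i s IH].
  by under eq_fun do rewrite big_nil; exact: measurable_cst.
by under eq_fun do rewrite big_cons; exact: measurable_funD.
Qed.

Lemma sq_cvg_sum (I : Type) (s : seq I) (f_ : I -> nat -> X -> R) (f : I -> X -> R) :
  (forall i k, measurable_fun setT (f_ i k)) -> (forall i, measurable_fun setT (f i)) ->
  (forall i, List.In i s -> sq_cvg (f_ i) (f i)) ->
  sq_cvg (fun k w => \sum_(i <- s) f_ i k w) (fun w => \sum_(i <- s) f i w).
Proof.
move=> mf_ mf; elim: s => [|i s IH] hs.
  by apply: eq_sq_cvg sq_cvg_cst0 => [k w|w]; rewrite big_nil.
apply: (@eq_sq_cvg (fun k w => f_ i k w + \sum_(j <- s) f_ j k w) (fun w => f i w + \sum_(j <- s) f j w)).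
- by move=> k w; rewrite big_cons.
- by move=> w; rewrite big_cons.
apply: sq_cvgD => //.
- by move=> k; exact: measurable_bigsum.
- exact: measurable_bigsum.
- exact: hs (or_introl erefl).
by apply: IH => j js; apply: hs; right.
Qed.

(** Continuity of the norm, in squared form: the weighted inequality is applied in both directions,
    first k tends to infinity and then the weight c to 0. *)
Lemma sq_cvg_integral (f_ : nat -> X -> R) f (e_ : nat -> R) (e : R) :
  (forall k, measurable_fun setT (f_ k)) -> measurable_fun setT f ->
  sq_cvg f_ f -> (forall k, sq_integral mu (f_ k) = (e_ k)%:E) ->
  e_ k @[k --> \oo] --> e -> sq_integral mu f = e%:E.
Proof.
move=> mf_ mf fcvg fe ecvg.
have mB k : measurable_fun setT (fun w => f_ k w - f w) by exact: measurable_funB.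
have /fine_cvgP[dfin dcvg] := fcvg.
pose dd k := fine (sq_integral mu (fun w => f_ k w - f w)).
have up (c : R) k : 0 < c -> sq_integral mu (fun w => f_ k w - f w) \is a fin_num ->
    (sq_integral mu f <= ((1 + c) * e_ k + (1 + c^-1) * dd k)%:E)%E.
  move=> c0 fin.
  rewrite (@eq_sq_integral _ _ _ _ _ (fun w => f_ k w + - 1 * (f_ k w - f w))); last first.
    by move=> w; congr (_ ^+ 2); ring.
  have mN : measurable_fun setT (fun w => - 1 * (f_ k w - f w)) by exact: measurable_funM.
  apply: (le_trans (sq_integralD_weighted mu c0 (mf_ k) mN)).
  rewrite fe sq_integralZ// sqrrN expr1n mul1e.
  by rewrite -(fineK fin) -!EFinM -EFinD lee_fin /dd.
have dn (c : R) k : 0 < c -> sq_integral mu (fun w => f_ k w - f w) \is a fin_num ->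
    ((e_ k)%:E <= (1 + c)%R%:E * sq_integral mu f + ((1 + c^-1) * dd k)%R%:E)%E.
  move=> c0 fin; rewrite -fe.
  rewrite (@eq_sq_integral _ _ _ _ (f_ k) (fun w => f w + (f_ k w - f w))); last first.
    by move=> w; congr (_ ^+ 2); ring.
  apply: (le_trans (sq_integralD_weighted mu c0 mf (mB k))).
  by rewrite leeD2l// -(fineK fin) -EFinM /dd.
have ffin : sq_integral mu f \is a fin_num.
  have [N _ /(_ N (leqnn N)) hN] := dfin.
  rewrite ge0_fin_numE ?sq_integral_ge0// (le_lt_trans (up 1 N ltr01 hN))//; exact: ltry.
rewrite -(fineK ffin); congr EFin; set r := fine _.
have hr : sq_integral mu f = r%:E by rewrite /r fineK.
have lim1 (a b : R) : a * e_ k + b * dd k @[k --> \oo] --> a * e.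
  rewrite -[X in _ --> X]addr0 -(mulr0 b); apply: cvgD; apply: cvgMr; [exact: ecvg|exact: dcvg].
have r0 : 0 <= r by rewrite -lee_fin -hr sq_integral_ge0.
have re (c : R) : 0 < c -> r <= (1 + c) * e.
  move=> c0; apply: (@ler_cvg_to _ \oo _ _ (fun=> r) (fun k => (1 + c) * e_ k + (1 + c^-1) * dd k)).
  - exact: cvg_cst.
  - exact: lim1.
  - by apply: filterS dfin => k hk; rewrite -lee_fin -hr; exact: up.
have er (c : R) : 0 < c -> e <= (1 + c) * r.
  move=> c0; apply: (@ler_cvg_to _ \oo _ _ (fun k => 1 * e_ k + - (1 + c^-1) * dd k) (fun=> (1 + c) * r)).
  - by rewrite -[X in _ --> X]mul1r; exact: lim1.
  - exact: cvg_cst.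
  - apply: filterS dfin => k hk; have := dn c k c0 hk.
    by rewrite hr -EFinM -EFinD lee_fin mul1r mulNr lerBlDr.
have e0 : 0 <= e.
  apply: (@ler_cvg_to _ \oo _ _ (fun=> 0) e_ _ _ (cvg_cst _) ecvg).
  by apply: nearW => k; rewrite -lee_fin -fe sq_integral_ge0.
have close (x y : R) : 0 <= y -> (forall c, 0 < c -> x <= (1 + c) * y) -> x <= y.
  move=> y0 h; apply/ler_addgt0Pr => z z0.
  have zy : 0 < z / (y + 1) by rewrite divr_gt0// ltr_wpDl.
  apply: (le_trans (h _ zy)); rewrite mulrDl mul1r lerD2l.
  by rewrite mulrAC ler_pdivrMr ?ltr_wpDl// ler_wpM2l ?lerDl// ltW.
by apply/eqP; rewrite eq_le; apply/andP; split; [exact: close e0 re|exact: close r0 er].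
Qed.

End SquareConvergence.

Section ZeroByMarkov.
Context {R : realType} d {X : measurableType d} (mu : {measure set X -> \bar R}) {n : nat}.

Lemma measurable_mx_norm (Z : X -> 'M[R]_n) :
  (forall i j, measurable_fun setT (fun w => Z w i j)) -> measurable_fun setT (fun w => `|Z w|).
Proof.
move=> mZ; apply: (measurableT_comp (_ : measurable_fun setT (fun x : borel 'M[R]_n => `|x : 'M[R]_n|))).
  apply: (@within_continuous_measurable R 'M[R]_n setT (fun x => `|x|)) => //.
  by apply: continuous_subspaceT; exact: norm_continuous.
exact: measurable_fun_mx.
Qed.

Lemma measurable_norm_ge (Z : X -> 'M[R]_n) (e : R) :
  (forall i j, measurable_fun setT (fun w => Z w i j)) -> measurable [set w | e <= `|Z w|].
Proof.
move=> /measurable_mx_norm mZ.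
have -> : [set w | e <= `|Z w|] = setT `&` (fun w => `|Z w|) @^-1` `[e, +oo[%classic.
  by rewrite setTI; apply/seteqP; split => w /=; rewrite in_itv/= andbT.
by apply: mZ => //; exact: measurable_itv.
Qed.

Lemma mx_norm_markov (Z : X -> 'M[R]_n) (e : R) : 0 < e ->
  (forall i j, measurable_fun setT (fun w => Z w i j)) ->
  ((e ^+ 2)%R%:E * mu [set w | (e <= `|Z w|)%R] <=
   \sum_(ij : 'I_n * 'I_n) sq_integral mu (fun w => Z w ij.1 ij.2))%E.
Proof.
move=> e0 mZ; have e20 : 0 < e ^+ 2 by rewrite exprn_gt0.
pose S w : \bar R := (\sum_(ij : 'I_n * 'I_n) (Z w ij.1 ij.2 ^+ 2)%:E)%E.
have mS1 ij : measurable_fun setT (fun w => (Z w ij.1 ij.2 ^+ 2)%:E : \bar R).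
  by apply/measurable_EFinP; exact: measurable_funX.
have mS : measurable_fun setT S by apply: emeasurable_sum.
have S0 w : (0 <= S w)%E by apply: sume_ge0 => ij _; rewrite lee_fin sqr_ge0.
have -> : (\sum_(ij : 'I_n * 'I_n) sq_integral mu (fun w => Z w ij.1 ij.2))%E = (\int[mu]_w `|S w|)%E.
  rewrite /sq_integral; under [RHS]eq_integral do rewrite gee0_abs//.
  by rewrite ge0_integral_sum// => ij w _; rewrite lee_fin sqr_ge0.
apply: le_trans (le_integral_abse mu measurableT mS e20); rewrite setTI.
apply: lee_wpmul2l; first by rewrite lee_fin ltW.
apply: le_measure; rewrite ?inE.
- exact: measurable_norm_ge.
- rewrite -[X in measurable X]setTI; apply: emeasurable_fun_c_infty => //.
  exact: measurableT_comp.
move=> w /= ew; rewrite gee0_abs// /S sumEFin lee_fin.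
rewrite leNgt; apply/negP => lt.
move: lt; set s := \sum_ij _ => lt; have s0 : 0 <= s by apply: sumr_ge0 => ij _; exact: sqr_ge0.
have : e <= Num.sqrt s.
  rewrite (le_trans ew)//; apply: mx_norm_le; first exact: sqrtr_ge0.
  move=> i j; rewrite -sqrtr_sqr ler_wsqrtr// /s (bigD1 (i, j))//= lerDl.
  by apply: sumr_ge0 => ij _; exact: sqr_ge0.
rewrite leNgt => /negP; apply.
by rewrite -(@ltr_pXn2r _ 2) ?nnegrE ?sqrtr_ge0 ?(ltW e0)// sqr_sqrtr.
Qed.

Lemma ae_eq0_mx (Z : X -> 'M[R]_n) : (forall i j, measurable_fun setT (fun w => Z w i j)) ->
  (forall e : R, 0 < e -> mu [set w | e <= `|Z w|] = 0%E) -> \forall w \ae mu, Z w = 0.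
Proof.
move=> mZ hZ; have : \forall w \ae mu, forall k : nat, `|Z w| < k.+1%:R^-1.
  apply: ae_foralln => k; exists [set w | k.+1%:R^-1 <= `|Z w|]; split.
  - exact: measurable_norm_ge.
  - by apply: hZ; rewrite invr_gt0 ltr0n.
  - by move=> w /= /negP; rewrite -leNgt.
apply: filterS => w h; apply/eqP; rewrite -normr_le0; apply/ler_addgt0Pr => e e0; rewrite add0r.
have [N _ /(_ N (leqnn N)) hN] := near_infty_natSinv_lt (PosNum e0).
by rewrite (le_trans (ltW (h N)))// ltW.
Qed.

End ZeroByMarkov.

(** * Density of exponentials *)

Lemma cvg_harmonic_bound {R : realType} (u : nat -> R) (a c : R) : 0 <= c ->
  (forall N, `|u N - a| <= c / N.+1%:R) -> u N @[N --> \oo] --> a.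
Proof.
move=> c0 h; apply/cvgrPdist_le => e e0; have e1 : 0 < e / (c + 1) by rewrite divr_gt0// ltr_wpDl.
near=> N; rewrite distrC (le_trans (h N))//.
have : N.+1%:R^-1 <= e / (c + 1).
  by apply/ltW; near: N; exact: (near_infty_natSinv_lt (PosNum e1)).
rewrite ler_pdivlMr ?ltr_wpDl// => h'; apply: le_trans h'.
by rewrite mulrC ler_wpM2l ?invr_ge0// lerDl.
Unshelve. all: by end_near. Qed.

Lemma limit_norm_le {R : realType} (u : nat -> R) (l b : R) :
  u k @[k --> \oo] --> l -> (forall k, `|u k| <= b) -> `|l| <= b.
Proof.
move=> /cvg_norm h ub; have <- : limn (fun k => `|u k|) = `|l| by exact: cvg_lim.
by apply: limr_le; [exact: cvgP h|exact: nearW].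
Qed.

Lemma sq_cvg_dominated {R : realType} d (X : measurableType d) (mu : {measure set X -> \bar R})
    (f_ : nat -> X -> R) (f g : X -> R) :
  (forall k, measurable_fun setT (f_ k)) -> measurable_fun setT f -> measurable_fun setT g ->
  (forall k w, `|f_ k w| <= g w) -> (sq_integral mu g < +oo)%E ->
  (\forall w \ae mu, f_ k w @[k --> \oo] --> f w) -> sq_cvg mu f_ f.
Proof.
move=> mf_ mf mg fg ig fcvg.
have m2 : measurable_fun setT (fun w => 2 * g w) by exact: measurable_funM.
have ig2 : mu.-integrable setT (fun w => ((2 * g w) ^+ 2)%:E).
  apply/integrableP; split; first by apply/measurable_EFinP; exact: measurable_funX.
  have -> : (\int[mu]_w `|((2 * g w) ^+ 2)%:E| = sq_integral mu (fun w => (2 * g w)%R))%E.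
    by apply: eq_integral => w _; rewrite gee0_abs// lee_fin sqr_ge0.
  by rewrite sq_integralZ// lte_mul_pinfty// lee_fin sqr_ge0.
have mk k : measurable_fun setT (fun w => ((f_ k w - f w) ^+ 2)%:E).
  by apply/measurable_EFinP; apply: measurable_funX; exact: measurable_funB.
have cv : \forall w \ae mu, setT w -> ((f_ k w - f w) ^+ 2)%:E @[k --> \oo] --> 0%E.
  apply: filterS fcvg => w h _; apply: cvg_EFin; first exact: nearW.
  have h2 : f_ k w - f w @[k --> \oo] --> 0.
    by rewrite -[X in _ --> X](subrr (f w)); apply: cvgB h _; exact: cvg_cst.
  have -> : fine \o (fun k => ((f_ k w - f w) ^+ 2)%:E) = fun k => (f_ k w - f w) * (f_ k w - f w).
    by apply/funext => k /=; rewrite expr2.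
  by rewrite -[X in _ --> X](mulr0 0); exact: cvgM.
have dom : \forall w \ae mu, forall k, setT w -> (`|((f_ k w - f w) ^+ 2)%:E| <= ((2 * g w) ^+ 2)%:E)%E.
  apply: filterS fcvg => w h k _; rewrite gee0_abs ?lee_fin ?sqr_ge0//.
  have gw : 0 <= g w by rewrite (le_trans _ (fg 0%N w)).
  have fw : `|f w| <= g w.
    exact: limit_norm_le h (fg ^~ w).
  rewrite -(real_normK (num_real (f_ k w - f w))) lerXn2r ?nnegrE ?mulr_ge0//.
  by rewrite (le_trans (ler_normB _ _))// mulr_natl mulr2n lerD.
by have [_ _] := dominated_convergence measurableT mk (measurable_cst 0%E) cv ig2 dom; rewrite integral0.
Qed.

(** * Power series of the exponential and the sine *)

Section ExponentialSeries.
Context {R : realType}.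
Implicit Types (x : R) (c : nat -> R).

(** Coefficients bounded by 1/k! give partial sums dominated by exp |x|; this treats the exponential
    and the sine at once. *)
Definition psum c (N : nat) x : R := \sum_(k < N) c k * x ^+ k.

Lemma psum_exp_coeff x : series (exp_coeff x) = (fun N => psum (fun k => k`!%:R^-1) N x).
Proof.
apply/funext => N; rewrite /psum /series /= big_mkord.
by apply: eq_bigr => k _; rewrite /exp_coeff /= mulrC.
Qed.

Lemma psum_expR x : psum (fun k => k`!%:R^-1) N x @[N --> \oo] --> expR x.
Proof.
rewrite expRE -psum_exp_coeff /pseries.
have -> : [series n0`!%:R^-1 * x ^+ n0]_n0 = series (exp_coeff x).
  by apply/funext => N; rewrite /series /=; apply: eq_bigr => k _; rewrite /exp_coeff /= mulrC.
exact: is_cvg_series_exp_coeff.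
Qed.

Lemma series_exp_le x N : series (exp_coeff `|x|) N <= expR `|x|.
Proof.
have := @psum_expR `|x|; rewrite -(psum_exp_coeff `|x|) => h.
have <- : limn (series (exp_coeff `|x|)) = expR `|x| by exact: cvg_lim.
apply: nondecreasing_cvgn_le; last exact: is_cvg_series_exp_coeff.
by apply: nondecreasing_series => k _ _; exact: exp_coeff_ge0.
Qed.

Lemma psum_le c N x : (forall k, `|c k| <= k`!%:R^-1) -> `|psum c N x| <= expR `|x|.
Proof.
move=> hc; apply: (@le_trans _ _ (series (exp_coeff `|x|) N)).
  rewrite /psum /series /= big_mkord (le_trans (ler_norm_sum _ _ _))//.
  by apply: ler_sum => k _; rewrite normrM normrX mulrC ler_wpM2l ?exprn_ge0.
exact: series_exp_le.
Qed.

(** The Taylor coefficients of the sine, not the cardinal sine. *)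
Definition sinc (k : nat) : R := (odd k)%:R * (-1) ^+ k.-1./2 / k`!%:R.

Lemma sinc_le k : `|sinc k| <= k`!%:R^-1.
Proof.
rewrite /sinc !normrM normrX normrN1 expr1n mulr1 normfV !normr_nat.
by case: odd; rewrite ?mul1r ?mul0r.
Qed.

Lemma psum_sin x : psum sinc N x @[N --> \oo] --> sin x.
Proof.
have -> : (fun N => psum sinc N x) = series (sin_coeff x).
  apply/funext => N; rewrite /psum /series /= big_mkord.
  by apply: eq_bigr => k _; rewrite /sin_coeff /sinc /=; ring.
by rewrite sin.unlock; exact: is_cvg_series_sin_coeff.
Qed.

Lemma expR_sub1_bounds x : 0 <= expR x - 1 - x <= x * (expR x - 1).
Proof.
apply/andP; split; first by rewrite -addrA -opprD subr_ge0 expR_ge1Dx.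
have := expR_ge1Dx (- x); rewrite expRN => h.
have e0 := expR_gt0 x.
have : expR x * (1 - x) <= expR x * (expR x)^-1 by rewrite ler_pM2l.
by rewrite divff ?gt_eqF// => ?; lra.
Qed.

Lemma norm_expR_sub1 x : `|expR x - 1| <= `|x| * expR `|x|.
Proof.
have /andP[h1 h2] := expR_sub1_bounds x.
have [x0|x0] := leP 0 x.
  rewrite [`|x|]ger0_norm// ger0_norm; last by lra.
  by move: (expR x) h2 => z; nra.
have e1 : expR x <= 1 by rewrite -[1]expR0 ler_expR ltW.
rewrite [`|x|]ltr0_norm// ler0_norm; last by lra.
have : 1 <= expR (- x) by rewrite -[1]expR0 ler_expR oppr_ge0 ltW.
by move: (expR (- x)) => z z1; nra.
Qed.

Lemma expR_diff_cvg x : k.+1%:R * (expR (k.+1%:R^-1 * x) - 1) @[k --> \oo] --> x.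
Proof.
apply: (@cvg_harmonic_bound _ _ _ (`|x| * (`|x| * expR `|x|))) => [|k].
  by rewrite !mulr_ge0 ?expR_ge0.
set y := _ * x; have k0 : (0 : R) < k.+1%:R by []. have kn := lt0r_neq0 k0.
have -> : k.+1%:R * (expR y - 1) - x = k.+1%:R * (expR y - 1 - y).
  by rewrite [RHS]mulrBr mulVKf.
have /andP[h1 h2] := expR_sub1_bounds y.
have yx : `|y| <= `|x|.
  rewrite /y normrM ger0_norm ?invr_ge0//; apply: ler_piMl => //.
  by rewrite invf_le1// ler1n.
rewrite ger0_norm ?mulr_ge0//.
have h3 : y * (expR y - 1) <= `|y| * (`|y| * expR `|x|).
  rewrite (le_trans (ler_norm _))// normrM ler_wpM2l// (le_trans (norm_expR_sub1 _))//.
  by rewrite ler_wpM2l// ler_expR.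
apply: (@le_trans _ _ (k.+1%:R * (`|y| * (`|y| * expR `|x|)))).
  by rewrite ler_pM2l// (le_trans h2).
rewrite /y !normrM [`|_^-1|]ger0_norm ?invr_ge0//.
by rewrite le_eqVlt; apply/orP; left; apply/eqP; field; rewrite addrC natr1 pnatr_eq0.
Qed.

Lemma norm_sin_sub x : `|sin x - x| <= x ^+ 2 * expR `|x|.
Proof.
have h : psum sinc (N + 2) x - x @[N --> \oo] --> sin x - x.
  by apply: cvgB; [rewrite (cvg_shiftn 2 (fun N => psum sinc N x)); exact: psum_sin|exact: cvg_cst].
apply: limit_norm_le h _ => N.
rewrite addn2 /psum !big_ord_recl.
have -> : sinc (@ord0 N.+1) = 0 by rewrite /sinc /= !mul0r.
have -> : sinc (lift ord0 (@ord0 N)) = 1 by rewrite /sinc /= expr0 invr1 !mul1r.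
rewrite mul0r add0r mul1r expr1 addrC addKr.
apply: (@le_trans _ _ (x ^+ 2 * series (exp_coeff `|x|) N)).
  rewrite /series /= big_mkord mulr_sumr (le_trans (ler_norm_sum _ _ _))//.
  apply: ler_sum => k _; rewrite normrM.
  have /(le_trans (sinc_le k.+2)) h1 : k.+2`!%:R^-1 <= k`!%:R^-1 :> R.
    by rewrite lef_pV2 ?posrE ?ltr0n ?fact_gt0// ler_nat !factS mulnA leq_pmull.
  have -> : x ^+ 2 * exp_coeff `|x| k = k`!%:R^-1 * `|x ^+ k.+2|.
    have -> : `|x ^+ k.+2| = `|x| ^+ k * x ^+ 2.
      by rewrite normrX -(addn2 k) exprD (real_normK (num_real x)).
    by rewrite /exp_coeff /=; ring.
  by rewrite ler_wpM2r.
by rewrite ler_wpM2l ?sqr_ge0// series_exp_le.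
Qed.

(** Makes k sin(x / k) a bounded substitute for x, with an error that is uniform where x is
    bounded. *)
Lemma sin_scale_bound x k : `|k.+1%:R * sin (k.+1%:R^-1 * x) - x| <= x ^+ 2 * expR `|x| / k.+1%:R.
Proof.
have k0 : (0 : R) < k.+1%:R by []. have kn := lt0r_neq0 k0.
have -> : k.+1%:R * sin (k.+1%:R^-1 * x) - x = k.+1%:R * (sin (k.+1%:R^-1 * x) - k.+1%:R^-1 * x).
  by rewrite [RHS]mulrBr mulVKf.
have h := norm_sin_sub (k.+1%:R^-1 * x).
have yx : `|k.+1%:R^-1 * x| <= `|x|.
  rewrite normrM ger0_norm ?invr_ge0//; apply: ler_piMl => //.
  by rewrite invf_le1// ler1n.
rewrite normrM ger0_norm//.
apply: (@le_trans _ _ (k.+1%:R * ((k.+1%:R^-1 * x) ^+ 2 * expR `|x|))).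
  rewrite ler_pM2l// (le_trans h)// ler_wpM2l ?sqr_ge0//.
  by rewrite ler_expR.
by rewrite le_eqVlt; apply/orP; left; apply/eqP; field; rewrite addrC natr1 pnatr_eq0.
Qed.

Lemma sin_scale_cvg x : k.+1%:R * sin (k.+1%:R^-1 * x) @[k --> \oo] --> x.
Proof.
apply: (@cvg_harmonic_bound _ _ _ (x ^+ 2 * expR `|x|)) => [|k]; last exact: sin_scale_bound.
by rewrite mulr_ge0 ?sqr_ge0 ?expR_ge0.
Qed.

End ExponentialSeries.

Record closed_subspace {R : realType} d {X : measurableType d} (mu : probability X R)
    (U : (X -> R) -> Prop) : Prop := ClosedSubspace {
  cs_measurable : forall f, U f -> measurable_fun setT f;
  cs_lin : forall a f g, U f -> U g -> U (fun w => a * f w + g w);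
  cs_lim : forall (f_ : nat -> X -> R) f, (forall k, U (f_ k)) ->
    measurable_fun setT f -> sq_cvg mu f_ f -> U f }.

Section ExponentialDensity.
Context {R : realType} d {X : measurableType d} (mu : probability X R).
Variables (L : (X -> R) -> Prop).
Hypothesis L_meas : forall f, L f -> measurable_fun setT f.
Hypothesis L_zero : L (fun=> 0).
Hypothesis L_lin : forall a f g, L f -> L g -> L (fun w => a * f w + g w).
Hypothesis L_fin : forall f, L f -> (sq_integral mu (fun w => expR (f w)) < +oo)%E.

(* The smallest closed subspace containing the exponentials, as an intersection:
   this gives the induction principle used for products of multipliers. *)
Definition exp_closure (f : X -> R) : Prop := forall U, closed_subspace mu U ->
  (forall g, L g -> U (fun w => expR (g w))) -> U f.

Local Notation V := exp_closure.

Let mexp f : L f -> measurable_fun setT (fun w => expR (f w)).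
Proof. by move=> Lf; apply: measurableT_comp => //; exact: L_meas. Qed.

Let measurable_subspace : closed_subspace mu (fun f : X -> R => measurable_fun setT f).
Proof.
split => // a f g mf mg; apply: measurable_funD => //; exact: measurable_funM.
Qed.

Let L_exp f : L f -> V (fun w => expR (f w)).
Proof. by move=> Lf U _; apply. Qed.

Lemma closed_exp_closure : closed_subspace mu V.
Proof.
split=> [f Vf|a f g Vf Vg U cU UL|f_ f Vf_ mf fcvg U cU UL].
- by apply: Vf measurable_subspace _ => g; exact: mexp.
- by apply: (cs_lin cU); [exact: Vf|exact: Vg].
- by apply: (cs_lim cU _ mf fcvg) => k; exact: Vf_.
Qed.

Let VmP := cs_measurable closed_exp_closure.
Let V_lin := cs_lin closed_exp_closure.
Let V_lim := cs_lim closed_exp_closure.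

Let L_scale a f : L f -> L (fun w => a * f w).
Proof. by move=> Lf; have := L_lin a Lf L_zero; under eq_fun do rewrite addr0. Qed.

Let V_zero : V (fun=> 0).
Proof.
have := V_lin (-1) (L_exp L_zero) (L_exp L_zero).
by under eq_fun do rewrite expR0 mulr1 addNr.
Qed.

Let V_scale a f : V f -> V (fun w => a * f w).
Proof. by move=> Vf; have := V_lin a Vf V_zero; under eq_fun do rewrite addr0. Qed.

Let V_sum (N : nat) (f : nat -> X -> R) : (forall k, V (f k)) -> V (fun w => \sum_(k < N) f k w).
Proof.
move=> Vf; elim: N => [|N IH]; first by under eq_fun do rewrite big_ord0.
under eq_fun do rewrite big_ord_recr/= addrC.
by have := V_lin 1 (Vf N) IH; under eq_fun do rewrite mul1r.
Qed.

(** This is 2 cosh(cf) exp(g): it dominates exp(c|f|) exp(g), and as a sum of two exponentials of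
    [L] it is square integrable. *)
Let Hyp (c : R) (f g : X -> R) (w : X) : R := expR (c * f w + g w) + expR (- c * f w + g w).

Let Hyp_fin c f g : L f -> L g -> (sq_integral mu (Hyp c f g) < +oo)%E.
Proof.
move=> Lf Lg; have h1 := L_lin c Lf Lg; have h2 := L_lin (- c) Lf Lg.
apply: le_lt_trans (sq_integralD _ (mexp h1) (mexp h2)) _.
by apply: lte_add_pinfty; rewrite lte_mul_pinfty// L_fin.
Qed.

Let measurable_Hyp c f g : L f -> L g -> measurable_fun setT (Hyp c f g).
Proof. by move=> Lf Lg; apply: measurable_funD; apply: mexp; exact: L_lin. Qed.

Let Hyp_le (c : R) f g w : 0 <= c -> expR (c * `|f w|) * expR (g w) <= Hyp c f g w.
Proof.
move=> c0; rewrite /Hyp -expRD; have [f0|f0] := leP 0 (f w).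
  by rewrite (ger0_norm f0) lerDl expR_ge0.
by rewrite (ltr0_norm f0) mulrN -mulNr lerDr expR_ge0.
Qed.

(** Differentiation of exp(sf + g) in s at 0: f^(j+1) exp(g) is the L^2 limit of the difference
    quotients k (f^j exp(f/k + g) - f^j exp(g)), which lie in the closed span by induction. *)
Let V_moment j f g : L f -> L g -> V (fun w => f w ^+ j * expR (g w)).
Proof.
elim: j f g => [|j IH] f g Lf Lg.
  by under eq_fun do rewrite expr0 mul1r; exact: L_exp.
have mf := L_meas Lf; have mg := L_meas Lg.
pose F k (w : X) := k.+1%:R * (f w ^+ j * expR (k.+1%:R^-1 * f w + g w)) +
  (- k.+1%:R) * (f w ^+ j * expR (g w)).
have FE k w : F k w = f w ^+ j * expR (g w) * (k.+1%:R * (expR (k.+1%:R^-1 * f w) - 1)).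
  by rewrite /F expRD; ring.
have VF k : V (F k).
  by apply: V_lin; [apply: IH => //; exact: L_lin|apply: V_scale; exact: IH].
apply: (V_lim VF).
  by apply: measurable_funM; [exact: measurable_funX|exact: mexp].
(* The power |f|^j costs exp(j|f|), and the difference quotient is at most |f| exp|f| <=
   exp(2|f|). *)
apply: (@sq_cvg_dominated _ _ _ _ _ _ (Hyp j.+2%:R f g)).
- by move=> k; exact: VmP.
- by apply: measurable_funM; [exact: measurable_funX|exact: mexp].
- exact: measurable_Hyp.
- move=> k w; rewrite FE; apply: le_trans (Hyp_le _ _ _ (ler0n _ _)).
  have -> : expR (j.+2%:R * `|f w|) * expR (g w) =
      expR `|f w| ^+ j * expR (g w) * (expR `|f w| * expR `|f w|).
    by rewrite expRM_natl -(addn2 j) exprD expr2; ring.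
  rewrite !normrM normrX [`|expR (g w)|]ger0_norm ?expR_ge0//.
  have fe : `|f w| <= expR `|f w| by apply: le_trans (expR_ge1Dx _); rewrite lerDr.
  apply: ler_pM; rewrite ?mulr_ge0 ?exprn_ge0 ?expR_ge0//.
    by rewrite ler_wpM2r ?expR_ge0// lerXn2r ?nnegrE ?expR_ge0.
  rewrite [`|k.+1%:R|]ger0_norm//.
  have k0 : (0 : R) < k.+1%:R by [].
  apply: (@le_trans _ _ (k.+1%:R * (k.+1%:R^-1 * `|f w| * expR `|f w|))).
    rewrite ler_pM2l//; apply: (le_trans (norm_expR_sub1 _)).
    rewrite normrM ger0_norm ?invr_ge0// ler_wpM2l ?mulr_ge0 ?invr_ge0//.
    by rewrite ler_expR; apply: ler_piMl => //; rewrite invf_le1// ler1n.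
  rewrite mulrA mulVKf ?lt0r_neq0//.
  by rewrite ler_wpM2r ?expR_ge0.
- exact: Hyp_fin.
- apply: aeW => w; under eq_fun do rewrite FE.
  have -> : f w ^+ j.+1 * expR (g w) = f w ^+ j * expR (g w) * f w by rewrite exprSr; ring.
  by apply: cvgMr; exact: expR_diff_cvg.
Qed.

Let msin (f : X -> R) : measurable_fun setT f -> measurable_fun setT (fun w => sin (f w)).
Proof.
move=> mf; apply: measurableT_comp mf; apply: continuous_measurable_fun.
exact: continuous_sin.
Qed.

Let V_sin f g : L f -> L g -> V (fun w => sin (f w) * expR (g w)).
Proof.
move=> Lf Lg; have mf := L_meas Lf; have mg := L_meas Lg.
pose F N (w : X) := \sum_(k < N) sinc k * (f w ^+ k * expR (g w)).
have FE N w : F N w = psum sinc N (f w) * expR (g w).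
  by rewrite /F /psum mulr_suml; apply: eq_bigr => k _; rewrite mulrA.
have VF N : V (F N).
  apply: (@V_sum N (fun k w => sinc k * (f w ^+ k * expR (g w)))) => k.
  by apply: V_scale; exact: V_moment.
have mse : measurable_fun setT (fun w => sin (f w) * expR (g w)).
  by apply: measurable_funM; [exact: msin|exact: mexp].
apply: (V_lim VF mse).
apply: (@sq_cvg_dominated _ _ _ _ _ _ (Hyp 1 f g)) => //.
- by move=> k; exact: VmP.
- exact: measurable_Hyp.
- move=> k w; rewrite FE; apply: le_trans (Hyp_le _ _ _ ler01).
  rewrite mul1r normrM [`|expR _|]ger0_norm ?expR_ge0// ler_wpM2r ?expR_ge0//.
  by apply: psum_le => m; exact: sinc_le.
- exact: Hyp_fin.
- by apply: aeW => w; under eq_fun do rewrite FE; apply: cvgMl; exact: psum_sin.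
Qed.

Definition multiplier (Y : X -> R) : Prop :=
  bounded_measurable Y /\ forall f, L f -> V (fun w => Y w * expR (f w)).

Lemma multiplier_V Y : multiplier Y -> V Y.
Proof. by move=> [_ /(_ _ L_zero)]; under eq_fun do rewrite expR0 mulr1. Qed.

Lemma multiplier_lin a Y Z : multiplier Y -> multiplier Z -> multiplier (fun w => a * Y w + Z w).
Proof.
move=> [bY hY] [bZ hZ]; split; first by apply: bmD => //; exact: bmZ.
move=> f Lf; have := V_lin a (hY f Lf) (hZ f Lf).
by under eq_fun do rewrite mulrA -mulrDl.
Qed.

Lemma multiplier_cst c : multiplier (fun=> c).
Proof.
split; first exact: bm_cst.
by move=> f Lf; apply: V_scale; exact: L_exp.
Qed.

Lemma multiplier_scale c Y : multiplier Y -> multiplier (fun w => c * Y w).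
Proof.
move=> hY; have := multiplier_lin c hY (multiplier_cst 0).
by under eq_fun do rewrite addr0.
Qed.

Lemma multiplier_lim (Y_ : nat -> X -> R) Y K : (forall k, multiplier (Y_ k)) ->
  (forall k w, `|Y_ k w| <= K) -> bounded_measurable Y ->
  (\forall w \ae mu, Y_ k w @[k --> \oo] --> Y w) -> multiplier Y.
Proof.
move=> hY YK bY Ycvg; split => // f Lf; have mf := L_meas Lf.
have mYe : measurable_fun setT (fun w => Y w * expR (f w)).
  by apply: measurable_funM; [case: bY|exact: mexp].
apply: (V_lim (fun k => (hY k).2 f Lf) mYe).
apply: (@sq_cvg_dominated _ _ _ _ _ _ (fun w => K * expR (f w))) => //.
- by move=> k; apply: VmP; exact: (hY k).2.
- by apply: measurable_funM => //; exact: mexp.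
- by move=> k w; rewrite normrM [`|expR _|]ger0_norm ?expR_ge0// ler_wpM2r ?expR_ge0.
- by rewrite sq_integralZ ?lte_mul_pinfty ?L_fin ?lee_fin ?sqr_ge0//; exact: mexp.
- by apply: filterS Ycvg => w h; exact: cvgMl.
Qed.

(** The f in the closed span with Yf in the closed span form a closed subspace, since Y is bounded;
    it contains the exponentials, so it is everything. This is what makes multipliers stable under
    products. *)
Let multiplier_mulV Y f : multiplier Y -> V f -> V (fun w => Y w * f w).
Proof.
move=> [bY hY] Vf; have [mY [K YK]] := bY.
suff : V f /\ V (fun w => Y w * f w) by case.
apply: (Vf (fun f => V f /\ V (fun w => Y w * f w))) => [|g Lg]; last first.
  by split; [exact: L_exp|exact: hY].
split=> [g [Vg _]|a g h [Vg VYg] [Vh VYh]|f_ g Vf_ mg fcvg]; first exact: VmP.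
  split; first exact: V_lin.
  have := V_lin a VYg VYh; congr V; apply/funext => w; ring.
split; first by apply: (V_lim _ mg fcvg) => k; exact: (Vf_ k).1.
have mf_ k := VmP (Vf_ k).1.
apply: (V_lim (fun k => (Vf_ k).2)); first exact: measurable_funM.
have K0 (w : X) : 0 <= K by rewrite (le_trans _ (YK w)).
apply: (@sq_cvg_squeeze _ _ _ _ _ _ (fun k => ((K ^+ 2)%R%:E * sq_integral mu (fun w => (f_ k w - g w)%R))%E)).
  move=> k; rewrite -sq_integralZ; last exact: measurable_funB.
  apply: le_sq_integral => [||w].
  - by apply: measurable_funB; exact: measurable_funM.
  - by apply: measurable_funM => //; exact: measurable_funB.
  by rewrite -mulrBr !normrM (ger0_norm (K0 w)) ler_wpM2r.
by rewrite -[X in _ --> X](mule0 (K ^+ 2)%:E); apply: cvgeZl.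
Qed.

Lemma multiplierM Y Z : multiplier Y -> multiplier Z -> multiplier (fun w => Y w * Z w).
Proof.
move=> hY [bZ hZ]; split; first exact: bmM hY.1 bZ.
move=> f Lf; have := multiplier_mulV hY (hZ f Lf).
by under eq_fun do rewrite mulrA.
Qed.

Lemma multiplier_psum c N Y : multiplier Y -> multiplier (fun w => psum c N (Y w)).
Proof.
move=> hY; have hX k : multiplier (fun w => Y w ^+ k).
  elim: k => [|k IH]; first by under eq_fun do rewrite expr0; exact: multiplier_cst.
  by under eq_fun do rewrite exprS; exact: multiplierM.
rewrite /psum; elim: N => [|N IH].
  by under eq_fun do rewrite big_ord0; exact: multiplier_cst.
by under eq_fun do rewrite big_ord_recr/= addrC; exact: multiplier_lin.
Qed.

Let multiplier_series c (phi : R -> R) Y : (forall k, `|c k| <= k`!%:R^-1) ->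
  (forall x, psum c N x @[N --> \oo] --> phi x) -> measurable_fun setT phi ->
  multiplier Y -> multiplier (fun w => phi (Y w)).
Proof.
move=> hc hphi mphi hY; have [[mY [K YK]] _] := hY.
have pK N w : `|psum c N (Y w)| <= expR K.
  by apply: le_trans (psum_le _ _ hc) _; rewrite ler_expR.
apply: (multiplier_lim (fun N => multiplier_psum c N hY) pK).
  split; first exact: measurableT_comp mphi mY.
  by exists (expR K) => w; exact: limit_norm_le (hphi (Y w)) (pK ^~ w).
by apply: aeW => w; exact: hphi.
Qed.

Lemma multiplier_sin Y : multiplier Y -> multiplier (fun w => sin (Y w)).
Proof.
apply: multiplier_series sinc_le psum_sin _.
by apply: continuous_measurable_fun; exact: continuous_sin.
Qed.

Lemma multiplier_expR Y : multiplier Y -> multiplier (fun w => expR (Y w)).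
Proof.
apply: (multiplier_series _ psum_expR) => // k.
by rewrite ger0_norm// invr_ge0.
Qed.

Definition sin_multiplier (Y : X -> R) : Prop :=
  measurable_fun setT Y /\ forall c, multiplier (fun w => sin (c * Y w)).

Lemma multiplier_sin_multiplier Y : multiplier Y -> sin_multiplier Y.
Proof.
move=> hY; split; first by case: hY => -[].
by move=> c; apply: multiplier_sin; exact: multiplier_scale.
Qed.

Let bm_sin (f : X -> R) : measurable_fun setT f -> bounded_measurable (fun w => sin (f w)).
Proof. by move=> mf; split; [exact: msin|exists 1 => w; exact: sin_max]. Qed.

Lemma sin_multiplier_L f : L f -> sin_multiplier f.
Proof.
move=> Lf; split; first exact: L_meas.
move=> c; have Lc := L_scale c Lf; split; first exact/bm_sin/L_meas.
by move=> g Lg; exact: V_sin.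
Qed.

(** The sines are bounded by 1, so almost sure convergence suffices and no integrability of Y
    enters. *)
Lemma sin_multiplier_ae_lim (Y_ : nat -> X -> R) (Y : X -> R) : (forall k, sin_multiplier (Y_ k)) ->
  measurable_fun setT Y -> (\forall w \ae mu, Y_ k w @[k --> \oo] --> Y w) -> sin_multiplier Y.
Proof.
move=> hY mY Ycvg; split => // c.
apply: (@multiplier_lim (fun k w => sin (c * Y_ k w)) _ 1) => [k|k w||].
- exact: (hY k).2.
- exact: sin_max.
- by apply: bm_sin; exact: measurable_funM.
- apply: filterS Ycvg => w h.
  have h2 : c * Y_ k w @[k --> \oo] --> c * Y w by exact: cvgMr.
  exact: cvg_comp h2 (@continuous_sin R (c * Y w)).
Qed.

Let multiplier_scaled_sin Y k : sin_multiplier Y -> multiplier (fun w => k.+1%:R * sin (k.+1%:R^-1 * Y w)).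
Proof. by move=> [_ hY]; exact: multiplier_scale. Qed.

(** YZ is the limit of the products of k sin(Y / k) and k sin(Z / k), which are bounded
    multipliers. *)
Lemma sin_multiplierM Y Z : sin_multiplier Y -> sin_multiplier Z -> sin_multiplier (fun w => Y w * Z w).
Proof.
move=> hY hZ.
apply: (@sin_multiplier_ae_lim (fun k w => (k.+1%:R * sin (k.+1%:R^-1 * Y w)) * (k.+1%:R * sin (k.+1%:R^-1 * Z w)))).
- by move=> k; apply: multiplier_sin_multiplier; apply: multiplierM; exact: multiplier_scaled_sin.
- by apply: measurable_funM; [exact: hY.1|exact: hZ.1].
- by apply: aeW => w; apply: cvgM; exact: sin_scale_cvg.
Qed.

Lemma sin_multiplier_lin a Y Z : sin_multiplier Y -> sin_multiplier Z ->
  sin_multiplier (fun w => a * Y w + Z w).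
Proof.
move=> hY hZ.
apply: (@sin_multiplier_ae_lim (fun k w => a * (k.+1%:R * sin (k.+1%:R^-1 * Y w)) + k.+1%:R * sin (k.+1%:R^-1 * Z w))).
- by move=> k; apply: multiplier_sin_multiplier; apply: multiplier_lin; exact: multiplier_scaled_sin.
- by apply: measurable_funD; [apply: measurable_funM => //; exact: hY.1|exact: hZ.1].
- by apply: aeW => w; apply: cvgD; [apply: cvgMr|]; exact: sin_scale_cvg.
Qed.

Lemma bounded_sin_multiplier Y K : sin_multiplier Y -> (forall w, `|Y w| <= K) -> multiplier Y.
Proof.
move=> hY YK; apply: (@multiplier_lim (fun k w => k.+1%:R * sin (k.+1%:R^-1 * Y w)) _ (K + K ^+ 2 * expR K)).
- by move=> k; exact: multiplier_scaled_sin.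
- move=> k w; rewrite -[_ * sin _](subrK (Y w)) (le_trans (ler_normD _ _))// addrC lerD//.
  apply: (le_trans (sin_scale_bound _ _)).
  apply: (@le_trans _ _ (Y w ^+ 2 * expR `|Y w|)).
    apply: ler_piMr; first by rewrite mulr_ge0 ?sqr_ge0 ?expR_ge0.
    by rewrite invf_le1 ?ltr0n// ler1n.
  rewrite -(real_normK (num_real (Y w))) ler_pM ?sqr_ge0 ?expR_ge0 ?ler_expR//.
  by rewrite lerXn2r ?nnegrE ?(le_trans _ (YK w)).
- by split; [exact: hY.1|exists K].
- by apply: aeW => w; exact: sin_scale_cvg.
Qed.

Let expR_neg_le (x : R) : 0 < x -> expR (- x) <= x^-1.
Proof.
move=> x0; rewrite expRN lef_pV2 ?posrE ?expR_gt0//.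
by rewrite (le_trans _ (expR_ge1Dx x))// lerDr.
Qed.

(** The indicator is the limit of exp(-k exp(-k(Y - a))): the inner exponential tends to 0 fast
    enough where Y > a and is at least 1 where Y <= a, so that the limit at Y = a is 0, as the
    strict inequality requires. *)
Lemma multiplier_gt Y (a : R) : multiplier Y -> multiplier (\1_[set w | a < Y w] : X -> R).
Proof.
move=> hY.
pose F k (w : X) := expR (- k.+1%:R * expR (- k.+1%:R * (Y w - a))).
have hB : multiplier (fun w => Y w - a).
  by have := multiplier_lin 1 hY (multiplier_cst (- a)); under eq_fun do rewrite mul1r.
have F01 k w : F k w <= 1.
  by rewrite -expR0 ler_expR mulNr oppr_le0 mulr_ge0 ?expR_ge0.
apply: (@multiplier_lim F _ 1) => [k|k w||].
- by apply/multiplier_expR/multiplier_scale/multiplier_expR/multiplier_scale.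
- by rewrite ger0_norm ?expR_ge0.
- apply: bm_indic.
  rewrite (_ : [set w | a < Y w] = setT `&` Y @^-1` `]a, +oo[%classic); first exact: hY.1.1.
  by rewrite setTI; apply/seteqP; split => w /=; rewrite in_itv/= andbT.
apply: aeW => w; have [aY|Ya] := ltP a (Y w).
  rewrite indicE mem_set// (_ : true%:R = 1 :> R)//.
  have y0 : 0 < Y w - a by rewrite subr_gt0.
  (* With x = Y - a, the bound exp(-u) <= 1/u at u = kx/2, squared, gives k exp(-kx) <= 4 / (k
     x^2). *)
  apply: (@cvg_harmonic_bound _ _ _ (4 / (Y w - a) ^+ 2)) => [|k]; first by rewrite divr_ge0 ?sqr_ge0.
  have k0 : (0 : R) < k.+1%:R by [].
  set x := Y w - a in y0 *; set y := k.+1%:R * expR (- k.+1%:R * x).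
  have -> : F k w = expR (- y) by rewrite /F mulNr.
  rewrite distrC ger0_norm; last by rewrite subr_ge0 /y -mulNr; exact: F01.
  apply: (@le_trans _ _ y); first by have := expR_ge1Dx (- y) => ?; lra.
  have h0 : 0 < k.+1%:R * x / 2 by rewrite divr_gt0// mulr_gt0.
  have h := expR_neg_le h0.
  have -> : y = k.+1%:R * (expR (- (k.+1%:R * x / 2)) * expR (- (k.+1%:R * x / 2))).
    by rewrite /y -expRD; congr (_ * expR _); field.
  have -> : 4 / x ^+ 2 / k.+1%:R = k.+1%:R * ((k.+1%:R * x / 2)^-1 * (k.+1%:R * x / 2)^-1).
    by field; rewrite (lt0r_neq0 y0) addrC natr1 pnatr_eq0.
  by rewrite ler_pM2l// ler_pM ?expR_ge0.
rewrite indicE memNset/=; last by apply/negP; rewrite -leNgt.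
apply: (@cvg_harmonic_bound _ _ _ 1) => // k.
rewrite subr0 ger0_norm ?expR_ge0// mul1r.
apply: le_trans (expR_neg_le (ltr0Sn _ _)).
rewrite ler_expR mulNr lerN2 ler_peMr// -expR0 ler_expR mulNr oppr_ge0.
by rewrite pmulr_rle0// subr_le0.
Qed.

(** Products and linear combinations give complements and finite unions, and bounded limits give
    countable unions. *)
Lemma multiplier_generated (Gen : set (set X)) :
  (forall A, Gen A -> measurable A) -> (forall A, Gen A -> multiplier (\1_A : X -> R)) ->
  forall A, <<s Gen >> A -> multiplier (\1_A : X -> R).
Proof.
move=> mG hG A GA.
suff sA : sigma_algebra setT [set B : set X | measurable B /\ multiplier (\1_B : X -> R)].
  by have [] : [set B : set X | measurable B /\ multiplier (\1_B : X -> R)] A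
    by apply: (smallest_sub sA _ GA) => B GB; split; [exact: mG|exact: hG].
have hU B1 B2 : multiplier (\1_B1 : X -> R) -> multiplier (\1_B2 : X -> R) -> multiplier (\1_(B1 `|` B2) : X -> R).
  move=> hA hB; have := multiplier_lin (-1) (multiplierM hA hB) (multiplier_lin 1 hA hB).
  congr multiplier; apply/funext => w; rewrite !indicE in_setU.
  by case: (w \in B1); case: (w \in B2) => /=; ring.
split=> [|B [mB hB]|B hB].
- split => //; have -> : (\1_set0 : X -> R) = fun=> 0 by apply/funext => w; rewrite indic0.
  exact: multiplier_cst.
- split; first exact: measurableD.
  have := multiplier_lin (-1) hB (multiplier_cst 1).
  congr multiplier; apply/funext => w; rewrite !indicE in_setD in_setT.
  by case: (w \in B) => /=; ring.
split; first by apply: bigcup_measurable => k _; exact: (hB k).1.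
pose C k := \bigcup_(i in `I_k) B i.
have hC k : multiplier (\1_(C k) : X -> R).
  elim: k => [|k IH].
    have -> : (\1_(C 0%N) : X -> R) = fun=> 0; last exact: multiplier_cst.
    by apply/funext => w; rewrite /C II0 bigcup_set0 indic0.
  have -> : C k.+1 = C k `|` B k; last by apply: hU => //; exact: (hB k).2.
  by rewrite /C IIS bigcup_setU bigcup_set1.
apply: (@multiplier_lim (fun k => \1_(C k) : X -> R) _ 1) => [//|k w||].
- by rewrite indicE; case: (w \in _); rewrite ?normr1 ?normr0.
- by apply: bm_indic; apply: bigcup_measurable => k _; exact: (hB k).1.
apply: aeW => w; have [[i _ Bi]|nB] := pselect ((\bigcup_k B k) w).
  rewrite indicE mem_set; last by exists i.
  apply: cvg_near_cst; near=> k.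
  rewrite indicE mem_set//; exists i => //=.
  by near: k; exact: nbhs_infty_gt.
rewrite indicE memNset//.
apply: cvg_near_cst; apply: nearW => k.
by rewrite indicE memNset// => -[i _ Bi]; apply: nB; exists i.
Unshelve. all: by end_near. Qed.

(** By the monotone class argument every bounded measurable function is a multiplier, hence lies in
    the closed span; a square integrable f is the L^2 limit of its truncations to |f| <= k. *)
Lemma dense_of_multipliers : (forall A, measurable A -> multiplier (\1_A : X -> R)) ->
  forall f : X -> R, measurable_fun setT f -> (sq_integral mu f < +oo)%E -> V f.
Proof.
move=> hA; have hb Y : bounded_measurable Y -> multiplier Y.
  apply: bounded_measurable_class => // [a Y1 Y2|Y_ Y1 K hY bY YK Ycvg bY1].
    exact: multiplier_lin.
  by apply: (multiplier_lim hY YK bY1); exact: aeW.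
move=> f mf ff.
pose f_ (k : nat) w := f w * \1_[set w | `|f w| <= k%:R] w.
have mn : measurable_fun setT (fun w => `|f w|) by exact: measurableT_comp.
have mI k : measurable [set w | `|f w| <= k%:R].
  rewrite (_ : [set _ | _] = setT `&` (fun w => `|f w|) @^-1` `]-oo, k%:R]%classic); first exact: mn.
  by rewrite setTI; apply/seteqP; split => w /=; rewrite in_itv.
have bf k : bounded_measurable (f_ k).
  split; first by apply: measurable_funM => //; exact: measurable_indic.
  exists k%:R => w; rewrite /f_ indicE.
  by have [h|h] := boolP (w \in _); rewrite ?mulr1 ?mulr0 ?normr0//; rewrite inE in h.
apply: (V_lim (fun k => multiplier_V (hb _ (bf k))) mf).
apply: (@sq_cvg_dominated _ _ _ _ _ _ (fun w => `|f w|)) => //.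
- by move=> k; case: (bf k).
- by move=> k w; rewrite /f_ indicE; case: (w \in _); rewrite ?mulr1 ?mulr0 ?normr0.
- by rewrite (@eq_sq_integral _ _ _ _ _ f)// => w; rewrite real_normK ?num_real.
apply: aeW => w; apply: cvg_near_cst; near=> k.
rewrite /f_ indicE mem_set ?mulr1//=.
by near: k; apply: nbhs_infty_ger.
Unshelve. all: by end_near. Qed.

End ExponentialDensity.

(** * The Borel sets of Wiener space *)

Section UniformContinuity.
Context {R : realType} {n : nat}.

Lemma within_uniform_continuous (f : R -> 'M[R]_n) (a b e : R) : 0 < e ->
  {within `[a, b], continuous f} -> exists2 delta : R, 0 < delta &
    forall s t, a <= s <= b -> a <= t <= b -> `|s - t| <= delta -> `|f s - f t| < e.
Proof.
move=> e0 /subspace_continuousP fc.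
have e2 : 0 < e / 2 by exact: divr_gt0.
have cK : compact (`[a, b]%classic : set R) by exact: segment_compact.
have : near_covering (`[a, b]%classic : set R) by exact/compact_near_coveringP.
move=> /(_ _ (0^'+ : set_system R) (fun delta s => a <= s <= b -> forall t, a <= t <= b ->
   `|s - t| <= delta -> `|f s - f t| < e)) [].
  move=> x xab.
  have /cvgrPdist_lt /(_ _ e2) := fc _ xab.
  move=> /nbhs_ballP[r /= r0 hr].
  have r2 : 0 < r / 2 by exact: divr_gt0.
  exists (ball x (r / 2), [set delta | delta < r / 2]) => /=.
    split; first exact: nbhsx_ballx.
    exact: nbhs_right_lt.
  move=> [s delta] /= [xs dr] sab t tab st.
  have h1 : `|f x - f s| < e / 2.
    apply: hr; last by rewrite /= in_itv.
    by apply: lt_trans xs _; lra.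
  have h2 : `|f x - f t| < e / 2.
    apply: hr; last by rewrite /= in_itv.
    rewrite /ball/= -(subrK s x) -addrA (le_lt_trans (ler_normD _ _))//.
    by move: xs; rewrite /ball/= => xs; lra.
  have -> : f s - f t = (f x - f t) - (f x - f s) by rewrite opprB [RHS]addrC addrA subrK.
  by rewrite (le_lt_trans (ler_normB _ _))//; lra.
move=> r /= r0 hr; exists (r / 2); first exact: divr_gt0.
have r2 : 0 < r / 2 by exact: divr_gt0.
have rr : `|0 - r / 2| < r by rewrite sub0r normrN ger0_norm ?(ltW r2)// ltr_pdivrMr// ltr_pMr// ltr1n.
by move=> s t sab; exact: (hr _ rr r2 s _ sab).
Qed.

End UniformContinuity.

Section WienerGenerated.
Context {R : realType} {n : nat} {G : compact_connected_lie_group R n} {T : R}.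
Hypothesis T0 : 0 < T.
Local Notation WS := (wiener_space G T).

Definition path_events : set (set WS) :=
  [set B | exists t i j a, B = [set w : WS | a < path_at t w i j]].

Local Notation Y := (g_sigma_algebraType path_events).

Let measurable_entry_events t i j : measurable_fun setT (fun w : Y => path_at t w i j).
Proof.
apply: (measurability _ (RGenOInfty.measurableE R)) => _ [_ [a ->] <-].
apply: sub_sigma_algebra; exists t, i, j, a.
by apply/seteqP; split => w; rewrite /= in_itv/= andbT; [case|].
Qed.

Let path_cts (w : WS) : {within `[0, T], continuous (path_at ^~ w)}.
Proof. by case: w => w pw; have [] := set_mem pw. Qed.

Let open_ball_path (U : set WS) (w0 : WS) : open U -> U w0 ->
  exists2 e : R, 0 < e & forall w : WS,
    (forall t, 0 <= t <= T -> `|path_at t w0 - path_at t w| < e) -> U w.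
Proof.
case=> O oO <- /= Ow0.
have /uniform_nbhs[D [eD DO]] : nbhs (set_val w0) O by exact: open_nbhs_nbhs.
move: eD; rewrite -entourage_ballE => -[e /= e0 eD].
exists e => // w hw; apply: DO => t /=; rewrite in_itv/= => tT.
by apply: eD => /=; rewrite -ball_normE /=; exact: hw.
Qed.

(** The point at the fraction p/(P+1) of the cell k among N+1 equal cells of [0, T]. Such points are
    countable and dense, so the oscillation of a continuous path on a cell is controlled by
    countably many measurable conditions. *)
Let grid (N k p P : nat) : R := T * (k%:R + p%:R / P.+1%:R) / N.+1%:R.

Let code N m (w : WS) : seq int :=
  [seq Num.floor (m.+1%:R * path_at (grid N x.1 0 0) w x.2.1 x.2.2) |
    x : 'I_N.+1 * ('I_n * 'I_n) <- enum {: 'I_N.+1 * ('I_n * 'I_n)}].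

Let oscillates_less N m (w : WS) : Prop := forall k p P, (k <= N)%N -> (p <= P.+1)%N ->
  `|path_at (grid N k p P) w - path_at (grid N k 0 0) w| < m.+1%:R^-1.

(* Paths with a prescribed rounding on a grid and small oscillation between grid
   points are close to each other; an open set is a countable union of such sets. *)
Let chunk (x : nat * nat * seq int) : set WS :=
  [set w | code x.1.1 x.1.2 w = x.2 /\ oscillates_less x.1.1 x.1.2 w].

Let measurable_map_eq (I : Type) (s : seq I) (f : I -> Y -> int) c :
  (forall i z, measurable [set w | f i w = z]) -> measurable [set w | [seq f i w | i <- s] = c].
Proof.
move=> mf; elim: s c => [|i s IH] [|z c] /=.
- by rewrite (_ : [set _ | _] = setT)//; apply/seteqP; split => w.
- by rewrite (_ : [set _ | _] = set0)//; apply/seteqP; split => w.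
- by rewrite (_ : [set _ | _] = set0)//; apply/seteqP; split => w.
rewrite (_ : [set _ | _] = [set w | f i w = z] `&` [set w | [seq f i w | i <- s] = c]).
  exact: measurableI.
by apply/seteqP; split => w /= [-> ->].
Qed.

Let measurable_chunk x : measurable (chunk x : set Y).
Proof.
case: x => -[N m] c; apply: (@measurableI _ Y).
  apply: measurable_map_eq => -[k [i j]] z /=.
  have mf : measurable_fun setT (fun w : Y => m.+1%:R * path_at (grid N k 0 0) w i j).
    exact: measurable_funM.
  rewrite (_ : [set _ | _] = setT `&` (fun w : Y => m.+1%:R * path_at (grid N k 0 0) w i j) @^-1` `[z%:~R, (z + 1)%:~R[%classic).
    exact: mf.
  rewrite setTI; apply/seteqP; split => w /=; rewrite in_itv/=.
    by move=> <-; exact: floor_itv.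
  exact: floor_def.
rewrite (_ : oscillates_less _ _ = \bigcap_k \bigcap_p \bigcap_P
    [set w : Y | (k <= N)%N -> (p <= P.+1)%N ->
      `|path_at (grid N k p P) w - path_at (grid N k 0 0) w| < m.+1%:R^-1]); last first.
  by apply/seteqP; split => w h; [move=> k _ p _ P _; exact: h|move=> k p P; exact: (h k _ p _ P)].
apply: bigcapT_measurable => k; apply: bigcapT_measurable => p; apply: bigcapT_measurable => P.
have [kN|kN] := boolP (k <= N)%N; last first.
  by rewrite (_ : [set _ | _] = setT)//; apply/seteqP; split.
have [pP|pP] := boolP (p <= P.+1)%N; last first.
  by rewrite (_ : [set _ | _] = setT)//; apply/seteqP; split.
rewrite (_ : [set _ | _] = ~` [set w : Y | m.+1%:R^-1 <= `|path_at (grid N k p P) w - path_at (grid N k 0 0) w|]).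
  apply: measurableC; apply: measurable_norm_ge => i j.
  by under eq_fun do rewrite !mxE; exact: measurable_funB.
by apply/seteqP; split => w /=; [move=> /(_ isT isT) h; apply/negP; rewrite -ltNge|move=> /negP; rewrite -ltNge].
Qed.

Let oscillates_ex m w : exists N, oscillates_less N m w.
Proof.
have m0 : (0 : R) < m.+1%:R^-1 by rewrite invr_gt0.
have [delta d0 hd] := within_uniform_continuous m0 (@path_cts w).
have [N hN] : exists N : nat, T / N.+1%:R <= delta.
  have e1 : 0 < delta / T by exact: divr_gt0.
  have [N _ /(_ N (leqnn _)) /ltW h] := near_infty_natSinv_lt (PosNum e1).
  by exists N; rewrite mulrC -ler_pdivlMr.
exists N => k p P kN pP.
have rE q : q%:R / P.+1%:R * (T / N.+1%:R) >= 0 :> R by rewrite mulr_ge0 ?divr_ge0// ltW.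
have inT q : (q <= P.+1)%N -> 0 <= grid N k q P <= T.
  move=> qP; have h : 0 <= (k%:R + q%:R / P.+1%:R : R) <= N.+1%:R.
    rewrite addr_ge0 ?divr_ge0//= -(natr1 N) lerD ?ler_nat//.
    by rewrite ler_pdivrMr// mul1r ler_nat.
  have /andP[h1 h2] := h; rewrite /grid divr_ge0 ?mulr_ge0 ?(ltW T0)//=.
  by rewrite ler_pdivrMr// ler_pM2l.
have -> : grid N k 0 0 = grid N k 0 P by rewrite /grid !mul0r.
apply: hd; [exact: inT|exact: inT|].
apply: le_trans hN.
have -> : grid N k p P - grid N k 0 P = p%:R / P.+1%:R * (T / N.+1%:R) by rewrite /grid mul0r; ring.
rewrite ger0_norm// -[leRHS]mul1r ler_wpM2r ?divr_ge0 ?(ltW T0)//.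
by rewrite ler_pdivrMr// mul1r ler_nat.
Qed.

(** Three comparisons, each costing 1/(m+1): each path at t with its value at the left end of the
    cell, and the two values there, which have the same rounding. *)
Let chunk_close N m c w0 w t : chunk (N, m, c) w0 -> chunk (N, m, c) w -> 0 <= t <= T ->
  `|path_at t w0 - path_at t w| <= 3 / m.+1%:R.
Proof.
move=> [/= c0 o0'] [/= c1 o1] tT; have /andP[t0 tT'] := tT.
have m0 : (0 : R) < m.+1%:R^-1 by rewrite invr_gt0.
have [k kN [y /andP[y0 y1] tE]] : exists2 k, (k <= N)%N & exists2 y : R, 0 <= y <= 1 &
    t = T * (k%:R + y) / N.+1%:R.
  pose z := t / T * N.+1%:R.
  have z0 : 0 <= z by rewrite mulr_ge0// divr_ge0// ltW.
  have zN : z <= N.+1%:R by rewrite ler_piMl// ler_pdivrMr// mul1r.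
  have tz a : a = z -> t = T * a / N.+1%:R.
    by move=> ->; rewrite /z; field; rewrite (lt0r_neq0 T0) addrC natr1 pnatr_eq0.
  (* The end point t = T is put in the last cell with fraction 1; truncation would number its cell
     N+1. *)
  have [zlt|zge] := ltP z N.+1%:R; last first.
    exists N => //; exists 1; rewrite ?ler01 ?lexx//; apply: tz.
    by rewrite natr1; apply/eqP; rewrite eq_le zge zN.
  have /andP[h1 h2] := truncn_itv z0.
  exists (Num.truncn z); first by rewrite -ltnS -(ltr_nat R) (le_lt_trans h1).
  exists (z - (Num.truncn z)%:R); last by apply: tz; rewrite addrC subrK.
  by rewrite subr_ge0 h1 lerBlDl natr1 ltW.
pose u P : R := grid N k (Num.truncn (y * P.+1%:R)) P.
have uP P : (Num.truncn (y * P.+1%:R) <= P.+1)%N.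
  have h : (Num.truncn (y * P.+1%:R))%:R <= y * P.+1%:R by rewrite truncn_le mulr_ge0.
  by rewrite -(ler_nat R) (le_trans h)// ler_piMl.
have osc w' : oscillates_less N m w' -> `|path_at t w' - path_at (grid N k 0 0) w'| <= m.+1%:R^-1.
  move=> ow; apply/ler_addgt0Pr => e e0.
  have [delta d0 hd] := within_uniform_continuous e0 (@path_cts w').
  have [P hP] : exists P : nat, T / P.+1%:R <= delta.
    have e1 : 0 < delta / T by exact: divr_gt0.
    have [P _ /(_ P (leqnn _)) /ltW h] := near_infty_natSinv_lt (PosNum e1).
    by exists P; rewrite mulrC -ler_pdivlMr.
  have h1 := ow k _ P kN (uP P); rewrite -/(u P) in h1.
  have yP0 : 0 <= y * P.+1%:R by rewrite mulr_ge0.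
  have /andP[h2 h3] := truncn_itv yP0.
  have tu : t - u P = T / N.+1%:R * (y - (Num.truncn (y * P.+1%:R))%:R / P.+1%:R).
    by rewrite tE /u /grid; ring.
  have hy : 0 <= y - (Num.truncn (y * P.+1%:R))%:R / P.+1%:R <= P.+1%:R^-1.
    rewrite subr_ge0 ler_pdivrMr// h2/= lerBlDl -[X in _ + X]mul1r -mulrDl natr1.
    by rewrite ler_pdivlMr// ltW.
  have tuP : 0 <= t - u P <= delta.
    have /andP[a1 a2] := hy; rewrite tu mulr_ge0 ?divr_ge0 ?(ltW T0)//=.
    apply: le_trans hP; apply: ler_pM => //; first by rewrite divr_ge0// ltW.
    by rewrite ler_pdivrMr// ler_peMr ?(ltW T0)// ler1n.
  have uT : 0 <= u P <= T.
    rewrite /u /grid divr_ge0 ?mulr_ge0 ?addr_ge0 ?divr_ge0 ?(ltW T0)//=.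
    by case/andP: tuP; rewrite subr_ge0 => h _; exact: le_trans h tT'.
  have h4 : `|path_at t w' - path_at (u P) w'| < e.
    by apply: hd => //; case/andP: tuP => a1 a2; rewrite ger0_norm.
  rewrite -(subrK (path_at (u P) w') (path_at t w')) -addrA (le_trans (ler_normD _ _))//.
  by rewrite [leRHS]addrC; apply: lerD; exact: ltW.
have mid : `|path_at (grid N k 0 0) w0 - path_at (grid N k 0 0) w| <= m.+1%:R^-1.
  have mE i j : `|path_at (grid N k 0 0) w0 i j - path_at (grid N k 0 0) w i j| <= m.+1%:R^-1.
    have kN' : (k < N.+1)%N by rewrite ltnS.
    have /eq_in_map/(_ (Ordinal kN', (i, j))) /= := etrans c0 (esym c1).
    rewrite mem_enum => /(_ isT) fE.
    have := floor_itv (m.+1%:R * path_at (grid N k 0 0) w0 i j); rewrite fE.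
    have := floor_itv (m.+1%:R * path_at (grid N k 0 0) w i j).
    rewrite intrD mulr1z => /andP[a1 a2] /andP[b1 b2].
    rewrite -[leRHS]mul1r ler_pdivlMr// mulrC -[X in X * _]ger0_norm// -normrM mulrBr.
    by rewrite ler_norml; apply/andP; split; lra.
  apply: mx_norm_le => [|i j]; first exact: ltW.
  by rewrite !mxE.
have := osc _ o0'; have := osc _ o1; rewrite [X in X <= _ -> _]distrC.
set a := path_at t w0; set b := path_at t w; set c' := path_at _ w0 in mid *; set d' := path_at _ w in mid *.
move=> h1 h2.
have -> : a - b = (a - c') + (c' - d') + (d' - b) by rewrite !addrA !subrK.
have -> : 3 / m.+1%:R = m.+1%:R^-1 + m.+1%:R^-1 + m.+1%:R^-1 :> R by ring.
rewrite (le_trans (ler_normD _ _))// lerD//.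
by rewrite (le_trans (ler_normD _ _))// lerD.
Qed.

Lemma path_events_measurable (A : set (wiener_measurable G T)) : measurable A -> <<s path_events >> (A : set WS).
Proof.
apply: smallest_sub; first exact: (smallest_sigma_algebra setT path_events).
move=> U oU.
have -> : U = \bigcup_k (if unpickle k is Some x then if pselect (chunk x `<=` U) then chunk x else set0 else set0).
  apply/seteqP; split => w; last first.
    move=> [k _]; case: unpickle => // x; case: pselect => // h; exact: h.
  move=> Uw; have [e e0 he] := open_ball_path oU Uw.
  have e3 : 0 < e / 3 by exact: divr_gt0.
  have [m _ /(_ m (leqnn _)) hm] := near_infty_natSinv_lt (PosNum e3).
  have [N oN] := oscillates_ex m w.
  exists (pickle (N, m, code N m w)) => //; rewrite pickleK.
  case: pselect => [?|]; first by split.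
  case=> w' cw'; apply: he => t tT.
  apply: le_lt_trans (chunk_close (c := code N m w) _ cw' tT) _; first by split.
  by rewrite mulrC -ltr_pdivlMr.
apply: (@bigcupT_measurable _ Y) => k; case: unpickle => [x|]; last exact: measurable0.
by case: pselect => ?; [exact: measurable_chunk|exact: measurable0].
Qed.

End WienerGenerated.

(** * Paths with a given step function as logarithmic derivative *)

Section MatrixCurves.
Context {R : realType} {n : nat}.
Local Notation M := 'M[R]_n.

Lemma derive1_mx (f : R -> M) (D : M) (t : R) :
  (forall i j, is_derive t 1 (fun s => f s i j) (D i j)) -> derive1 f t = D.
Proof.
move=> hD; rewrite /derive1; apply: cvg_lim => //; apply/cvg_mx => i j.
have [df dE] := hD i j; rewrite -dE; move: df; rewrite /derivable /derive.
set F := (fun h : R => h^-1 *: _) => cF.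
have -> : (fun x : R => (x^-1 *: (f (x + t) - f t)) i j) = F.
  by apply/funext => h; rewrite /F /= !mxE [h *: 1]mulr1.
exact: cF.
Qed.

Context (G : compact_connected_lie_group R n).

(** The bound is global in time because exp(tA) stays in the compact set G: nearby times use the
    first order estimate and a translation, times more than 1 apart the diameter of G. *)
Lemma expmx_lipschitz (A : M) : lie_algebra G A ->
  exists2 K : R, 0 <= K & forall s t, `|expmx (s *: A) - expmx (t *: A)| <= K * `|s - t|.
Proof.
move=> GA; have [KG KG0 hG] := lie_norm_bounded G; have [K K0 hK] := expmx_order1 A.
exists (n%:R * KG * K + (KG + KG)) => [|s t].
  by rewrite !addr_ge0 ?mulr_ge0.
wlog ts : s t / t <= s.
  move=> h; have [ts|/ltW st] := leP t s; first exact: h.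
  by rewrite distrC [`|s - t|]distrC; exact: h.
rewrite [`|s - t|]ger0_norm ?subr_ge0//.
have [->|st] := eqVneq s t; first by rewrite !subrr normr0 mulr0.
have d0 : 0 < s - t by rewrite subr_gt0 lt_neqAle eq_sym st.
have [d1|d1] := leP (s - t) 1.
  have -> : expmx (s *: A) - expmx (t *: A) = expmx (t *: A) *m (expmx ((s - t) *: A) - 1%:M).
    by rewrite mulmxBr mulmx1 -expmxDl [t + _]addrC subrK.
  rewrite (le_trans (norm_mulmx_le _ _))// mulrDl -[leLHS]addr0 lerD//; last first.
    by apply: mulr_ge0; [exact: addr_ge0|exact: ltW].
  by rewrite -(mulrA _ K) ler_pM ?mulr_ge0 ?ler_wpM2l ?hG ?hK ?d0.
rewrite (le_trans (ler_normB _ _))// mulrDl -[leLHS]add0r lerD//.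
  by rewrite !mulr_ge0// ltW.
rewrite (@le_trans _ _ (KG + KG)) ?lerD ?hG//.
by rewrite ler_peMr ?addr_ge0// ltW.
Qed.

(** A solution of phi' = f phi on [0, c], frozen after c. [F] lists the finitely many times at which
    the equation may fail. *)
Record development (f : R -> M) (F : seq R) (c : R) (phi : R -> M) : Prop := Development {
  dev_one : phi 0 = 1%:M;
  dev_lie : forall t, lie_set G (phi t);
  dev_lip : exists2 K : R, 0 <= K & forall s t, `|phi s - phi t| <= K * `|s - t|;
  dev_cst : forall t, c <= t -> phi t = phi c;
  dev_der : forall t, 0 < t < c -> t \notin F -> forall i j,
    is_derive t 1 (fun s => phi s i j) ((f t *m phi t) i j) }.

(** The time spent in [c, c'] before t, so that exp(clamp A) is 1 up to c and frozen after c'. *)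
Let clamp (c c' t : R) : R := if t <= c then 0 else if t <= c' then t - c else c' - c.

Let clamp_lip c c' s t : c <= c' -> `|clamp c c' s - clamp c c' t| <= `|s - t|.
Proof.
move=> cc; wlog ts : s t / t <= s.
  move=> h; have [ts|/ltW st] := leP t s; first exact: h.
  by rewrite distrC [`|s - t|]distrC; exact: h.
rewrite /clamp [`|s - t|]ger0_norm ?subr_ge0//.
by case: (leP s c) => ?; case: (leP t c) => ?; case: (leP s c') => ?; case: (leP t c') => ?;
  rewrite ler_norml; apply/andP; split; lra.
Qed.

Let development_extend f F c phi c' A : development f F c phi -> 0 <= c -> c < c' ->
  lie_algebra G A -> (forall t, c < t -> t < c' -> f t = A) ->
  development f (c :: F) c' (fun t => expmx (clamp c c' t *: A) *m phi t).
Proof.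
move=> [p1 pG [K K0 pK] pc pD] c0 cc' GA fA; have lcc := ltW cc'.
have [KG KG0 hG] := lie_norm_bounded G; have [KA KA0 hA] := expmx_lipschitz GA.
split.
- by rewrite /clamp c0 scale0r expmx0 mul1mx.
- by move=> t; apply: lie_mul.
- exists (n%:R * KG * K + n%:R * KA * KG); first by rewrite addr_ge0 ?mulr_ge0.
  move=> s t; set es := expmx _; set et := expmx _.
  have -> : es *m phi s - et *m phi t = es *m (phi s - phi t) + (es - et) *m phi t.
    by rewrite mulmxBr mulmxBl addrA subrK.
  have h : `|es - et| <= KA * `|s - t|.
    by rewrite (le_trans (hA _ _))// ler_wpM2l// clamp_lip.
  rewrite (le_trans (ler_normD _ _))// mulrDl lerD// (le_trans (norm_mulmx_le _ _))//.
    by rewrite -(mulrA _ K) ler_pM ?mulr_ge0// ler_wpM2l//; exact/hG/GA.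
  have -> : n%:R * KA * KG * `|s - t| = n%:R * (KA * `|s - t|) * KG by ring.
  by rewrite ler_pM ?mulr_ge0// ?ler_wpM2l// hG.
- move=> t c't; have ct := lt_le_trans cc' c't.
  rewrite (pc _ (ltW ct)) (pc _ lcc) /clamp (leNgt t c) ct/= (leNgt c' c) cc'/= lexx.
  have [->|tc] := eqVneq t c'; first by rewrite lexx.
  have c't' : c' < t by rewrite lt_neqAle eq_sym tc.
  by rewrite leNgt c't'.
move=> t /andP[t0 tc']; rewrite inE negb_or => /andP[tc tF] i j.
have [tlt|tge] := ltP t c.
  have e1 s : s < c -> expmx (clamp c c' s *: A) *m phi s = phi s.
    by move=> sc; rewrite /clamp (ltW sc) scale0r expmx0 mul1mx.
  rewrite e1//; apply: near_eq_is_derive (pD t _ tF i j); last by rewrite t0 tlt.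
  by near=> s; rewrite e1//; near: s; exact: lt_nbhsl.
have tgt : c < t by rewrite lt_neqAle eq_sym tc.
have e1 s : c < s -> s < c' -> expmx (clamp c c' s *: A) *m phi s = expmx ((1 * s + (- c)) *: A) *m phi c.
  by move=> cs sc'; rewrite /clamp leNgt cs/= (ltW sc') mul1r (pc s (ltW cs)).
rewrite e1// fA//.
have -> : (A *m (expmx ((1 * t + - c) *: A) *m phi c)) i j =
  ((1 *: (A *m expmx ((1 * t + - c) *: A))) *m phi c + expmx ((1 * t + - c) *: A) *m 0) i j.
  by rewrite scale1r mulmx0 addr0 mulmxA.
have h : is_derive t 1 (fun s => (expmx ((1 * s + - c) *: A) *m phi c) i j)
    ((1 *: (A *m expmx ((1 * t + - c) *: A)) *m phi c + expmx ((1 * t + - c) *: A) *m 0) i j).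
  apply: (@is_derive_mulmx _ _ _ _ (fun s => expmx ((1 * s + - c) *: A)) (fun=> phi c)) => {}i {}j.
    by rewrite mxE; exact: is_derive_expmx_comp.
  by rewrite mxE; exact: is_derive_cst.
apply: near_eq_is_derive h.
by near=> s; rewrite e1//; near: s; [exact: lt_nbhsr|exact: lt_nbhsl].
Unshelve. all: by end_near. Qed.

Variable (T : R).
Hypothesis T0 : 0 < T.
Variable (l : seq (R * R * M)).
Hypothesis hl : is_step G T l.

Let lie_step t : lie_algebra G (step_fun l t).
Proof.
rewrite /step_fun big_seq; apply: (big_ind (lie_algebra G)).
- exact: lie_algebra0.
- by move=> A B; exact: lie_algebraD.
- by move=> x /hl[_ _ _ GA]; exact: lie_algebraZ.
Qed.

Let step_cst c c' s t : (forall x, x \in l -> ~ (c < x.1.1 < c') /\ ~ (c < x.1.2 < c')) ->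
  c < s < c' -> c < t < c' -> step_fun l s = step_fun l t.
Proof.
move=> hx /andP[cs sc] /andP[ct tc]; rewrite /step_fun !big_seq; apply: eq_bigr => x /hx[h1 h2].
congr (_ *: _); rewrite !indicE; congr ((_ : bool)%:R).
have side a u v : ~ (c < a < c') -> c < u < c' -> c < v < c' -> (a < u) = (a < v).
  move=> h /andP[cu uc] /andP[cv vc]; have [ca|ac] := ltP c a.
    have ca' : c' <= a by rewrite leNgt; apply/negP => ac; apply: h; rewrite ca ac.
    by rewrite !ltNge (le_trans (ltW uc) ca') (le_trans (ltW vc) ca').
  by rewrite (le_lt_trans ac cu) (le_lt_trans ac cv).
have inE u : (u \in (`]x.1.1, x.1.2]%classic : set R)) = (x.1.1 < u <= x.1.2).
  by apply/idP/idP => [/set_mem|h]; [rewrite /= in_itv|apply/mem_set; rewrite /= in_itv].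
by rewrite !inE !leNgt (side x.1.1 s t) ?(side x.1.2 s t) ?cs ?ct.
Qed.

(** Induction over the break points [s] still ahead of c. The last condition on [s] says that every
    end point of an interval of l beyond c is in [s], so that the step function is constant up to
    the next break point. *)
Let development_exists (s : seq R) c : path <%R c s -> 0 <= c -> c <= T ->
  (forall t, t \in s -> t <= T) -> T \in c :: s ->
  (forall x, x \in l -> (c < x.1.1 -> x.1.1 \in s) /\ (c < x.1.2 -> x.1.2 \in s)) ->
  forall F phi, development (step_fun l) F c phi ->
  exists F' psi, development (step_fun l) F' T psi.
Proof.
elim: s c => [|c' s IH] c cs c0 cT sT Ts hs F phi dphi.
  by move: Ts dphi; rewrite inE => /eqP <- dphi; exists F, phi.
move: cs => /= /andP[cc' c's].
have c'T : c' <= T by apply: sT; rewrite mem_head.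
have s_gt t : t \in s -> c' < t by move: t; apply/allP; exact: order_path_min lt_trans c's.
have nin a : (c < a -> a \in c' :: s) -> ~ (c < a < c').
  move=> h /andP[ca ac']; have := h ca; rewrite inE => /orP[/eqP e|/s_gt].
    by rewrite e ltxx in ac'.
  by rewrite ltNge (ltW ac').
pose m := (c + c') / 2; have cm : c < m < c' by rewrite midf_lt// midf_lt.
(* The value at the midpoint m is the value of the step function on the whole open interval ]c,
   c'[. *)
have dpsi : development (step_fun l) (c :: F) c' (fun t => expmx (clamp c c' t *: step_fun l m) *m phi t).
  apply: development_extend => // t ct tc.
  apply: (@step_cst c c') => //; last by rewrite ct tc.
  by move=> x xl; have [h1 h2] := hs x xl; split; exact: nin.
apply: (IH c' c's (le_trans c0 (ltW cc')) c'T _ _ _ _ _ dpsi).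
- by move=> t ts; apply: sT; rewrite inE ts orbT.
- move: Ts; rewrite inE => /orP[/eqP Tc|//].
  by move: (lt_le_trans cc' c'T); rewrite Tc ltxx.
move=> x xl; have [h1 h2] := hs x xl; split => ca.
  have := h1 (lt_trans cc' ca); rewrite inE => /orP[/eqP e|//].
  by rewrite e ltxx in ca.
have := h2 (lt_trans cc' ca); rewrite inE => /orP[/eqP e|//].
by rewrite e ltxx in ca.
Qed.

Lemma step_development : exists F phi, development (step_fun l) F T phi.
Proof.
pose pts := T :: [seq t <- [seq x.1.1 | x <- l] ++ [seq x.1.2 | x <- l] | 0 < t].
have mem_pts t : t \in sort <=%R (undup pts) -> 0 < t <= T.
  rewrite mem_sort mem_undup inE => /orP[/eqP ->|]; first by rewrite T0 lexx.
  rewrite mem_filter mem_cat => /andP[-> /orP[] /mapP[x /hl[x0 xx xT _] ->]] //=.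
  exact: le_trans xT.
apply: (@development_exists (sort <=%R (undup pts)) 0 _ (lexx 0) (ltW T0) _ _ _ [::] (fun=> 1%:M)).
- rewrite path_sortedE; last exact: lt_trans.
  rewrite lt_sorted_uniq_le sort_uniq undup_uniq sort_le_sorted !andbT.
  by apply/allP => t /mem_pts /andP[].
- by move=> t /mem_pts /andP[].
- by rewrite inE mem_sort mem_undup mem_head orbT.
- move=> x xl; rewrite !mem_sort !mem_undup !inE !mem_filter !mem_cat; split => ->.
    by rewrite (map_f (fun x => x.1.1) xl) orbT.
  by rewrite (map_f (fun x => x.1.2) xl) !orbT.
split => //.
- by move=> t; exact: lie_one.
- by exists 0 => // s t; rewrite subrr normr0 mul0r.
- by move=> t /andP[t0 /(lt_trans t0)]; rewrite ltxx.
Qed.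

End MatrixCurves.

Section StepPaths.
Context {R : realType} {n : nat} {G : compact_connected_lie_group R n} {T : R}.
Hypothesis T0 : 0 < T.
Local Notation M := 'M[R]_n.

Lemma lipschitz_absolutely_continuous (h : R -> M) (K : R) : 0 <= K ->
  (forall s t, 0 <= s <= T -> 0 <= t <= T -> `|h s - h t| <= K * `|s - t|) ->
  absolutely_continuous_path T h.
Proof.
move=> K0 hK e e0; have K1 : 0 < K + 1 by rewrite ltr_wpDl.
exists (e / (K + 1)) => [|m a b ab _ s]; first exact: divr_gt0.
apply: (@le_lt_trans _ _ (\sum_i K * (b i - a i))).
  apply: ler_sum => i _; have [a0 aib bT] := ab i.
  rewrite (le_trans (hK _ _ _ _)) ?a0 ?bT ?(le_trans a0)// ?(le_trans aib)//.
  by rewrite ger0_norm ?subr_ge0.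
rewrite -mulr_sumr; move: s; rewrite ltr_pdivlMr//; apply: le_lt_trans.
rewrite mulrC ler_wpM2l ?lerDl// sumr_ge0// => i _.
by have [_ aib _] := ab i; rewrite subr_ge0.
Qed.

Lemma step_path (l : seq (R * R * M)) : is_step G T l ->
  exists (h : wiener_space G T) (F : seq R), absolutely_continuous_path T (path_at ^~ h) /\
    forall t, 0 <= t <= T -> t \notin F ->
      derive1 (path_at ^~ h) t = step_fun l t *m path_at t h.
Proof.
move=> hl; have [F [phi [p1 pG [K K0 pK] _ pD]]] := step_development T0 hl.
pose w : {uniform` `[0, T] -> M} := fun t : R => if t \in `[0, T] then phi t else 1%:M.
have wE t : 0 <= t <= T -> (w : R -> M) t = phi t by rewrite /w in_itv/= => ->.
have pc : continuous phi.
  move=> t; apply/cvgrPdist_lt => e e0; have K1 : 0 < K + 1 by rewrite ltr_wpDl.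
  near=> s; apply: (le_lt_trans (pK t s)).
  apply: (@le_lt_trans _ _ ((K + 1) * `|t - s|)); first by rewrite ler_wpM2r// lerDl.
  rewrite mulrC -ltr_pdivlMr//; near: s.
  have : nbhs t (ball t (e / (K + 1))) by apply: nbhsx_ballx; exact: divr_gt0.
  by apply: filterS => s; rewrite /ball/=.
have pw : w \in @wiener_paths R n G T.
  apply/mem_set; split.
  - apply: (@subspace_eq_continuous _ _ _ phi); last exact: continuous_subspaceT.
    by move=> t /set_mem /=; rewrite in_itv/= => /wE.
  - by move=> t; rewrite in_itv/= => /wE ->.
  - by rewrite wE ?lexx ?ltW.
  - by move=> t tT; rewrite /w (negbTE tT).
pose h : wiener_space G T := exist (fun w => w \in @wiener_paths R n G T) w pw.
have hE t : path_at t h = (w : R -> M) t by [].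
(* The path is extended by the identity outside [0, T], so the two-sided derivative at 0 and T is
   not controlled; both times are exceptional. *)
exists h, (0 :: T :: F); split.
  by apply: (lipschitz_absolutely_continuous K0) => s t sT tT; rewrite !hE !wE.
move=> t tT; rewrite !inE !negb_or => /and3P[t0 tneT tF].
have t0T : 0 < t < T.
  by have /andP[t0' tT'] := tT; rewrite lt_neqAle eq_sym t0 t0' lt_neqAle tneT tT'.
apply: derive1_mx => i j; rewrite hE wE//.
apply: near_eq_is_derive (pD t t0T tF i j).
have /andP[t0' tT'] := t0T; near=> s; rewrite hE wE//; apply/andP; split; apply: ltW; near: s.
  exact: lt_nbhsr.
exact: lt_nbhsl.
Unshelve. all: by end_near. Qed.

Lemma eq_energy (ip : M -> M -> R) (F : seq R) (f g : R -> M) :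
  (forall t, 0 <= t <= T -> t \notin F -> ip (f t) (f t) = ip (g t) (g t)) ->
  measurable_fun (`[0, T]%classic : set R) (fun t => ip (g t) (g t)) ->
  energy T ip f = energy T ip g.
Proof.
move=> fg mg; rewrite /energy.
have mF (S : set R) : S `<=` [set` F] -> measurable S.
  move=> SF; apply: countable_measurable; first by move=> t; exact: measurable_set1.
  by apply: (sub_countable (subset_card_le SF)); exact: finite_set_countable.
have mD : measurable (`[0, T]%classic : set R) by exact: measurable_itv.
apply: ae_eq_integral => //.
- apply/measurable_EFinP => _ Y mY.
  rewrite (_ : _ `&` _ = ((`[0, T]%classic `&` (fun t => ip (g t) (g t)) @^-1` Y) `\` [set` F]) `|`
     ((`[0, T]%classic `&` (fun t => ip (f t) (f t)) @^-1` Y) `&` [set` F])).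
    apply: measurableU; first by apply: measurableD; [exact: mg|exact: mF].
    by apply: mF => t [].
  apply/seteqP; split => t /=.
    rewrite in_itv/= => -[tT Yt]; have [tF|tF] := boolP (t \in F); [right|left] => //.
    by split; [split => //; rewrite -fg|apply/negP].
  rewrite in_itv/= => -[[[tT Yt] /negP tF]|[[tT Yt] _]] //; split => //.
  by rewrite fg.
- exact/measurable_EFinP.
exists [set` F]; split; first exact: mF.
- by apply: countable_lebesgue_measure0; exact: finite_set_countable.
move=> t /=; rewrite in_itv/= => /not_implyP[tT]; apply: contra_notP => /negP tF.
by rewrite fg.
Qed.

End StepPaths.

Section SquareNorm.
Context {R : realType} d {X : measurableType d} (mu : {measure set X -> \bar R}).

Lemma sq_integral_Lnorm (f : X -> R) :
  sq_integral mu f = ('N[mu]_(2%:E) [EFin \o f] * 'N[mu]_(2%:E) [EFin \o f])%E.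
Proof.
have n2 : (2 : R) != 0 by rewrite pnatr_eq0.
have := poweR_Lnorm mu (EFin \o f) n2.
have -> : (\int[mu]_x `|(EFin \o f) x| `^ 2)%E = sq_integral mu f.
  apply: eq_integral => w _; rewrite /comp abse_EFin poweR_EFin; congr (_%:E).
  by rewrite powR_mulrn// real_normK ?num_real.
move=> <-; have := Lnorm_ge0 mu 2%:E (EFin \o f).
case: ('N[mu]_(2%:E) [EFin \o f])%E => [r r0| |] //; last by rewrite poweRyr// mulyy.
by rewrite poweR_EFin powR_mulrn// -EFinM expr2.
Qed.

Lemma Lfun2P (f : X -> R) : f \in Lfun mu 2%:E <->
  measurable_fun setT f /\ (sq_integral mu f < +oo)%E.
Proof.
have N0 : (0 <= 'N[mu]_(2%:E) [EFin \o f])%E by exact: Lnorm_ge0.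
have fin : ('N[mu]_(2%:E) [EFin \o f] < +oo)%E <-> (sq_integral mu f < +oo)%E.
  rewrite sq_integral_Lnorm; move: N0; case: ('N[mu]_(2%:E) [EFin \o f])%E => // r r0.
  by rewrite -EFinM !ltry.
rewrite -fin; split => [/andP[mf ff]|[mf ff]].
  split; first by move: mf; rewrite inE.
  by move: ff; rewrite inE.
by apply/andP; split; rewrite inE/=//; apply/asboolP.
Qed.

Lemma Lnorm_lt (f : X -> R) (e : R) : 0 < e -> (sq_integral mu f <= ((e / 2) ^+ 2)%R%:E)%E ->
  ('N[mu]_(2%:E) [EFin \o f] < e%:E)%E.
Proof.
move=> e0; rewrite sq_integral_Lnorm => h; rewrite ltNge; apply/negP => eN.
have : (e%:E * e%:E <= ((e / 2) ^+ 2)%R%:E)%E by apply: le_trans h; apply: lee_pmul => //; rewrite lee_fin ltW.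
by rewrite -EFinM lee_fin leNgt => /negP; apply; rewrite expr2; nra.
Qed.

Lemma Lnorm_sq_cvg (f_ : nat -> X -> R) (f : X -> R) :
  'N[mu]_(2%:E) [EFin \o (f_ k \- f)%R]%E @[k --> \oo] --> 0%E -> sq_cvg mu f_ f.
Proof.
move=> h; rewrite /sq_cvg.
rewrite (_ : (fun k => _) = (fun k => ('N[mu]_(2%:E) [EFin \o (f_ k \- f)%R] * 'N[mu]_(2%:E) [EFin \o (f_ k \- f)%R])%E)).
  rewrite -[X in _ --> X](mule0 0%E); exact: cvgeM.
by apply/funext => k; rewrite -sq_integral_Lnorm.
Qed.

Lemma Lnorm_eq0 (f : X -> R) : sq_integral mu f = 0%E -> 'N[mu]_(2%:E) [EFin \o f]%E = 0%E.
Proof. by rewrite sq_integral_Lnorm => /eqP; rewrite mule_eq0 orbb => /eqP. Qed.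

End SquareNorm.

(** * Independence of increments *)

Section BrownianMotion.
Context {R : realType} {n : nat} (G : compact_connected_lie_group R n).
Context (ip : 'M[R]_n -> 'M[R]_n -> R).
Hypothesis hip : Ad_invariant_inner_product G ip.
Context (d : nat) (E : 'I_d -> 'M[R]_n).
Hypothesis hE : orthonormal_basis G ip E.
Context (T : R).
Hypothesis T0 : 0 < T.
Context (lam : {measure set (borel 'M[R]_n) -> \bar R}).
Hypothesis hlam : haar_measure G lam.
Context (p : R -> 'M[R]_n -> R).
Hypothesis hp : heat_kernel G E lam p.
Context (mu : probability (wiener_measurable G T) R).
Hypothesis hmu : wiener_measure lam p mu.
Local Notation W := (wiener_measurable G T).
Local Notation M := (borel 'M[R]_n).
Local Notation mG := (measurable_lie G).
Local Notation GE := (onb_mem hE).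
Local Notation incr_mean := (increment_mean G lam p).
Local Notation "''E' X" := (Ex mu X) (at level 8, format "''E' X").

Definition lie_bm (f : M -> R) : Prop :=
  measurable_fun (G : set M) f /\ exists K : R, forall x, lie_set G x -> `|f x| <= K.

Lemma smooth_lie_bm F : smooth G F -> lie_bm F.
Proof.
move=> sF; split; first exact: smooth_measurable.
by have [K _ FK] := smooth_bounded sF; exists K.
Qed.

Lemma lie_bm_restrict f : lie_bm f -> bounded_measurable (f \_ G : M -> R).
Proof.
move=> [mf [K fK]]; split; first by apply/(measurable_restrictT _ mG).
exists `|K| => x; rewrite patchE; case: ifPn => [/set_mem Gx|_]; last by rewrite normr0.
exact: le_trans (fK _ Gx) (ler_norm K).
Qed.

Lemma lie_bm_incr (s t : R) f : lie_bm f -> bounded_measurable (fun w : W => f (incr s t w)).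
Proof.
move=> /lie_bm_restrict bf; have := @bm_incr R n G T s t _ bf; congr bounded_measurable.
by apply/funext => w; rewrite patchE mem_set//; exact: incr_lie.
Qed.

Lemma lie_bmM f g : lie_bm f -> lie_bm g -> lie_bm (fun x => f x * g x).
Proof.
move=> [mf [K fK]] [mg [K' gK]]; split; first exact: measurable_funM.
by exists (K * K') => x Gx; rewrite normrM ler_pM// ?fK// gK.
Qed.

Lemma incr_mean_cst1 t : 0 <= t -> incr_mean t (fun=> 1) = 1.
Proof.
rewrite /increment_mean le_eqVlt => /orP[/eqP <-|t0]; first by rewrite eqxx.
by rewrite gt_eqF// (heat_mean1 hlam GE hp).
Qed.

Lemma Ex_prod_incr (k : nat) (r : nat -> R) (f : nat -> M -> R) :
  (forall i, (i < k)%N -> r i <= r i.+1) -> 0 <= r 0%N -> r k <= T ->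
  (forall i, lie_bm (f i)) ->
  'E (fun w => \prod_(i < k) f i (incr (r i) (r i.+1) w)) =
  \prod_(i < k) incr_mean (r i.+1 - r i) (f i).
Proof.
move=> rr r0 rk bf.
pose g i : M -> R := f i \_ G.
pose l j m : seq (R * (M -> R)) := [seq (r i.+1, g i) | i <- iota j m].
have plE m j (w : W) : incr_prod (r j) (l j m) w = \prod_(i <- iota j m) f i (incr (r i) (r i.+1) w).
  elim: m j => [|m IH] j; first by rewrite big_nil.
  rewrite /l /= -/(l j.+1 m) IH big_cons /g patchE mem_set//; exact: incr_lie.
have pmE m j : incr_mean_prod G lam p (r j) (l j m) =
    \prod_(i <- iota j m) incr_mean (r i.+1 - r i) (f i).
  elim: m j => [|m IH] j; first by rewrite big_nil.
  rewrite /l /= -/(l j.+1 m) IH big_cons; congr (_ * _).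
  rewrite /increment_mean /g patchE mem_set; last exact: lie_one.
  case: ifP => // _; apply: eq_Rintegral => x /[dup] Gx _.
  by rewrite patchE Gx.
have bigE (F : nat -> R) : \prod_(i < k) F i = \prod_(i <- iota 0 k) F i.
  by rewrite -(big_mkord xpredT) /index_iota subn0.
rewrite (bigE (fun i => incr_mean (r i.+1 - r i) (f i))) -pmE.
transitivity ('E (incr_prod (r 0%N) (l 0%N k))).
  by apply: eq_Ex => w; rewrite plE (bigE (fun i => f i (incr (r i) (r i.+1) w))).
(* The law of the increments is known from time 0 on: an increment over [0, r 0] with the function 1
   is put in front. *)
pose l0 := (r 0%N, fun=> 1) :: l 0%N k.
have pl m j : (j + m <= k)%N -> path <=%R (r j) (map fst (l j m)) /\
    last (r j) (map fst (l j m)) = r (j + m)%N.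
  elim: m j => [|m IH] j jm /=; first by rewrite addn0.
  have [|h1 h2] := IH j.+1; first by rewrite addSnnS.
  by rewrite rr ?h1 ?h2 ?addSnnS// (leq_trans _ jm)// addnS ltnS leq_addr.
have [pl0 ll0] := pl k 0%N (leqnn k).
have := Ex_incr_prod hlam GE hp hmu (l := l0).
rewrite /= r0 pl0 ll0 => /(_ isT rk) h.
transitivity ('E (fun w => 1 * incr_prod (r 0%N) (l 0%N k) w)).
  by apply: eq_Ex => w; rewrite mul1r.
rewrite h; last first.
  move=> x [<-|]; first exact: bm_cst.
  by move=> /List.in_map_iff[i [<- _]] /=; exact: lie_bm_restrict.
by rewrite subr0 incr_mean_cst1// mul1r.
Qed.

Lemma Ex_incr (s t : R) f : 0 <= s -> s <= t -> t <= T -> lie_bm f ->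
  'E (fun w => f (incr s t w)) = incr_mean (t - s) f.
Proof.
move=> s0 st tT bf.
have := @Ex_prod_incr 1 (fun i => if i == 0%N then s else t) (fun=> f).
rewrite big_ord1 => <-//; last by case.
by apply: eq_Ex => w; rewrite big_ord1.
Qed.

Section TensorAlgebra.
Variables (k : nat) (r : nat -> R).
Hypothesis rr : forall i, (i < k)%N -> r i <= r i.+1.
Hypothesis r0 : 0 <= r 0%N.
Hypothesis rk : r k <= T.
Implicit Types P Q : pred nat.

Let term (cf : R * (nat -> M -> R)) (w : W) : R :=
  cf.1 * \prod_(i < k) cf.2 i (incr (r i) (r i.+1) w).

Let supported P (cf : R * (nat -> M -> R)) : Prop :=
  (forall i, lie_bm (cf.2 i)) /\ (forall i, ~~ P i -> cf.2 i = fun=> 1).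

(* Sums of products of functions of single increments, with indices in [P]. *)
Definition tensor P (Z : W -> R) : Prop :=
  exists2 s : seq (R * (nat -> M -> R)), (forall cf, List.In cf s -> supported P cf) &
    forall w, Z w = \sum_(cf <- s) term cf w.

Let bm_term P cf : supported P cf -> bounded_measurable (term cf).
Proof. by move=> [bf _]; apply: bmZ; apply: bm_prod => i; exact: lie_bm_incr. Qed.

Lemma lie_bm_cst c : lie_bm (fun=> c).
Proof. by split; [exact: measurable_cst|exists `|c|]. Qed.

Lemma tensor_bm P Z : tensor P Z -> bounded_measurable Z.
Proof.
move=> [s sP ZE]; rewrite (_ : Z = fun w => \sum_(cf <- s) term cf w); last exact/funext.
elim: s sP {ZE} => [|cf s IH] sP; first by under eq_fun do rewrite big_nil; exact: bm_cst.
under eq_fun do rewrite big_cons; apply: bmD; last by apply: IH => x xs; apply: sP; right.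
by apply: (@bm_term P); apply: sP; left.
Qed.

Lemma tensor_cst P c : tensor P (fun=> c).
Proof.
exists [:: (c, fun _ _ => 1)] => [cf [<-|[]]|w].
  by split => // i; exact: lie_bm_cst.
by rewrite big_cons big_nil addr0 /term /= big1 ?mulr1.
Qed.

Lemma tensor_gen P i f : (i < k)%N -> P i -> lie_bm f ->
  tensor P (fun w => f (incr (r i) (r i.+1) w)).
Proof.
move=> ik Pi bf; exists [:: (1, fun j => if j == i then f else fun=> 1)] => [cf [<-|[]]|w].
  split => j /=; first by case: ifP => // _; exact: lie_bm_cst.
  by move=> Pj; case: ifP => // /eqP ji; move: Pj; rewrite ji Pi.
rewrite big_cons big_nil addr0 /term /= mul1r (bigD1 (Ordinal ik))//= eqxx.
by rewrite big1 ?mulr1// => j; rewrite -val_eqE/= => /negbTE ->.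
Qed.

Lemma tensorD P Y Z : tensor P Y -> tensor P Z -> tensor P (fun w => Y w + Z w).
Proof.
move=> [s sP YE] [t tP ZE]; exists (s ++ t) => [cf /List.in_app_iff[/sP|/tP]//|w].
by rewrite big_cat YE ZE.
Qed.

Lemma tensorM P Q Y Z : tensor P Y -> tensor Q Z ->
  tensor (fun i => P i || Q i) (fun w => Y w * Z w).
Proof.
move=> [s sP YE] [t tQ ZE].
exists [seq (cf.1 * cg.1, fun i x => cf.2 i x * cg.2 i x) | cf <- s, cg <- t] => [cf|w].
  elim: s sP {YE} => //= cf0 s IH sP /List.in_app_iff[|]; last first.
    by apply: IH => x xs; apply: sP; right.
  move=> /List.in_map_iff[cg [<- /tQ[b1 b2]]].
  have [a1 a2] := sP cf0 (or_introl erefl); split => i /=; first exact: lie_bmM.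
  by rewrite negb_or => /andP[/a2 -> /b2 ->]; apply/funext => x; rewrite mulr1.
rewrite YE ZE big_allpairs_dep big_distrl/=; apply: eq_bigr => cf _.
rewrite big_distrr/=; apply: eq_bigr => cg _.
by rewrite /term/= big_split/=; ring.
Qed.

Lemma tensor_sub P Q Z : {subset P <= Q} -> tensor P Z -> tensor Q Z.
Proof.
move=> PQ [s sP ZE]; exists s => // cf /sP[a1 a2]; split => // i Qi.
by apply: a2; apply: contra Qi => /PQ.
Qed.

Lemma tensorMl P Y Z : tensor P Y -> tensor P Z -> tensor P (fun w => Y w * Z w).
Proof.
move=> tY tZ; apply: tensor_sub (tensorM tY tZ) => i.
by rewrite /in_mem /= orbb.
Qed.

Lemma tensorZ P c Z : tensor P Z -> tensor P (fun w => c * Z w).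
Proof. by move=> tZ; apply: tensorMl => //; exact: tensor_cst. Qed.

Lemma tensorB P Y Z : tensor P Y -> tensor P Z -> tensor P (fun w => Y w - Z w).
Proof.
move=> tY tZ; have := tensorD tY (tensorZ (-1) tZ); congr tensor.
by apply/funext => w; rewrite mulN1r.
Qed.

Lemma tensor_sum P (I : Type) (s : seq I) (Z : I -> W -> R) :
  (forall i, tensor P (Z i)) -> tensor P (fun w => \sum_(i <- s) Z i w).
Proof.
move=> tZ; elim: s => [|i s IH].
  by under eq_fun do rewrite big_nil; exact: tensor_cst.
by under eq_fun do rewrite big_cons; exact: tensorD.
Qed.

Lemma tensor_ext P Y Z : (forall w, Y w = Z w) -> tensor P Y -> tensor P Z.
Proof. by move=> /funext ->. Qed.

Lemma tensor_mulmx P a b c (A : W -> 'M[R]_(a, b)) (B : W -> 'M[R]_(b, c)) :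
  (forall i j, tensor P (fun w => A w i j)) -> (forall i j, tensor P (fun w => B w i j)) ->
  forall i j, tensor P (fun w => (A w *m B w) i j).
Proof.
move=> tA tB i j.
apply: (@tensor_ext _ (fun w => \sum_l A w i l * B w l j)) => [w|]; first by rewrite mxE.
by apply: tensor_sum => l; exact: tensorMl.
Qed.

Lemma tensor_incr P (i j : nat) a b : (i <= j)%N -> (j <= k)%N ->
  (forall l, (i <= l < j)%N -> P l) -> tensor P (fun w => incr (r i) (r j) w a b).
Proof.
elim: j a b => [|j IH] a b.
  rewrite leqn0 => /eqP -> _ _; apply: (@tensor_ext _ (fun=> (1%:M : 'M[R]_n) a b)).
    by move=> w; rewrite incrii.
  exact: tensor_cst.
rewrite leq_eqVlt => /orP[/eqP ->|]; last rewrite ltnS => ij jk Pl.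
  move=> _ _; apply: (@tensor_ext _ (fun=> (1%:M : 'M[R]_n) a b)).
    by move=> w; rewrite incrii.
  exact: tensor_cst.
apply: (@tensor_ext _ (fun w => (incr (r i) (r j) w *m incr (r j) (r j.+1) w) a b)).
  by move=> w; rewrite -incrD.
apply: tensor_mulmx => {}a {}b.
  by apply: IH => // [|l /andP[il lj]]; [exact: ltnW|apply: Pl; rewrite il ltnW].
apply: (@tensor_gen P j (fun x : M => x a b)) => //.
  by apply: Pl; rewrite ij ltnSn.
exact/smooth_lie_bm/smooth_entry.
Qed.

Lemma tensor_incrV P (i j : nat) a b : (i <= j)%N -> (j <= k)%N ->
  (forall l, (i <= l < j)%N -> P l) -> tensor P (fun w => invmx (incr (r i) (r j) w) a b).
Proof.
elim: j a b => [|j IH] a b.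
  rewrite leqn0 => /eqP -> _ _; apply: (@tensor_ext _ (fun=> (1%:M : 'M[R]_n) a b)).
    by move=> w; rewrite incrii invmx1.
  exact: tensor_cst.
rewrite leq_eqVlt => /orP[/eqP ->|]; last rewrite ltnS => ij jk Pl.
  move=> _ _; apply: (@tensor_ext _ (fun=> (1%:M : 'M[R]_n) a b)).
    by move=> w; rewrite incrii invmx1.
  exact: tensor_cst.
apply: (@tensor_ext _ (fun w => (invmx (incr (r j) (r j.+1) w) *m invmx (incr (r i) (r j) w)) a b)).
  by move=> w; rewrite !incrV -incrD.
apply: tensor_mulmx => {}a {}b; last first.
  by apply: IH => // [|l /andP[il lj]]; [exact: ltnW|apply: Pl; rewrite il ltnW].
apply: (@tensor_gen P j (fun x : M => invmx x a b)) => //.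
  by apply: Pl; rewrite ij ltnSn.
exact/smooth_lie_bm/smooth_inv.
Qed.

Let Ex_term P cf : supported P cf ->
  'E (term cf) = cf.1 * \prod_(i < k) incr_mean (r i.+1 - r i) (cf.2 i).
Proof.
move=> [bf _]; rewrite /term ExZ; first by rewrite Ex_prod_incr.
by apply: bm_prod => i; exact: lie_bm_incr.
Qed.

(** For products of functions of single increments this is the product formula for their
    expectation, each index carrying a nontrivial factor from one side only; both sides are
    bilinear. *)
Lemma tensor_indep P Q Y Z : (forall i, P i -> ~~ Q i) ->
  tensor P Y -> tensor Q Z -> 'E (fun w => Y w * Z w) = 'E Y * 'E Z.
Proof.
move=> PQ [s sP YE] [t tQ ZE].
have term2 cf cg : supported P cf -> supported Q cg ->
    'E (fun w => term cf w * term cg w) = 'E (term cf) * 'E (term cg).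
  move=> hf hg; rewrite (Ex_term hf) (Ex_term hg).
  have [a1 a2] := hf; have [b1 b2] := hg.
  pose cfg : R * (nat -> M -> R) := (cf.1 * cg.1, fun i x => cf.2 i x * cg.2 i x).
  have hfg : supported (fun i => P i || Q i) cfg.
    split => i; first exact: lie_bmM.
    by rewrite negb_or => /andP[/a2 /= -> /b2 ->]; apply/funext => x; rewrite mulr1.
  transitivity ('E (term cfg)).
    by apply: eq_Ex => w; rewrite /term/= big_split/=; ring.
  rewrite (Ex_term hfg)/= mulrACA; congr (_ * _); rewrite -big_split/=.
  apply: eq_bigr => i _.
  have [Pi|/a2 ->] := boolP (P i).
    rewrite (b2 _ (PQ _ Pi)) incr_mean_cst1 ?subr_ge0 ?rr// mulr1.
    by congr incr_mean; apply/funext => x; rewrite mulr1.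
  rewrite incr_mean_cst1 ?subr_ge0 ?rr// mul1r.
  by congr incr_mean; apply/funext => x; rewrite mul1r.
have bmY : bounded_measurable Y by apply: (@tensor_bm P); exists s.
have bmZ' : bounded_measurable Z by apply: (@tensor_bm Q); exists t.
have sumE (s' : seq (R * (nat -> M -> R))) (Z' : W -> R) Q' : (forall cf, List.In cf s' -> supported Q' cf) ->
   bounded_measurable Z' ->
   'E (fun w => Z' w * \sum_(cf <- s') term cf w) = \sum_(cf <- s') 'E (fun w => Z' w * term cf w).
  move=> sQ bZ'; elim: s' sQ => [|cf s' IH] sQ.
    by under eq_Ex do rewrite big_nil mulr0; rewrite big_nil Ex_cst.
  under eq_Ex do rewrite big_cons mulrDr.
  have sQ' x : List.In x s' -> supported Q' x by move=> xs; apply: sQ; right.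
  rewrite big_cons -IH// -ExD//.
  - by apply: bmM => //; apply: (@bm_term Q'); apply: sQ; left.
  - by apply: bmM => //; apply: (@tensor_bm Q'); exists s'.
transitivity ('E (fun w => Y w * \sum_(cf <- t) term cf w)).
  by apply: eq_Ex => w; rewrite -ZE.
rewrite (sumE _ _ Q)//.
have -> : 'E Z = \sum_(cf <- t) 'E (term cf).
  transitivity ('E (fun w => 1 * \sum_(cf <- t) term cf w)).
    by apply: eq_Ex => w; rewrite mul1r ZE.
  rewrite (sumE _ _ Q)//; last exact: bm_cst.
  by apply: eq_bigr => cf _; apply: eq_Ex => w; rewrite mul1r.
have -> : 'E Y = \sum_(cf <- s) 'E (term cf).
  transitivity ('E (fun w => 1 * \sum_(cf <- s) term cf w)).
    by apply: eq_Ex => w; rewrite mul1r YE.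
  rewrite (sumE _ _ P)//; last exact: bm_cst.
  by apply: eq_bigr => cf _; apply: eq_Ex => w; rewrite mul1r.
have inner cg : supported Q cg ->
    'E (fun w => Y w * term cg w) = (\sum_(cf <- s) 'E (term cf)) * 'E (term cg).
  move=> hg; transitivity ('E (fun w => term cg w * \sum_(cf <- s) term cf w)).
    by apply: eq_Ex => w; rewrite YE mulrC.
  rewrite (sumE _ _ P)//; last exact: (@bm_term Q).
  rewrite mulr_suml; elim: s sP {YE} => [|cf s' IH] sP; first by rewrite !big_nil.
  rewrite !big_cons IH; last by move=> x xs; apply: sP; right.
  congr (_ + _); rewrite -term2//; last by apply: sP; left.
  by apply: eq_Ex => w; rewrite mulrC.
rewrite mulr_sumr; elim: t tQ {ZE} => [|cg t IH] tQ; first by rewrite !big_nil.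
rewrite !big_cons IH; last by move=> x xs; apply: tQ; right.
by rewrite inner//; apply: tQ; left.
Qed.

End TensorAlgebra.

(** * Moments of increments *)

(** The maximum principle assumed for the heat expansions: [heat_mean] is an expectation under the
    probability mu. *)
Let hmb (F : 'M[R]_n -> R) (K t : R) : smooth G F -> 0 < t <= T ->
  (forall x, lie_set G x -> `|F x| <= K) -> `|heat_mean G lam p F t| <= K.
Proof.
move=> sF /andP[t0 tT] FK.
have := Ex_incr (lexx 0) (ltW t0) tT (smooth_lie_bm sF).
rewrite subr0 /increment_mean gt_eqF// => <-.
apply: Ex_norm_le; first exact/lie_bm_incr/smooth_lie_bm.
by move=> w; apply: FK; exact: incr_lie.
Qed.

Lemma incr_mean_order1 F : smooth G F ->
  exists2 K : R, 0 <= K & forall t, 0 <= t <= T -> `|incr_mean t F - F 1%:M| <= K * t.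
Proof.
move=> sF; have [K K0 h] := heat_mean_order1 hlam GE hp hmb sF.
exists K => // t /andP[]; rewrite le_eqVlt => /orP[/eqP <- _|t0 tT].
  by rewrite /increment_mean eqxx subrr normr0 mulr0.
by rewrite /increment_mean gt_eqF// h// t0.
Qed.

Lemma incr_mean_order2 F : smooth G F ->
  exists2 K : R, 0 <= K & forall t, 0 <= t <= T ->
    `|incr_mean t F - F 1%:M - t / 2 * laplacian E F 1%:M| <= K * t ^+ 2.
Proof.
move=> sF; have [K K0 h] := heat_mean_order2 hlam GE hp hmb sF.
exists K => // t /andP[]; rewrite le_eqVlt => /orP[/eqP <- _|t0 tT].
  by rewrite /increment_mean eqxx subrr !mul0r subr0 normr0 expr2 !mulr0.
by rewrite /increment_mean gt_eqF// h// t0.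
Qed.

Let C : 'M[R]_n := \sum_i E i *m E i.

Definition incr_mean_mx (t : R) : 'M[R]_n := expmx ((t / 2) *: C).

Lemma incr_mean_entry t i j : 0 <= t -> incr_mean t (fun x => x i j) = incr_mean_mx t i j.
Proof.
rewrite /increment_mean le_eqVlt => /orP[/eqP <-|t0].
  by rewrite eqxx /incr_mean_mx mul0r scale0r expmx0.
by rewrite gt_eqF// /incr_mean_mx -(mean_mxE hlam GE hp t0) mxE.
Qed.

Lemma incr_mean_inv t i j : 0 <= t -> incr_mean t (fun x => invmx x i j) = incr_mean_mx t i j.
Proof.
rewrite /increment_mean le_eqVlt => /orP[/eqP <-|t0].
  by rewrite eqxx /incr_mean_mx mul0r scale0r expmx0 invmx1.
by rewrite gt_eqF// /incr_mean_mx -(mean_inv_mxE hlam GE hp t0) mxE.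
Qed.

Lemma incr_mean_mx_comm s t : incr_mean_mx s *m incr_mean_mx t = incr_mean_mx t *m incr_mean_mx s.
Proof. by rewrite /incr_mean_mx -!expmxDl addrC. Qed.

Lemma incr_mean_mx_near1 : exists2 K : R, 0 <= K & forall t i j, 0 <= t <= T ->
  `|incr_mean_mx t i j - (i == j)%:R| <= K * t.
Proof.
have h i j := incr_mean_order1 (smooth_entry G i j).
pose K i j := sval (cid2 (h i j)).
have K0 i j : 0 <= K i j by rewrite /K; case: cid2.
have Kle i j t : 0 <= t <= T -> `|incr_mean t (fun x => x i j) - (1%:M : 'M[R]_n) i j| <= K i j * t.
  by rewrite /K; case: cid2 => k /= _; apply.
exists (\sum_i \sum_j K i j) => [|t i j tT].
  by apply: sumr_ge0 => i _; exact: sumr_ge0.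
have := Kle i j t tT; rewrite incr_mean_entry; last by case/andP: tT.
rewrite mxE => /le_trans -> //; apply: ler_wpM2r; first by case/andP: tT.
rewrite (bigD1 i)//= (bigD1 j)//= -addrA lerDl addr_ge0//; first exact: sumr_ge0.
by apply: sumr_ge0 => k _; exact: sumr_ge0.
Qed.

(** A conditional expectation: A depends on increments independent of those in B and Y, and it
    enters linearly. The right-hand version follows by transposition. *)
Lemma Ex_mean_left k (r : nat -> R) (P Q : pred nat) (A B : W -> 'M[R]_n) (Y : W -> R) (m : 'M[R]_n) i j :
  (forall i, (i < k)%N -> r i <= r i.+1) -> 0 <= r 0%N -> r k <= T ->
  (forall i, P i -> ~~ Q i) ->
  (forall i j, tensor k r P (fun w => A w i j)) ->
  (forall i j, 'E (fun w => A w i j) = m i j) ->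
  (forall i j, tensor k r Q (fun w => B w i j)) -> tensor k r Q Y ->
  'E (fun w => (A w *m B w) i j * Y w) = 'E (fun w => (m *m B w) i j * Y w).
Proof.
move=> rr r0 rk PQ tA EA tB tY.
transitivity ('E (fun w => \sum_l A w i l * (B w l j * Y w))).
  by apply: eq_Ex => w; rewrite mxE mulr_suml; apply: eq_bigr => l _; rewrite mulrA.
have tBY l : tensor k r Q (fun w => B w l j * Y w) by exact: tensorMl.
rewrite Ex_sum; last by move=> l; apply: bmM; [exact: tensor_bm (tA _ _)|exact: tensor_bm (tBY l)].
transitivity ('E (fun w => \sum_l m i l * (B w l j * Y w))); last first.
  by apply: eq_Ex => w; rewrite mxE mulr_suml; apply: eq_bigr => l _; rewrite mulrA.
rewrite Ex_sum; last by move=> l; apply: bmZ; exact: tensor_bm (tBY l).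
apply: eq_bigr => l _; rewrite (tensor_indep rr r0 rk PQ (tA i l) (tBY l)) EA ExZ//.
exact: tensor_bm (tBY l).
Qed.

Lemma Ex_mean_right k (r : nat -> R) (P Q : pred nat) (A B : W -> 'M[R]_n) (Y : W -> R) (m : 'M[R]_n) i j :
  (forall i, (i < k)%N -> r i <= r i.+1) -> 0 <= r 0%N -> r k <= T ->
  (forall i, P i -> ~~ Q i) ->
  (forall i j, tensor k r P (fun w => A w i j)) ->
  (forall i j, 'E (fun w => A w i j) = m i j) ->
  (forall i j, tensor k r Q (fun w => B w i j)) -> tensor k r Q Y ->
  'E (fun w => (B w *m A w) i j * Y w) = 'E (fun w => (B w *m m) i j * Y w).
Proof.
move=> rr r0 rk PQ tA EA tB tY.
have := @Ex_mean_left k r P Q (fun w => (A w)^T) (fun w => (B w)^T) Y m^T j i rr r0 rk PQ.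
have tr (f : W -> 'M[R]_n) D : (forall a b, tensor k r D (fun w => f w a b)) ->
    forall a b, tensor k r D (fun w => (f w)^T a b).
  by move=> tf a b; apply: tensor_ext (tf b a) => w; rewrite mxE.
move=> /(_ (tr _ _ tA) _ (tr _ _ tB) tY) h.
transitivity ('E (fun w => ((A w)^T *m (B w)^T) j i * Y w)).
  by apply: eq_Ex => w; rewrite -trmx_mul [in RHS]mxE.
rewrite h => [|a b]; first by apply: eq_Ex => w; rewrite -trmx_mul [in LHS]mxE.
by rewrite mxE -EA; apply: eq_Ex => w; rewrite mxE.
Qed.

(* The midpoint rule for g^-1 dg on [s, t] is [theta] of the increment x = g_s^-1 g_t:
   (g_s^-1 + g_t^-1) (g_t - g_s) / 2 = (x - x^-1) / 2. *)
Definition theta i j (x : M) : R := 2^-1 * (x i j - invmx x i j).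

Lemma smooth_theta i j : smooth G (theta i j).
Proof. by apply: smoothZ; apply: smoothB; [exact: smooth_entry|exact: smooth_inv]. Qed.

(** The covariance of the entries (i, j) and (k, l) of a Brownian motion in the Lie algebra at time
    1. *)
Definition gram i j k l : R := \sum_m E m i j * E m k l.

Lemma left_field_theta m i j : left_field (E m) (theta i j) 1%:M = E m i j.
Proof.
have d1 := @is_derive_left_curve R n (E m) 1%:M i j.
have d2 := is_derive_left_curveV (E m) i j (lie_one G).
have dd : is_derive (0 : R) 1 (theta i j \o left_curve (E m) 1%:M) (E m i j).
  have := is_deriveZ (2^-1 : R) (is_deriveB d1 d2).
  rewrite invmx1 mul1mx mulmx1 => h; apply: (is_derive_eq h).
  by rewrite opprK -[LHS]/(2^-1 * (E m i j + E m i j)); field.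
by rewrite /left_field derive1E; have [_ ->] := dd.
Qed.

Lemma theta1 i j : theta i j 1%:M = 0.
Proof. by rewrite /theta invmx1 subrr mulr0. Qed.

Lemma laplacian_theta2 i j k l :
  laplacian E (fun x => theta i j x * theta k l x) 1%:M = 2 * gram i j k l.
Proof.
rewrite (laplacianM GE (lie_one G) (smooth_theta i j) (smooth_theta k l)).
rewrite !theta1 mulr0 mul0r add0r addr0; congr (_ * _).
by apply: eq_bigr => m _; rewrite !left_field_theta.
Qed.

(** One constant for a finite family of estimates: the sum of the individual constants. *)
Let uniform (I : finType) (Q : I -> R -> R -> Prop) :
  (forall i, exists2 K : R, 0 <= K & forall t, 0 <= t <= T -> Q i K t) ->
  (forall i K K' t, 0 <= t <= T -> K <= K' -> Q i K t -> Q i K' t) ->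
  exists2 K : R, 0 <= K & forall i t, 0 <= t <= T -> Q i K t.
Proof.
move=> h hle; pose K i := sval (cid2 (h i)).
have K0 i : 0 <= K i by rewrite /K; case: cid2.
exists (\sum_i K i) => [|i t tT]; first exact: sumr_ge0.
apply: (hle _ (K i)) => //.
  by rewrite (bigD1 i)//= lerDl sumr_ge0.
by rewrite /K; case: cid2 => k /= _; apply.
Qed.

(** An entry of x ([true]) or of x^-1 ([false]), so that expressions in both are linear forms over
    one finite index set. *)
Let slot : Type := ('I_n * 'I_n * bool)%type.

Definition incr_coord (s : 'I_n * 'I_n * bool) (x : M) : R :=
  (if s.2 then x else invmx x) s.1.1 s.1.2 - (s.1.1 == s.1.2)%:R.

Lemma smooth_incr_coord s : smooth G (incr_coord s).
Proof.
by apply: smoothB; [case: s.2; [exact: smooth_entry|exact: smooth_inv]|exact: smooth_cst].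
Qed.

Lemma incr_coord1 s : incr_coord s 1%:M = 0.
Proof. by rewrite /incr_coord invmx1; case: s.2; rewrite mxE subrr. Qed.

Lemma incr_coord_mean : exists2 K : R, 0 <= K & forall s s' t, 0 <= t <= T ->
  `|incr_mean t (fun x => incr_coord s x * incr_coord s' x)| <= K * t.
Proof.
have [|i K K' t /andP[t0 _] KK' /le_trans|K K0 h] := @uniform (slot * slot)%type
  (fun s K t => `|incr_mean t (fun x => incr_coord s.1 x * incr_coord s.2 x)| <= K * t).
- move=> s; have [K K0 h] := incr_mean_order1 (smoothM (smooth_incr_coord s.1) (smooth_incr_coord s.2)).
  by exists K => // t /h; rewrite incr_coord1 mul0r subr0.
- by apply; apply: ler_wpM2r.
by exists K => // s s' t; exact: (h (s, s')).
Qed.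

Lemma theta_mean : exists2 K : R, 0 <= K & forall i j k l t, 0 <= t <= T ->
  `|incr_mean t (fun x => theta i j x * theta k l x) - t * gram i j k l| <= K * t ^+ 2.
Proof.
have [|i K K' t /andP[t0 _] KK' /le_trans|K K0 h] := @uniform ('I_n * 'I_n * ('I_n * 'I_n))%type
  (fun s K t => `|incr_mean t (fun x => theta s.1.1 s.1.2 x * theta s.2.1 s.2.2 x) -
    t * gram s.1.1 s.1.2 s.2.1 s.2.2| <= K * t ^+ 2).
- move=> s; have [K K0 h] := incr_mean_order2 (smoothM (smooth_theta s.1.1 s.1.2) (smooth_theta s.2.1 s.2.2)).
  exists K => // t /h; rewrite theta1 mul0r subr0 laplacian_theta2.
  by rewrite mulrA divfK.
- by apply; apply: ler_wpM2r => //; exact: exprn_ge0.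
by exists K => // i j k l t; exact: (h ((i, j), (k, l))).
Qed.

Definition incr_form (a : slot -> R) (x : M) : R := \sum_s a s * incr_coord s x.

(** With m_q the mean of an increment of duration q, this is the linear form (m_q x m_q' - m_q' x^-1
    m_q)_ij. It is what remains of twice theta of a product y x z after averaging over independent
    outer increments y and z of durations q and q'. *)
Definition sandwich_coef (q q' : R) i j (s : slot) : R :=
  if s.2 then incr_mean_mx q i s.1.1 * incr_mean_mx q' s.1.2 j
  else - (incr_mean_mx q' i s.1.1 * incr_mean_mx q s.1.2 j).

(** [incr_coord] subtracts the identity from x and x^-1; the two corrections m_q m_q' and m_q' m_q
    cancel because the means commute. *)
Lemma incr_form_sandwich q q' i j (x : M) :
  incr_form (sandwich_coef q q' i j) x =
  (incr_mean_mx q *m x *m incr_mean_mx q') i j -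
  (incr_mean_mx q' *m invmx x *m incr_mean_mx q) i j.
Proof.
have mulE (A B X : 'M[R]_n) : \sum_(ab : 'I_n * 'I_n) A i ab.1 * B ab.2 j * X ab.1 ab.2 = (A *m X *m B) i j.
  rewrite -(pair_bigA _ (fun a b => A i a * B b j * X a b))/= exchange_big/= mxE.
  apply: eq_bigr => b _; rewrite mxE mulr_suml; apply: eq_bigr => a _; ring.
have split_slot (F : slot -> R) : \sum_s F s = \sum_ab F (ab, true) + \sum_ab F (ab, false).
  transitivity (\sum_ab \sum_(b : bool) F (ab, b)).
    by rewrite pair_bigA; apply: eq_bigr => -[].
  by rewrite -big_split/=; apply: eq_bigr => ab _; rewrite big_bool.
rewrite /incr_form split_slot /sandwich_coef /incr_coord/=.
set P := incr_mean_mx q; set Q := incr_mean_mx q'.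
have -> : \sum_ab P i ab.1 * Q ab.2 j * (x ab.1 ab.2 - (ab.1 == ab.2)%:R) =
    (P *m (x - 1%:M) *m Q) i j.
  by rewrite -mulE; apply: eq_bigr => ab _; rewrite !mxE.
have -> : \sum_ab (- (Q i ab.1 * P ab.2 j) * (invmx x ab.1 ab.2 - (ab.1 == ab.2)%:R)) =
    - (Q *m (invmx x - 1%:M) *m P) i j.
  by rewrite -mulE -sumrN; apply: eq_bigr => ab _; rewrite mulNr !mxE.
have alg (A B X Y : 'M[R]_n) : A *m B = B *m A ->
    (A *m (X - 1%:M) *m B) i j - (B *m (Y - 1%:M) *m A) i j =
    (A *m X *m B) i j - (B *m Y *m A) i j.
  move=> AB; rewrite !mulmxBr !mulmxBl !mulmx1 AB.
  have subE (U V : 'M[R]_n) : (U - V) i j = U i j - V i j by rewrite !mxE.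
  by rewrite !subE opprB addrA subrK.
exact: alg (incr_mean_mx_comm q q').
Qed.

Lemma sandwich_coef0 i j (x : M) : incr_form (sandwich_coef 0 0 i j) x = 2 * theta i j x.
Proof.
rewrite incr_form_sandwich /incr_mean_mx mul0r scale0r expmx0 !mul1mx !mulmx1 /theta.
by rewrite mulrA divff// mul1r.
Qed.

Lemma sandwich_coef_near : exists2 K : R, 0 <= K & forall q q' i j s,
  0 <= q <= T -> 0 <= q' <= T ->
  `|sandwich_coef q q' i j s| <= K /\
  `|sandwich_coef q q' i j s - sandwich_coef 0 0 i j s| <= K * (q + q').
Proof.
have [K K0 near] := incr_mean_mx_near1.
have K1 : 0 <= K * T by rewrite mulr_ge0// ltW.
have mle q i j : 0 <= q <= T -> `|incr_mean_mx q i j| <= 1 + K * T.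
  move=> /[dup] qT /andP[q0 qlT]; rewrite -[X in `|X|](subrK (i == j)%:R) addrC.
  rewrite (le_trans (ler_normD _ _))// lerD//; first by case: (i == j); rewrite ?normr1 ?normr0.
  by rewrite (le_trans (near _ _ _ qT))// ler_wpM2l.
have m0 i j : incr_mean_mx 0 i j = (i == j)%:R.
  by rewrite /incr_mean_mx mul0r scale0r expmx0 mxE.
have prodle q q' i a b j : 0 <= q <= T -> 0 <= q' <= T ->
   `|incr_mean_mx q i a * incr_mean_mx q' b j| <= (1 + K * T) ^+ 2.
  by move=> qT qT'; rewrite normrM expr2 ler_pM// mle.
have prodnear q q' i a b j : 0 <= q <= T -> 0 <= q' <= T ->
   `|incr_mean_mx q i a * incr_mean_mx q' b j - (i == a)%:R * (b == j)%:R| <= (K * (1 + K * T)) * (q + q').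
  move=> qT qT'.
  have -> : incr_mean_mx q i a * incr_mean_mx q' b j - (i == a)%:R * (b == j)%:R =
    (incr_mean_mx q i a - (i == a)%:R) * incr_mean_mx q' b j + (i == a)%:R * (incr_mean_mx q' b j - (b == j)%:R).
    by ring.
  rewrite (le_trans (ler_normD _ _))// (mulrDr (K * (1 + K * T))) lerD//.
    by rewrite normrM mulrAC ler_pM// ?near ?mle.
  rewrite normrM mulrAC -[leLHS]mulrC ler_pM ?near//.
  case: (i == a); rewrite ?normr1 ?normr0 ?lerDl//.
  by rewrite addr_ge0.
exists ((1 + K * T) ^+ 2 + K * (1 + K * T)) => [|q q' i j s qT qT'].
  by rewrite addr_ge0 ?exprn_ge0 ?mulr_ge0 ?addr_ge0.
have qq0 : 0 <= q + q' by rewrite addr_ge0//; [case/andP: qT|case/andP: qT'].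
rewrite /sandwich_coef; case: s.2; split.
- by rewrite (le_trans (prodle _ _ _ _ _ _ qT qT'))// lerDl mulr_ge0// addr_ge0.
- rewrite !m0 (le_trans (prodnear _ _ _ _ _ _ qT qT'))// ler_wpM2r// lerDr.
  by rewrite exprn_ge0 ?addr_ge0.
- by rewrite normrN (le_trans (prodle _ _ _ _ _ _ qT' qT))// lerDl mulr_ge0// addr_ge0.
- rewrite !m0 -opprD normrN (le_trans (prodnear _ _ _ _ _ _ qT' qT))// (addrC q') ler_wpM2r// lerDr.
  by rewrite exprn_ge0 ?addr_ge0.
Qed.

(** Comparison with the case of no outer increments, where both forms are 2 theta, whence the factor
    4. Moving the coefficients costs O(q1 + q2 + q3 + q4) times second moments of size O(t); the
    rest is the second order expansion of the mean of a product of two thetas. *)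
Lemma sandwich_mean : exists2 K : R, 0 <= K & forall q1 q2 q3 q4 t i j k l,
  0 <= q1 <= T -> 0 <= q2 <= T -> 0 <= q3 <= T -> 0 <= q4 <= T -> 0 <= t <= T ->
  `|incr_mean t (fun x => incr_form (sandwich_coef q1 q2 i j) x *
      incr_form (sandwich_coef q3 q4 k l) x) - 4 * (t * gram i j k l)| <=
  K * (q1 + q2 + q3 + q4 + t) * t.
Proof.
have [K K0 cle] := incr_coord_mean.
have [K1 K10 sle] := sandwich_coef_near.
have [K2 K20 tle] := theta_mean.
have lin t a b : 0 <= t <= T -> incr_mean t (fun x => incr_form a x * incr_form b x) =
    \sum_s \sum_s' a s * b s' * incr_mean t (fun x => incr_coord s x * incr_coord s' x).
  move=> /andP[t0 tT].
  have bs s s' : lie_bm (fun x => incr_coord s x * incr_coord s' x).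
    by apply: smooth_lie_bm; apply: smoothM; exact: smooth_incr_coord.
  have sf c : smooth G (incr_form c).
    by apply: smooth_sum => s; apply: smoothZ; exact: smooth_incr_coord.
  have := Ex_incr (lexx 0) t0 tT (smooth_lie_bm (smoothM (sf a) (sf b))).
  rewrite subr0 => <-.
  transitivity ('E (fun w => \sum_s \sum_s' a s * b s' *
      (incr_coord s (incr 0 t w) * incr_coord s' (incr 0 t w)))).
    apply: eq_Ex => w; rewrite /incr_form big_distrl/=; apply: eq_bigr => s _.
    by rewrite big_distrr/=; apply: eq_bigr => s' _; rewrite mulrACA.
  rewrite Ex_sum; last first.
    by move=> s; apply: bm_sum => s'; apply: bmZ; exact: (lie_bm_incr _ _ (bs s s')).
  apply: eq_bigr => s _; rewrite Ex_sum; last first.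
    by move=> s'; apply: bmZ; exact: (lie_bm_incr _ _ (bs s s')).
  apply: eq_bigr => s' _; rewrite ExZ; last exact: (lie_bm_incr _ _ (bs s s')).
  by rewrite (Ex_incr (lexx 0) t0 tT (bs s s')) subr0.
pose N : R := \sum_(s : slot) \sum_(s' : slot) 1.
have N0 : 0 <= N by apply: sumr_ge0 => s _; exact: sumr_ge0.
exists (N * (K1 * K1 * K) + 4 * K2) => [|q1 q2 q3 q4 t i j k l qT1 qT2 qT3 qT4 tT].
  by rewrite addr_ge0// mulr_ge0// !mulr_ge0.
have t0 : 0 <= t by case/andP: tT.
have q10 : 0 <= q1 by case/andP: qT1.
have q20 : 0 <= q2 by case/andP: qT2.
have q30 : 0 <= q3 by case/andP: qT3.
have q40 : 0 <= q4 by case/andP: qT4.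
have T00 : 0 <= (0 : R) <= T by rewrite lexx ltW.
set a := sandwich_coef q1 q2 i j; set b := sandwich_coef q3 q4 k l.
set a0 := sandwich_coef 0 0 i j; set b0 := sandwich_coef 0 0 k l.
have e0 : incr_mean t (fun x => incr_form a0 x * incr_form b0 x) =
    4 * incr_mean t (fun x => theta i j x * theta k l x).
  have bt : lie_bm (fun x => theta i j x * theta k l x).
    by apply: smooth_lie_bm; apply: smoothM; exact: smooth_theta.
  have tT' : t <= T by case/andP: tT.
  have := Ex_incr (lexx 0) t0 tT' bt; rewrite subr0 => <-.
  have bt4 : lie_bm (fun x => incr_form a0 x * incr_form b0 x).
    have := lie_bmM (lie_bm_cst 4) bt; congr lie_bm; apply/funext => x.
    by rewrite !sandwich_coef0; ring.
  have := Ex_incr (lexx 0) t0 tT' bt4; rewrite subr0 => <-.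
  rewrite -ExZ; last exact: (lie_bm_incr 0 t bt).
  by apply: eq_Ex => w; rewrite !sandwich_coef0; ring.
have a1 s : `|a s| <= K1 by have [] := sle q1 q2 i j s qT1 qT2.
have a2 s : `|a s - a0 s| <= K1 * (q1 + q2) by have [] := sle q1 q2 i j s qT1 qT2.
have b1 s : `|b s| <= K1 by have [] := sle q3 q4 k l s qT3 qT4.
have b2 s : `|b s - b0 s| <= K1 * (q3 + q4) by have [] := sle q3 q4 k l s qT3 qT4.
have a01 s : `|a0 s| <= K1 by have [] := sle 0 0 i j s T00 T00.
clearbody a b a0 b0.
have alg (x y z u : R) : y = 4 * z -> x - 4 * u = (x - y) + 4 * (z - u) by move=> ->; ring.
rewrite (alg _ _ _ _ e0).
rewrite (le_trans (ler_normD _ _))// (mulrDl (N * _)) (mulrDl (N * _ * _)) lerD//; last first.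
  rewrite normrM ger0_norm// -!mulrA ler_wpM2l// (le_trans (tle _ _ _ _ _ tT))// expr2.
  rewrite ler_wpM2l// ler_wpM2r// lerDr !addr_ge0//.
have -> : N * (K1 * K1 * K) * (q1 + q2 + q3 + q4 + t) * t =
    \sum_(s : slot) \sum_(s' : slot) K1 * K1 * K * (q1 + q2 + q3 + q4 + t) * t.
  rewrite -!(mulrA N) /N mulr_suml; apply: eq_bigr => s _.
  by rewrite mulr_suml; apply: eq_bigr => s' _; rewrite mul1r.
rewrite (lin t a b tT) (lin t a0 b0 tT) -sumrB (le_trans (ler_norm_sum _ _ _))//; apply: ler_sum => s _.
rewrite -sumrB (le_trans (ler_norm_sum _ _ _))//; apply: ler_sum => s' _.
rewrite -mulrBl normrM.
have -> : K1 * K1 * K * (q1 + q2 + q3 + q4 + t) * t =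
  (K1 * (q1 + q2 + q3 + q4 + t) * K1) * (K * t) by ring.
apply: ler_pM => //; last exact: cle.
have -> : a s * b s' - a0 s * b0 s' = (a s - a0 s) * b s' + a0 s * (b s' - b0 s') by ring.
rewrite (le_trans (ler_normD _ _))// !normrM.
apply: (@le_trans _ _ (K1 * (q1 + q2) * K1 + K1 * (K1 * (q3 + q4)))).
  by apply: lerD; apply: ler_pM.
have -> : K1 * (q1 + q2) * K1 + K1 * (K1 * (q3 + q4)) = K1 * (q1 + q2 + q3 + q4) * K1 by ring.
by rewrite ler_wpM2r// ler_wpM2l// lerDl.
Qed.

Lemma Ex_entry s t i j : 0 <= s -> s <= t -> t <= T ->
  'E (fun w => incr s t w i j) = incr_mean_mx (t - s) i j.
Proof.
move=> s0 st tT; rewrite -incr_mean_entry ?subr_ge0//.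
exact: (Ex_incr s0 st tT (smooth_lie_bm (smooth_entry G i j))).
Qed.

Lemma Ex_entryV s t i j : 0 <= s -> s <= t -> t <= T ->
  'E (fun w => invmx (incr s t w) i j) = incr_mean_mx (t - s) i j.
Proof.
move=> s0 st tT; rewrite -incr_mean_inv ?subr_ge0//.
exact: (Ex_incr s0 st tT (smooth_lie_bm (smooth_inv G i j))).
Qed.

Lemma bm_theta s t i j : bounded_measurable (fun w : W => theta i j (incr s t w)).
Proof. exact: (lie_bm_incr s t (smooth_lie_bm (smooth_theta i j))). Qed.

Lemma Ex_theta s t i j : 0 <= s -> s <= t -> t <= T ->
  'E (fun w => theta i j (incr s t w)) = 0.
Proof.
move=> s0 st tT; rewrite /theta ExZ; last first.
  apply: bmB; first exact: (lie_bm_incr s t (smooth_lie_bm (smooth_entry G i j))).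
  exact: (lie_bm_incr s t (smooth_lie_bm (smooth_inv G i j))).
rewrite ExB ?Ex_entry ?Ex_entryV ?subrr ?mulr0//.
  exact: (lie_bm_incr s t (smooth_lie_bm (smooth_entry G i j))).
exact: (lie_bm_incr s t (smooth_lie_bm (smooth_inv G i j))).
Qed.

(** * Covariances of midpoint terms over two intervals *)

Section FourTimes.
Variables a b c e : R.
Hypotheses (a0 : 0 <= a) (ab : a <= b) (bc : b <= c) (ce : c <= e) (eT : e <= T).

Let r (i : nat) : R := nth e [:: a; b; c] i.

Let rr i : (i < 3)%N -> r i <= r i.+1.
Proof. by case: i => [|[|[|]]]. Qed.

Let r0 : 0 <= r 0%N. Proof. by []. Qed.
Let r3 : r 3%N <= T. Proof. by []. Qed.

Let tens := tensor 3 r.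

Let t01 (P : pred nat) x y : P 0%N -> tens P (fun w => incr a b w x y).
Proof. by move=> P0; apply: (@tensor_incr 3 r P 0 1) => // -[]. Qed.
Let t12 (P : pred nat) x y : P 1%N -> tens P (fun w => incr b c w x y).
Proof. by move=> P0; apply: (@tensor_incr 3 r P 1 2) => // -[|[]]. Qed.
Let t23 (P : pred nat) x y : P 2%N -> tens P (fun w => incr c e w x y).
Proof. by move=> P0; apply: (@tensor_incr 3 r P 2 3) => // -[|[|[]]]. Qed.
Let v01 (P : pred nat) x y : P 0%N -> tens P (fun w => invmx (incr a b w) x y).
Proof. by move=> P0; apply: (@tensor_incrV 3 r P 0 1) => // -[]. Qed.
Let v12 (P : pred nat) x y : P 1%N -> tens P (fun w => invmx (incr b c w) x y).
Proof. by move=> P0; apply: (@tensor_incrV 3 r P 1 2) => // -[|[]]. Qed.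
Let v23 (P : pred nat) x y : P 2%N -> tens P (fun w => invmx (incr c e w) x y).
Proof. by move=> P0; apply: (@tensor_incrV 3 r P 2 3) => // -[|[|[]]]. Qed.

Let tens_half (P : pred nat) i j (A B : W -> 'M[R]_n) :
  (forall i j, tens P (fun w => A w i j)) -> (forall i j, tens P (fun w => B w i j)) ->
  tens P (fun w => 2^-1 * (A w i j - B w i j)).
Proof. by move=> tA tB; exact: (tensorZ 2^-1 (tensorB (tA i j) (tB i j))). Qed.

Let tens_cst (P : pred nat) (A : 'M[R]_n) i j : tens P (fun _ => A i j).
Proof. exact: tensor_cst. Qed.

(** Averages out an outer increment A on the left of the product; in the inverse its counterpart A'
    stands on the right and has the same mean. *)
Let half_left (P Q : pred nat) (A A' B B' : W -> 'M[R]_n) (Y : W -> R) (m : 'M[R]_n) i j :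
  (forall i, P i -> ~~ Q i) ->
  (forall i j, tens P (fun w => A w i j)) -> (forall i j, tens P (fun w => A' w i j)) ->
  (forall i j, 'E (fun w => A w i j) = m i j) -> (forall i j, 'E (fun w => A' w i j) = m i j) ->
  (forall i j, tens Q (fun w => B w i j)) -> (forall i j, tens Q (fun w => B' w i j)) ->
  tens Q Y ->
  'E (fun w => 2^-1 * ((A w *m B w) i j - (B' w *m A' w) i j) * Y w) =
  'E (fun w => 2^-1 * ((m *m B w) i j - (B' w *m m) i j) * Y w).
Proof.
move=> PQ tA tA' EA EA' tB tB' tY.
have half (U V : W -> R) : bounded_measurable U -> bounded_measurable V ->
    'E (fun w => 2^-1 * (U w - V w) * Y w) = 2^-1 * ('E (fun w => U w * Y w) - 'E (fun w => V w * Y w)).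
  move=> bU bV; have bY := tensor_bm tY.
  rewrite -ExB; [|exact: bmM|exact: bmM].
  rewrite -ExZ; first by apply: eq_Ex => w; rewrite -mulrA mulrBl.
  by apply: bmB; exact: bmM.
have bmul (D D' : pred nat) (U V : W -> 'M[R]_n) : (forall i j, tens D (fun w => U w i j)) ->
    (forall i j, tens D' (fun w => V w i j)) -> bounded_measurable (fun w => (U w *m V w) i j).
  move=> tU tV; apply: (@tensor_bm 3 r xpredT).
  by apply: tensor_mulmx => x y; [exact: tensor_sub (tU x y)|exact: tensor_sub (tV x y)].
rewrite half; [|exact: bmul tA tB|exact: bmul tB' tA'].
rewrite half; [|exact: (bmul Q Q (fun=> m))|exact: (bmul Q Q _ (fun=> m))].
rewrite (Ex_mean_left i j rr r0 r3 PQ tA EA tB tY).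
by rewrite (Ex_mean_right i j rr r0 r3 PQ tA' EA' tB' tY).
Qed.

Let half_right (P Q : pred nat) (A A' B B' : W -> 'M[R]_n) (Y : W -> R) (m : 'M[R]_n) i j :
  (forall i, P i -> ~~ Q i) ->
  (forall i j, tens P (fun w => A w i j)) -> (forall i j, tens P (fun w => A' w i j)) ->
  (forall i j, 'E (fun w => A w i j) = m i j) -> (forall i j, 'E (fun w => A' w i j) = m i j) ->
  (forall i j, tens Q (fun w => B w i j)) -> (forall i j, tens Q (fun w => B' w i j)) ->
  tens Q Y ->
  'E (fun w => 2^-1 * ((B w *m A w) i j - (A' w *m B' w) i j) * Y w) =
  'E (fun w => 2^-1 * ((B w *m m) i j - (m *m B' w) i j) * Y w).
Proof.
move=> PQ tA tA' EA EA' tB tB' tY.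
have /(congr1 -%R) := half_left i j PQ tA' tA EA' EA tB' tB tY.
have opp (U V : W -> R) : bounded_measurable (fun w => 2^-1 * (V w - U w) * Y w) ->
    'E (fun w => 2^-1 * (U w - V w) * Y w) = - 'E (fun w => 2^-1 * (V w - U w) * Y w).
  by move=> bUV; rewrite -mulN1r -ExZ//; apply: eq_Ex => w; ring.
have bmul (D D' : pred nat) (U V : W -> 'M[R]_n) : (forall i j, tens D (fun w => U w i j)) ->
    (forall i j, tens D' (fun w => V w i j)) -> bounded_measurable (fun w => (U w *m V w) i j).
  move=> tU tV; apply: (@tensor_bm 3 r xpredT).
  by apply: tensor_mulmx => x y; [exact: tensor_sub (tU x y)|exact: tensor_sub (tV x y)].
have bY := tensor_bm tY.
rewrite -opp; last first.
  by apply: bmM => //; apply: bmZ; apply: bmB; [exact: bmul tA' tB'|exact: bmul tB tA].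
rewrite -opp//.
apply: bmM => //; apply: bmZ; apply: bmB; first exact: (bmul Q Q (fun=> m)).
exact: (bmul Q Q _ (fun=> m)).
Qed.

Let incrM s t u (w : W) : incr s u w = incr s t w *m incr t u w.
Proof. exact: incrD. Qed.

Let invM s t u (w : W) : invmx (incr s u w) = invmx (incr t u w) *m invmx (incr s t w).
Proof. by rewrite !incrV -incrD. Qed.

Let theta_final q1 q2 q3 q4 i j k l :
  'E (fun w => 2^-1 * ((incr_mean_mx q1 *m incr b c w *m incr_mean_mx q2) i j -
                       (incr_mean_mx q2 *m invmx (incr b c w) *m incr_mean_mx q1) i j) *
               (2^-1 * ((incr_mean_mx q3 *m incr b c w *m incr_mean_mx q4) k l -
                       (incr_mean_mx q4 *m invmx (incr b c w) *m incr_mean_mx q3) k l))) =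
  4^-1 * incr_mean (c - b) (fun x => incr_form (sandwich_coef q1 q2 i j) x *
    incr_form (sandwich_coef q3 q4 k l) x).
Proof.
have sf q : smooth G (incr_form q).
  by apply: smooth_sum => s; apply: smoothZ; exact: smooth_incr_coord.
have bf q q' := smooth_lie_bm (smoothM (sf q) (sf q')).
rewrite -(Ex_incr (le_trans a0 ab) bc (le_trans ce eT) (bf _ _)).
rewrite -ExZ; last exact: (lie_bm_incr b c (bf _ _)).
apply: eq_Ex => w; rewrite !incr_form_sandwich.
have alg (x y z u : R) : 2^-1 * (x - y) * (2^-1 * (z - u)) = 4^-1 * ((x - y) * (z - u)) by field.
exact: alg.
Qed.

Let mean0 : incr_mean_mx 0 = 1%:M.
Proof. by rewrite /incr_mean_mx mul0r scale0r expmx0. Qed.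

Lemma cov_disjoint i j k l :
  'E (fun w => theta i j (incr a b w) * theta k l (incr c e w)) = 0.
Proof.
have tI : tens (pred1 0%N) (fun w => theta i j (incr a b w)).
  by apply: tens_half => x y; [exact: t01|exact: v01].
have tJ : tens (pred1 2%N) (fun w => theta k l (incr c e w)).
  by apply: tens_half => x y; [exact: t23|exact: v23].
rewrite (tensor_indep rr r0 r3 _ tI tJ); last by move=> x /eqP ->.
by rewrite Ex_theta ?mul0r// (le_trans bc)// (le_trans ce).
Qed.

(** The intervals [a, c] and [b, e] share [b, c]. The increment over [a, b] is averaged out of the
    first factor and the one over [c, e] out of the second, which leaves one mean over the common
    increment. *)
Lemma cov_shifted i j k l :
  'E (fun w => theta i j (incr a c w) * theta k l (incr b e w)) =
  4^-1 * incr_mean (c - b) (fun x => incr_form (sandwich_coef (b - a) 0 i j) x *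
    incr_form (sandwich_coef 0 (e - c) k l) x).
Proof.
have bT : b <= T by rewrite (le_trans bc)// (le_trans ce).
have b0 : 0 <= b by exact: le_trans ab.
have c0 : 0 <= c by exact: le_trans bc.
rewrite -theta_final mean0.
transitivity ('E (fun w => 2^-1 * ((incr a b w *m incr b c w) i j -
    (invmx (incr b c w) *m invmx (incr a b w)) i j) * theta k l (incr b e w))).
  by apply: eq_Ex => w; rewrite /theta (invM a b c w) (incrM a b c).
rewrite (@half_left (pred1 0%N) (fun i => (0 < i)%N) (incr a b) (fun w => invmx (incr a b w)) (incr b c)
  (fun w => invmx (incr b c w)) (fun w => theta k l (incr b e w)) (incr_mean_mx (b - a))) //; last first.
- rewrite /theta; apply: tens_half => x y.
    by apply: (@tensor_incr 3 r _ 1 3) => // l' /andP[].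
  by apply: (@tensor_incrV 3 r _ 1 3) => // l' /andP[].
- by move=> x y; exact: v12.
- by move=> x y; exact: t12.
- by move=> x y; exact: Ex_entryV.
- by move=> x y; exact: Ex_entry.
- by move=> x y; exact: v01.
- by move=> x y; exact: t01.
- by move=> x /eqP ->.
pose Z (w : W) := 2^-1 * ((incr_mean_mx (b - a) *m incr b c w) i j -
  (invmx (incr b c w) *m incr_mean_mx (b - a)) i j).
transitivity ('E (fun w => 2^-1 * ((incr b c w *m incr c e w) k l -
    (invmx (incr c e w) *m invmx (incr b c w)) k l) * Z w)).
  by apply: eq_Ex => w; rewrite mulrC /theta (invM b c e w) (incrM b c e).
rewrite (@half_right (pred1 2%N) (pred1 1%N) (incr c e) (fun w => invmx (incr c e w)) (incr b c)
  (fun w => invmx (incr b c w)) Z (incr_mean_mx (e - c))) //; last first.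
- apply: tens_half => x y; apply: tensor_mulmx => x' y'; do ?exact: tens_cst; [exact: t12|exact: v12].
- by move=> x y; exact: v12.
- by move=> x y; exact: t12.
- by move=> x y; exact: Ex_entryV.
- by move=> x y; exact: Ex_entry.
- by move=> x y; exact: v23.
- by move=> x y; exact: t23.
- by move=> x /eqP ->.
by apply: eq_Ex => w; rewrite mulrC /Z !mulmx1 !mul1mx.
Qed.

(** Here both outer increments, over [a, b] and [c, e], belong to the first factor. *)
Lemma cov_nested i j k l :
  'E (fun w => theta i j (incr a e w) * theta k l (incr b c w)) =
  4^-1 * incr_mean (c - b) (fun x => incr_form (sandwich_coef (b - a) (e - c) i j) x *
    incr_form (sandwich_coef 0 0 k l) x).
Proof.
have bT : b <= T by rewrite (le_trans bc)// (le_trans ce).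
have b0 : 0 <= b by exact: le_trans ab.
have c0 : 0 <= c by exact: le_trans bc.
have tY : tens (pred1 1%N) (fun w => theta k l (incr b c w)).
  by rewrite /theta; apply: tens_half => x y; [exact: t12|exact: v12].
rewrite -theta_final mean0.
transitivity ('E (fun w => 2^-1 * ((incr a b w *m incr b e w) i j -
    (invmx (incr b e w) *m invmx (incr a b w)) i j) * theta k l (incr b c w))).
  by apply: eq_Ex => w; rewrite /theta (invM a b e w) (incrM a b e).
rewrite (@half_left (pred1 0%N) (fun i => (0 < i)%N) (incr a b) (fun w => invmx (incr a b w)) (incr b e)
  (fun w => invmx (incr b e w)) (fun w => theta k l (incr b c w)) (incr_mean_mx (b - a))) //; last first.
- by apply: tensor_sub tY => x /eqP ->.
- by move=> x y; apply: (@tensor_incrV 3 r _ 1 3) => // l' /andP[].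
- by move=> x y; apply: (@tensor_incr 3 r _ 1 3) => // l' /andP[].
- by move=> x y; exact: Ex_entryV.
- by move=> x y; exact: Ex_entry.
- by move=> x y; exact: v01.
- by move=> x y; exact: t01.
- by move=> x /eqP ->.
transitivity ('E (fun w => 2^-1 * (((incr_mean_mx (b - a) *m incr b c w) *m incr c e w) i j -
    (invmx (incr c e w) *m (invmx (incr b c w) *m incr_mean_mx (b - a))) i j) * theta k l (incr b c w))).
  by apply: eq_Ex => w; rewrite (invM b c e w) (incrM b c e) !mulmxA.
rewrite (@half_right (pred1 2%N) (pred1 1%N) (incr c e) (fun w => invmx (incr c e w))
  (fun w => incr_mean_mx (b - a) *m incr b c w) (fun w => invmx (incr b c w) *m incr_mean_mx (b - a))
  (fun w => theta k l (incr b c w)) (incr_mean_mx (e - c))) //; last first.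
- by move=> x y; apply: tensor_mulmx => x' y'; [exact: v12|exact: tens_cst].
- by move=> x y; apply: tensor_mulmx => x' y'; [exact: tens_cst|exact: t12].
- by move=> x y; exact: Ex_entryV.
- by move=> x y; exact: Ex_entry.
- by move=> x y; exact: v23.
- by move=> x y; exact: t23.
- by move=> x /eqP ->.
by apply: eq_Ex => w; rewrite !mulmx1 !mul1mx !mulmxA.
Qed.

End FourTimes.

(** By symmetry s1 <= s2, which leaves the disjoint, shifted and nested positions. The overlap
    itself is a factor of the error, so summing over all pairs of cells of two partitions costs only
    the two meshes times the total overlap. *)
Lemma cov_overlap : exists2 K : R, 0 <= K & forall i j k l s1 t1 s2 t2,
  0 <= s1 -> s1 <= t1 -> t1 <= T -> 0 <= s2 -> s2 <= t2 -> t2 <= T ->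
  `|'E (fun w => theta i j (incr s1 t1 w) * theta k l (incr s2 t2 w)) -
    overlap s1 t1 s2 t2 * gram i j k l| <=
  K * ((t1 - s1) + (t2 - s2)) * overlap s1 t1 s2 t2.
Proof.
have [K K0 h] := sandwich_mean.
exists K => // i j k l s1 t1 s2 t2.
wlog s12 : i j k l s1 t1 s2 t2 / s1 <= s2.
  move=> wl s10 st1 tT1 s20 st2 tT2.
  have [s12|/ltW s21] := leP s1 s2; first exact: wl.
  have := wl k l i j s2 t2 s1 t1 s21 s20 st2 tT2 s10 st1 tT1.
  have -> : gram k l i j = gram i j k l by apply: eq_bigr => m _; rewrite mulrC.
  rewrite (overlapC st2 st1) (addrC (t2 - s2)).
  have -> // : 'E (fun w => theta k l (incr s2 t2 w) * theta i j (incr s1 t1 w)) =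
    'E (fun w => theta i j (incr s1 t1 w) * theta k l (incr s2 t2 w)).
  by apply: eq_Ex => w; rewrite mulrC.
move=> s10 st1 tT1 s20 st2 tT2.
have [ts|/ltW st21] := leP t1 s2.
  by rewrite (overlap_disjoint st1 ts st2) cov_disjoint// !mul0r subr0 mulr0 normr0.
have quarter (x y z u v : R) : `|x - 4 * y| <= K * u * v -> u * v <= z * v * 4 -> `|4^-1 * x - y| <= K * z * v.
  move=> h1 h2; have -> : 4^-1 * x - y = 4^-1 * (x - 4 * y) by field.
  rewrite normrM ger0_norm// ler_pdivrMl// (le_trans h1)//.
  have -> : 4 * (K * z * v) = K * (z * v * 4) by ring.
  by rewrite -mulrA ler_wpM2l.
have zT : 0 <= (0 : R) <= T by rewrite lexx ltW.
have [tt|/ltW tt] := leP t1 t2.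
  rewrite (overlap_shifted s12 st21 tt) cov_shifted//; apply: quarter; first apply: h => //; try by apply/andP; split; lra.
  rewrite [leRHS]mulrAC; apply: ler_wpM2r; lra.
rewrite (overlap_nested s12 st2 tt) cov_nested//; apply: quarter; first apply: h => //; try by apply/andP; split; lra.
rewrite [leRHS]mulrAC; apply: ler_wpM2r; lra.
Qed.

Definition fine_times (r : nat -> R) (m : nat) (s t delta : R) : Prop :=
  [/\ r 0%N = s, r m = t, 0 <= s, t <= T &
      forall q, (q < m)%N -> r q <= r q.+1 /\ r q.+1 <= r q + delta].

Lemma fine_times_mono r m s t delta : fine_times r m s t delta ->
  forall u q, (u <= q)%N -> (q <= m)%N -> r u <= r q.
Proof.
move=> [_ _ _ _ h] u; elim=> [|q IH]; first by rewrite leqn0 => /eqP ->.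
rewrite leq_eqVlt => /orP[/eqP ->//|]; rewrite ltnS => uq qm.
by rewrite (le_trans (IH uq (ltnW qm)))//; have [] := h q qm.
Qed.

Lemma fine_times_range r m s t delta : fine_times r m s t delta ->
  s <= t /\ forall q, (q <= m)%N -> 0 <= r q /\ r q <= T.
Proof.
move=> ft; have mono := fine_times_mono ft; have [r0 rm s0 tT h] := ft.
split; first by rewrite -r0 -rm mono.
move=> q qm; split; first by rewrite (le_trans s0)// -r0 mono.
by rewrite (le_trans _ tT)// -rm mono.
Qed.

Definition theta_sum (r : nat -> R) (m : nat) i j (w : W) : R :=
  \sum_(q < m) theta i j (incr (r q) (r q.+1) w).

Lemma bm_theta_sum r m i j : bounded_measurable (theta_sum r m i j).
Proof. by apply: bm_sum => q; exact: bm_theta. Qed.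

Lemma cov_theta_sum : exists2 K : R, 0 <= K & forall i j k l r m s t delta r' m' s' t' delta',
  fine_times r m s t delta -> fine_times r' m' s' t' delta' ->
  `|'E (fun w => theta_sum r m i j w * theta_sum r' m' k l w) -
    overlap s t s' t' * gram i j k l| <= K * (delta + delta') * overlap s t s' t'.
Proof.
have [K K0 h] := cov_overlap; exists K => // i j k l r m s t delta r' m' s' t' delta' ft ft'.
have [st rng] := fine_times_range ft; have [st' rng'] := fine_times_range ft'.
have [r0 rm s0 tT step] := ft; have [r0' rm' s0' tT' step'] := ft'.
have ovE : overlap s t s' t' =
    \sum_(q < m) \sum_(q' < m') overlap (r q) (r q.+1) (r' q') (r' q'.+1).
  under eq_bigr do rewrite overlap_sum r0' rm'.
  transitivity (\sum_(q < m) overlap s' t' (r q) (r q.+1)).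
    by rewrite overlap_sum r0 rm overlapC.
  by apply: eq_bigr => q _; rewrite overlapC//; have [] := step q (ltn_ord q).
have EE : 'E (fun w => theta_sum r m i j w * theta_sum r' m' k l w) =
    \sum_(q < m) \sum_(q' < m') 'E (fun w => theta i j (incr (r q) (r q.+1) w) *
      theta k l (incr (r' q') (r' q'.+1) w)).
  transitivity ('E (fun w => \sum_(q < m) \sum_(q' < m') theta i j (incr (r q) (r q.+1) w) *
      theta k l (incr (r' q') (r' q'.+1) w))).
    apply: eq_Ex => w; rewrite /theta_sum big_distrl/=; apply: eq_bigr => q _.
    by rewrite big_distrr.
  rewrite Ex_sum => [|q]; last by apply: bm_sum => q'; apply: bmM; exact: bm_theta.
  by apply: eq_bigr => q _; rewrite Ex_sum// => q'; apply: bmM; exact: bm_theta.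
rewrite EE ovE mulr_suml -sumrB (le_trans (ler_norm_sum _ _ _))// mulr_sumr.
apply: ler_sum => q _; have qm := ltn_ord q.
rewrite mulr_suml -sumrB (le_trans (ler_norm_sum _ _ _))// mulr_sumr.
apply: ler_sum => q' _; have qm' := ltn_ord q'.
have [a1 a2] := step q qm; have [b1 b2] := step' q' qm'.
have [r1 _] := rng q (ltnW qm); have [_ r2] := rng q.+1 qm.
have [r1' _] := rng' q' (ltnW qm'); have [_ r2'] := rng' q'.+1 qm'.
apply: (le_trans (h i j k l _ _ _ _ r1 a1 r2 r1' b1 r2')).
have [ov0 _ _] := overlap_bounds a1 b1.
by apply: ler_wpM2r => //; apply: ler_wpM2l => //; apply: lerD; rewrite lerBlDl.
Qed.

Implicit Types L : 'I_n -> 'I_n -> R.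

Definition lin L (A : 'M[R]_n) : R := \sum_i \sum_j L i j * A i j.

Definition lin_sum L (r : nat -> R) (m : nat) (w : W) : R :=
  \sum_(q < m) lin L (\matrix_(i, j) theta i j (incr (r q) (r q.+1) w)).

Lemma lin_sumE L r m w : lin_sum L r m w = \sum_i \sum_j L i j * theta_sum r m i j w.
Proof.
rewrite /lin_sum /lin exchange_big/=; apply: eq_bigr => i _.
rewrite exchange_big/=; apply: eq_bigr => j _; rewrite /theta_sum mulr_sumr.
by apply: eq_bigr => q _; rewrite mxE.
Qed.

Lemma bm_lin_sum L r m : bounded_measurable (lin_sum L r m).
Proof.
rewrite (_ : lin_sum L r m = fun w => \sum_i \sum_j L i j * theta_sum r m i j w); last first.
  by apply/funext => w; exact: lin_sumE.
by apply: bm_sum => i; apply: bm_sum => j; apply: bmZ; exact: bm_theta_sum.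
Qed.

Definition lin_gram L L' : R := \sum_m lin L (E m) * lin L' (E m).

Lemma lin_gramE L L' : lin_gram L L' =
  \sum_i \sum_j \sum_k \sum_l L i j * L' k l * gram i j k l.
Proof.
have lin2 m : lin L (E m) * lin L' (E m) =
    \sum_i \sum_j \sum_k \sum_l L i j * L' k l * (E m i j * E m k l).
  rewrite /lin mulr_suml; apply: eq_bigr => i _; rewrite mulr_suml; apply: eq_bigr => j _.
  rewrite mulr_sumr; apply: eq_bigr => k _; rewrite mulr_sumr; apply: eq_bigr => l _.
  by rewrite mulrACA.
rewrite /lin_gram; under eq_bigr do rewrite lin2.
rewrite exchange_big/=; apply: eq_bigr => i _; rewrite exchange_big/=; apply: eq_bigr => j _.
rewrite exchange_big/=; apply: eq_bigr => k _; rewrite exchange_big/=; apply: eq_bigr => l _.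
by rewrite /gram mulr_sumr.
Qed.

Lemma cov_lin_sum L L' : exists2 K : R, 0 <= K & forall r m s t delta r' m' s' t' delta',
  fine_times r m s t delta -> fine_times r' m' s' t' delta' ->
  `|'E (fun w => lin_sum L r m w * lin_sum L' r' m' w) -
    overlap s t s' t' * lin_gram L L'| <= K * (delta + delta') * overlap s t s' t'.
Proof.
have [K K0 h] := cov_theta_sum.
exists (\sum_i \sum_j \sum_k \sum_l `|L i j * L' k l| * K) => [|r m s t delta r' m' s' t' delta' ft ft'].
  by do 4 (apply: sumr_ge0 => ? _); rewrite mulr_ge0.
have -> : 'E (fun w => lin_sum L r m w * lin_sum L' r' m' w) =
    \sum_i \sum_j \sum_k \sum_l L i j * L' k l * 'E (fun w => theta_sum r m i j w * theta_sum r' m' k l w).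
  have bb i j k l : bounded_measurable (fun w => L i j * L' k l * (theta_sum r m i j w * theta_sum r' m' k l w)).
    by apply: bmZ; apply: bmM; exact: bm_theta_sum.
  transitivity ('E (fun w => \sum_i \sum_j \sum_k \sum_l
      L i j * L' k l * (theta_sum r m i j w * theta_sum r' m' k l w))).
    apply: eq_Ex => w; rewrite !lin_sumE mulr_suml; apply: eq_bigr => i _; rewrite mulr_suml; apply: eq_bigr => j _.
    rewrite mulr_sumr; apply: eq_bigr => k _; rewrite mulr_sumr; apply: eq_bigr => l _.
    by rewrite mulrACA.
  rewrite Ex_sum => [|i]; last by do 3 (apply: bm_sum => ?).
  apply: eq_bigr => i _; rewrite Ex_sum => [|j]; last by do 2 (apply: bm_sum => ?).
  apply: eq_bigr => j _; rewrite Ex_sum => [|k]; last by apply: bm_sum => ?.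
  apply: eq_bigr => k _; rewrite Ex_sum//.
  by apply: eq_bigr => l _; rewrite ExZ//; apply: bmM; exact: bm_theta_sum.
rewrite lin_gramE mulr_sumr -sumrB (le_trans (ler_norm_sum _ _ _))// -mulrA mulr_suml; apply: ler_sum => i _.
rewrite mulr_sumr -sumrB (le_trans (ler_norm_sum _ _ _))// mulr_suml; apply: ler_sum => j _.
rewrite mulr_sumr -sumrB (le_trans (ler_norm_sum _ _ _))// mulr_suml; apply: ler_sum => k _.
rewrite mulr_sumr -sumrB (le_trans (ler_norm_sum _ _ _))// mulr_suml; apply: ler_sum => l _.
rewrite mulrCA -mulrBr normrM -mulrA ler_wpM2l// mulrA.
exact: h ft ft'.
Qed.

(** The Cauchy estimate. The square expands into three covariances whose leading terms add up to the
    length of the symmetric difference of [s, t] and [s', t']; the remainders are of the order of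
    the meshes. *)
Lemma sq_diff_lin_sum L : exists2 K : R, 0 <= K & forall r m s t delta r' m' s' t' delta',
  0 <= delta -> 0 <= delta' ->
  fine_times r m s t delta -> fine_times r' m' s' t' delta' ->
  'E (fun w => (lin_sum L r m w - lin_sum L r' m' w) ^+ 2) <=
  K * (`|s - s'| + `|t - t'| + (delta + delta') * ((t - s) + (t' - s'))).
Proof.
have [K K0 h] := cov_lin_sum L L; set g := lin_gram L L.
have g0 : 0 <= g by apply: sumr_ge0 => m _; rewrite -expr2 sqr_ge0.
exists (g + 4 * K) => [|r m s t delta r' m' s' t' delta' d0 d0' ft ft'].
  by rewrite addr_ge0// mulr_ge0.
have [st _] := fine_times_range ft; have [st' _] := fine_times_range ft'.
have b := bm_lin_sum L r m; have b' := bm_lin_sum L r' m'.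
set X := lin_sum L r m; set X' := lin_sum L r' m'.
have -> : 'E (fun w => (X w - X' w) ^+ 2) =
    'E (fun w => X w * X w) - 2 * 'E (fun w => X w * X' w) + 'E (fun w => X' w * X' w).
  rewrite -ExZ; last exact: bmM.
  rewrite -ExB; [|exact: bmM|by apply: bmZ; exact: bmM].
  rewrite -ExD; [|by apply: bmB; [|apply: bmZ]; exact: bmM|exact: bmM].
  by apply: eq_Ex => w; ring.
have := h _ _ _ _ _ _ _ _ _ _ ft ft; have := h _ _ _ _ _ _ _ _ _ _ ft ft'.
have := h _ _ _ _ _ _ _ _ _ _ ft' ft'.
rewrite -/X -/X' -/g (overlap_nested (lexx s') st' (lexx t')) (overlap_nested (lexx s) st (lexx t)).
have [ov0 ov1 ov2] := overlap_bounds st st'.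
have od := overlap_dist st st'.
move: ov0 ov1 ov2 od; set v := overlap s t s' t' => ov0 ov1 ov2 od.
have n0 : 0 <= `|s - s'| + `|t - t'| by exact: addr_ge0.
move: n0 od; set D := `|s - s'| + `|t - t'| => n0 od.
have ts : 0 <= t - s by rewrite subr_ge0.
have ts' : 0 <= t' - s' by rewrite subr_ge0.
move: (t - s) (t' - s') ts ts' ov1 ov2 od => a a' a0 a0' ov1 ov2 od.
rewrite !ler_norml => /andP[_ h3] /andP[h2 _] /andP[_ h1].
move: ('E _) ('E _) ('E _) h1 h2 h3 => x y z.
have e1 : g * (a + a' - 2 * v) <= g * D by exact: ler_wpM2l.
have e2 : K * (delta + delta') * v <= K * (delta + delta') * a.
  by rewrite ler_wpM2l// mulr_ge0// addr_ge0.
have e3 : K * (delta + delta') * v <= K * (delta + delta') * a'.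
  by rewrite ler_wpM2l// mulr_ge0// addr_ge0.
have e4 : 0 <= K * delta * a' by rewrite !mulr_ge0.
have e5 : 0 <= K * delta' * a by rewrite !mulr_ge0.
have e6 : 0 <= K * delta * a by rewrite !mulr_ge0.
have e7 : 0 <= K * delta' * a' by rewrite !mulr_ge0.
have e8 : 0 <= g * ((delta + delta') * (a + a')) by rewrite !mulr_ge0// addr_ge0.
have e9 : 0 <= K * D by rewrite !mulr_ge0.
move: e1 e2 e3 e4 e5 e6 e7 e8 e9; clear.
move: (g : R) D v => {}g D v *; lra.
Qed.

(** * The Brownian motion in the Lie algebra *)

Lemma sq_integral_Ex (X : W -> R) : bounded_measurable X ->
  sq_integral mu X = ('E (fun w => X w ^+ 2))%:E.
Proof.
move=> bX; rewrite /sq_integral /Ex /Rintegral fineK//.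
have : mu.-integrable setT (EFin \o (fun w => X w ^+ 2)).
  apply: bm_integrable; under eq_fun do rewrite expr2; exact: bmM.
exact: integrable_fin_num.
Qed.

(** The mesh 4^-N turns the Cauchy estimate into the rate needed for almost sure convergence.
    [idx N t] counts the cells that end before or at t. *)
Let grid (N q : nat) : R := T * q%:R * 4^-1 ^+ N.
Let gap (N : nat) : R := T * 4^-1 ^+ N.
Let idx (N : nat) (t : R) : nat := Num.truncn (t / gap N).

Let gap_gt0 N : 0 < gap N.
Proof. by rewrite mulr_gt0// exprn_gt0. Qed.

Let gridE N q : grid N q = q%:R * gap N.
Proof. by rewrite /grid /gap mulrAC mulrC. Qed.

Let grid_idx N t : 0 <= t -> grid N (idx N t) <= t /\ t - gap N <= grid N (idx N t).
Proof.
move=> t0; have t1 : 0 <= t / gap N by rewrite divr_ge0// ltW.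
have /andP[h1 h2] := truncn_itv t1.
rewrite gridE; split; first by rewrite -ler_pdivlMr.
move: h2; rewrite ltr_pdivrMr// -natr1 mulrDl mul1r => /ltW h2.
by rewrite lerBlDr.
Qed.

Let fine_grid N t : 0 <= t <= T ->
  fine_times (grid N) (idx N t) 0 (grid N (idx N t)) (gap N).
Proof.
move=> /andP[t0 tT]; split => //; first by rewrite gridE mul0r.
  by have [h _] := grid_idx N t0; exact: le_trans tT.
move=> q _; rewrite !gridE -natr1 mulrDl mul1r; split => //.
by rewrite lerDl ltW.
Qed.

Let idx_mono N s t : 0 <= s -> s <= t -> (idx N s <= idx N t)%N.
Proof.
move=> s0 st; apply: le_truncn; apply: ler_wpM2r => //.
by rewrite invr_ge0 ltW.
Qed.

Let fine_grid2 N s t : 0 <= s -> s <= t -> t <= T ->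
  fine_times (fun q => grid N (idx N s + q)%N) (idx N t - idx N s)
    (grid N (idx N s)) (grid N (idx N t)) (gap N).
Proof.
move=> s0 st tT; have tT' : 0 <= t <= T by rewrite tT (le_trans s0).
have [_ _ _ h1 h2] := fine_grid N tT'.
split => //; [by rewrite addn0|by rewrite subnKC// idx_mono|by rewrite gridE mulr_ge0// ltW|].
by move=> q qm; rewrite addnS; apply: h2; rewrite -ltn_subRL.
Qed.

Let lin_sum_diff L N s t w : 0 <= s -> s <= t ->
  lin_sum L (fun q => grid N (idx N s + q)%N) (idx N t - idx N s) w =
  lin_sum L (grid N) (idx N t) w - lin_sum L (grid N) (idx N s) w.
Proof.
move=> s0 st; have := idx_mono N s0 st => ist; rewrite /lin_sum.
pose F q := lin L (\matrix_(i, j) theta i j (incr (grid N q) (grid N q.+1) w)).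
rewrite -(big_mkord xpredT (fun q => lin L (\matrix_(i, j) theta i j (incr (grid N q) (grid N q.+1) w)))).
rewrite -(big_mkord xpredT F) (big_cat_nat (n := idx N s))//=.
rewrite addrAC subrr add0r -[in RHS](add0n (idx N s)) big_addn -/F big_mkord.
by apply: eq_bigr => q _; rewrite /F addnS (addnC q).
Qed.

Let gap_cvg0 (e : R) : 0 < e -> exists N0, forall N, (N0 <= N)%N -> gap N <= e.
Proof.
move=> e0; have te : 0 <= T / e by rewrite divr_ge0// ltW.
exists (Num.truncn (T / e)).+1 => N hN.
have /andP[_ h2] := truncn_itv te.
rewrite /gap exprVn ler_pdivrMr ?exprn_gt0//.
rewrite -ler_pdivrMl// mulrC (le_trans (ltW h2))// -natrX ler_nat.
by rewrite (leq_trans hN)// ltnW// ltn_expl.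
Qed.

Lemma lin_delta i j (A : 'M[R]_n) :
  lin (fun a b => ((a == i) && (b == j))%:R) A = A i j.
Proof.
rewrite /lin (bigD1 i)//= (bigD1 j)//= !eqxx mul1r !big1 ?addr0// => [a ai|b bj].
  by rewrite big1// => b _; rewrite (negbTE ai) mul0r.
by rewrite (negbTE bj) andbF mul0r.
Qed.

Let brown_exists t : 0 <= t <= T -> exists B : W -> 'M[R]_n,
  (forall i j, measurable_fun setT (fun w => B w i j)) /\
  \forall w \ae mu, forall i j, theta_sum (grid N) (idx N t) i j w @[N --> \oo] --> B w i j.
Proof.
move=> tT; have [t0 tT'] := andP tT.
have ent i j : exists2 B : W -> R, measurable_fun setT B &
    \forall w \ae mu, theta_sum (grid N) (idx N t) i j w @[N --> \oo] --> B w.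
  have [K K0 hK] := sq_diff_lin_sum (fun a b => ((a == i) && (b == j))%:R).
  have tE r m w : lin_sum (fun a b => ((a == i) && (b == j))%:R) r m w = theta_sum r m i j w.
    by apply: eq_bigr => q _; rewrite lin_delta mxE.
  apply: (@ae_limit _ _ _ mu (fun N => theta_sum (grid N) (idx N t) i j) (K * (2 * T + 4 * T * T))).
    by move=> N; have [] := bm_theta_sum (grid N) (idx N t) i j.
  move=> N; rewrite sq_integral_Ex ?lee_fin; last by apply: bmB; exact: bm_theta_sum.
  have h := hK _ _ _ _ _ _ _ _ _ _ (ltW (gap_gt0 N.+1)) (ltW (gap_gt0 N)) (fine_grid N.+1 tT) (fine_grid N tT).
  rewrite (_ : 'E _ = 'E (fun w => (lin_sum (fun a b => ((a == i) && (b == j))%:R) (grid N.+1) (idx N.+1 t) w -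
    lin_sum (fun a b => ((a == i) && (b == j))%:R) (grid N) (idx N t) w) ^+ 2)); last first.
    by apply: eq_Ex => w; rewrite !tE.
  apply: (le_trans h); rewrite -mulrA ler_wpM2l// subrr normr0 add0r.
  have [a1 a2] := grid_idx N t0; have [b1 b2] := grid_idx N.+1 t0.
  have gg : gap N.+1 <= gap N.
    rewrite /gap ler_wpM2l ?(ltW T0)// exprS ler_piMl ?exprn_ge0// invf_le1//.
    by rewrite ler1n.
  have g0 := gap_gt0 N; have g1 := gap_gt0 N.+1.
  have -> : (2 * T + 4 * T * T) * 4^-1 ^+ N = 2 * gap N + (gap N + gap N) * (T + T).
    by rewrite /gap; ring.
  have e1 : `|grid N.+1 (idx N.+1 t) - grid N (idx N t)| <= 2 * gap N.
    rewrite ler_norml; apply/andP; split; lra.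
  apply: lerD => //; rewrite !subr0; apply: ler_pM => //.
  - by rewrite addr_ge0// ltW.
  - by rewrite addr_ge0// gridE mulr_ge0// ltW.
  - by rewrite lerD.
  - by apply: lerD; exact: le_trans tT'.
pose B i j := sval (cid2 (ent i j)).
have hB i j : measurable_fun setT (B i j) /\
    \forall w \ae mu, theta_sum (grid N) (idx N t) i j w @[N --> \oo] --> B i j w.
  by rewrite /B; case: cid2.
exists (fun w => \matrix_(i, j) B i j w); split => [i j|].
  by under eq_fun do rewrite mxE; have [] := hB i j.
have : \forall w \ae mu, forall ij : 'I_n * 'I_n,
    theta_sum (grid N) (idx N t) ij.1 ij.2 w @[N --> \oo] --> B ij.1 ij.2 w.
  by apply: filter_forall => ij; have [] := hB ij.1 ij.2.
by apply: filterS => w hw i j; rewrite mxE; exact: (hw (i, j)).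
Qed.

Definition brown (t : R) : W -> 'M[R]_n :=
  if pselect (0 <= t <= T) is left h then sval (cid (brown_exists h)) else fun=> 0.

Lemma measurable_brown t i j : measurable_fun setT (fun w => brown t w i j).
Proof.
rewrite /brown; case: pselect => [h|_]; first by case: cid => /= B [].
by under eq_fun do rewrite mxE; exact: measurable_cst.
Qed.

Let brown_cvg t : 0 <= t <= T ->
  \forall w \ae mu, forall L, lin_sum L (grid N) (idx N t) w @[N --> \oo] --> lin L (brown t w).
Proof.
move=> tT; rewrite /brown; case: pselect => // h; case: cid => /= B [_].
apply: filterS => w hw L; under eq_fun do rewrite lin_sumE.
by apply: cvg_sumr => i _; apply: cvg_sumr => j _; apply: cvgMr; exact: hw.
Qed.

Lemma measurable_lin_brown L t : measurable_fun setT (fun w => lin L (brown t w)).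
Proof.
apply: measurable_sum => i; apply: measurable_sum => j.
by apply: measurable_funM => //; exact: measurable_brown.
Qed.

(** Fatou's lemma carries the Cauchy estimate to the limit along the grids. The sequence is shifted
    so that every grid in it has mesh at most delta. *)
Lemma brown_approx L : exists2 K : R, 0 <= K & forall r m s t delta, 0 < delta ->
  fine_times r m s t delta ->
  (sq_integral mu (fun w => (lin_sum L r m w - (lin L (brown t w) - lin L (brown s w)))%R) <=
   (K * delta)%R%:E)%E.
Proof.
have [K K0 hK] := sq_diff_lin_sum L.
(* The end points s and t are each within delta of the grid, which gives 2 delta; the meshes
   contribute 2 delta times a total length of at most 2T. *)
exists (K * (2 + 4 * T)) => [|r m s t delta d0 ft]; first by rewrite mulr_ge0// addr_ge0// mulr_ge0// ltW.
have [st _] := fine_times_range ft; have [_ _ s0 tT _] := ft.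
have sT : 0 <= s <= T by rewrite s0 (le_trans st).
have tT' : 0 <= t <= T by rewrite tT (le_trans s0).
have [N0 hN0] := gap_cvg0 d0.
pose f N w := lin_sum L r m w - (lin_sum L (grid N) (idx N t) w - lin_sum L (grid N) (idx N s) w).
have bf N : bounded_measurable (f N) by apply: bmB; [|apply: bmB]; exact: bm_lin_sum.
apply: (@sq_integral_fatou _ _ _ mu (fun N => f (N + N0)%N)).
- by move=> N; have [] := bf (N + N0)%N.
- apply: measurable_funB; first by have [] := bm_lin_sum L r m.
  by apply: measurable_funB; exact: measurable_lin_brown.
- apply: filterS2 (brown_cvg tT') (brown_cvg sT) => w h1 h2.
  rewrite (cvg_shiftn N0 (f ^~ w)); apply: cvgB; first exact: cvg_cst.
  by apply: cvgB; [exact: h1|exact: h2].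
- move=> N; rewrite sq_integral_Ex// lee_fin; set M' := (N + N0)%N.
  have gd : gap M' <= delta by apply: hN0; exact: leq_addl.
  have g0 := gap_gt0 M'.
  rewrite (_ : 'E _ = 'E (fun w => (lin_sum L r m w -
    lin_sum L (fun q => grid M' (idx M' s + q)%N) (idx M' t - idx M' s) w) ^+ 2)); last first.
    by apply: eq_Ex => w; rewrite lin_sum_diff.
  apply: (le_trans (hK _ _ _ _ _ _ _ _ _ _ (ltW d0) (ltW g0) ft (fine_grid2 M' s0 st tT))).
  rewrite -mulrA ler_wpM2l//.
  have [a1 a2] := grid_idx M' s0; have [b1 b2] := grid_idx M' (le_trans s0 st).
  have ga : 0 <= grid M' (idx M' s) by rewrite gridE mulr_ge0// ltW.
  have -> : (2 + 4 * T) * delta = delta + delta + (delta + delta) * (T + T) by ring.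
  apply: lerD; first by apply: lerD; rewrite ger0_norm; lra.
  have [gm _] := fine_times_range (fine_grid2 M' s0 st tT).
  apply: ler_pM; lra.
Qed.

Lemma ip_lin_l (I : Type) (s : seq I) (c : I -> R) (A : I -> 'M[R]_n) B :
  (forall i, lie_algebra G (A i)) -> lie_algebra G B ->
  ip (\sum_(i <- s) c i *: A i) B = \sum_(i <- s) c i * ip (A i) B.
Proof.
move=> GA GB; elim: s => [|i s IH].
  rewrite !big_nil; have := ip_linear hip 1 (lie_algebra0 G) (lie_algebra0 G) GB.
  by rewrite scale1r addr0 mul1r => /eqP; rewrite -subr_eq0 opprD addNKr oppr_eq0 => /eqP.
rewrite !big_cons (ip_linear hip)// ?IH//; apply: lie_algebra_sum => j.
exact: lie_algebraZ.
Qed.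

Lemma ip_basis (c : 'I_d -> R) m : ip (\sum_k c k *: E k) (E m) = c m.
Proof.
rewrite ip_lin_l//; [|exact: GE|exact: GE].
rewrite (bigD1 m)//= (onb_ortho hE) eqxx mulr1 big1 ?addr0// => k km.
by rewrite (onb_ortho hE) (negbTE km) mulr0.
Qed.

Lemma lie_expand A : lie_algebra G A -> A = \sum_m ip A (E m) *: E m.
Proof.
move=> /(onb_span hE)[c Ac]; rewrite [LHS]Ac; apply: eq_bigr => m _.
by rewrite Ac ip_basis.
Qed.

Lemma ip_expand A B : lie_algebra G A -> lie_algebra G B ->
  ip A B = \sum_m ip A (E m) * ip B (E m).
Proof.
move=> GA GB; rewrite {1}(lie_expand GA) ip_lin_l//; last exact: GE.
by apply: eq_bigr => m _; rewrite (ip_sym hip (GE m) GB).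
Qed.

Lemma coord_exists : exists c : 'I_d -> 'I_n -> 'I_n -> R,
  forall m k, lin (c m) (E k) = (m == k)%:R.
Proof.
pose L : 'M[R]_(d, n * n) := \matrix_k mxvec (E k).
have /row_freeP[D LD] : row_free L.
  rewrite -kermx_eq0; apply/rowV0P => v /sub_kermxP vL.
  have vE : \sum_k v 0 k *: E k = 0.
    apply: (can_inj mxvecK); rewrite linear0 linear_sum/=.
    transitivity (v *m L); last exact: vL.
    by rewrite mulmx_sum_row; apply: eq_bigr => k _; rewrite linearZ/= rowK.
  apply/rowP => k; rewrite mxE -(ip_basis (fun k => v 0 k)) vE.
  have := @ip_lin_l nat [::] (fun=> 0) (fun=> E k) (E k) (fun=> GE k) (GE k).
  by rewrite !big_nil.
exists (fun m i j => D (mxvec_index i j) m) => m k.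
have := congr1 (fun M : 'M[R]_d => M k m) LD; rewrite !mxE eq_sym => <-.
transitivity (\sum_(ab : 'I_n * 'I_n) L k (mxvec_index ab.1 ab.2) * D (mxvec_index ab.1 ab.2) m); last first.
  by rewrite [RHS](reindex _ (curry_mxvec_bij n n)); apply: eq_bigr => -[].
rewrite -(pair_bigA _ (fun i j => L k (mxvec_index i j) * D (mxvec_index i j) m))/=.
apply: eq_bigr => i _; apply: eq_bigr => j _.
by rewrite mulrC; congr (_ * _); rewrite mxE mxvecE.
Qed.

Definition coord : 'I_d -> 'I_n -> 'I_n -> R := sval (cid coord_exists).

Lemma coordE m k : lin (coord m) (E k) = (m == k)%:R.
Proof. by rewrite /coord; case: cid. Qed.

(** The entry (i, j) of A minus that of its image under the projection onto the span of E given by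
    [coord]. It vanishes on every E_k, so this component of the Brownian motion has variance zero;
    hence [brown] lies in the Lie algebra almost surely. *)
Let res i j : 'I_n -> 'I_n -> R :=
  fun a b => ((a == i) && (b == j))%:R - \sum_m E m i j * coord m a b.

Let resE i j A : lin (res i j) A = A i j - \sum_m E m i j * lin (coord m) A.
Proof.
rewrite -[in RHS](lin_delta i j A) /lin.
have -> : \sum_m E m i j * (\sum_i0 \sum_j0 coord m i0 j0 * A i0 j0) =
    \sum_i0 \sum_j0 (\sum_m E m i j * coord m i0 j0) * A i0 j0.
  under eq_bigr do rewrite mulr_sumr.
  rewrite exchange_big/=; apply: eq_bigr => a _; under eq_bigr do rewrite mulr_sumr.
  rewrite exchange_big/=; apply: eq_bigr => b _; rewrite mulr_suml.
  by apply: eq_bigr => m _; rewrite mulrA.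
rewrite -sumrB; apply: eq_bigr => a _; rewrite -sumrB; apply: eq_bigr => b _.
by rewrite /res mulrBl.
Qed.

Let gram_res i j : lin_gram (res i j) (res i j) = 0.
Proof.
rewrite /lin_gram big1// => k _; rewrite resE (bigD1 k)//= coordE eqxx mulr1.
rewrite big1 ?addr0 ?subrr ?mul0r// => m mk.
by rewrite coordE (negbTE mk) mulr0.
Qed.

Definition even_times (s t : R) (N q : nat) : R := s + (t - s) * (q%:R / N.+1%:R).

Lemma fine_even_times s t N : 0 <= s -> s <= t -> t <= T ->
  fine_times (even_times s t N) N.+1 s t (T / N.+1%:R).
Proof.
move=> s0 st tT; split => //; rewrite /even_times.
- by rewrite mul0r mulr0 addr0.
- by rewrite divff ?pnatr_eq0// mulr1 addrC subrK.
- move=> q _; have ts : 0 <= t - s by rewrite subr_ge0.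
  rewrite -(natr1 q) [(_ + 1) / _]mulrDl mulrDr addrA; split.
    by rewrite lerDl mulr_ge0// mul1r invr_ge0.
  rewrite lerD2l mul1r ler_wpM2r ?invr_ge0//.
  by rewrite lerBlDr (le_trans tT)// lerDl.
Qed.

Lemma sq_cvg_brown L s t : 0 <= s -> s <= t -> t <= T ->
  sq_cvg mu (fun N => lin_sum L (even_times s t N) N.+1)
    (fun w => lin L (brown t w) - lin L (brown s w)).
Proof.
move=> s0 st tT; have [K K0 hK] := brown_approx L.
apply: (@sq_cvg_bound _ _ _ _ _ _ (K * T)) => N.
have d0 : 0 < T / N.+1%:R by rewrite divr_gt0.
by rewrite -mulrA; exact: hK d0 (fine_even_times N s0 st tT).
Qed.

Lemma measurable_brown_incr L s t : measurable_fun setT (fun w => lin L (brown t w) - lin L (brown s w)).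
Proof. by apply: measurable_funB; exact: measurable_lin_brown. Qed.

Lemma sq_integral_brown_incr L s t : 0 <= s -> s <= t -> t <= T ->
  sq_integral mu (fun w => (lin L (brown t w) - lin L (brown s w))) =
  ((t - s) * lin_gram L L)%:E.
Proof.
move=> s0 st tT; have [K K0 hK] := cov_lin_sum L L.
apply: (sq_cvg_integral _ (measurable_brown_incr L s t) (sq_cvg_brown L s0 st tT)).
- by move=> k; have [] := bm_lin_sum L (even_times s t k) k.+1.
- by move=> k; apply: sq_integral_Ex; exact: bm_lin_sum.
apply/cvgrPdist_le => e e0.
have T0' := ltW T0.
have c0 : 0 <= K * (T + T) * (t - s).
  by apply: mulr_ge0; [apply: mulr_ge0 => //; exact: addr_ge0|rewrite subr_ge0].
have e1 : 0 < e / (K * (T + T) * (t - s) + 1) by rewrite divr_gt0// ltr_wpDl.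
near=> N.
have ft := fine_even_times N s0 st tT.
have := hK _ _ _ _ _ _ _ _ _ _ ft ft.
rewrite (overlap_nested (lexx s) st (lexx t)) distrC.
under [X in 'E X]eq_fun do rewrite -expr2.
move/le_trans; apply.
have -> : K * (T / N.+1%:R + T / N.+1%:R) * (t - s) = K * (T + T) * (t - s) / N.+1%:R.
  by rewrite -mulrDl mulrA mulrAC.
have : N.+1%:R^-1 <= e / (K * (T + T) * (t - s) + 1).
  by apply/ltW; near: N; exact: (near_infty_natSinv_lt (PosNum e1)).
rewrite ler_pdivlMr ?ltr_wpDl// => h; apply: le_trans h.
by rewrite mulrC ler_wpM2l ?invr_ge0// lerDl.
Unshelve. all: by end_near. Qed.

Let brown0 : \forall w \ae mu, forall L, lin L (brown 0 w) = 0.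
Proof.
have T00 : 0 <= (0 : R) <= T by rewrite lexx ltW.
apply: filterS (brown_cvg T00) => w h L; apply: (cvgr_uniq (h L)).
rewrite (_ : (fun N => _) = cst 0); first exact: cvg_cst.
by apply/funext => N; rewrite /idx mul0r truncn0 /lin_sum big_ord0.
Qed.

(* [brown t] lies in the Lie algebra only almost surely, [bl t] does so everywhere. *)
Definition bl (t : R) (w : W) : 'M[R]_n := \sum_m lin (coord m) (brown t w) *: E m.

Lemma lie_bl t w : lie_algebra G (bl t w).
Proof. by apply: lie_algebra_sum => m; apply: lie_algebraZ; exact: GE. Qed.

Lemma measurable_bl t i j : measurable_fun setT (fun w => bl t w i j).
Proof.
under eq_fun do rewrite summxE.
apply: measurable_bigsum => m; under eq_fun do rewrite mxE.
by apply: measurable_funM => //; exact: measurable_lin_brown.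
Qed.

Lemma bl_brown t : 0 <= t <= T -> \forall w \ae mu, bl t w = brown t w.
Proof.
move=> /andP[t0 tT].
have : \forall w \ae mu, forall ij : 'I_n * 'I_n, lin (res ij.1 ij.2) (brown t w) = 0.
  apply: filter_forall => -[i j] /=.
  have := sq_integral_brown_incr (res i j) (lexx 0) t0 tT.
  rewrite gram_res mulr0 => /(sq_integral_eq0 (measurable_brown_incr _ _ _)) h.
  by apply: filterS2 h brown0 => w + h0; rewrite h0 subr0.
apply: filterS => w h; apply/matrixP => i j; have := h (i, j); rewrite resE => /subr0_eq ->.
by rewrite /bl summxE; apply: eq_bigr => m _; rewrite mxE mulrC.
Qed.

Lemma mesh_ge s q : (q < size s)%N -> nth 0 s q - nth 0 (0 :: s) q <= mesh s :> R.
Proof.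
move=> qs; exact: (le_bigmax _ (fun i : 'I_(size s) => nth 0 s i - nth 0 (0 :: s) i) (Ordinal qs)).
Qed.

Lemma fine_itv_partition t (s : seq R) : t <= T -> itv_partition 0 t s ->
  fine_times (nth 0 (0 :: s)) (size s) 0 t (mesh s).
Proof.
move=> tT [ps /eqP ls]; split => //.
  by rewrite -ls (last_nth 0).
move=> q qs; split; last by rewrite addrC -lerBlDr; exact: (mesh_ge qs).
by apply/ltW; have /(pathP 0) := ps; apply.
Qed.

Lemma midpoint_sum_theta (s : seq R) w i j :
  midpoint_sum (fun s w => invmx (path_at s w)) path_at s w i j =
  theta_sum (nth 0 (0 :: s)) (size s) i j w.
Proof.
rewrite /midpoint_sum summxE; apply: eq_bigr => q _ /=.
set a := nth 0 (0 :: s) q; set b := nth 0 s q.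
have ua := lie_unitmx (path_at_lie a w); have ub := lie_unitmx (path_at_lie b w).
rewrite -scalemxAl mxE mulmxDl !mulmxBr !mulVmx// /theta incrV /incr; congr (_ * _).
have add (U V : 'M[R]_n) : (U + V) i j = U i j + V i j by rewrite !mxE.
have sub (U V : 'M[R]_n) : (U - V) i j = U i j - V i j by rewrite !mxE.
by rewrite add !sub addrA subrK.
Qed.

Let ae_residue t : 0 <= t <= T -> \forall w \ae mu, forall i j,
  bl t w i j = lin (fun a b => ((a == i) && (b == j))%:R) (brown t w) -
               lin (fun a b => ((a == i) && (b == j))%:R) (brown 0 w).
Proof.
move=> tT; apply: filterS2 (bl_brown tT) brown0 => w h1 h2 i j.
by rewrite h2 subr0 lin_delta h1.
Qed.

Lemma measurable_midpoint (s : seq R) i j : measurable_fun setT (fun w : W =>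
  midpoint_sum (fun s w => invmx (path_at s w)) path_at s w i j).
Proof.
under eq_fun do rewrite midpoint_sum_theta.
by have [] := bm_theta_sum (nth 0 (0 :: s)) (size s) i j.
Qed.

Lemma bl_midpoint i j : exists2 K : R, 0 <= K & forall t (s : seq R) delta, 0 <= t <= T ->
  itv_partition 0 t s -> mesh s <= delta -> 0 < delta ->
  (sq_integral mu (fun w => (midpoint_sum (fun s w => invmx (path_at s w)) path_at s w i j -
     bl t w i j)%R) <= (K * delta)%R%:E)%E.
Proof.
pose L : 'I_n -> 'I_n -> R := fun a b => ((a == i) && (b == j))%:R.
have [K K0 hK] := brown_approx L.
exists K => // t s delta /[dup] tT /andP[t0 tT'] ps ms d0.
have [h1 h2 h3 h4 h5] := fine_itv_partition tT' ps.
have ft : fine_times (nth 0 (0 :: s)) (size s) 0 t delta.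
  split => // q qs; have [a b] := h5 q qs; split => //.
  by rewrite (le_trans b)// lerD2l.
rewrite (@ae_eq_sq_integral _ _ _ _ _ (fun w => lin_sum L (nth 0 (0 :: s)) (size s) w -
  (lin L (brown t w) - lin L (brown 0 w)))); first exact: hK d0 ft.
- by apply: measurable_funB; [exact: measurable_midpoint|exact: measurable_bl].
- apply: measurable_funB; last exact: measurable_brown_incr.
  by have [] := bm_lin_sum L (nth 0 (0 :: s)) (size s).
apply: filterS (ae_residue tT) => w ->; rewrite midpoint_sum_theta; congr (_ - _).
by rewrite /theta_sum /lin_sum; apply: eq_bigr => q _; rewrite lin_delta mxE.
Qed.

Lemma stratonovich_bl t : 0 <= t <= T ->
  stratonovich_integral mu (fun s w => invmx (path_at s w)) path_at t (bl t).
Proof.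
move=> tT; split => [i j|s ps ms e e0]; first exact: measurable_bl.
pose K i j := sval (cid2 (bl_midpoint i j)).
have hK i j : 0 <= K i j /\ forall t (s : seq R) delta, 0 <= t <= T ->
    itv_partition 0 t s -> mesh s <= delta -> 0 < delta ->
    (sq_integral mu (fun w => (midpoint_sum (fun s w => invmx (path_at s w)) path_at s w i j -
     bl t w i j)%R) <= (K i j * delta)%R%:E)%E by rewrite /K; case: cid2.
pose KK : R := \sum_(ij : 'I_n * 'I_n) K ij.1 ij.2.
have KK0 : 0 <= KK by apply: sumr_ge0 => ij _; have [] := hK ij.1 ij.2.
(* The rate is stated for a strictly positive delta; the mesh may vanish, since the partition of
   [0, 0] is empty. *)
pose delta k := `|mesh (s k)| + k.+1%:R^-1.
have d0 k : 0 < delta k by rewrite ltr_wpDl// invr_gt0 ltr0n.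
have dcvg : (e ^+ 2)^-1 * (KK * delta k) @[k --> \oo] --> 0.
  rewrite -[X in _ --> X](mulr0 (e ^+ 2)^-1); apply: cvgMr.
  rewrite -[X in _ --> X](mulr0 KK); apply: cvgMr.
  rewrite -[X in _ --> X]addr0; apply: cvgD; last exact: cvg_harmonic.
  by rewrite -(normr0 R); apply: cvg_norm.
apply: (@squeeze_cvge nat \oo _ R (fun=> 0%E) _ (fun k => ((e ^+ 2)^-1 * (KK * delta k))%:E)).
- apply: nearW => k; rewrite measure_ge0/=.
  have e2 : 0 < e ^+ 2 by rewrite exprn_gt0.
  rewrite EFinM lee_pdivlMl//.
  apply: (le_trans (mx_norm_markov mu e0 _)).
    move=> i j; under eq_fun do rewrite !mxE.
    have -> : (fun w : W => midpoint_sum (fun s w => invmx (path_at s w)) path_at (s k) w i j + - bl t w i j) =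
      (fun w : W => midpoint_sum (fun s w => invmx (path_at s w)) path_at (s k) w i j - bl t w i j) by [].
    by apply: measurable_funB; [exact: measurable_midpoint|exact: measurable_bl].
  rewrite /KK mulr_suml -sumEFin; apply: lee_sum => ij _.
  rewrite (@eq_sq_integral _ _ _ _ _ (fun w => midpoint_sum (fun s w => invmx (path_at s w)) path_at (s k) w ij.1 ij.2 -
    bl t w ij.1 ij.2)); last first.
    by move=> w; have sub (U V : 'M[R]_n) a b : (U - V) a b = U a b - V a b by [rewrite !mxE]; rewrite sub.
  apply: (hK ij.1 ij.2).2 => //.
  by rewrite /delta (le_trans (ler_norm _))// lerDl invr_ge0.
- exact: cvg_cst.
- by apply: cvg_EFin; [exact: nearW|exact: dcvg].
Qed.

(** Both are limits in probability of the same symmetric sums along one sequence of partitions. *)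
Lemma stratonovich_unique t (I1 I2 : W -> 'M[R]_n) : 0 <= t <= T ->
  stratonovich_integral mu (fun s w => invmx (path_at s w)) path_at t I1 ->
  stratonovich_integral mu (fun s w => invmx (path_at s w)) path_at t I2 ->
  \forall w \ae mu, I1 w = I2 w.
Proof.
move=> /andP[t0 tT] [mI1 h1] [mI2 h2].
(* The definition quantifies over sequences of partitions with vanishing mesh, so one must be
   exhibited: the even partitions, or the empty one when t = 0. *)
have [s [ps ms]] : exists s : nat -> seq R, (forall m, itv_partition 0 t (s m)) /\
    mesh (s m) @[m --> \oo] --> 0.
  have [t00|tn0] := eqVneq t 0.
    exists (fun=> [::]); split => [m|]; first by split => //=; rewrite t00.
    by rewrite /mesh; under eq_fun do rewrite big_ord0; exact: cvg_cst.
  have t1 : 0 < t by rewrite lt_neqAle eq_sym tn0.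
  pose c m q : R := t * (q%:R / m.+1%:R).
  exists (fun m => mkseq (fun q => c m q.+1) m.+1).
  have nE m q : (q <= m.+1)%N -> nth 0 (0 :: mkseq (fun q => c m q.+1) m.+1) q = c m q.
    case: q => [_|q qm]; first by rewrite /c mul0r mulr0.
    exact: (nth_mkseq 0 (fun q => c m q.+1) qm).
  have cD m q : c m q.+1 = c m q + t / m.+1%:R.
    by rewrite /c -natr1 mulrDl mulrDr mul1r.
  split => [m|].
    split.
      apply/(pathP 0) => q; rewrite size_mkseq => qm.
      rewrite nE ?(ltnW qm)// -[X in _ < X]/(nth 0 (0 :: mkseq (fun q => c m q.+1) m.+1) q.+1) nE//.
      by rewrite cD ltrDl divr_gt0.
    by rewrite (last_nth 0) size_mkseq nE// /c divff ?mulr1// pnatr_eq0.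
  apply: (@squeeze_cvgr nat \oo _ R (fun=> 0) (fun m => t / m.+1%:R)).
  - apply: nearW => m; rewrite /mesh; apply/andP; split.
      by apply: bigmax_ge_id.
    apply: bigmax_le => [|q _]; first by rewrite divr_ge0// ltW.
    have := ltn_ord q; rewrite {2}size_mkseq => qm.
    rewrite nE ?(ltnW qm)// -[X in X - _]/(nth 0 (0 :: mkseq (fun q => c m q.+1) m.+1) q.+1) nE//.
    by rewrite cD addrC addKr.
  - exact: cvg_cst.
  - by rewrite -[X in _ --> X](mulr0 t); apply: cvgMr; exact: cvg_harmonic.
have mB i j : measurable_fun setT (fun w => (I1 w - I2 w) i j).
  by under eq_fun do rewrite !mxE; exact: (measurable_funB (mI1 i j) (mI2 i j)).
have : \forall w \ae mu, I1 w - I2 w = 0.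
  apply: ae_eq0_mx => // e e0; have e2 : 0 < e / 2 by rewrite divr_gt0.
  have mM (I : W -> 'M[R]_n) m : (forall i j, measurable_fun setT (fun w => I w i j)) ->
      measurable [set w | e / 2 <= `|midpoint_sum (fun s w => invmx (path_at s w)) path_at (s m) w - I w|].
    move=> mI; apply: measurable_norm_ge => i j; under eq_fun do rewrite !mxE.
    exact: (measurable_funB (measurable_midpoint (s m) i j) (mI i j)).
  apply/eqP; rewrite eq_le measure_ge0 andbT.
  have adef : ((0 : \bar R) +? 0)%E by [].
  have /(_ _) lim := cvgeD adef (h1 s ps ms _ e2) (h2 s ps ms _ e2).
  rewrite adde0 in lim; rewrite -(cvg_lim _ lim)//; apply: lime_ge; first by apply/cvg_ex; exists 0%E.
  apply: nearW => m; apply: le_trans (measureU2 _ _ _); [|exact: mM|exact: mM].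
  apply: le_measure; rewrite ?inE; [exact: measurable_norm_ge|by apply: measurableU; exact: mM|].
  move=> w /= ew; apply: contrapT => /not_orP[/negP]; rewrite -ltNge => a1 /negP; rewrite -ltNge => a2.
  move: ew; rewrite leNgt => /negP; apply.
  rewrite (_ : I1 w - I2 w = (midpoint_sum (fun s w => invmx (path_at s w)) path_at (s m) w - I2 w) -
    (midpoint_sum (fun s w => invmx (path_at s w)) path_at (s m) w - I1 w)); last first.
    by rewrite opprB [RHS]addrC addrA subrK.
  by rewrite (le_lt_trans (ler_normB _ _))// [e]splitr ltrD.
by apply: filterS => w /subr0_eq.
Qed.

(** As [bl t] meets the specification, so does the version picked by [xget], and two versions agree
    almost surely. *)
Lemma BL_bl t : 0 <= t <= T -> \forall w \ae mu, BL mu t w = bl t w.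
Proof.
move=> tT; have h : exists I, (forall w, lie_algebra G (I w)) /\
    stratonovich_integral mu (fun s w => invmx (path_at s w)) path_at t I.
  by exists (bl t); split; [exact: lie_bl|exact: stratonovich_bl].
have [_ hs] := xgetPex (fun=> 0) h.
exact: stratonovich_unique tT hs (stratonovich_bl tT).
Qed.

(** * Integrals of step functions *)

(** A linear functional on all matrices that is the inner product with A on the Lie algebra. *)
Definition lincoef (A : 'M[R]_n) : 'I_n -> 'I_n -> R :=
  fun a b => \sum_m ip A (E m) * coord m a b.

Lemma lin_lincoef A X : lin (lincoef A) X = \sum_m ip A (E m) * lin (coord m) X.
Proof.
under [RHS]eq_bigr do rewrite /lin mulr_sumr.
rewrite exchange_big/=; apply: eq_bigr => a _; under [RHS]eq_bigr do rewrite mulr_sumr.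
rewrite exchange_big/=; apply: eq_bigr => b _; rewrite /lincoef mulr_suml.
by apply: eq_bigr => m _; rewrite mulrA.
Qed.

Lemma lin_lincoef_brown A t w : lie_algebra G A ->
  lin (lincoef A) (brown t w) = ip A (bl t w).
Proof.
move=> GA; rewrite (ip_sym hip GA (lie_bl t w)) /bl ip_lin_l//; last exact: GE.
rewrite lin_lincoef; apply: eq_bigr => m _.
by rewrite mulrC (ip_sym hip GA (GE m)).
Qed.

Lemma lin_gram_lincoef A B : lie_algebra G A -> lie_algebra G B ->
  lin_gram (lincoef A) (lincoef B) = ip A B.
Proof.
have h C' k : lie_algebra G C' -> lin (lincoef C') (E k) = ip C' (E k).
  move=> GC; rewrite lin_lincoef (bigD1 k)//= coordE eqxx mulr1 big1 ?addr0// => m mk.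
  by rewrite coordE (negbTE mk) mulr0.
move=> GA GB; rewrite (ip_expand GA GB); apply: eq_bigr => k _.
by rewrite !h.
Qed.

Implicit Types l : seq (R * R * 'M[R]_n).

(** The I(l) of the overview. Being written with [lincoef] and [brown] rather than [ip] and [BL], it
    is a linear expression of explicit limits; it is almost surely [step_integral]. *)
Definition wint l (w : W) : R := \sum_(x <- l)
  (lin (lincoef x.2) (brown x.1.2 w) - lin (lincoef x.2) (brown x.1.1 w)).

Lemma measurable_wint l : measurable_fun setT (wint l).
Proof. by apply: measurable_bigsum => x; exact: measurable_brown_incr. Qed.

Lemma is_step_cons x l : is_step G T (x :: l) ->
  [/\ 0 <= x.1.1, x.1.1 <= x.1.2, x.1.2 <= T & lie_algebra G x.2] /\ is_step G T l.
Proof.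
move=> h; split; first by apply: h; exact: mem_head.
by move=> y yl; apply: h; rewrite inE yl orbT.
Qed.

Lemma ae_step_integral l : is_step G T l -> \forall w \ae mu, step_integral ip mu l w = wint l w.
Proof.
elim: l => [_|x l IH /is_step_cons[[x0 xx xT Gx] /IH h]].
  by apply: aeW => w; rewrite /step_integral /wint !big_nil.
have h1 : 0 <= x.1.1 <= T by rewrite x0 (le_trans xx).
have h2 : 0 <= x.1.2 <= T by rewrite xT (le_trans x0).
apply: filterS3 h (BL_bl h1) (BL_bl h2) => w + e1 e2.
rewrite /step_integral /wint !big_cons => ->; congr (_ + _).
rewrite e1 e2 !lin_lincoef_brown//.
have := ip_linear hip (-1) (lie_bl x.1.1 w) (lie_bl x.1.2 w) Gx.
rewrite scaleN1r mulN1r (ip_sym hip (lie_bl _ w) Gx) (ip_sym hip (lie_bl x.1.2 w) Gx) => h3.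
have GB : lie_algebra G (- bl x.1.1 w + bl x.1.2 w).
  by rewrite -scaleN1r; apply: lie_algebraD; [apply: lie_algebraZ|]; exact: lie_bl.
by rewrite addrC (ip_sym hip Gx GB) h3 addrC.
Qed.

Lemma wint_cat l1 l2 w : wint (l1 ++ l2) w = wint l1 w + wint l2 w.
Proof. by rewrite /wint big_cat. Qed.

Definition step_scale (c : R) l := [seq (x.1, c *: x.2) | x <- l].

Lemma is_step_cat l1 l2 : is_step G T l1 -> is_step G T l2 -> is_step G T (l1 ++ l2).
Proof. by move=> h1 h2 x; rewrite mem_cat => /orP[/h1|/h2]. Qed.

Lemma is_step_scale c l : is_step G T l -> is_step G T (step_scale c l).
Proof. by move=> h x /mapP[y /h[? ? ? ?] ->]; split => //; exact: lie_algebraZ. Qed.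

Lemma wint_scale c l w : is_step G T l -> wint (step_scale c l) w = c * wint l w.
Proof.
elim: l => [_|x l IH /is_step_cons[[_ _ _ Gx] /IH h]]; first by rewrite /wint !big_nil mulr0.
rewrite /wint /step_scale /= !big_cons -/(step_scale c l) mulrDr -[in RHS]/(wint l w) -h; congr (_ + _).
have e t : lin (lincoef (c *: x.2)) (brown t w) = c * lin (lincoef x.2) (brown t w).
  rewrite !lin_lincoef mulr_sumr; apply: eq_bigr => m _; rewrite mulrA; congr (_ * _).
  have := ip_linear hip c Gx (lie_algebra0 G) (GE m); rewrite addr0 => ->.
  have := @ip_lin_l nat [::] (fun=> 0) (fun=> E m) (E m) (fun=> GE m) (GE m).
  by rewrite !big_nil => ->; rewrite addr0.
by rewrite /= !e mulrBr.
Qed.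

Lemma step_fun_scale c l t : step_fun (step_scale c l) t = c *: step_fun l t.
Proof.
rewrite /step_fun big_map scaler_sumr; apply: eq_bigr => x _ /=.
by rewrite !scalerA mulrC.
Qed.

(** The squared L^2 norm of the step function. The intervals in l may overlap one another, hence the
    double sum. *)
Definition quad l : R :=
  \sum_(x <- l) \sum_(y <- l) ip x.2 y.2 * overlap x.1.1 x.1.2 y.1.1 y.1.2.

Lemma In_mem (U : eqType) (s : seq U) u : List.In u s -> u \in s.
Proof. by elim: s => //= v s IH [->|/IH]; rewrite inE ?eqxx// => ->; rewrite orbT. Qed.

Lemma sq_integral_wint l : is_step G T l -> sq_integral mu (wint l) = (quad l)%:E.
Proof.
move=> hl; pose f x N := lin_sum (lincoef x.2) (even_times x.1.1 x.1.2 N) N.+1.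
have bf x N : bounded_measurable (f x N) by exact: bm_lin_sum.
pose S N w := \sum_(x <- l) f x N w.
have bS N : bounded_measurable (S N) by exact: bm_sum.
apply: (@sq_cvg_integral _ _ _ mu S (wint l) (fun N => 'E (fun w => S N w ^+ 2))).
- by move=> N; have [] := bS N.
- exact: measurable_wint.
- apply: (sq_cvg_sum (f_ := f)) => [x k|x|x /In_mem/hl[x0 xx xT Gx]].
  + by have [] := bf x k.
  + exact: measurable_brown_incr.
  + exact: sq_cvg_brown.
- by move=> N; exact: sq_integral_Ex.
have SE N : 'E (fun w => S N w ^+ 2) = \sum_(x <- l) \sum_(y <- l) 'E (fun w => f x N w * f y N w).
  transitivity ('E (fun w => \sum_(x <- l) \sum_(y <- l) f x N w * f y N w)).
    apply: eq_Ex => w; rewrite expr2 /S mulr_suml; apply: eq_bigr => x _.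
    by rewrite mulr_sumr.
  rewrite Ex_sum => [|x]; last by apply: bm_sum => y; exact: bmM.
  by apply: eq_bigr => x _; rewrite Ex_sum// => y; exact: bmM.
under eq_fun do rewrite SE big_seq; rewrite /quad big_seq.
apply: cvg_sumr => x /hl[x0 xx xT Gx].
under eq_fun do rewrite big_seq; rewrite big_seq; apply: cvg_sumr => y /hl[y0 yy yT Gy].
have [K K0 hK] := cov_lin_sum (lincoef x.2) (lincoef y.2).
have [ov0 _ _] := overlap_bounds xx yy.
apply: (@cvg_harmonic_bound _ _ _ (K * (T + T) * overlap x.1.1 x.1.2 y.1.1 y.1.2)) => [|N].
  by rewrite !mulr_ge0// addr_ge0// ltW.
have := hK _ _ _ _ _ _ _ _ _ _ (fine_even_times N x0 xx xT) (fine_even_times N y0 yy yT).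
rewrite lin_gram_lincoef// -/(f x N) -/(f y N) mulrC => /le_trans -> //.
by rewrite -mulrDl mulrA mulrAC.
Qed.

Let lebesgue_overlap (a b s t : R) : a <= b -> s <= t ->
  lebesgue_measure (`]a, b]%classic `&` `]s, t]%classic : set R) = (overlap a b s t)%:E.
Proof.
wlog as_ : a b s t / a <= s.
  move=> wl ab st; have [as_|/ltW sa] := leP a s; first exact: wl.
  by rewrite setIC (overlapC ab st); exact: wl.
have itvE (x y : R) : x <= y -> lebesgue_measure (`]x, y]%classic : set R) = (y - x)%:E.
  move=> xy; rewrite lebesgue_measure_itv/= lte_fin; case: ltP => [_|yx]; first by rewrite EFinB.
  by rewrite (_ : y = x) ?subrr//; apply/eqP; rewrite eq_le yx.
move=> ab st; have [bs|/ltW sb] := leP b s.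
  rewrite (overlap_disjoint ab bs st) (_ : _ `&` _ = set0) ?measure0//.
  apply/seteqP; split => x //= [+ +]; rewrite !in_itv/= => /andP[_ xb] /andP[sx _].
  by have := lt_le_trans sx (le_trans xb bs); rewrite ltxx.
have [bt|/ltW tb] := leP b t.
  rewrite (overlap_shifted as_ sb bt) -itvE//; congr (lebesgue_measure _).
  apply/seteqP; split => x /=; rewrite !in_itv/=.
    by move=> [/andP[_ xb] /andP[sx _]]; rewrite sx.
  by move=> /andP[sx xb]; rewrite sx xb (le_lt_trans as_ sx) (le_trans xb).
rewrite (overlap_nested as_ st tb) -itvE//; congr (lebesgue_measure _).
apply/seteqP; split => x /=; rewrite !in_itv/=.
  by move=> [_ /andP[sx xt]]; rewrite sx.
by move=> /andP[sx xt]; rewrite sx xt (le_lt_trans as_ sx) (le_trans xt).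
Qed.

Lemma lie_step_fun l t : is_step G T l -> lie_algebra G (step_fun l t).
Proof.
elim: l => [_|x l IH /is_step_cons[[_ _ _ Gx] /IH h]].
  by rewrite /step_fun big_nil; exact: lie_algebra0.
by rewrite /step_fun big_cons; apply: lie_algebraD h; exact: lie_algebraZ.
Qed.

Lemma ip_step_fun l t B : is_step G T l -> lie_algebra G B ->
  ip (step_fun l t) B = \sum_(x <- l) (\1_(`]x.1.1, x.1.2] : set R) t : R) * ip x.2 B.
Proof.
move=> hl GB; elim: l hl => [_|x l IH /is_step_cons[[_ _ _ Gx] hl]].
  rewrite /step_fun !big_nil.
  have := @ip_lin_l nat [::] (fun=> 0) (fun=> B) B (fun=> GB) GB.
  by rewrite !big_nil.
by rewrite /step_fun !big_cons (ip_linear hip)// -/(step_fun l t) ?IH//; exact: lie_step_fun.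
Qed.

Lemma ip_step_fun2 l t : is_step G T l -> ip (step_fun l t) (step_fun l t) =
  \sum_(x <- l) \sum_(y <- l) ip x.2 y.2 *
    \1_(`]x.1.1, x.1.2]%classic `&` `]y.1.1, y.1.2]%classic) t.
Proof.
move=> hl; rewrite ip_step_fun//; last exact: lie_step_fun.
rewrite !big_seq; apply: eq_bigr => x /hl[_ _ _ Gx].
rewrite (ip_sym hip Gx (lie_step_fun t hl)) ip_step_fun// mulr_sumr !big_seq; apply: eq_bigr => y /hl[_ _ _ Gy].
by rewrite (ip_sym hip Gy Gx) indicI /= mulrA mulrC.
Qed.

Lemma energy_step l : is_step G T l -> energy T ip (step_fun l) = (quad l)%:E.
Proof.
move=> hl; rewrite /energy.
have fin0T : (lebesgue_measure (`[0%R, T]%classic : set R) < +oo)%E.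
  by rewrite lebesgue_measure_itv/= lte_fin T0 -EFinB ltry.
under eq_integral do rewrite ip_step_fun2// -sumEFin.
have mI x y : measurable (`]x.1.1, x.1.2]%classic `&` `]y.1.1, y.1.2]%classic : set R).
  by apply: measurableI; exact: measurable_itv.
have intI x y : lebesgue_measure.-integrable `[0, T]%classic (fun t : R => (ip x.2 y.2 *
    \1_(`]x.1.1, x.1.2]%classic `&` `]y.1.1, y.1.2]%classic) t)%:E).
  apply: (@bounded_integrable _ _ _ _ _ _ `|ip x.2 y.2|) => //.
  - apply: measurable_funM; first exact: measurable_cst.
    by apply: measurable_funTS; apply: measurable_indic; exact: mI.
  - move=> t _; rewrite normrM ler_piMr//.
    by rewrite indicE; case: (_ \in _); rewrite ?normr1 ?normr0.
have intS x : lebesgue_measure.-integrable `[0, T]%classic (fun t : R => (\sum_(y <- l) ip x.2 y.2 *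
    \1_(`]x.1.1, x.1.2]%classic `&` `]y.1.1, y.1.2]%classic) t)%:E).
  have -> : (fun t : R => (\sum_(y <- l) ip x.2 y.2 *
      \1_(`]x.1.1, x.1.2]%classic `&` `]y.1.1, y.1.2]%classic) t)%:E) =
      (fun t : R => \sum_(y <- l) (ip x.2 y.2 *
      \1_(`]x.1.1, x.1.2]%classic `&` `]y.1.1, y.1.2]%classic) t)%R%:E)%E.
    by apply/funext => t; rewrite sumEFin.
  by apply: integrable_sum => // y _; exact: intI.
rewrite integral_sum// /quad -sumEFin !big_seq; apply: eq_bigr => x /hl[x0 xx xT Gx].
under eq_integral do rewrite -sumEFin.
rewrite integral_sum//.
rewrite -sumEFin !big_seq; apply: eq_bigr => y /hl[y0 yy yT Gy].
under eq_integral do rewrite EFinM.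
rewrite integralZl//; last first.
  apply: (@bounded_integrable _ _ _ _ _ _ 1) => //.
  - by apply: measurable_funTS; apply: measurable_indic; exact: mI.
  - by move=> t _; rewrite indicE; case: (_ \in _); rewrite ?normr1 ?normr0.
rewrite [X in (_ * X)%E](_ : _ = (overlap x.1.1 x.1.2 y.1.1 y.1.2)%:E); first by rewrite -EFinM.
rewrite integral_indic//; last exact: mI.
rewrite -lebesgue_overlap//; congr (lebesgue_measure _).
apply: setIidl => t [/=]; rewrite !in_itv/= => /andP[xt tx] _.
by rewrite (le_trans x0 (ltW xt)) (le_trans tx).
Qed.

Let left_field_exp A F x : lie_algebra G A -> lie_set G x -> smooth G F ->
  left_field A (fun x => expR (F x)) x = expR (F x) * left_field A F x.
Proof.
move=> GA Gx sF; have c0 : left_curve A x 0 = x by rewrite /left_curve scale0r expmx0 mulmx1.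
have dF := smooth_is_derive GA sF Gx.
have h := @is_derive1_comp _ expR (F \o left_curve A x) 0 _ _ (is_derive_expR _) dF.
by rewrite {1}/left_field derive1E; have [_ ->] := h; rewrite /= c0.
Qed.

Let laplacian_exp F : smooth G F -> F 1%:M = 0 ->
  laplacian E (fun x => expR (F x)) 1%:M =
  \sum_k left_field (E k) F 1%:M ^+ 2 + laplacian E F 1%:M.
Proof.
move=> sF F1; rewrite /laplacian -big_split/=; apply: eq_bigr => k _.
rewrite (@eq_left_field _ _ G _ _ (fun x => expR (F x) * left_field (E k) F x)); first last.
- by move=> x Gx; rewrite left_field_exp//; exact: GE.
- exact: lie_one.
- exact: GE.
have sL := smooth_left_field (GE k) sF.
rewrite (left_fieldM (GE k) (lie_one G) (smooth_exp sF) sL) (left_field_exp (GE k) (lie_one G) sF).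
by rewrite F1 expR0 !mul1r expr2.
Qed.

Let lin_theta L (x : M) : R := lin L (\matrix_(i, j) theta i j x).

Let smooth_lin_theta L : smooth G (lin_theta L).
Proof.
apply: smooth_sum => i; apply: smooth_sum => j.
by under [X in smooth _ X]eq_fun do rewrite mxE; apply: smoothZ; exact: smooth_theta.
Qed.

Let lin_theta1 L : lin_theta L 1%:M = 0.
Proof.
by rewrite /lin_theta /lin big1// => i _; rewrite big1// => j _; rewrite mxE theta1 mulr0.
Qed.

Let left_field_sum A (I : Type) (s : seq I) (c : I -> R) (F : I -> M -> R) x :
  lie_algebra G A -> lie_set G x -> (forall i, smooth G (F i)) ->
  left_field A (fun x => \sum_(i <- s) c i * F i x) x = \sum_(i <- s) c i * left_field A (F i) x.
Proof.
move=> GA Gx sF.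
have h := is_derive_sumr s (fun i => is_deriveZ (c i) (smooth_is_derive GA (sF i) Gx)).
by rewrite {1}/left_field derive1E; have [_ ->] := h.
Qed.

Let lin_thetaE L (x : M) : lin_theta L x = \sum_(ij : 'I_n * 'I_n) L ij.1 ij.2 * theta ij.1 ij.2 x.
Proof.
rewrite /lin_theta /lin pair_bigA/=; apply: eq_bigr => ij _.
by rewrite mxE.
Qed.

Let left_field_lin_theta k L : left_field (E k) (lin_theta L) 1%:M = lin L (E k).
Proof.
have -> : lin_theta L = fun x => \sum_(ij : 'I_n * 'I_n) L ij.1 ij.2 * theta ij.1 ij.2 x.
  by apply/funext => x; exact: lin_thetaE.
rewrite left_field_sum; [|exact: GE|exact: lie_one|by move=> ij; exact: smooth_theta].
rewrite /lin pair_bigA/=; apply: eq_bigr => ij _.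
by rewrite left_field_theta.
Qed.

Let incr_mean_theta L t : 0 <= t <= T -> incr_mean t (lin_theta L) = 0.
Proof.
move=> /andP[t0 tT].
have := Ex_incr (lexx 0) t0 tT (smooth_lie_bm (smooth_lin_theta L)); rewrite subr0 => <-.
transitivity ('E (fun w => \sum_(ij : 'I_n * 'I_n) L ij.1 ij.2 * theta ij.1 ij.2 (incr 0 t w))).
  by apply: eq_Ex => w; rewrite lin_thetaE.
rewrite Ex_sum => [|ij]; last by apply: bmZ; exact: bm_theta.
by rewrite big1// => ij _; rewrite ExZ; [rewrite Ex_theta ?mulr0|exact: bm_theta].
Qed.

(** Deduced from the vanishing of the mean of theta for every t: the second order expansion leaves
    (t/2)|D| <= K t^2, so D = 0. *)
Let laplacian_lin_theta L : laplacian E (lin_theta L) 1%:M = 0.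
Proof.
have [K K0 hK] := incr_mean_order2 (smooth_lin_theta L).
apply/eqP; rewrite -normr_eq0 eq_le normr_ge0 andbT; set D := laplacian _ _ _.
have h t : 0 < t <= T -> `|D| <= 2 * K * t.
  move=> /andP[t0 tT]; have t0' : 0 <= t <= T by rewrite (ltW t0).
  have := hK t t0'; rewrite incr_mean_theta// lin_theta1 subrr sub0r normrN.
  rewrite normrM ger0_norm ?divr_ge0 ?(ltW t0)// -/D => hh.
  rewrite -(@ler_pM2l _ (t / 2)) ?divr_gt0// (le_trans hh)//.
  by have -> : t / 2 * (2 * K * t) = K * t ^+ 2 by field.
apply/ler_addgt0Pr => e e0; rewrite add0r.
pose t := Num.min T (e / (2 * K + 1)).
have k1 : 0 < 2 * K + 1 by rewrite ltr_wpDl// mulr_ge0.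
have t0 : 0 < t by rewrite lt_min T0 divr_gt0.
apply: (le_trans (h t _)); first by rewrite t0 ge_min lexx.
have : t <= e / (2 * K + 1) by rewrite ge_min lexx orbT.
rewrite ler_pdivlMr// => ht; apply: le_trans ht; rewrite mulrC ler_wpM2l ?ltW//.
by rewrite ltrDl.
Qed.

Lemma exp_theta_mean L : exists2 K : R, 0 <= K & forall t, 0 <= t <= T ->
  `|incr_mean t (fun x => expR (lin_theta L x)) - 1 - t / 2 * lin_gram L L| <= K * t ^+ 2.
Proof.
have [K K0 hK] := incr_mean_order2 (smooth_exp (smooth_lin_theta L)).
exists K => // t /hK; rewrite laplacian_exp// laplacian_lin_theta addr0 lin_theta1 expR0.
by under eq_bigr do rewrite left_field_lin_theta expr2.
Qed.

Let step0 : R * R * 'M[R]_n := (0, 0, 0).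

(** The integrand seen by a cell on which exactly the steps selected by c are active. There are
    finitely many patterns, whatever the grid, so estimates for each of them become uniform. *)
Let pattern_coef l (c : {ffun 'I_(size l) -> bool}) : 'I_n -> 'I_n -> R :=
  fun a b => \sum_i (c i)%:R * lincoef (nth step0 l i).2 a b.

Let sq_cvg_grid L t : 0 <= t <= T ->
  sq_cvg mu (fun N => lin_sum L (grid N) (idx N t)) (fun w => lin L (brown t w)).
Proof.
move=> tT; have [t0 tT'] := andP tT; have [K K0 hK] := sq_diff_lin_sum L.
have gapN N : gap N <= T / N.+1%:R.
  rewrite /gap exprVn ler_wpM2l ?(ltW T0)// lef_pV2 ?posrE ?exprn_gt0 ?ltr0n//.
  by rewrite -natrX ler_nat ltn_expl.
have gap_le k N : gap (k + N)%N <= gap N.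
  rewrite /gap ler_wpM2l ?(ltW T0)// exprD ler_piMl ?exprn_ge0//.
  by apply: exprn_ile1 => //; rewrite invf_le1// ler1n.
apply: (@sq_cvg_bound _ _ _ _ _ _ (K * (2 + 4 * T) * T)) => N.
apply: (@sq_integral_fatou _ _ _ mu (fun k w => lin_sum L (grid N) (idx N t) w -
  lin_sum L (grid (k + N)%N) (idx (k + N)%N t) w)).
- by move=> k; apply: measurable_funB; [have [] := bm_lin_sum L (grid N) (idx N t)|
    have [] := bm_lin_sum L (grid (k + N)%N) (idx (k + N)%N t)].
- apply: measurable_funB; last exact: measurable_lin_brown.
  by have [] := bm_lin_sum L (grid N) (idx N t).
- apply: filterS (brown_cvg tT) => w /(_ L) h; apply: cvgB; first exact: cvg_cst.
  by rewrite (cvg_shiftn N (fun k => lin_sum L (grid k) (idx k t) w)).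
move=> k; rewrite sq_integral_Ex ?lee_fin; last by apply: bmB; exact: bm_lin_sum.
have g0 := gap_gt0 N; have g1 := gap_gt0 (k + N)%N.
apply: (le_trans (hK _ _ _ _ _ _ _ _ _ _ (ltW g0) (ltW g1) (fine_grid N tT) (fine_grid (k + N)%N tT))).
rewrite subrr normr0 add0r -2!mulrA ler_wpM2l//.
have [a1 a2] := grid_idx N t0; have [b1 b2] := grid_idx (k + N)%N t0.
have gg := gap_le k N.
apply: (@le_trans _ _ ((2 + 4 * T) * gap N)); last first.
  by rewrite ler_wpM2l ?addr_ge0 ?mulr_ge0 ?(ltW T0).
have -> : (2 + 4 * T) * gap N = 2 * gap N + (gap N + gap N) * (T + T) by ring.
have a0 : 0 <= grid N (idx N t) by rewrite gridE mulr_ge0// ltW.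
have b0 : 0 <= grid (k + N)%N (idx (k + N)%N t) by rewrite gridE mulr_ge0// ltW.
apply: lerD.
  rewrite ler_norml; apply/andP; split; lra.
rewrite !subr0; apply: ler_pM; lra.
Qed.

Let wint_grid l N (w : W) : R := \sum_(x <- l)
  (lin_sum (lincoef x.2) (grid N) (idx N x.1.2) w - lin_sum (lincoef x.2) (grid N) (idx N x.1.1) w).

Let bm_wint_grid l N : bounded_measurable (wint_grid l N).
Proof. by apply: bm_sum => x; apply: bmB; exact: bm_lin_sum. Qed.

Let sq_cvg_wint_grid l : is_step G T l -> sq_cvg mu (wint_grid l) (wint l).
Proof.
move=> hl; apply: (sq_cvg_sum (f_ := fun x N w => lin_sum (lincoef x.2) (grid N) (idx N x.1.2) w -
  lin_sum (lincoef x.2) (grid N) (idx N x.1.1) w)) => [x k|x|x /In_mem/hl[x0 xx xT Gx]].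
- by have [] := bmB (bm_lin_sum (lincoef x.2) (grid k) (idx k x.1.2)) (bm_lin_sum (lincoef x.2) (grid k) (idx k x.1.1)).
- exact: measurable_brown_incr.
have m1 L N t : measurable_fun setT (lin_sum L (grid N) (idx N t)).
  by have [] := bm_lin_sum L (grid N) (idx N t).
have h1 : 0 <= x.1.1 <= T by rewrite x0 (le_trans xx).
have h2 : 0 <= x.1.2 <= T by rewrite xT (le_trans x0).
apply: (@eq_sq_cvg _ _ _ _ (fun N w => lin_sum (lincoef x.2) (grid N) (idx N x.1.2) w +
  -1 * lin_sum (lincoef x.2) (grid N) (idx N x.1.1) w) (fun w => lin (lincoef x.2) (brown x.1.2 w) +
  -1 * lin (lincoef x.2) (brown x.1.1 w))) => [k w|w|]; rewrite ?mulN1r//.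
apply: sq_cvgD; [by move=> k; exact: m1|exact: measurable_lin_brown| | |exact: sq_cvg_grid|].
- by move=> k; apply: measurable_funM.
- by apply: measurable_funM => //; exact: measurable_lin_brown.
by apply: sq_cvgZ; [by move=> k; exact: m1|exact: measurable_lin_brown|exact: sq_cvg_grid].
Qed.

Let ae_cvg_wint_grid l : is_step G T l ->
  \forall w \ae mu, wint_grid l N w @[N --> \oo] --> wint l w.
Proof.
elim: l => [_|x l IH /is_step_cons[[x0 xx xT Gx] /IH h]].
  apply: aeW => w; rewrite /wint_grid /wint big_nil; under eq_fun do rewrite big_nil.
  exact: cvg_cst.
have h1 : 0 <= x.1.1 <= T by rewrite x0 (le_trans xx).
have h2 : 0 <= x.1.2 <= T by rewrite xT (le_trans x0).
apply: filterS3 h (brown_cvg h1) (brown_cvg h2) => w h e1 e2.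
rewrite /wint_grid /wint big_cons; under eq_fun do rewrite big_cons.
by apply: cvgD => //; apply: cvgB; [exact: e2|exact: e1].
Qed.

Let active l (N q : nat) : {ffun 'I_(size l) -> bool} :=
  [ffun i : 'I_(size l) => (idx N (nth step0 l i).1.1 <= q < idx N (nth step0 l i).1.2)%N].

(** Exchanging the sum over steps with the sum over cells writes the approximation as a sum of
    functions of distinct increments, which are independent. *)
Let wint_gridE l N w : is_step G T l -> wint_grid l N w =
  \sum_(q < idx N T) lin_theta (pattern_coef (active l N q)) (incr (grid N q) (grid N q.+1) w).
Proof.
move=> hl; pose th q : 'M[R]_n := \matrix_(a, b) theta a b (incr (grid N q) (grid N q.+1) w).
have cell (q : nat) : lin_theta (pattern_coef (active l N q)) (incr (grid N q) (grid N q.+1) w) =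
    \sum_(x <- l) (idx N x.1.1 <= q < idx N x.1.2)%N%:R * lin (lincoef x.2) (th q).
  rewrite (big_nth step0) big_mkord /lin_theta -/(th q) /lin /pattern_coef.
  transitivity (\sum_i \sum_j \sum_(k < size l) (active l N q k)%:R * (lincoef (nth step0 l k).2 i j * th q i j)).
    apply: eq_bigr => i _; apply: eq_bigr => j _; rewrite mulr_suml; apply: eq_bigr => k _.
    by rewrite mulrA.
  under eq_bigr do rewrite exchange_big/=.
  rewrite exchange_big/=; apply: eq_bigr => k _; rewrite ffunE mulr_sumr; apply: eq_bigr => i _.
  by rewrite mulr_sumr.
under eq_bigr do rewrite cell.
rewrite exchange_big/= /wint_grid !big_seq; apply: eq_bigr => x /hl[x0 xx xT Gx].
rewrite -lin_sum_diff// /lin_sum.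
have i1 := idx_mono N x0 xx; have i2 := idx_mono N (le_trans x0 xx) xT.
transitivity (\sum_(idx N x.1.1 <= q < idx N x.1.2) lin (lincoef x.2) (th q)).
  rewrite -[idx N x.1.1 in RHS]add0n big_addn big_mkord; apply: eq_bigr => q _.
  by rewrite /th addnS (addnC q).
rewrite -(big_mkord xpredT (fun q => (idx N x.1.1 <= q < idx N x.1.2)%N%:R * lin (lincoef x.2) (th q))).
rewrite [RHS](big_cat_nat (n := idx N x.1.1))//=; last exact: (leq_trans i1 i2).
rewrite [X in _ = X + _]big_nat_cond [X in _ = X + _]big1 ?add0r; last first.
  by move=> q /andP[/andP[_ qx] _]; rewrite leqNgt qx mul0r.
rewrite [RHS](big_cat_nat (n := idx N x.1.2))//= [X in _ = _ + X]big_nat_cond [X in _ = _ + X]big1 ?addr0; last first.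
  by move=> q /andP[/andP[qx _] _]; rewrite (ltnNge q) qx andbF mul0r.
rewrite big_nat_cond [RHS]big_nat_cond; apply: eq_bigr => q /andP[/andP[q1 q2] _].
by rewrite q1 q2 mul1r.
Qed.

Let sq_theta_mean L : exists2 K : R, 0 <= K & forall t, 0 <= t <= T ->
  `|incr_mean t (fun x => lin_theta L x * lin_theta L x) - t * lin_gram L L| <= K * t ^+ 2.
Proof.
have sL := smooth_lin_theta L.
have [K K0 hK] := incr_mean_order2 (smoothM sL sL).
exists K => // t /hK; rewrite (laplacianM GE (lie_one G) sL sL) !lin_theta1 !(mulr0, mul0r) addr0 add0r subr0.
rewrite mulrA divfK//.
by under eq_bigr do rewrite !left_field_lin_theta.
Qed.

(** To second order the mean of exp(X) is 1 plus half the mean of X^2; then 1 + u <= exp(u). The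
    exponential form multiplies well over cells. *)
Let exp_theta_le l : exists2 K : R, 0 <= K & forall (c : {ffun 'I_(size l) -> bool}) t, 0 <= t <= T ->
  incr_mean t (fun x => expR (lin_theta (pattern_coef c) x)) <=
  expR (2^-1 * incr_mean t (fun x => lin_theta (pattern_coef c) x * lin_theta (pattern_coef c) x) + K * t ^+ 2).
Proof.
apply: uniform => [c|c K K' t tT KK' /le_trans]; last first.
  by apply; rewrite ler_expR lerD2l ler_wpM2r ?sqr_ge0.
have [K K0 hK] := exp_theta_mean (pattern_coef c); have [K' K0' hK'] := sq_theta_mean (pattern_coef c).
exists (K + K') => [|t tT]; first by rewrite addr_ge0.
apply: le_trans (expR_ge1Dx _).
have := hK t tT; have := hK' t tT; rewrite !ler_norml => /andP[h1 _] /andP[_ h2].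
have e0 : 0 <= K' * t ^+ 2 by rewrite mulr_ge0 ?sqr_ge0.
move: (incr_mean _ _) (incr_mean _ _) h1 h2 => x y h1 h2.
rewrite mulrDl; move: (K * t ^+ 2) (K' * t ^+ 2) e0 h1 h2 => u v e0 h1 h2.
by have : t / 2 * lin_gram (pattern_coef c) (pattern_coef c) =
  2^-1 * (t * lin_gram (pattern_coef c) (pattern_coef c)) by [field]; move: (_ * lin_gram _ _) h1 h2 => z *; lra.
Qed.

(** Terms from different cells are exactly uncorrelated. The exponents of the cellwise bounds
    therefore add up to half the second moment of the whole sum. *)
Let wint_grid_sq l N : is_step G T l -> 'E (fun w => wint_grid l N w ^+ 2) =
  \sum_(q < idx N T) incr_mean (gap N) (fun x => lin_theta (pattern_coef (active l N q)) x *
    lin_theta (pattern_coef (active l N q)) x).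
Proof.
move=> hl; have TT : 0 <= T <= T by rewrite lexx ltW.
have [g0 gT gs gt gq] := fine_grid N TT.
have [_ rng] := fine_times_range (fine_grid N TT).
have mono := fine_times_mono (fine_grid N TT).
pose x (q : nat) (w : W) := lin_theta (pattern_coef (active l N q)) (incr (grid N q) (grid N q.+1) w).
have bx q : bounded_measurable (x q) by exact: (lie_bm_incr _ _ (smooth_lie_bm (smooth_lin_theta _))).
transitivity (\sum_(q < idx N T) \sum_(q' < idx N T) 'E (fun w => x q w * x q' w)).
  transitivity ('E (fun w => \sum_(q < idx N T) \sum_(q' < idx N T) x q w * x q' w)).
    apply: eq_Ex => w; rewrite wint_gridE// expr2 mulr_suml; apply: eq_bigr => q _.
    by rewrite mulr_sumr.
  rewrite Ex_sum => [|q]; last by apply: bm_sum => q'; exact: bmM.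
  by apply: eq_bigr => q _; rewrite Ex_sum// => q'; exact: bmM.
apply: eq_bigr => q _; have qm := ltn_ord q.
rewrite (bigD1 q)//= big1 ?addr0; last first.
  move=> q' qq'; have qm' := ltn_ord q'.
  have cross (a b : nat) L L' : (a < b)%N -> (b < idx N T)%N ->
      'E (fun w => lin_theta L (incr (grid N a) (grid N a.+1) w) *
                   lin_theta L' (incr (grid N b) (grid N b.+1) w)) = 0.
    move=> ab bm; have am := ltn_trans ab bm.
    have cij i j k m : 'E (fun w => theta i j (incr (grid N a) (grid N a.+1) w) *
        theta k m (incr (grid N b) (grid N b.+1) w)) = 0.
      apply: cov_disjoint; [exact: (rng a (ltnW am)).1|exact: (gq a am).1|exact: mono (ltnW bm)|exact: (gq b bm).1|].
      exact: (rng b.+1 bm).2.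
    transitivity ('E (fun w => \sum_(u : 'I_n * 'I_n) \sum_(v : 'I_n * 'I_n) (L u.1 u.2 * L' v.1 v.2) *
        (theta u.1 u.2 (incr (grid N a) (grid N a.+1) w) * theta v.1 v.2 (incr (grid N b) (grid N b.+1) w)))).
      apply: eq_Ex => w; rewrite !lin_thetaE mulr_suml; apply: eq_bigr => u _.
      by rewrite mulr_sumr; apply: eq_bigr => v _; rewrite mulrACA.
    have bb u v : bounded_measurable (fun w : W => (L u.1 u.2 * L' v.1 v.2) *
        (theta u.1 u.2 (incr (grid N a) (grid N a.+1) w) * theta v.1 v.2 (incr (grid N b) (grid N b.+1) w))).
      by apply: bmZ; apply: bmM; exact: bm_theta.
    rewrite Ex_sum => [|u]; last by apply: bm_sum.
    rewrite big1// => u _; rewrite Ex_sum// big1// => v _.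
    by rewrite ExZ ?cij ?mulr0//; apply: bmM; exact: bm_theta.
  have [lt|gt'|/val_inj eq] := ltngtP q' q.
  - transitivity ('E (fun w => x q' w * x q w)); first by apply: eq_Ex => w; rewrite mulrC.
    exact: (cross q' q (pattern_coef (active l N q')) (pattern_coef (active l N q)) lt qm).
  - exact: cross.
  - by rewrite eq eqxx in qq'.
have := Ex_incr (rng q (ltnW qm)).1 (gq q qm).1 (rng q.+1 qm).2
  (smooth_lie_bm (smoothM (smooth_lin_theta (pattern_coef (active l N q))) (smooth_lin_theta (pattern_coef (active l N q))))).
rewrite /x => ->; congr incr_mean.
by rewrite !gridE -natr1 mulrDl mul1r addrC addKr.
Qed.

(** For the grid approximations the expectation is a product over cells, bounded cell by cell;
    Fatou's lemma passes to the limit. *)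
Lemma exp_wint l : is_step G T l ->
  (\int[mu]_w (expR (wint l w))%:E <= (expR (quad l + 1))%:E)%E.
Proof.
move=> hl; have TT : 0 <= T <= T by rewrite lexx ltW.
have [K K0 hK] := exp_theta_le l.
have lex N : 'E (fun w => expR (wint_grid l N w)) <=
    expR (2^-1 * 'E (fun w => wint_grid l N w ^+ 2) + K * T * gap N).
  have [g0 gT gs gt gq] := fine_grid N TT.
  have gN : 0 <= gap N <= T.
    by rewrite (ltW (gap_gt0 N))/= /gap ler_piMr ?(ltW T0)// exprn_ile1// invf_le1// ler1n.
  pose f q (x : M) := expR (lin_theta (pattern_coef (active l N q)) x).
  have bf q : lie_bm (f q) by apply: smooth_lie_bm; apply: smooth_exp; exact: smooth_lin_theta.
  rewrite (_ : 'E _ = 'E (fun w => \prod_(q < idx N T) f q (incr (grid N q) (grid N q.+1) w))); last first.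
    by apply: eq_Ex => w; rewrite wint_gridE// expR_sum.
  rewrite (Ex_prod_incr (r := grid N) (f := f))//; [|by move=> q qm; exact: (gq q qm).1|by rewrite g0].
  have gapE q : grid N q.+1 - grid N q = gap N by rewrite !gridE -natr1 mulrDl mul1r addrC addKr.
  apply: (@le_trans _ _ (\prod_(q < idx N T) expR (2^-1 * incr_mean (gap N) (fun x => lin_theta (pattern_coef (active l N q)) x *
      lin_theta (pattern_coef (active l N q)) x) + K * gap N ^+ 2))).
    apply: ler_prod => q _; rewrite gapE hK// andbT.
    have := Ex_incr (lexx 0) (ltW (gap_gt0 N)) (andP gN).2 (bf q); rewrite subr0 => <-.
    by apply: Ex_ge0 => w; exact: expR_ge0.
  rewrite -expR_sum ler_expR big_split/= -mulr_sumr -wint_grid_sq// lerD2l sumr_const card_ord -[leLHS]mulr_natl.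
  rewrite expr2 mulrCA -mulrA ler_wpM2l// mulrA ler_wpM2r ?(ltW (gap_gt0 N))//.
  by rewrite -gridE; have [] := grid_idx N (ltW T0).
have scvg := sq_cvg_wint_grid hl.
have mW N : measurable_fun setT (wint_grid l N) by have [] := bm_wint_grid l N.
(* The second moment of the approximation is at most 2 [quad l] plus twice the squared distance to
   the limit. With that squared distance and the error K T gap both at most 1/4, the exponent is at
   most [quad l] + 1/2. *)
have [N0 hN0] : exists N0, forall N, (N0 <= N)%N -> 'E (fun w => expR (wint_grid l N w)) <= expR (quad l + 1).
  have /fine_cvgP[dfin /cvgrPdist_le /(_ 4^-1)] := scvg.
  rewrite invr_gt0 ltr0n => /(_ isT) dle.
  have kt : 0 < 4^-1 / (K * T + 1) by rewrite divr_gt0// ltr_wpDl// mulr_ge0// ltW.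
  have [N1 hN1] := gap_cvg0 kt.
  have : \forall N \near \oo, (N1 <= N)%N /\ sq_integral mu (fun w => wint_grid l N w - wint l w) \is a fin_num /\
      `|0 - (fine \o (fun N => sq_integral mu (fun w => wint_grid l N w - wint l w))) N| <= 4^-1.
    by near=> N; split; [near: N; exact: nbhs_infty_ge|split; near: N].
  move=> [N0 _ h]; exists N0 => N /h[/hN1 gN [fin]] /=; rewrite sub0r normrN => dN.
  apply: (le_trans (lex N)); rewrite ler_expR.
  have KT : K * T * gap N <= 4^-1.
    have := gN; rewrite ler_pdivlMr ?ltr_wpDl ?mulr_ge0 ?(ltW T0)// => /(le_trans _); apply.
    by rewrite mulrC ler_wpM2l ?(ltW (gap_gt0 N))// lerDl.
  have : (('E (fun w => wint_grid l N w ^+ 2))%:E <= (2 * quad l + 2 * fine (sq_integral mu (fun w => wint_grid l N w - wint l w)))%:E)%E.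
    rewrite -sq_integral_Ex; last exact: bm_wint_grid.
    rewrite (@eq_sq_integral _ _ _ _ (wint_grid l N) (fun w => wint l w + (wint_grid l N w - wint l w))); last first.
      by move=> w; congr (_ ^+ 2); ring.
    apply: (le_trans (sq_integralD mu (measurable_wint l) (measurable_funB (mW N) (measurable_wint l)))).
    by rewrite sq_integral_wint// (EFinD (2 * quad l)) (EFinM 2 (quad l)) (EFinM 2 (fine _)) (fineK fin).
  rewrite lee_fin => hEx; have := le_trans (ler_norm _) dN => dN'.
  move: hEx KT dN'; move: ('E _) (fine _) (K * T * gap N) (quad l) => *; lra.
apply: (@fatou_ae _ _ _ mu (fun k w => expR (wint_grid l (k + N0)%N w))).
- by move=> k; apply: measurableT_comp => //; exact: mW.
- by apply: measurableT_comp => //; exact: measurable_wint.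
- by move=> k w; exact: expR_ge0.
- by move=> w; exact: expR_ge0.
- apply: filterS (ae_cvg_wint_grid hl) => w h.
  have hc : wint_grid l (k + N0)%N w @[k --> \oo] --> wint l w.
    by rewrite (cvg_shiftn N0 (fun N => wint_grid l N w)).
  apply: continuous_cvg; [exact: continuous_expR|exact: hc].
move=> k; have bexp : bounded_measurable (fun w => expR (wint_grid l (k + N0)%N w)).
  have [mX [B hB]] := bm_wint_grid l (k + N0)%N; split; first exact: measurableT_comp.
  by exists (expR B) => w; rewrite ger0_norm ?expR_ge0// ler_expR (le_trans (ler_norm _)).
have /integrable_fin_num fin := bm_integrable mu bexp.
by rewrite -(fineK (fin measurableT)) lee_fin; apply: hN0; exact: leq_addl.
Unshelve. all: by end_near. Qed.

(** * The Euler scheme *)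

Let entry_order2 : exists2 K : R, 0 <= K & forall i j t, 0 <= t <= T ->
  `|incr_mean_mx t i j - (i == j)%:R - t / 2 * C i j| <= K * t ^+ 2.
Proof.
have [||K K0 hK] := @uniform ('I_n * 'I_n)%type (fun ij K t =>
  `|incr_mean_mx t ij.1 ij.2 - (ij.1 == ij.2)%:R - t / 2 * C ij.1 ij.2| <= K * t ^+ 2).
- move=> [i j] /=; have [K K0 hK] := incr_mean_order2 (smooth_entry G i j).
  exists K => // t /[dup] /andP[t0 _] /hK.
  by rewrite incr_mean_entry// (laplacian_entry GE i j (lie_one G)) mul1mx mxE.
- by move=> i K K' t _ KK' /le_trans; apply; rewrite ler_wpM2r ?sqr_ge0.
by exists K => // i j t; exact: (hK (i, j)).
Qed.

Let left_fieldB A F H x : lie_algebra G A -> lie_set G x -> smooth G F -> smooth G H ->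
  left_field A (fun x => F x - H x) x = left_field A F x - left_field A H x.
Proof.
move=> GA Gx sF sH; have h := is_deriveB (smooth_is_derive GA sF Gx) (smooth_is_derive GA sH Gx).
by rewrite {1}/left_field derive1E; have [_ ->] := h.
Qed.

(** The function x - 1 - theta(x) vanishes at the identity together with its first derivatives, so
    the Laplacian of its square is zero there and the mean of the square is O(t^2). *)
Let entry_theta_sq : exists2 K : R, 0 <= K & forall i j t, 0 <= t <= T ->
  incr_mean t (fun x => (x i j - (i == j)%:R - theta i j x) * (x i j - (i == j)%:R - theta i j x)) <= K * t ^+ 2.
Proof.
have [||K K0 hK] := @uniform ('I_n * 'I_n)%type (fun ij K t =>
  incr_mean t (fun x => (x ij.1 ij.2 - (ij.1 == ij.2)%:R - theta ij.1 ij.2 x) *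
     (x ij.1 ij.2 - (ij.1 == ij.2)%:R - theta ij.1 ij.2 x)) <= K * t ^+ 2).
- move=> [i j] /=; pose F (x : 'M[R]_n) := x i j - (i == j)%:R - theta i j x.
  have sF : smooth G F.
    by apply: smoothB; [apply: smoothB; [exact: smooth_entry|exact: smooth_cst]|exact: smooth_theta].
  have F1 : F 1%:M = 0 by rewrite /F theta1 mxE subrr subr0.
  have dF k : left_field (E k) F 1%:M = 0.
    have se := smoothB (smooth_entry G i j) (smooth_cst G (i == j)%:R).
    rewrite /F (left_fieldB (GE k) (lie_one G) se (smooth_theta i j)).
    rewrite (left_fieldB (GE k) (lie_one G) (smooth_entry G i j) (smooth_cst G _)) left_field_theta.
    have -> : left_field (E k) (fun=> (i == j)%:R) 1%:M = 0 by rewrite /left_field; exact: derive1_cst.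
    have := is_derive_left_curve (E k) 1%:M i j.
    rewrite mul1mx => h2; rewrite /left_field derive1E; have [_ ->] := h2.
    by rewrite subr0 subrr.
  have [K K0 hK] := incr_mean_order2 (smoothM sF sF).
  exists K => // t /hK; rewrite (laplacianM GE (lie_one G) sF sF) F1 !(mulr0, mul0r) addr0 add0r.
  rewrite big1 => [|k _]; last by rewrite dF mul0r.
  by rewrite !mulr0 !subr0 => /(le_trans (ler_norm _)).
- by move=> i K K' t _ KK' /le_trans; apply; rewrite ler_wpM2r ?sqr_ge0.
by exists K => // i j t; exact: (hK (i, j)).
Qed.

Let half_le (x : R) : 0 <= x -> 2^-1 * x <= x.
Proof. by move=> x0; apply: ler_piMl => //; rewrite invf_le1 ?ler1n. Qed.

Let quarter_le (x : R) : 0 <= x -> 4^-1 * x <= x.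
Proof. by move=> x0; apply: ler_piMl => //; rewrite invf_le1 ?ler1n. Qed.

Definition euler_step (delta : R) (B : 'M[R]_n) : 'M[R]_n := 1%:M + B + (delta / 2) *: C.

(** The moments that feed the error recursion. v - 1 is a centred sum of thetas plus (e - c)C/2. The
    mean of the defect is the second order remainder of exp((e - c)C/2); its square is split into x
    - 1 - theta, theta minus the sum of thetas, and the drift. *)
Let block_bounds : exists2 K : R, 0 <= K & forall r m c e delta i j,
  fine_times r m c e delta -> 0 <= delta -> delta <= e - c ->
  let beta := fun w : W => \matrix_(a, b) theta_sum r m a b w in
  let v := fun w => euler_step (e - c) (beta w) in
  [/\ `|'E (fun w => (v w - 1%:M) i j)| <= K * (e - c),
      'E (fun w => (v w - 1%:M) i j ^+ 2) <= K * (e - c),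
      `|'E (fun w => (incr c e w - v w) i j)| <= K * (e - c) ^+ 2 &
      'E (fun w => (incr c e w - v w) i j ^+ 2) <= K * (e - c) ^+ 2].
Proof.
have [K1 K10 h1] := entry_order2; have [K2 K20 h2] := entry_theta_sq.
have [K3 K30 h3] := cov_theta_sum.
have h4 i j := sq_diff_lin_sum (fun a b => ((a == i) && (b == j))%:R).
pose K4 i j := sval (cid2 (h4 i j)).
pose g : R := \sum_i \sum_j `|gram i j i j|; pose cc : R := \sum_i \sum_j `|C i j|.
pose k4 : R := \sum_i \sum_j `|K4 i j|.
have le2 (F : 'I_n -> 'I_n -> R) i j : `|F i j| <= \sum_i \sum_j `|F i j|.
  rewrite (bigD1 i)//= (bigD1 j)//= -addrA lerDl addr_ge0//; first exact: sumr_ge0.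
  by apply: sumr_ge0 => k _; exact: sumr_ge0.
have ge2 (F : 'I_n -> 'I_n -> R) : 0 <= \sum_i \sum_j `|F i j|.
  by apply: sumr_ge0 => i _; exact: sumr_ge0.
have h4K r m s t delta r' m' s' t' delta' i j : 0 <= delta -> 0 <= delta' ->
    fine_times r m s t delta -> fine_times r' m' s' t' delta' ->
    'E (fun w => (theta_sum r m i j w - theta_sum r' m' i j w) ^+ 2) <=
    k4 * (`|s - s'| + `|t - t'| + (delta + delta') * ((t - s) + (t' - s'))).
  move=> d0 d0' ft ft'; have [st _] := fine_times_range ft; have [st' _] := fine_times_range ft'.
  have : 'E (fun w => (lin_sum (fun a b => ((a == i) && (b == j))%:R) r m w -
       lin_sum (fun a b => ((a == i) && (b == j))%:R) r' m' w) ^+ 2) <=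
    K4 i j * (`|s - s'| + `|t - t'| + (delta + delta') * ((t - s) + (t' - s'))).
    by rewrite /K4; case: cid2 => K /= K0; apply.
  have tE r0 m0 w : lin_sum (fun a b => ((a == i) && (b == j))%:R) r0 m0 w = theta_sum r0 m0 i j w.
    by apply: eq_bigr => q _; rewrite lin_delta mxE.
  under [X in 'E X]eq_fun do rewrite !tE.
  move/le_trans; apply; apply: ler_wpM2r.
    by apply: addr_ge0; [exact: addr_ge0|apply: mulr_ge0; apply: addr_ge0; rewrite ?subr_ge0].
  exact: le_trans (ler_norm _) (le2 _ i j).
have T0' := ltW T0.
(* One summand for each of the four bounds, in their order. *)
pose K : R := cc + (2 * (g + K3 * (T + T)) + cc * cc * T) + K1 + 4 * (K2 + 4 * k4 + cc * cc).
have G0 : 0 <= g by exact: ge2.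
have C0 : 0 <= cc by exact: ge2.
have k40 : 0 <= k4 by exact: ge2.
have A2 : 0 <= 2 * (g + K3 * (T + T)) + cc * cc * T.
  by apply: addr_ge0; rewrite !mulr_ge0// addr_ge0// mulr_ge0// addr_ge0.
have A4 : 0 <= 4 * (K2 + 4 * k4 + cc * cc).
  by rewrite mulr_ge0// !addr_ge0// mulr_ge0.
have [K0 Kcc Kb Kc Kd] : [/\ 0 <= K, cc <= K, 2 * (g + K3 * (T + T)) + cc * cc * T <= K,
    K1 <= K & 4 * (K2 + 4 * k4 + cc * cc) <= K].
  by rewrite /K; move: (2 * _ + _) (4 * _) A2 A4 => a b a0 b0; split; lra.
exists K => // r m c e delta i j ft d0 dle beta v.
have [ce rng] := fine_times_range ft; have [r0 rm c0 eT hq] := ft.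
have D0 : 0 <= e - c by rewrite subr_ge0.
have DT : 0 <= e - c <= T by rewrite D0 lerBlDr (le_trans eT)// lerDl.
have DlT : e - c <= T by case/andP: DT.
have bb : bounded_measurable (theta_sum r m i j) by exact: bm_theta_sum.
have bu : bounded_measurable (fun w : W => incr c e w i j).
  exact: (lie_bm_incr c e (smooth_lie_bm (smooth_entry G i j))).
have vE w : (v w - 1%:M) i j = theta_sum r m i j w + (e - c) / 2 * C i j.
  by rewrite /v /euler_step /beta !mxE; ring.
have rE w : (incr c e w - v w) i j = incr c e w i j - (i == j)%:R - theta_sum r m i j w - (e - c) / 2 * C i j.
  by rewrite /v /euler_step /beta mxE [in X in _ + X]mxE [in X in - X]mxE [in X in - X]mxE !mxE; ring.
have Eth : 'E (theta_sum r m i j) = 0.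
  rewrite /theta_sum Ex_sum => [|q]; last exact: bm_theta.
  rewrite big1// => q _; have qm := ltn_ord q; apply: Ex_theta.
  - exact: (rng q (ltnW qm)).1.
  - exact: (hq q qm).1.
  - exact: (rng q.+1 qm).2.
have Cle : `|C i j| <= cc by exact: le2.
split.
- under [X in 'E X]eq_fun do rewrite vE.
  rewrite ExD ?Ex_cst ?Eth ?add0r//; last exact: bm_cst.
  have -> : `|(e - c) / 2 * C i j| = 2^-1 * (`|C i j| * (e - c)).
    by rewrite normrM ger0_norm ?divr_ge0//; ring.
  have h : `|C i j| * (e - c) <= K * (e - c) by rewrite ler_wpM2r// (le_trans Cle).
  by apply: le_trans h; apply: half_le; exact: mulr_ge0.
- under [X in 'E X]eq_fun do rewrite vE.
  apply: (@le_trans _ _ ('E (fun w => 2 * (theta_sum r m i j w * theta_sum r m i j w) + 2 * ((e - c) / 2 * C i j) ^+ 2))).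
    apply: Ex_le => [||w]; first by under eq_fun do rewrite expr2; apply: bmM; apply: bmD => //; exact: bm_cst.
      by apply: bmD; [apply: bmZ; exact: bmM|exact: bm_cst].
    rewrite -subr_ge0; set x := theta_sum _ _ _ _ _; set y := _ * C i j.
    by have -> : 2 * (x * x) + 2 * y ^+ 2 - (x + y) ^+ 2 = (x - y) ^+ 2 by [ring]; exact: sqr_ge0.
  rewrite ExD; [|by apply: bmZ; exact: bmM|exact: bm_cst]; rewrite Ex_cst ExZ; last exact: bmM.
  have := h3 i j i j _ _ _ _ _ _ _ _ _ _ ft ft.
  rewrite (overlap_nested (lexx c) ce (lexx e)) ler_norml => /andP[_ hh].
  have gle : gram i j i j <= g by apply: le_trans (ler_norm _) _; exact: (le2 (fun i j => gram i j i j)).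
  have e1 : (e - c) * gram i j i j <= (e - c) * g by exact: ler_wpM2l.
  have e2 : K3 * (delta + delta) * (e - c) <= K3 * (T + T) * (e - c).
    by rewrite ler_wpM2r// ler_wpM2l// lerD// (le_trans dle).
  have e3 : 2 * ((e - c) / 2 * C i j) ^+ 2 <= cc * cc * T * (e - c).
    have -> : 2 * ((e - c) / 2 * C i j) ^+ 2 = 2^-1 * (C i j ^+ 2 * ((e - c) * (e - c))) by field.
    have h : C i j ^+ 2 * ((e - c) * (e - c)) <= cc * cc * T * (e - c).
      rewrite -mulrA; apply: ler_pM; rewrite ?sqr_ge0 ?mulr_ge0//; last by rewrite ler_wpM2r.
      by rewrite -(real_normK (num_real (C i j))) expr2 ler_pM.
    by apply: le_trans h; apply: half_le; apply: mulr_ge0; rewrite ?sqr_ge0 ?mulr_ge0.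
  apply: (@le_trans _ _ ((2 * (g + K3 * (T + T)) + cc * cc * T) * (e - c))); last by rewrite ler_wpM2r.
  rewrite (mulrDl _ (cc * cc * T)) lerD// -mulrA ler_wpM2l// mulrDl.
  by move: hh e1 e2; move: ('E _) (_ * gram _ _ _ _) (_ * (e - c)) (_ * (e - c)) => *; lra.
- under [X in 'E X]eq_fun do rewrite rE.
  rewrite ExB; [|by apply: bmB => //; apply: bmB => //; exact: bm_cst|exact: bm_cst].
  rewrite ExB//; last by apply: bmB => //; exact: bm_cst.
  rewrite ExB//; last exact: bm_cst.
  rewrite !Ex_cst Eth subr0 Ex_entry//.
  by rewrite (le_trans (h1 i j _ DT))// ler_wpM2r ?sqr_ge0.
- under [X in 'E X]eq_fun do rewrite rE.
  pose x (w : W) := incr c e w i j - (i == j)%:R - theta i j (incr c e w).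
  pose y (w : W) := theta i j (incr c e w) - theta_sum r m i j w.
  pose z := (e - c) / 2 * C i j.
  have bt : bounded_measurable (fun w : W => theta i j (incr c e w)) by exact: bm_theta.
  have bx : bounded_measurable x by apply: bmB => //; apply: bmB => //; exact: bm_cst.
  have by_ : bounded_measurable y by exact: bmB.
  apply: (@le_trans _ _ ('E (fun w => 4 * (x w * x w) + 4 * (y w ^+ 2) + 4 * z ^+ 2))).
    apply: Ex_le => [||w].
    - under eq_fun do rewrite expr2.
      by apply: bmM; (apply: bmB; last exact: bm_cst); apply: bmB => //; apply: bmB => //; exact: bm_cst.
    - apply: bmD; last exact: bm_cst; apply: bmD; apply: bmZ; first exact: bmM.
      by under eq_fun do rewrite expr2; exact: bmM.
    have -> : incr c e w i j - (i == j)%:R - theta_sum r m i j w - z = x w + y w - z by rewrite /x /y; ring.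
    rewrite -subr_ge0; move: (x w) (y w) z => a b f.
    have -> : 4 * (a * a) + 4 * b ^+ 2 + 4 * f ^+ 2 - (a + b - f) ^+ 2 =
      (a - b) ^+ 2 + (a + f) ^+ 2 + (b + f) ^+ 2 + a ^+ 2 + b ^+ 2 + f ^+ 2 by ring.
    by rewrite !addr_ge0 ?sqr_ge0.
  have by2 : bounded_measurable (fun w => y w ^+ 2) by under eq_fun do rewrite expr2; exact: bmM.
  rewrite ExD; [|by apply: bmD; apply: bmZ => //; exact: bmM|exact: bm_cst].
  rewrite ExD; [|by apply: bmZ; exact: bmM|exact: bmZ].
  rewrite Ex_cst ExZ ?ExZ//; last exact: bmM.
  have e1 : 'E (fun w => x w * x w) <= K2 * (e - c) ^+ 2.
    pose F (u : 'M[R]_n) := u i j - (i == j)%:R - theta i j u.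
    have sF : smooth G F by apply: smoothB; [apply: smoothB; [exact: smooth_entry|exact: smooth_cst]|exact: smooth_theta].
    have := Ex_incr c0 ce eT (smooth_lie_bm (smoothM sF sF)); rewrite /F /x => ->.
    exact: h2.
  have e2 : 'E (fun w => y w ^+ 2) <= 4 * k4 * (e - c) ^+ 2.
    pose r1 (q : nat) := if q is 0%N then c else e.
    have ft1 : fine_times r1 1 c e (e - c).
      by split => // -[|//] _ /=; split => //; rewrite addrC subrK.
    have := h4K _ _ _ _ _ _ _ _ _ _ i j D0 d0 ft1 ft.
    rewrite !subrr normr0 !add0r.
    rewrite (_ : 'E _ = 'E (fun w => y w ^+ 2)); last by apply: eq_Ex => w; rewrite /y /theta_sum big_ord1.
    move=> /le_trans; apply.
    have -> : 4 * k4 * (e - c) ^+ 2 = k4 * ((e - c + (e - c)) * (e - c + (e - c))) by ring.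
    have h : e - c + delta <= e - c + (e - c) by rewrite lerD2l.
    by apply: ler_wpM2l => //; apply: ler_wpM2r => //; exact: addr_ge0.
  have e3 : z ^+ 2 <= cc * cc * (e - c) ^+ 2.
    have -> : z ^+ 2 = 4^-1 * (C i j ^+ 2 * (e - c) ^+ 2) by rewrite /z; field.
    have h : C i j ^+ 2 * (e - c) ^+ 2 <= cc * cc * (e - c) ^+ 2.
      by rewrite ler_wpM2r ?sqr_ge0// -(real_normK (num_real (C i j))) expr2 ler_pM.
    by apply: le_trans h; apply: quarter_le; apply: mulr_ge0; rewrite ?sqr_ge0.
  apply: (@le_trans _ _ (4 * (K2 + 4 * k4 + cc * cc) * (e - c) ^+ 2)); last by rewrite ler_wpM2r ?sqr_ge0.
  have -> : 4 * (K2 + 4 * k4 + cc * cc) * (e - c) ^+ 2 = 4 * (K2 * (e - c) ^+ 2) +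
    4 * (4 * k4 * (e - c) ^+ 2) + 4 * (cc * cc * (e - c) ^+ 2) by ring.
  apply: lerD; last by rewrite ler_wpM2l.
  by apply: lerD; rewrite ler_wpM2l.
Qed.

Definition sqsum (D : W -> 'M[R]_n) : R := \sum_i \sum_j 'E (fun w => D w i j ^+ 2).

Let sum_sq_le (x : 'I_n -> R) : (\sum_i x i) ^+ 2 <= n%:R * \sum_i x i ^+ 2.
Proof.
have -> : (\sum_i x i) ^+ 2 = \sum_i \sum_j x i * x j.
  by rewrite expr2 mulr_suml; apply: eq_bigr => i _; rewrite mulr_sumr.
apply: (@le_trans _ _ (\sum_i \sum_j 2^-1 * (x i ^+ 2 + x j ^+ 2))).
  apply: ler_sum => i _; apply: ler_sum => j _; rewrite -subr_ge0.
  have -> : 2^-1 * (x i ^+ 2 + x j ^+ 2) - x i * x j = 2^-1 * (x i - x j) ^+ 2 by field.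
  by rewrite mulr_ge0 ?sqr_ge0.
under eq_bigr do rewrite -mulr_sumr big_split/= sumr_const card_ord.
rewrite -mulr_sumr big_split/= sumr_const card_ord -[X in _ * (_ + X)]mulr_natl.
have -> : \sum_(i < n) x i ^+ 2 *+ n = n%:R * \sum_i x i ^+ 2.
  by rewrite mulr_sumr; apply: eq_bigr => i _; rewrite -[LHS]mulr_natl.
by move: (n%:R * _) => a; have -> : 2^-1 * (a + a) = a by field.
Qed.

(* The recursion D' = D (1 + v) + U rem for the error of the Euler scheme: [D] and [U]
   are functions of the past, [v] and [rem] of the next increment. *)
Let recursion : exists2 K : R, 0 <= K & forall k (r : nat -> R) (P Q : pred nat)
    (D U v rem : W -> 'M[R]_n) (c delta : R),
  (forall i, (i < k)%N -> r i <= r i.+1) -> 0 <= r 0%N -> r k <= T ->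
  (forall i, P i -> ~~ Q i) ->
  (forall i j, tensor k r P (fun w => D w i j)) -> (forall i j, tensor k r P (fun w => U w i j)) ->
  (forall i j, tensor k r Q (fun w => v w i j)) -> (forall i j, tensor k r Q (fun w => rem w i j)) ->
  (forall w, lie_set G (U w)) -> 0 <= c -> 0 <= delta <= T ->
  (forall i j, `|'E (fun w => v w i j)| <= c * delta) ->
  (forall i j, 'E (fun w => v w i j ^+ 2) <= c * delta) ->
  (forall i j, `|'E (fun w => rem w i j)| <= c * delta ^+ 2) ->
  (forall i j, 'E (fun w => rem w i j ^+ 2) <= c * delta ^+ 2) ->
  sqsum (fun w => D w + D w *m v w + U w *m rem w) <=
  (1 + K * c * delta) * sqsum D + K * c * delta ^+ 2.
Proof.
have [KG KG0 hG] := lie_norm_bounded G; pose N : R := n%:R.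
have N0 : 0 <= N by [].
have T0' := ltW T0.
exists (2 * N * N + 2 * N + N * KG * T + (2 * N * N * N * N * KG * KG + N * N * N * KG)).
  by rewrite !addr_ge0 ?mulr_ge0.
move=> k r P Q D U v rem c delta rr r0 rk PQ tD tU tv trem GU c0 /andP[d0 dT] Ev Ev2 Er Er2.
have bD i j : bounded_measurable (fun w => D w i j) by exact: tensor_bm (tD i j).
have bU i j : bounded_measurable (fun w => U w i j) by exact: tensor_bm (tU i j).
have bv i j : bounded_measurable (fun w => v w i j) by exact: tensor_bm (tv i j).
have br i j : bounded_measurable (fun w => rem w i j) by exact: tensor_bm (trem i j).
have bsq (X : W -> R) : bounded_measurable X -> bounded_measurable (fun w => X w ^+ 2).
  by move=> bX; under eq_fun do rewrite expr2; exact: bmM.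
have tsq S (X : W -> R) : tensor k r S X -> tensor k r S (fun w => X w ^+ 2).
  by move=> tX; under eq_fun do rewrite expr2; exact: tensorMl.
have bmx (A B : W -> 'M[R]_n) : (forall i j, bounded_measurable (fun w => A w i j)) ->
    (forall i j, bounded_measurable (fun w => B w i j)) ->
    forall i j, bounded_measurable (fun w => (A w *m B w) i j).
  move=> bA bB i j; under eq_fun do rewrite mxE.
  by apply: bm_sum => l; exact: bmM.
have indep (X Y : W -> R) : tensor k r P X -> tensor k r Q Y -> 'E (fun w => X w * Y w) = 'E X * 'E Y.
  by move=> tX tY; exact: (tensor_indep rr r0 rk PQ tX tY).
pose e := sqsum D.
have ED0 i j : 0 <= 'E (fun w => D w i j ^+ 2) by apply: Ex_ge0 => w; exact: sqr_ge0.
have e0 : 0 <= e by apply: sumr_ge0 => i _; apply: sumr_ge0 => j _.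
have U1 i j w : `|U w i j| <= KG by rewrite (le_trans (le_mx_norm _ _ _))// hG.
have prodsq (X Y : W -> R) : bounded_measurable X -> bounded_measurable Y ->
    `|'E (fun w => X w * Y w)| <= 2^-1 * ('E (fun w => X w ^+ 2) + 'E (fun w => Y w ^+ 2)).
  move=> bX bY; have b1 := bmM bX bY.
  have b2 := bsq _ bX; have b3 := bsq _ bY.
  rewrite -(ExD mu b2 b3) -ExZ; last exact: bmD.
  rewrite ler_norml; apply/andP; split; last first.
    apply: Ex_le => //; first by apply: bmZ; apply: bmD; exact: bsq.
    move=> w; rewrite -subr_ge0.
    have -> : 2^-1 * (X w ^+ 2 + Y w ^+ 2) - X w * Y w = 2^-1 * (X w - Y w) ^+ 2 by field.
    by rewrite mulr_ge0 ?sqr_ge0.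
  rewrite lerNl -mulN1r -ExZ//; apply: Ex_le; [exact: bmZ|by apply: bmZ; apply: bmD; exact: bsq|].
  move=> w; rewrite -subr_ge0.
  have -> : 2^-1 * (X w ^+ 2 + Y w ^+ 2) - -1 * (X w * Y w) = 2^-1 * (X w + Y w) ^+ 2 by field.
  by rewrite mulr_ge0 ?sqr_ge0.
have Psq i j : 'E (fun w => (D w *m v w) i j ^+ 2) <= N * (c * delta) * \sum_l 'E (fun w => D w i l ^+ 2).
  apply: (@le_trans _ _ ('E (fun w => N * \sum_l (D w i l ^+ 2 * v w l j ^+ 2)))).
    apply: Ex_le => [||w]; [exact/bsq/bmx| |].
      by apply: bmZ; apply: bm_sum => l; apply: bmM; exact: bsq.
    rewrite mxE (le_trans (sum_sq_le _))// ler_wpM2l//.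
    by apply: ler_sum => l _; rewrite exprMn.
  rewrite ExZ; last by apply: bm_sum => l; apply: bmM; exact: bsq.
  rewrite -mulrA ler_wpM2l// Ex_sum => [|l]; last by apply: bmM; exact: bsq.
  rewrite mulr_sumr; apply: ler_sum => l _; rewrite indep; [|exact: tsq|exact: tsq].
  by rewrite mulrC ler_wpM2r.
have Qsq i j : 'E (fun w => (U w *m rem w) i j ^+ 2) <= N * N * (KG * KG) * (c * delta ^+ 2).
  apply: (@le_trans _ _ ('E (fun w => N * \sum_l (KG * KG * rem w l j ^+ 2)))).
    apply: Ex_le => [||w]; [exact/bsq/bmx| |].
      by apply: bmZ; apply: bm_sum => l; apply: bmZ; exact: bsq.
    rewrite mxE (le_trans (sum_sq_le _))// ler_wpM2l//.
    apply: ler_sum => l _; rewrite exprMn ler_wpM2r ?sqr_ge0//.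
    by rewrite -(real_normK (num_real (U w i l))) expr2 ler_pM.
  rewrite ExZ; last by apply: bm_sum => l; apply: bmZ; exact: bsq.
  rewrite -!mulrA ler_wpM2l// Ex_sum => [|l]; last by apply: bmZ; exact: bsq.
  apply: (@le_trans _ _ (\sum_(l < n) KG * (KG * (c * delta ^+ 2)))); last first.
    by rewrite sumr_const card_ord -[leLHS]mulr_natl.
  apply: ler_sum => l _; rewrite ExZ; last exact: bsq.
  by rewrite -mulrA; do 2 (apply: ler_wpM2l => //).
(* In the cross terms independence brings in only the mean of v, of order delta; the Cauchy-Schwarz
   inequality would give the square root of delta. The same device is used for rem. *)
have DP i j : 'E (fun w => D w i j * (D w *m v w) i j) <=
    c * delta * \sum_l 2^-1 * ('E (fun w => D w i j ^+ 2) + 'E (fun w => D w i l ^+ 2)).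
  rewrite (_ : 'E _ = \sum_l 'E (fun w => D w i j * D w i l) * 'E (fun w => v w l j)).
    rewrite mulr_sumr; apply: ler_sum => l _; apply: le_trans (ler_norm _) _.
    by rewrite normrM mulrC ler_pM// prodsq.
  transitivity ('E (fun w => \sum_l (D w i j * D w i l) * v w l j)).
    by apply: eq_Ex => w; rewrite mxE mulr_sumr; apply: eq_bigr => l _; rewrite mulrA.
  rewrite Ex_sum => [|l]; last by apply: bmM => //; exact: bmM.
  by apply: eq_bigr => l _; rewrite indep//; exact: tensorMl.
have DQ i j : 'E (fun w => D w i j * (U w *m rem w) i j) <=
    N * KG * (c * delta ^+ 2) * (2^-1 * ('E (fun w => D w i j ^+ 2) + 1)).
  rewrite (_ : 'E _ = \sum_l 'E (fun w => D w i j * U w i l) * 'E (fun w => rem w l j)); last first.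
    transitivity ('E (fun w => \sum_l (D w i j * U w i l) * rem w l j)).
      by apply: eq_Ex => w; rewrite mxE mulr_sumr; apply: eq_bigr => l _; rewrite mulrA.
    rewrite Ex_sum => [|l]; last by apply: bmM => //; exact: bmM.
    by apply: eq_bigr => l _; rewrite indep//; exact: tensorMl.
  apply: (@le_trans _ _ (\sum_(l < n) KG * (2^-1 * ('E (fun w => D w i j ^+ 2) + 1)) * (c * delta ^+ 2))); last first.
    by rewrite sumr_const card_ord -[leLHS]mulr_natl -/N le_eqVlt; apply/orP; left; apply/eqP; ring.
  apply: ler_sum => l _; apply: le_trans (ler_norm _) _; rewrite normrM ler_pM//.
  have bD2 := bsq _ (bD i j).
  have b1 : bounded_measurable (fun w => KG * (2^-1 * (D w i j ^+ 2 + 1))).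
    by apply: bmZ; apply: bmZ; apply: bmD => //; exact: bm_cst.
  have bDU : bounded_measurable (fun w => D w i j * U w i l) by exact: bmM.
  have pw w : `|D w i j * U w i l| <= KG * (2^-1 * (D w i j ^+ 2 + 1)).
    rewrite normrM mulrC; apply: ler_pM => //.
    rewrite -(real_normK (num_real (D w i j))) -subr_ge0; move: `|D w i j| => x.
    have -> : 2^-1 * (x ^+ 2 + 1) - x = 2^-1 * (x - 1) ^+ 2 by field.
    by rewrite mulr_ge0 ?sqr_ge0.
  have EE : 'E (fun w => KG * (2^-1 * (D w i j ^+ 2 + 1))) = KG * (2^-1 * ('E (fun w => D w i j ^+ 2) + 1)).
    rewrite ExZ; last by apply: bmZ; apply: bmD => //; exact: bm_cst.
    rewrite ExZ; last by apply: bmD => //; exact: bm_cst.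
    by rewrite ExD ?Ex_cst//; exact: bm_cst.
  rewrite -EE ler_norml; apply/andP; split.
    rewrite lerNl -mulN1r -ExZ//; apply: Ex_le => //; first exact: bmZ.
    by move=> w; rewrite mulN1r (le_trans _ (pw w))// -normrN ler_norm.
  by apply: Ex_le => // w; exact: le_trans (ler_norm _) (pw w).
have cell i j : 'E (fun w => (D w + D w *m v w + U w *m rem w) i j ^+ 2) <=
    'E (fun w => D w i j ^+ 2) + 2 * (N * (c * delta) * \sum_l 'E (fun w => D w i l ^+ 2)) +
    2 * (N * N * (KG * KG) * (c * delta ^+ 2)) +
    2 * (c * delta * \sum_l 2^-1 * ('E (fun w => D w i j ^+ 2) + 'E (fun w => D w i l ^+ 2))) +
    2 * (N * KG * (c * delta ^+ 2) * (2^-1 * ('E (fun w => D w i j ^+ 2) + 1))).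
  pose dv (w : W) := (D w *m v w) i j; pose ur (w : W) := (U w *m rem w) i j.
  have bp : bounded_measurable dv by exact: bmx.
  have bq : bounded_measurable ur by exact: bmx.
  have bD2 := bsq _ (bD i j).
  apply: (@le_trans _ _ ('E (fun w => D w i j ^+ 2 + 2 * dv w ^+ 2 + 2 * ur w ^+ 2 +
    2 * (D w i j * dv w) + 2 * (D w i j * ur w)))).
    have addE (X Y : 'M[R]_n) : (X + Y) i j = X i j + Y i j by rewrite mxE.
    apply: Ex_le => [||w].
    - apply: bsq; under eq_fun do rewrite !addE.
      by apply: bmD => //; exact: bmD.
    - by do 4 (apply: bmD; last by [apply: bmZ; exact: bsq|apply: bmZ; exact: bmM]).
    rewrite !addE -/(dv w) -/(ur w) -subr_ge0; move: (D w i j) (dv w) (ur w) => x y z.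
    have -> : x ^+ 2 + 2 * y ^+ 2 + 2 * z ^+ 2 + 2 * (x * y) + 2 * (x * z) - (x + y + z) ^+ 2 = (y - z) ^+ 2 by ring.
    exact: sqr_ge0.
  have b2 (X : W -> R) : bounded_measurable X -> bounded_measurable (fun w => 2 * X w) by exact: bmZ.
  have bDp : bounded_measurable (fun w => D w i j * dv w) by exact: bmM.
  have bDq : bounded_measurable (fun w => D w i j * ur w) by exact: bmM.
  have bp2 := bsq _ bp; have bq2 := bsq _ bq.
  rewrite ExD; [|by do 3 (apply: bmD; last exact: b2)|exact: b2].
  rewrite ExD; [|by do 2 (apply: bmD; last exact: b2)|exact: b2].
  rewrite ExD; [|by apply: bmD; last exact: b2|exact: b2].
  rewrite ExD; [|by []|exact: b2].
  rewrite !ExZ//.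
  apply: lerD; last by apply: ler_wpM2l => //; exact: DQ.
  apply: lerD; last by apply: ler_wpM2l => //; exact: DP.
  apply: lerD; last by apply: ler_wpM2l => //; exact: Qsq.
  by apply: lerD => //; apply: ler_wpM2l => //; exact: Psq.
apply: (@le_trans _ _ (\sum_i \sum_j ('E (fun w => D w i j ^+ 2) + 2 * (N * (c * delta) * \sum_l 'E (fun w => D w i l ^+ 2)) +
    2 * (N * N * (KG * KG) * (c * delta ^+ 2)) +
    2 * (c * delta * \sum_l 2^-1 * ('E (fun w => D w i j ^+ 2) + 'E (fun w => D w i l ^+ 2))) +
    2 * (N * KG * (c * delta ^+ 2) * (2^-1 * ('E (fun w => D w i j ^+ 2) + 1)))))).
  by apply: ler_sum => i _; apply: ler_sum => j _; exact: cell.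
have cst2 (a : R) : \sum_(i < n) \sum_(j < n) a = N * N * a.
  by under eq_bigr do rewrite sumr_const card_ord; rewrite sumr_const card_ord -mulrnA -[LHS]mulr_natl natrM.
have s1 : \sum_i \sum_(j < n) \sum_l 'E (fun w => D w i l ^+ 2) = N * e.
  rewrite /e /sqsum mulr_sumr; apply: eq_bigr => i _.
  by rewrite sumr_const card_ord -[LHS]mulr_natl.
have s2 : \sum_i \sum_j \sum_l 2^-1 * ('E (fun w => D w i j ^+ 2) + 'E (fun w => D w i l ^+ 2)) = N * e.
  transitivity (2^-1 * (\sum_i \sum_j \sum_(l < n) 'E (fun w => D w i j ^+ 2) + \sum_i \sum_(j < n) \sum_l 'E (fun w => D w i l ^+ 2))).
    rewrite -big_split/= mulr_sumr; apply: eq_bigr => i _; rewrite -big_split/= mulr_sumr; apply: eq_bigr => j _.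
    by rewrite -big_split/= mulr_sumr.
  rewrite s1; have -> : \sum_i \sum_j \sum_(l < n) 'E (fun w => D w i j ^+ 2) = N * e.
    rewrite /e /sqsum mulr_sumr; apply: eq_bigr => i _; rewrite mulr_sumr; apply: eq_bigr => j _.
    by rewrite sumr_const card_ord -[LHS]mulr_natl.
  by field.
have s3 : \sum_i \sum_j (2^-1 * ('E (fun w => D w i j ^+ 2) + 1)) = 2^-1 * (e + N * N).
  rewrite -[N * N]mulr1 -cst2 /e /sqsum -big_split/= mulr_sumr; apply: eq_bigr => i _.
  by rewrite -big_split/= mulr_sumr.
have split2 (F H : 'I_n -> 'I_n -> R) : \sum_i \sum_j (F i j + H i j) = \sum_i \sum_j F i j + \sum_i \sum_j H i j.
  by rewrite -big_split/=; apply: eq_bigr => i _; rewrite big_split.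
have mul2 (a : R) (F : 'I_n -> 'I_n -> R) : \sum_i \sum_j (a * F i j) = a * \sum_i \sum_j F i j.
  by rewrite mulr_sumr; apply: eq_bigr => i _; rewrite mulr_sumr.
do 4 rewrite split2.
rewrite cst2 -/(sqsum D) -/e.
rewrite (mul2 2 (fun i j => N * (c * delta) * _)) mul2 s1.
rewrite (mul2 2 (fun i j => c * delta * _)) mul2 s2.
rewrite (mul2 2 (fun i j => N * KG * (c * delta ^+ 2) * _)) mul2 s3.
have h : N * KG * (c * delta ^+ 2) * e <= N * KG * T * c * delta * e.
  rewrite ler_wpM2r// (_ : N * KG * T * c * delta = N * KG * (c * (T * delta))); last by ring.
  by rewrite ler_wpM2l ?mulr_ge0// ler_wpM2l// expr2 ler_wpM2r.
set lhs := (X in X <= _); set rhs := (X in _ <= X).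
have -> : rhs = lhs + (N * KG * T * c * delta * e - N * KG * (c * delta ^+ 2) * e +
    ((2 * N * N * N * N * KG * KG + N * N * N * KG) * c * delta * e +
     (2 * N * N + 2 * N + N * KG * T) * c * delta ^+ 2)).
  by rewrite /lhs /rhs; field.
rewrite lerDl addr_ge0 ?subr_ge0// addr_ge0//.
  by do 3 (apply: mulr_ge0 => //); rewrite addr_ge0 ?mulr_ge0.
by apply: mulr_ge0; rewrite ?sqr_ge0// mulr_ge0// !addr_ge0 ?mulr_ge0.
Qed.

Fixpoint mprod (f : nat -> 'M[R]_n) (k : nat) : 'M[R]_n :=
  if k is k'.+1 then mprod f k' *m f k' else 1%:M.

Lemma cvg_mprod (f_ : nat -> nat -> 'M[R]_n) (f : nat -> 'M[R]_n) k :
  (forall q i j, (q < k)%N -> f_ N q i j @[N --> \oo] --> f q i j) ->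
  forall i j, mprod (f_ N) k i j @[N --> \oo] --> mprod f k i j.
Proof.
elim: k => [|k IH] hf i j /=; first exact: cvg_cst.
under eq_fun do rewrite mxE; rewrite mxE; apply: cvg_sumr => l _.
by apply: cvgM; [apply: IH => q a b qk; apply: hf; exact: ltnW|exact: hf].
Qed.

Let kb : R := sval (cid2 block_bounds).
Let kr : R := sval (cid2 recursion).

Let kb_ge0 : 0 <= kb. Proof. by rewrite /kb; case: cid2. Qed.
Let kr_ge0 : 0 <= kr. Proof. by rewrite /kr; case: cid2. Qed.

Let mxBE (A B : 'M[R]_n) i j : (A - B) i j = A i j - B i j.
Proof. by rewrite !mxE. Qed.

(** * The Euler scheme driven by midpoint sums *)

Section EulerScheme.
Variables (t : R) (a b : nat).
Hypotheses (t0 : 0 < t) (tT : t <= T) (a0 : (0 < a)%N) (b0 : (0 < b)%N).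

(** There are a Euler steps, each driven by a midpoint sum over b cells. Midpoint sums are bounded
    functions of the increments, so independence of the steps is exact; b tends to infinity
    afterwards. *)
Let r (q : nat) : R := t * (q%:R / (a * b)%:R).
Let cell i (w : W) : 'M[R]_n := \matrix_(x, y) theta_sum (fun q => r (i * b + q)%N) b x y w.
Let v i (w : W) := euler_step (t / a%:R) (cell i w).

Let ab0 : (0 : R) < (a * b)%:R.
Proof. by rewrite ltr0n muln_gt0 a0. Qed.

Let rS q : r q.+1 = r q + t / (a * b)%:R.
Proof. by rewrite /r -(natr1 q) [(_ + 1) / _]mulrDl mulrDr mul1r. Qed.

Let rb i : r (i * b) = i%:R * (t / a%:R).
Proof. by rewrite /r !natrM; field; rewrite !pnatr_eq0 -!lt0n a0 b0. Qed.

Let r_le i : (i < a * b)%N -> r i <= r i.+1.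
Proof. by move=> _; rewrite rS lerDl divr_ge0// ltW. Qed.

Let r_end : r (a * b) <= T.
Proof. by rewrite /r divff ?gt_eqF// mulr1. Qed.

Let cell_len i : r (i.+1 * b) - r (i * b) = t / a%:R.
Proof. by rewrite !rb -(natr1 i) mulrDl mul1r addrAC subrr add0r. Qed.

Let fine_cell i : (i < a)%N ->
  fine_times (fun q => r (i * b + q)%N) b (r (i * b)) (r (i.+1 * b)) (t / (a * b)%:R).
Proof.
move=> ia; split; [by rewrite addn0|by rewrite mulSn addnC| | |].
- by rewrite rb mulr_ge0// divr_ge0// ltW.
- apply: le_trans r_end; rewrite rb /r divff ?gt_eqF// mulr1 mulrCA.
  by rewrite ler_piMr ?(ltW t0)// ler_pdivrMr ?ltr0n// mul1r ler_nat.
- move=> q _; rewrite addnS rS; split => //.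
  by rewrite lerDl divr_ge0// ltW.
Qed.

Let tensor_v i x y : (i < a)%N ->
  tensor (a * b) r (fun q => (i * b <= q < i.+1 * b)%N) (fun w => (v i w - 1%:M) x y).
Proof.
move=> ia.
apply: (@tensor_ext _ _ _ (fun w => \sum_(q < b) theta x y (incr (r (i * b + q)) (r (i * b + q).+1) w) + t / a%:R / 2 * C x y)).
  move=> w; rewrite /v /euler_step /cell !mxE /theta_sum.
  rewrite (eq_bigr (fun q : 'I_b => theta x y (incr (r (i * b + q)) (r (i * b + q.+1)) w))); first by ring.
  by move=> q _; rewrite addnS.
apply: tensorD; last exact: tensor_cst.
apply: tensor_sum => q.
apply: (@tensor_gen _ _ _ (i * b + q) (theta x y)).
- by rewrite (@leq_trans (i.+1 * b))// ?leq_mul2r ?ia ?orbT// mulSn addnC ltn_add2r.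
- by rewrite leq_addr mulSn addnC ltn_add2r ltn_ord.
- exact: (smooth_lie_bm (smooth_theta x y)).
Qed.

Let tensor_V i x y : (i <= a)%N ->
  tensor (a * b) r (fun q => (q < i * b)%N) (fun w => mprod (fun q => v q w) i x y).
Proof.
elim: i x y => [|i IH] x y ia /=; first exact: tensor_cst.
apply: tensor_mulmx => {}x {}y.
  by apply: tensor_sub (IH _ _ (ltnW ia)) => q /leq_trans; apply; rewrite leq_mul2r leqnSn orbT.
apply: (@tensor_ext _ _ _ (fun w => (v i w - 1%:M) x y + (1%:M : 'M[R]_n) x y)).
  by move=> w; rewrite mxBE subrK.
apply: tensorD; last exact: tensor_cst.
by apply: tensor_sub (tensor_v x y ia) => q /andP[].
Qed.

Let D i (w : W) := incr 0 (r (i * b)) w - mprod (fun q => v q w) i.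

Let D_step i w : D i.+1 w = D i w + D i w *m (v i w - 1%:M) +
  incr 0 (r (i * b)) w *m (incr (r (i * b)) (r (i.+1 * b)) w - v i w).
Proof.
rewrite /D /= (incrD 0 (r (i * b))) !mulmxBr !mulmx1 mulmxBl.
set x := incr 0 _ w; set y := mprod _ i; set u := incr _ _ w; set z := v i w.
by apply/matrixP => i1 i2; rewrite !mxE; ring.
Qed.

Let D_next i : (i < a)%N ->
  sqsum (D i.+1) <= (1 + kr * kb * (t / a%:R)) * sqsum (D i) + kr * kb * (t / a%:R) ^+ 2.
Proof.
move=> ia; have -> : D i.+1 = fun w => D i w + D i w *m (v i w - 1%:M) +
  incr 0 (r (i * b)) w *m (incr (r (i * b)) (r (i.+1 * b)) w - v i w).
  by apply/funext => w; exact: D_step.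
have d0 : 0 <= t / a%:R by rewrite divr_ge0// ltW.
have dd : t / (a * b)%:R <= t / a%:R.
  by rewrite ler_pM2l// lef_pV2 ?posrE ?ltr0n ?muln_gt0 ?a0// ler_nat leq_pmulr.
have d1 : 0 <= t / (a * b)%:R by rewrite divr_ge0// ltW.
have ft := fine_cell ia; have [ce _] := fine_times_range ft.
have KB0 := kb_ge0.
have hb x y : [/\ `|'E (fun w => (v i w - 1%:M) x y)| <= kb * (t / a%:R),
      'E (fun w => (v i w - 1%:M) x y ^+ 2) <= kb * (t / a%:R),
      `|'E (fun w => (incr (r (i * b)) (r (i.+1 * b)) w - v i w) x y)| <= kb * (t / a%:R) ^+ 2 &
      'E (fun w => (incr (r (i * b)) (r (i.+1 * b)) w - v i w) x y ^+ 2) <= kb * (t / a%:R) ^+ 2].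
  rewrite /kb; case: cid2 => KB /= _ /(_ _ _ _ _ _ x y ft d1).
  by rewrite cell_len => /(_ dd).
have r00 : r 0%N = 0 by rewrite /r mul0r mulr0.
rewrite /kr; case: cid2 => KR /= _ hr.
apply: (hr (a * b)%N r (fun q => (q < i * b)%N) (fun q => (i * b <= q < i.+1 * b)%N)) => //.
- by rewrite r00.
- by move=> q; rewrite ltnNge => /negPf ->.
- move=> x y; apply: (@tensor_ext _ _ _ (fun w => incr (r 0%N) (r (i * b)) w x y - mprod (fun q => v q w) i x y)).
    by move=> w; rewrite r00 /D !mxE.
  apply: tensorB; last exact: tensor_V (ltnW ia).
  by apply: tensor_incr => //; rewrite leq_mul2r (ltnW ia) orbT.
- move=> x y; rewrite -r00; apply: tensor_incr => //; first by rewrite leq_mul2r (ltnW ia) orbT.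
- by move=> x y; exact: tensor_v.
- move=> x y; apply: (@tensor_ext _ _ _ (fun w => incr (r (i * b)) (r (i.+1 * b)) w x y - ((v i w - 1%:M) x y + (1%:M : 'M[R]_n) x y))).
    by move=> w; rewrite !mxBE subrK.
  apply: tensorB; last by apply: tensorD; [exact: tensor_v|exact: tensor_cst].
  by apply: tensor_incr => //; rewrite leq_mul2r ?ia ?leqnSn orbT.
- by move=> w; exact: incr_lie.
- by rewrite d0 (le_trans _ tT)// ler_piMr ?(ltW t0)// invf_le1 ?ltr0n// ler1n.
- by move=> x y; have [] := hb x y.
- by move=> x y; have [] := hb x y.
- by move=> x y; have [] := hb x y.
- by move=> x y; have [] := hb x y.
Qed.

(** A discrete Gronwall argument: the recursion gives the bound i x (t/a) (1 + x)^i after i steps,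
    with x = kr kb t / a, and (1 + x)^a <= exp(ax). The bound does not depend on b. *)
Lemma euler_block_error :
  sqsum (fun w => path_at t w - mprod (fun q => v q w) a) <=
  kr * kb * t ^+ 2 * expR (kr * kb * t) / a%:R.
Proof.
have kk0 : 0 <= kr * kb by exact: mulr_ge0 kr_ge0 kb_ge0.
pose x := kr * kb * (t / a%:R).
have d0 : 0 <= t / a%:R by rewrite divr_ge0// ltW.
have x0 : 0 <= x by exact: mulr_ge0.
have e0 i : (i <= a)%N -> sqsum (D i) <= i%:R * (x * (t / a%:R)) * (1 + x) ^+ i.
  elim: i => [_|i IH ia].
    rewrite !mul0r /sqsum big1// => y _; rewrite big1// => z _.
    rewrite (_ : (fun w => _) = fun=> 0) ?Ex_cst//.
    by apply/funext => w; rewrite /D /= /r mul0r mulr0 incrii subrr mxE expr0n.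
  apply: (le_trans (D_next ia)); rewrite -/x [_ ^+ i.+1]exprS -natr1.
  have h : (1 + x) * sqsum (D i) <= (1 + x) * (i%:R * (x * (t / a%:R)) * (1 + x) ^+ i).
    by rewrite ler_wpM2l ?addr_ge0// IH// ltnW.
  have -> : kr * kb * (t / a%:R) ^+ 2 = x * (t / a%:R) by rewrite /x; ring.
  have h2 : x * (t / a%:R) <= x * (t / a%:R) * ((1 + x) * (1 + x) ^+ i).
    apply: ler_peMr; first exact: mulr_ge0.
    by rewrite -exprS; apply: exprn_ege1; rewrite lerDl.
  rewrite (le_trans (lerD h h2))// le_eqVlt; apply/orP; left; apply/eqP.
  by move: ((1 + x) ^+ i) (x * (t / a%:R)) (i%:R) => z y u; ring.
have -> : (fun w => path_at t w - mprod (fun q => v q w) a) = D a.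
  by apply/funext => w; rewrite /D /r divff ?gt_eqF// mulr1 incr0.
apply: (le_trans (e0 a (leqnn a))).
have aR : (a%:R : R) != 0 by rewrite pnatr_eq0 -lt0n.
have -> : a%:R * (x * (t / a%:R)) = kr * kb * t ^+ 2 / a%:R by rewrite /x; field.
rewrite -[leRHS]mulrA (mulrC (expR _)) [leRHS]mulrA ler_wpM2l//.
  by rewrite divr_ge0// mulr_ge0// sqr_ge0.
have -> : kr * kb * t = a%:R * x by rewrite /x; field.
rewrite expRM_natl; apply: lerXn2r; rewrite ?nnegrE ?addr_ge0 ?expR_ge0//.
exact: expR_ge1Dx.
Qed.

End EulerScheme.

Let ae_all_I (k : nat) (P : 'I_k -> W -> Prop) :
  (forall i, \forall w \ae mu, P i w) -> \forall w \ae mu, forall i, P i w.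
Proof. by move=> h; apply: filter_forall. Qed.

Lemma measurable_mprod (f : nat -> W -> 'M[R]_n) k :
  (forall q i j, measurable_fun setT (fun w => f q w i j)) ->
  forall i j, measurable_fun setT (fun w => mprod (fun q => f q w) k i j).
Proof.
move=> mf; elim: k => [|k IH] i j /=; first exact: measurable_cst.
exact: measurable_fun_mulmx.
Qed.

Definition euler_bl (t : R) (a : nat) (w : W) : 'M[R]_n :=
  mprod (fun q => euler_step (t / a%:R)
    (bl (t * (q.+1%:R / a%:R)) w - bl (t * (q%:R / a%:R)) w)) a.

Lemma measurable_euler_bl t a i j : measurable_fun setT (fun w => euler_bl t a w i j).
Proof.
apply: measurable_mprod => q {}i {}j; rewrite /euler_step.
under eq_fun do rewrite !mxE.
apply: measurable_funD => //; apply: measurable_funD => //.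
by apply: measurable_funB; exact: measurable_bl.
Qed.

(** The number of cells per step is 4^N. As N grows the midpoint sums converge almost surely to the
    increments of [bl], and Fatou's lemma keeps the error bound, which is uniform in N. *)
Let euler_bl_error : exists2 K : R, 0 <= K & forall t a, 0 < t -> t <= T -> (0 < a)%N ->
  forall i j, (sq_integral mu (fun w => (euler_bl t a w i j - path_at t w i j)%R) <=
    (K / a%:R)%:E)%E.
Proof.
exists (kr * kb * T ^+ 2 * expR (kr * kb * T)).
  by rewrite mulr_ge0 ?expR_ge0// mulr_ge0 ?sqr_ge0// mulr_ge0 ?kr_ge0 ?kb_ge0.
move=> t a t0 tT a0 i j.
pose r N (q : nat) : R := t * (q%:R / (a * 4 ^ N)%:R).
pose cell N q (w : W) : 'M[R]_n :=
  \matrix_(x, y) theta_sum (fun m => r N (q * 4 ^ N + m)%N) (4 ^ N) x y w.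
pose v N q (w : W) := euler_step (t / a%:R) (cell N q w).
have b0 N : (0 < 4 ^ N)%N by rewrite expn_gt0.
have bcell N q x y : bounded_measurable (fun w => cell N q w x y).
  by under eq_fun do rewrite mxE; exact: bm_theta_sum.
have bv N q x y : bounded_measurable (fun w => v N q w x y).
  under eq_fun do rewrite /v /euler_step mxE [X in X + _]mxE.
  by apply: bmD; [apply: bmD => //; exact: bm_cst|exact: bm_cst].
have bV N k x y : bounded_measurable (fun w => mprod (fun q => v N q w) k x y).
  elim: k x y => [|k IH] x y /=; first exact: bm_cst.
  by under eq_fun do rewrite mxE; apply: bm_sum => m; exact: bmM.
have bp x y : bounded_measurable (fun w : W => path_at t w x y).
  rewrite (_ : (fun w : W => _) = (fun w : W => incr 0 t w x y)).
    exact: (lie_bm_incr 0 t (smooth_lie_bm (smooth_entry G x y))).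
  by apply/funext => w; rewrite incr0.
apply: (@sq_integral_fatou _ _ _ _ (fun N w => mprod (fun q => v N q w) a i j - path_at t w i j)).
- by move=> N; apply: measurable_funB; [case: (bV N a i j)|case: (bp i j)].
- by apply: measurable_funB; [exact: measurable_euler_bl|case: (bp i j)].
- have rE N q : r N (q * 4 ^ N)%N = t * (q%:R / a%:R).
    by rewrite /r !natrM; field; rewrite !pnatr_eq0 -!lt0n a0 b0.
  have cT q : (q <= a)%N -> 0 <= t * (q%:R / a%:R) <= T.
    move=> qa; rewrite mulr_ge0 ?(ltW t0)//= (le_trans _ tT)// ler_piMr ?(ltW t0)//.
    by rewrite ler_pdivrMr ?ltr0n// mul1r ler_nat.
  have fine N q : (q < a)%N -> fine_times (fun m => r N (q * 4 ^ N + m)%N) (4 ^ N)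
      (t * (q%:R / a%:R)) (t * (q.+1%:R / a%:R)) (t / a%:R * 4^-1 ^+ N).
    move=> qa; split.
    - by rewrite addn0 rE.
    - by rewrite addnC -mulSn rE.
    - by case/andP: (cT _ (ltnW qa)).
    - by case/andP: (cT _ qa).
    move=> m _; rewrite addnS.
    have -> : r N (q * 4 ^ N + m).+1 = r N (q * 4 ^ N + m)%N + t / a%:R * 4^-1 ^+ N.
      rewrite /r -(natr1 (q * 4 ^ N + m)) [(_ + 1) / _]mulrDl mulrDr; congr (_ + _).
      by rewrite mul1r natrM invfM natrX exprVn mulrA.
    by split => //; rewrite lerDl mulr_ge0 ?exprn_ge0 ?divr_ge0// ltW.
  have cvg_cell (q : 'I_a) (x y : 'I_n) : \forall w \ae mu,
      cell N q w x y @[N --> \oo] --> bl (t * (q.+1%:R / a%:R)) w x y - bl (t * (q%:R / a%:R)) w x y.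
    have [K K0 hK] := brown_approx (fun b c => ((b == x) && (c == y))%:R).
    pose f N (w : W) := lin_sum (fun b c => ((b == x) && (c == y))%:R) (fun m => r N (q * 4 ^ N + m)%N) (4 ^ N) w.
    have : \forall w \ae mu, f N w @[N --> \oo] -->
        lin (fun b c => ((b == x) && (c == y))%:R) (brown (t * (q.+1%:R / a%:R)) w) -
        lin (fun b c => ((b == x) && (c == y))%:R) (brown (t * (q%:R / a%:R)) w).
      apply: (@ae_cvg_sq _ _ _ mu _ _ (K * (t / a%:R))) => [N||N].
      - by case: (bm_lin_sum (fun b c => ((b == x) && (c == y))%:R) (fun m => r N (q * 4 ^ N + m)%N) (4 ^ N)).
      - exact: measurable_brown_incr.
      rewrite -mulrA; apply: hK (fine N q (ltn_ord q)).
      by rewrite mulr_gt0 ?exprn_gt0// divr_gt0// ltr0n.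
    apply: filterS3 (bl_brown (cT _ (ltn_ord q))) (bl_brown (cT _ (ltnW (ltn_ord q)))) => w -> ->.
    rewrite !lin_delta => h; apply: cvg_trans h; apply: near_eq_cvg; apply: nearW => N.
    by rewrite /f /lin_sum mxE; apply: eq_bigr => m _; rewrite lin_delta mxE.
  have : \forall w \ae mu, forall (q : 'I_a) (x y : 'I_n),
      cell N q w x y @[N --> \oo] --> bl (t * (q.+1%:R / a%:R)) w x y - bl (t * (q%:R / a%:R)) w x y.
    by apply: ae_all_I => q; apply: ae_all_I => x; apply: ae_all_I => y; exact: cvg_cell.
  apply: filterS => w h; apply: cvgB; last exact: cvg_cst.
  apply: cvg_mprod => q x y qa; have := h (Ordinal qa) x y => /= hq.
  under eq_fun do rewrite /v /euler_step !mxE; rewrite /euler_step !mxE.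
  apply: cvgD; last exact: cvg_cst.
  by apply: cvgD; [exact: cvg_cst|apply: cvg_trans hq; apply: near_eq_cvg; apply: nearW => N; rewrite /cell mxE].
move=> N; rewrite sq_integral_Ex; last exact: bmB.
rewrite lee_fin; have := euler_block_error t0 tT a0 (b0 N).
have k0 : 0 <= kr * kb by rewrite mulr_ge0 ?kr_ge0 ?kb_ge0.
have t00 := ltW t0; have T00 := ltW T0.
have kle : kr * kb * t ^+ 2 * expR (kr * kb * t) / a%:R <= kr * kb * T ^+ 2 * expR (kr * kb * T) / a%:R.
  rewrite ler_wpM2r// ler_pM ?expR_ge0 ?mulr_ge0 ?sqr_ge0//.
    by rewrite ler_wpM2l// lerXn2r.
  by rewrite ler_expR ler_wpM2l.
move=> /le_trans /(_ kle); apply: le_trans; rewrite /sqsum (bigD1 i)//= (bigD1 j)//=.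
rewrite -addrA (_ : 'E _ = 'E (fun w => (path_at t w - mprod (fun q => v N q w) a) i j ^+ 2)).
  rewrite lerDl addr_ge0//; first by apply: sumr_ge0 => y _; apply: Ex_ge0 => w; exact: sqr_ge0.
  by apply: sumr_ge0 => x _; apply: sumr_ge0 => y _; apply: Ex_ge0 => w; exact: sqr_ge0.
by apply: eq_Ex => w; rewrite -sqrrN opprB !mxE.
Qed.

Lemma euler_bl_cvg t i j : 0 < t -> t <= T ->
  \forall w \ae mu, euler_bl t (4 ^ k) w i j @[k --> \oo] --> path_at t w i j.
Proof.
move=> t0 tT; have [K K0 hK] := euler_bl_error.
apply: (@ae_cvg_sq _ _ _ mu _ _ K) => [k||k].
- exact: measurable_euler_bl.
- exact: measurable_path_entry.
have k0 : (0 < 4 ^ k)%N by rewrite expn_gt0.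
by apply: (le_trans (hK t _ t0 tT k0 i j)); rewrite natrX -exprVn.
Qed.

(** * Density *)

Local Opaque multiplier sin_multiplier.

Definition wints (f : W -> R) : Prop := exists2 l, is_step G T l & f = wint l.

Let wints_meas f : wints f -> measurable_fun setT f.
Proof. by move=> [l _ ->]; exact: measurable_wint. Qed.

Let wints_zero : wints (fun=> 0).
Proof. by exists [::] => //; apply/funext => w; rewrite /wint big_nil. Qed.

Let wints_lin a f g : wints f -> wints g -> wints (fun w => a * f w + g w).
Proof.
move=> [l hl ->] [l' hl' ->]; exists (step_scale a l ++ l').
  by apply: is_step_cat => //; exact: is_step_scale.
by apply/funext => w; rewrite wint_cat wint_scale.
Qed.

Let wints_fin f : wints f -> (sq_integral mu (fun w => expR (f w)) < +oo)%E.
Proof.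
move=> [l hl ->]; rewrite /sq_integral.
apply: le_lt_trans (ltry (expR (quad (step_scale 2 l) + 1))).
apply: (le_trans _ (exp_wint (is_step_scale (c := 2) hl))).
rewrite le_eqVlt; apply/orP; left; apply/eqP; apply: eq_integral => w _.
by rewrite wint_scale// expRM_natl.
Qed.

Local Notation multiplier := (multiplier mu wints).
Local Notation sin_multiplier := (sin_multiplier mu wints).

Let sin_multiplier_cst c : sin_multiplier (fun=> c).
Proof.
apply: (multiplier_sin_multiplier wints_meas wints_zero wints_fin).
exact: (multiplier_cst mu wints_meas wints_zero c).
Qed.

Let sin_multiplier_sum (I : Type) (s : seq I) (a : I -> R) (Z : I -> W -> R) :
  (forall i, sin_multiplier (Z i)) -> sin_multiplier (fun w => \sum_(i <- s) a i * Z i w).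
Proof.
move=> hY; elim: s => [|i s IH]; first by under eq_fun do rewrite big_nil; exact: sin_multiplier_cst.
by under eq_fun do rewrite big_cons; exact: (sin_multiplier_lin wints_meas wints_zero wints_fin).
Qed.

Let wint_coord s t m w : wint [:: (s, t, E m)] w = lin (coord m) (brown t w) - lin (coord m) (brown s w).
Proof.
have e X : lin (lincoef (E m)) X = lin (coord m) X.
  rewrite lin_lincoef (bigD1 m)//= (onb_ortho hE) eqxx mul1r big1 ?addr0// => k km.
  by rewrite (onb_ortho hE) eq_sym (negbTE km) mul0r.
by rewrite /wint big_cons big_nil addr0 /= !e.
Qed.

Let sin_multiplier_bl s t i j : 0 <= s -> s <= t -> t <= T ->
  sin_multiplier (fun w => (bl t w - bl s w) i j).
Proof.
move=> s0 st tT.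
rewrite (_ : (fun w => _) = fun w => \sum_m E m i j * wint [:: (s, t, E m)] w).
  apply: sin_multiplier_sum => m; apply: (sin_multiplier_L wints_meas wints_zero wints_lin wints_fin).
  exists [:: (s, t, E m)] => // x; rewrite inE => /eqP -> /=; split => //; exact: GE.
apply/funext => w; rewrite /bl -sumrB summxE; apply: eq_bigr => m _.
by rewrite wint_coord -scalerBl mxE mulrC.
Qed.

Let sin_multiplier_euler t a i j : 0 < t -> t <= T -> (0 < a)%N ->
  sin_multiplier (fun w => euler_bl t a w i j).
Proof.
move=> t0 tT a0; rewrite /euler_bl.
suff : forall k, (k <= a)%N -> forall i j, sin_multiplier (fun w => mprod (fun q => euler_step (t / a%:R)
    (bl (t * (q.+1%:R / a%:R)) w - bl (t * (q%:R / a%:R)) w)) k i j) by move=> /(_ a (leqnn a)).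
elim=> [|k IH] ka {}i {}j /=; first exact: sin_multiplier_cst.
under eq_fun do rewrite mxE.
have := @sin_multiplier_sum _ (index_enum 'I_n) (fun=> 1) (fun y w =>
  mprod (fun q => euler_step (t / a%:R) (bl (t * (q.+1%:R / a%:R)) w - bl (t * (q%:R / a%:R)) w)) k i y *
  euler_step (t / a%:R) (bl (t * (k.+1%:R / a%:R)) w - bl (t * (k%:R / a%:R)) w) y j).
under eq_fun do under eq_bigr do rewrite mul1r.
apply=> y; apply: (sin_multiplierM wints_meas wints_zero wints_fin); first exact: IH (ltnW ka) _ _.
rewrite (_ : (fun w => _) = fun w => 1 * (bl (t * (k.+1%:R / a%:R)) w - bl (t * (k%:R / a%:R)) w) y j +
    ((1%:M : 'M[R]_n) y j + t / a%:R / 2 * C y j)); last first.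
  by apply/funext => w; rewrite /euler_step mul1r !mxE; ring.
apply: (sin_multiplier_lin wints_meas wints_zero wints_fin); last exact: sin_multiplier_cst.
have aR : (0 : R) < a%:R by rewrite ltr0n.
apply: sin_multiplier_bl.
- by rewrite mulr_ge0 ?divr_ge0// ltW.
- by rewrite ler_pM2l// ler_pM2r ?invr_gt0// ler_nat.
- by rewrite (le_trans _ tT)// ler_piMr ?(ltW t0)// ler_pdivrMr// mul1r ler_nat.
Qed.

(** The Euler approximations are polynomials in unbounded variables, hence sine multipliers only;
    their limit has values in the compact group, and a bounded sine multiplier is a multiplier.
    Outside ]0, T] the path is the identity. *)
Let multiplier_path t i j : multiplier (fun w => path_at t w i j).
Proof.
have cst0 : (forall w : W, path_at t w = 1%:M) -> multiplier (fun w => path_at t w i j).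
  move=> h; under eq_fun do rewrite h; exact: (multiplier_cst mu wints_meas wints_zero _).
have [t0|t0] := leP t 0.
  apply: cst0 => w; move: t0; rewrite le_eqVlt => /orP[/eqP ->|t0]; first exact: path_at0.
  case: w => w pw; have [_ _ _] := set_mem pw; apply.
  by rewrite in_itv/= negb_and -ltNge t0.
have [tT|tT] := leP t T; last first.
  apply: cst0 => w; case: w => w pw; have [_ _ _] := set_mem pw; apply.
  by rewrite in_itv/= negb_and -!ltNge tT orbT.
have [K K0 hK] := lie_norm_bounded G.
apply: (bounded_sin_multiplier wints_meas wints_zero wints_fin (K := K)); last first.
  by move=> w; rewrite (le_trans (le_mx_norm _ _ _))// hK//; exact: path_at_lie.
apply: (sin_multiplier_ae_lim wints_meas wints_fin (Y_ := fun k w => euler_bl t (4 ^ k) w i j)).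
- by move=> k; apply: sin_multiplier_euler; rewrite ?expn_gt0.
- exact: measurable_path_entry.
- exact: euler_bl_cvg.
Qed.

Lemma wint_dense (f : W -> R) : measurable_fun setT f -> (sq_integral mu f < +oo)%E ->
  exp_closure mu wints f.
Proof.
apply: (dense_of_multipliers wints_meas wints_zero wints_fin) => A /(path_events_measurable T0).
apply: (multiplier_generated wints_meas wints_zero wints_fin (Gen := @path_events R n G T)).
- move=> _ [t [i [j [a ->]]]].
  rewrite (_ : [set _ | _] = setT `&` (fun w : W => path_at t w i j) @^-1` `]a, +oo[%classic).
    exact: measurable_path_entry.
  by rewrite setTI; apply/seteqP; split => w /=; rewrite in_itv/= andbT.
move=> _ [t [i [j [a ->]]]].
exact: (multiplier_gt wints_meas wints_zero wints_fin a (multiplier_path t i j)).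
Qed.

Lemma lie_BL t w : 0 <= t <= T -> lie_algebra G (BL mu t w).
Proof.
move=> tT; have h : exists I, (forall w, lie_algebra G (I w)) /\
    stratonovich_integral mu (fun s w => invmx (path_at s w)) path_at t I.
  by exists (bl t); split; [exact: lie_bl|exact: stratonovich_bl].
by have [hl _] := xgetPex (fun=> 0) h; exact: hl.
Qed.

Lemma measurable_BL t i j : 0 <= t <= T -> measurable_fun setT (fun w => BL mu t w i j).
Proof.
move=> tT; have h : exists I, (forall w, lie_algebra G (I w)) /\
    stratonovich_integral mu (fun s w => invmx (path_at s w)) path_at t I.
  by exists (bl t); split; [exact: lie_bl|exact: stratonovich_bl].
by have [_ [mI _]] := xgetPex (fun=> 0) h; exact: mI.
Qed.

Let lin_comb L (c : 'I_d -> R) : lin L (\sum_m c m *: E m) = \sum_m c m * lin L (E m).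
Proof.
rewrite /lin; under [RHS]eq_bigr do rewrite mulr_sumr.
rewrite [RHS]exchange_big/=; apply: eq_bigr => i _.
under [RHS]eq_bigr do rewrite mulr_sumr.
rewrite [RHS]exchange_big/=; apply: eq_bigr => j _.
by rewrite summxE mulr_sumr; apply: eq_bigr => m _; rewrite mxE mulrCA.
Qed.

Let lin_lincoef_lie A X : lie_algebra G A -> lie_algebra G X -> lin (lincoef A) X = ip A X.
Proof.
move=> GA GX; rewrite lin_lincoef (ip_expand GA GX); apply: eq_bigr => m _; congr (_ * _).
rewrite {1}(lie_expand GX) lin_comb (bigD1 m)//= coordE eqxx mulr1 big1 ?addr0// => k km.
by rewrite coordE eq_sym (negbTE km) mulr0.
Qed.

Lemma measurable_step_integral l : is_step G T l -> measurable_fun setT (step_integral ip mu l).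
Proof.
elim: l => [_|x l IH /is_step_cons[[x0 xx xT Gx] /IH h]].
  by rewrite /step_integral; under eq_fun do rewrite big_nil; exact: measurable_cst.
rewrite /step_integral; under eq_fun do rewrite big_cons.
apply: measurable_funD => //.
have h1 : 0 <= x.1.1 <= T by rewrite x0 (le_trans xx).
have h2 : 0 <= x.1.2 <= T by rewrite xT (le_trans x0).
have GD w : lie_algebra G (BL mu x.1.2 w - BL mu x.1.1 w).
  by apply: lie_algebraD; [exact: lie_BL|rewrite -scaleN1r; apply: lie_algebraZ; exact: lie_BL].
under eq_fun do rewrite -(lin_lincoef_lie Gx (GD _)) /lin.
apply: measurable_bigsum => i; apply: measurable_bigsum => j; apply: measurable_funM => //.
by under eq_fun do rewrite !mxE; apply: measurable_funB; exact: measurable_BL.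
Qed.

Lemma step_integral_sq_cvg (l_ : nat -> seq (R * R * 'M[R]_n)) I :
  measurable_fun setT I -> (forall m, is_step G T (l_ m)) ->
  sq_cvg mu (fun m => step_integral ip mu (l_ m)) I <-> sq_cvg mu (fun m => wint (l_ m)) I.
Proof.
move=> mI hl; rewrite /sq_cvg.
rewrite (_ : (fun k => sq_integral mu (fun w => step_integral ip mu (l_ k) w - I w)) =
   (fun k => sq_integral mu (fun w => wint (l_ k) w - I w)))//.
apply/funext => k; apply: ae_eq_sq_integral.
- by apply: measurable_funB => //; exact: measurable_step_integral.
- by apply: measurable_funB => //; exact: measurable_wint.
by apply: filterS (ae_step_integral (hl k)) => w ->.
Qed.

(** [xget] returns 0 when there is no version of the integral. Keeping both cases gives the square
    integrability of (Z_phi)^(1/2) for every path phi without an existence theorem. *)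
Let BL_integral_spec (f : R -> 'M[R]_n) : BL_integral ip mu f = (fun=> 0) \/
  [/\ measurable_fun setT (BL_integral ip mu f), (sq_integral mu (BL_integral ip mu f) < +oo)%E &
    exists2 l_, (forall m, is_step G T (l_ m)) &
      energy T ip (fun t => step_fun (l_ m) t - f t) @[m --> \oo] --> 0%E /\
      sq_cvg mu (fun m => wint (l_ m)) (BL_integral ip mu f)].
Proof.
rewrite /BL_integral; case: xgetP => [I _ [LI [l_ hl [el NI]]]|_]; last by left.
have [mI fI] := (Lfun2P mu _).1 LI.
right; split => //; exists l_ => //; split=> //.
by apply/(step_integral_sq_cvg mI hl); exact: Lnorm_sq_cvg NI.
Qed.

Lemma measurable_BL_integral f : measurable_fun setT (BL_integral ip mu f).
Proof. by case: (BL_integral_spec f) => [->|[]//]; exact: measurable_cst. Qed.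

Let quad_scaleN l : is_step G T l -> quad (step_scale (-1) l) = quad l.
Proof.
move=> hl; apply: EFin_inj; rewrite -!sq_integral_wint//; last exact: is_step_scale.
by apply: eq_sq_integral => w; rewrite wint_scale// mulN1r sqrrN.
Qed.

(* Fatou along an almost surely convergent sequence of step integrals *)
Lemma exp_BL_integral_fin f : exists K : R,
  (\int[mu]_w (expR (- BL_integral ip mu f w))%:E <= K%:E)%E.
Proof.
have [->|[mI fI [l_ hl [_ cI]]]] := BL_integral_spec f.
  exists 1; under eq_integral do rewrite oppr0 expR0.
  by rewrite integral_cst// mul1e; exact: probability_le1.
set I := BL_integral ip mu f in mI fI cI *.
have [S fS] : exists S : R, sq_integral mu I = S%:E.
  have := sq_integral_ge0 mu I; move: fI; case: (sq_integral mu I) => // S _ _.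
  by exists S.
have sub k : exists m, (sq_integral mu (fun w => (wint (l_ m) w - I w)%R) <= (4^-1 ^+ k)%:E)%E.
  have e0 : (0 : R) < 4^-1 ^+ k by rewrite exprn_gt0.
  have := cI; move/fine_cvgP => [fin /cvgrPdist_le /(_ _ e0) near0].
  have [m [h1 h2]] : exists m, (sq_integral mu (fun w => (wint (l_ m) w - I w)%R) \is a fin_num) /\
      `|0 - (fine \o (fun m => sq_integral mu (fun w => (wint (l_ m) w - I w)%R))) m| <= 4^-1 ^+ k.
    exact: filter_ex (filterI fin near0).
  exists m; rewrite -(fineK h1) lee_fin; move: h2; rewrite sub0r normrN /=.
  by apply: le_trans; exact: ler_norm.
have [m_ hm] := choice sub.
(* The step integrals chosen are within squared distance 4^-k <= 1 of I, so their second moment is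
   at most 2 + 2S; the last 1 comes from the exponential bound. *)
exists (expR (2 + 2 * S + 1)).
apply: (@fatou_ae _ _ _ mu (fun k w => expR (- wint (l_ (m_ k)) w))).
- move=> k; apply: measurableT_comp => //; apply: measurableT_comp => //; exact: measurable_wint.
- by apply: measurableT_comp => //; exact: measurableT_comp.
- by move=> k w; exact: expR_ge0.
- by move=> w; exact: expR_ge0.
- have : \forall w \ae mu, wint (l_ (m_ k)) w @[k --> \oo] --> I w.
    apply: (@ae_cvg_sq _ _ _ mu _ _ 1) => // [k|k]; first exact: measurable_wint.
    by rewrite mul1r.
  apply: filterS => w h; have h2 : - wint (l_ (m_ k)) w @[k --> \oo] --> - I w by exact: cvgN.
  exact: cvg_comp h2 (@continuous_expR R (- I w)).
move=> k; have hs := is_step_scale (c := -1) (hl (m_ k)).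
under eq_integral do rewrite -mulN1r -wint_scale//.
apply: (le_trans (exp_wint hs)); rewrite lee_fin ler_expR lerD2r quad_scaleN//.
rewrite -lee_fin -sq_integral_wint//.
rewrite (@eq_sq_integral _ _ _ _ _ (fun w => (wint (l_ (m_ k)) w - I w) + I w)); last first.
  by move=> w; rewrite subrK.
apply: (le_trans (sq_integralD _ _ _)) => //.
  by apply: measurable_funB => //; exact: measurable_wint.
rewrite fS (EFinD 2 (2 * S)) (EFinM 2 S); apply: leeD => //.
rewrite -[leRHS]mule1; apply: lee_wpmul2l; first by rewrite lee_fin.
by apply: (le_trans (hm k)); rewrite lee_fin exprn_ile1// invf_le1// ler1n.
Qed.

Let sqrt_expR (x : R) : Num.sqrt (expR x) = expR (2^-1 * x).
Proof.
have -> : expR x = expR (2^-1 * x) ^+ 2 by rewrite -expRM_natl mulrA divff ?mul1r.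
by rewrite sqrtr_sqr ger0_norm ?expR_ge0.
Qed.

Lemma sqrt_ZR (phi : wiener_space G T) w : Num.sqrt (ZR ip mu phi w) =
  expR (- 2^-1 * BL_integral ip mu (right_log_derivative phi) w -
        4^-1 * fine (energy T ip (right_log_derivative phi))).
Proof. by rewrite /ZR sqrt_expR; congr expR; field. Qed.

Lemma measurable_sqrt_ZR (phi : wiener_space G T) :
  measurable_fun setT (fun w => Num.sqrt (ZR ip mu phi w)).
Proof.
under eq_fun do rewrite sqrt_ZR; apply: measurableT_comp => //.
apply: measurable_funB => //; apply: measurable_funM => //.
exact: measurable_BL_integral.
Qed.

Lemma sq_integral_sqrt_ZR (phi : wiener_space G T) :
  (sq_integral mu (fun w => Num.sqrt (ZR ip mu phi w)) < +oo)%E.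
Proof.
set f := right_log_derivative phi; have [K hK] := exp_BL_integral_fin f.
pose c : R := expR (- 2^-1 * fine (energy T ip f)).
apply: (@le_lt_trans _ _ (c%:E * \int[mu]_w (expR (- BL_integral ip mu f w))%:E)%E); last first.
  by apply: le_lt_trans (ltry (c * K)); rewrite EFinM; apply: lee_wpmul2l => //; rewrite lee_fin expR_ge0.
rewrite -ge0_integralZl//.
- rewrite le_eqVlt; apply/orP; left; apply/eqP; apply: eq_integral => w _.
  rewrite -EFinM -expRD sqr_sqrtr ?expR_ge0// /ZR; congr (expR _)%:E.
  by rewrite -/f addrC mulNr.
- by apply/measurable_EFinP; do 2 apply: measurableT_comp => //; exact: measurable_BL_integral.
- by rewrite lee_fin expR_ge0.
Qed.

Lemma step_fun_cat (l1 l2 : seq (R * R * 'M[R]_n)) t :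
  step_fun (l1 ++ l2) t = step_fun l1 t + step_fun l2 t.
Proof. by rewrite /step_fun big_cat. Qed.

Lemma measurable_ip_step_fun l : is_step G T l ->
  measurable_fun (`[0, T]%classic : set R) (fun t => ip (step_fun l t) (step_fun l t)).
Proof.
move=> hl; apply: measurable_funTS; under eq_fun do rewrite ip_step_fun2//.
apply: measurable_bigsum => x; apply: measurable_bigsum => y.
apply: measurable_funM => //; apply: measurable_indic.
by apply: measurableI; exact: measurable_itv.
Qed.

(** The constant sequence l shows that a version exists. For the version picked, any approximating
    sequence converges to f, that is to the step function of l, in energy; by the isometry its
    integrals converge to [wint l] as well. *)
Let BL_integral_step (F : seq R) l f : is_step G T l ->
  (forall t, 0 <= t <= T -> t \notin F -> f t = step_fun l t) ->
  \forall w \ae mu, BL_integral ip mu f w = wint l w.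
Proof.
move=> hl fE.
have mI := measurable_BL_integral f; have mw := measurable_wint l.
have energyE l' : is_step G T l' ->
    energy T ip (fun t => step_fun l' t - f t) = sq_integral mu (fun w => (wint l' w - wint l w)%R).
  move=> hl'; have hs : is_step G T (l' ++ step_scale (-1) l).
    by apply: is_step_cat => //; exact: is_step_scale.
  rewrite (@eq_energy _ _ T ip F _ (step_fun (l' ++ step_scale (-1) l))).
  - rewrite energy_step// -sq_integral_wint//; apply: eq_sq_integral => w.
    by rewrite wint_cat wint_scale// mulN1r.
  - by move=> t tT tF; rewrite fE// step_fun_cat step_fun_scale scaleN1r.
  - exact: measurable_ip_step_fun.
have hex : exists I, I \in Lfun mu 2%:E /\
    exists2 l_ : nat -> seq (R * R * 'M[R]_n), (forall m, is_step G T (l_ m)) &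
      (energy T ip (fun t => step_fun (l_ m) t - f t) @[m --> \oo] --> 0%E) /\
      ('N[mu]_(2%:E) [EFin \o (step_integral ip mu (l_ m) \- I)%R]%E @[m --> \oo] --> 0%E).
  exists (wint l); split.
    by apply/Lfun2P; split => //; rewrite sq_integral_wint// ltry.
  exists (fun=> l) => //; split.
    rewrite energyE// (_ : sq_integral _ _ = 0%E); first exact: cvg_cst.
    by rewrite /sq_integral; under eq_integral do rewrite subrr expr0n; rewrite integral0.
  rewrite (_ : 'N[mu]_(2%:E) [_]%E = 0%E); first exact: cvg_cst.
  apply: Lnorm_eq0; rewrite (@ae_eq_sq_integral _ _ _ _ _ (fun=> 0)).
  - by rewrite /sq_integral; under eq_integral do rewrite expr0n; rewrite integral0.
  - by apply: measurable_funB => //; exact: measurable_step_integral.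
  - exact: measurable_cst.
  by apply: filterS (ae_step_integral hl) => w /= ->; rewrite subrr.
have [/Lfun2P[_ fI] [l_ hl_ [el NI]]] := xgetPex (fun=> 0) hex.
have cI : sq_cvg mu (fun m => wint (l_ m)) (BL_integral ip mu f).
  by apply/(step_integral_sq_cvg mI hl_); exact: Lnorm_sq_cvg NI.
have cw : sq_cvg mu (fun m => wint (l_ m)) (wint l).
  by move: el; under eq_fun do rewrite energyE//.
have h0 : sq_integral mu (fun w => BL_integral ip mu f w - wint l w) = 0%E.
  have c0 : (fun m => 2%:E * sq_integral mu (fun w => (wint (l_ m) w - BL_integral ip mu f w)%R) +
      2%:E * sq_integral mu (fun w => (wint (l_ m) w - wint l w)%R))%E m @[m --> \oo] --> 0%E.
    rewrite -[X in _ --> X](adde0 0%E); apply: cvgeD => //; rewrite -[X in _ --> X](mule0 2%:E);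
      exact: cvgeZl.
  apply/eqP; rewrite eq_le sq_integral_ge0 andbT -(cvg_lim _ c0)//.
  apply: lime_ge; first by apply/cvg_ex; exists 0%E.
  apply: nearW => m.
  rewrite (@eq_sq_integral _ _ _ _ _ (fun w => (wint (l_ m) w - BL_integral ip mu f w) + (- (wint (l_ m) w - wint l w)))); last first.
    by move=> w; rewrite -sqrrN; congr (_ ^+ 2); ring.
  have m1 : measurable_fun setT (fun w => wint (l_ m) w - BL_integral ip mu f w).
    by apply: measurable_funB => //; exact: measurable_wint.
  have m2 : measurable_fun setT (fun w => wint (l_ m) w - wint l w).
    by apply: measurable_funB => //; exact: measurable_wint.
  apply: (le_trans (sq_integralD mu m1 _)); first exact: measurableT_comp.
  by rewrite (@eq_sq_integral _ _ _ _ (fun w => - _) (fun w => wint (l_ m) w - wint l w))// => w; rewrite sqrrN.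
have := sq_integral_eq0 _ h0 => /(_ (measurable_funB mI mw)).
by apply: filterS => w /eqP; rewrite subr_eq0 => /eqP.
Qed.

Let exp_wint_HG l : is_step G T l -> exists2 h, HG ip mu h &
  \forall w \ae mu, h w = expR (wint l w).
Proof.
(* The random part of the exponent of (Z_phi)^(1/2) is - I / 2; the logarithmic derivative -2l turns
   it into I(l). *)
move=> hl; pose l2 := step_scale (-2) l.
have hl2 : is_step G T l2 by exact: is_step_scale.
have [phi [F [ac dphi]]] := step_path T0 hl2.
have up t : path_at t phi \in unitmx by exact: (lie_unitmx (path_at_lie t phi)).
have fE t : 0 <= t <= T -> t \notin F -> right_log_derivative phi t = step_fun l2 t.
  by move=> tT tF; rewrite /right_log_derivative dphi// mulmxK.
have cm : cameron_martin ip phi.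
  split => //.
  rewrite (@eq_energy _ _ T ip F _ (step_fun l2)); last exact: measurable_ip_step_fun.
    by rewrite energy_step// ltry.
  move=> t tT tF; rewrite dphi//.
  (* H(G) is defined by the left logarithmic derivative and the equation controls the right one;
     they are conjugate by phi, and the norm is Ad-invariant. *)
  have := ip_Ad hip (lie_inv (path_at_lie t phi)) (lie_step_fun t hl2) (lie_step_fun t hl2).
  by rewrite invmxK mulmxA.
have eE : energy T ip (right_log_derivative phi) = (quad l2)%:E.
  rewrite -energy_step//; apply: (@eq_energy _ _ T ip F) => [t tT tF|]; last exact: measurable_ip_step_fun.
  by rewrite fE.
exists (fun w => expR (4^-1 * quad l2) * Num.sqrt (ZR ip mu phi w)).
  exists 1%N, (fun=> expR (4^-1 * quad l2)), (fun=> fun w => Num.sqrt (ZR ip mu phi w)).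
  by split => [_|]; [exists phi|apply/funext => w; rewrite big_ord1].
apply: filterS (BL_integral_step hl2 fE) => w h.
by rewrite sqrt_ZR h eE /= -expRD wint_scale//; congr expR; field.
Qed.

Let HG_lin a h1 h2 : HG ip mu h1 -> HG ip mu h2 -> HG ip mu (fun w => a * h1 w + h2 w).
Proof.
move=> [m1 [c1 [z1 [hz1 ->]]]] [m2 [c2 [z2 [hz2 ->]]]].
exists (m1 + m2)%N, (fun i : 'I_(m1 + m2) => match fintype.split i with inl j => a * c1 j | inr j => c2 j end),
  (fun i : 'I_(m1 + m2) => match fintype.split i with inl j => z1 j | inr j => z2 j end); split.
  by move=> i; case: (fintype.split i).
apply/funext => w; rewrite big_split_ord/= mulr_sumr; congr (_ + _); apply: eq_bigr => j _.
  by rewrite (unsplitK (inl j)) mulrA.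
by rewrite (unsplitK (inr j)).
Qed.

Let HG_L2 h : HG ip mu h -> measurable_fun setT h /\ (sq_integral mu h < +oo)%E.
Proof.
move=> [m [c [z [hz ->]]]].
have hz' i : measurable_fun setT (z i) /\ (sq_integral mu (z i) < +oo)%E.
  have [phi _ <-] := hz i.
  by split; [exact: measurable_sqrt_ZR|exact: sq_integral_sqrt_ZR].
elim: (index_enum _) => [|i s [IH1 IH2]].
  split; first by under eq_fun do rewrite big_nil; exact: measurable_cst.
  by rewrite /sq_integral; under eq_integral do rewrite big_nil expr0n; rewrite integral0 ltry.
have mz : measurable_fun setT (fun w => c i * z i w) by apply: measurable_funM => //; exact: (hz' i).1.
split; first by under eq_fun do rewrite big_cons; exact: measurable_funD.
rewrite (@eq_sq_integral _ _ _ _ _ (fun w => c i * z i w + \sum_(j <- s) c j * z j w)); last first.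
  by move=> w; rewrite big_cons.
apply: (le_lt_trans (sq_integralD mu mz IH1)); apply: lte_add_pinfty; rewrite lte_mul_pinfty//.
by rewrite sq_integralZ ?lte_mul_pinfty ?lee_fin ?sqr_ge0//; [exact: (hz' i).2|exact: (hz' i).1].
Qed.

(** The L^2 closure of H_G in squared form. It is a closed subspace containing the exponentials, so
    minimality of [exp_closure] applies to it. *)
Let HG_closure (f : W -> R) : Prop := measurable_fun setT f /\ forall e : R, 0 < e ->
  exists2 h, HG ip mu h & (sq_integral mu (fun w => (f w - h w)%R) <= e%:E)%E.

Let closed_HG_closure : closed_subspace mu HG_closure.
Proof.
split=> [f []//|a f g [mf hf] [mg hg]|f_ f hf_ mf fcvg].
  split; first by apply: measurable_funD => //; exact: measurable_funM.
  (* The tolerance e / (4 (a^2 + 1)) for f and e / 4 for g make each of the two terms at most e / 2;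
     the added 1 keeps the quotient defined when a = 0. *)
  move=> e e0; have c0 : 0 < 4 * (a ^+ 2 + 1) by rewrite mulr_gt0// ltr_wpDl ?sqr_ge0.
  have e1 : 0 < e / (4 * (a ^+ 2 + 1)) by exact: divr_gt0.
  have e2 : 0 < e / 4 by exact: divr_gt0.
  have [h1 H1 fh1] := hf _ e1; have [h2 H2 gh2] := hg _ e2.
  exists (fun w => a * h1 w + h2 w); first exact: HG_lin.
  have m1 : measurable_fun setT (fun w => f w - h1 w) by apply: measurable_funB => //; exact: (HG_L2 H1).1.
  have m2 : measurable_fun setT (fun w => g w - h2 w) by apply: measurable_funB => //; exact: (HG_L2 H2).1.
  rewrite (@eq_sq_integral _ _ _ _ _ (fun w => a * (f w - h1 w) + (g w - h2 w))); last first.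
    by move=> w; congr (_ ^+ 2); ring.
  apply: (le_trans (sq_integralD mu _ m2)); first exact: measurable_funM.
  rewrite sq_integralZ//.
  apply: (@le_trans _ _ (2%:E * ((a ^+ 2)%:E * (e / (4 * (a ^+ 2 + 1)))%:E) + 2%:E * (e / 4)%:E)%E).
    apply: leeD; apply: lee_wpmul2l; rewrite ?lee_fin//.
    by apply: lee_wpmul2l; rewrite ?lee_fin ?sqr_ge0.
  rewrite -!EFinM -EFinD lee_fin.
  have -> : 2 * (a ^+ 2 * (e / (4 * (a ^+ 2 + 1)))) = e / 2 * (a ^+ 2 / (a ^+ 2 + 1)).
    by field; rewrite gt_eqF// ltr_wpDl ?sqr_ge0.
  have h : a ^+ 2 / (a ^+ 2 + 1) <= 1 by rewrite ler_pdivrMr ?ltr_wpDl ?sqr_ge0// mul1r lerDl.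
  have e20 : 0 <= e / 2 by rewrite divr_ge0// ltW.
  have := ler_wpM2l e20 h; rewrite mulr1; move: (e / 2 * _) => z hz; lra.
split => // e e0; have e1 : 0 < e / 4 by exact: divr_gt0.
have [k hk] : exists k, (sq_integral mu (fun w => (f_ k w - f w)%R) <= (e / 4)%:E)%E.
  have := fcvg; move/fine_cvgP => [fin /cvgrPdist_le /(_ _ e1) near0].
  have [k [h1 h2]] := filter_ex (filterI fin near0).
  exists k; rewrite -(fineK h1) lee_fin; move: h2; rewrite sub0r normrN /=.
  by apply: le_trans; exact: ler_norm.
have [mk hfk] := hf_ k; have [h Hh fh] := hfk _ e1.
exists h => //; have mh := (HG_L2 Hh).1.
have m1 : measurable_fun setT (fun w => f_ k w - f w) by exact: measurable_funB.
have m2 : measurable_fun setT (fun w => f_ k w - h w) by exact: measurable_funB.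
rewrite (@eq_sq_integral _ _ _ _ _ (fun w => - (f_ k w - f w) + (f_ k w - h w))); last first.
  by move=> w; congr (_ ^+ 2); ring.
apply: (le_trans (sq_integralD mu _ m2)); first exact: measurableT_comp.
rewrite (@eq_sq_integral _ _ _ _ (fun w => - _) (fun w => f_ k w - f w)); last by move=> w; rewrite sqrrN.
apply: (@le_trans _ _ (2%:E * (e / 4)%:E + 2%:E * (e / 4)%:E)%E).
  by apply: leeD; apply: lee_wpmul2l; rewrite ?lee_fin.
by rewrite -!EFinM -EFinD lee_fin le_eqVlt; apply/orP; left; apply/eqP; field.
Qed.

Lemma HG_dense : dense_in_L2 mu (HG ip mu).
Proof.
split=> [h /HG_L2 hh|f /Lfun2P[mf ff] e e0]; first exact/Lfun2P.
have [|g [l hl ->]|_ dense] := wint_dense mf ff (U := HG_closure).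
- exact: closed_HG_closure.
- split; first by apply: measurableT_comp => //; exact: measurable_wint.
  move=> e' e'0; have [h Hh hw] := exp_wint_HG hl; exists h => //.
  rewrite (@ae_eq_sq_integral _ _ _ _ _ (fun=> 0)).
  + by rewrite /sq_integral; under eq_integral do rewrite expr0n; rewrite integral0 lee_fin ltW.
  + by apply: measurable_funB; [apply: measurableT_comp => //; exact: measurable_wint|exact: (HG_L2 Hh).1].
  + exact: measurable_cst.
  by apply: filterS hw => w ->; rewrite subrr.
have e2 : 0 < (e / 2) ^+ 2 by rewrite exprn_gt0// divr_gt0.
have [h Hh fh] := dense _ e2.
by exists h => //; exact: Lnorm_lt.
Qed.

End BrownianMotion.

Theorem theorem3p1 (R : realType) (n : nat)
  (G : compact_connected_lie_group R n)
  (ip : 'M[R]_n -> 'M[R]_n -> R) (hip : Ad_invariant_inner_product G ip)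
  (d : nat) (E : 'I_d -> 'M[R]_n) (hE : orthonormal_basis G ip E)
  (T : R) (hT : 0 < T)
  (lam : {measure set (borel 'M[R]_n) -> \bar R}) (hlam : haar_measure G lam)
  (p : R -> 'M[R]_n -> R) (hp : heat_kernel G E lam p)
  (mu : probability (wiener_measurable G T) R) (hmu : wiener_measure lam p mu) :
  dense_in_L2 mu (HG ip mu).
Proof. exact: (HG_dense hip hE hT hlam hp hmu). Qed.
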